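(* Let $\Gamma=(V,E)$ be a connected infinite isoradial graph with common radius $1$ such that, for some $\eta\in(0,\pi/4)$, all rhombic half-angles satisfy $\theta_{x,y}\in(\eta,\pi/2-\eta)$ for all $x\sim y$. Let $(Y_t)_{t\ge0}$ be the Markov jump process on $V$ with conductances $c_{x,y}=\tan(\theta_{x,y})$, $x\sim y$, started at a vertex $x_0\in V$. For $N\in\mathbb{N}$ let $V_N=\{x\in V: d_\Gamma(x,x_0)\le N\}$, $\tau_N=\inf\{t\ge 0:Y_t\notin V_N\}$, $\ell_x^t=\int_0^t\mathbf{1}_{\{Y_s=x\}}ds$, and for $a\in[0,1]$ let $\mathcal{M}_N(a)=\{x\in V_N:\ell_x^{\tau_N}\ge \frac{a}{\pi}(\log N)^2\}$. Then, $\mathbb{P}_{x_0}$-almost surely, $$\lim_{N\to\infty}\frac{\max_{x\in V_N}\ell_x^{\tau_N}}{(\log N)^2}=\frac1\pi$$ and, for all $a\in[0,1)$, $\mathbb{P}_{x_0}$-almost surely, $$\lim_{N\to\infty}\frac{\log|\mathcal{M}_N(a)|}{\log N}=2(1-a).$$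
   Context: $\Gamma$ isoradial with common radius $1$ means: $\Gamma$ is a planar graph embedded in $\mathbb{C}$ and each face is inscribed into a circle of radius $1$. If $x,y\in V$ are adjacent, then $x$, $y$ and the centres of the two faces adjacent to the edge $\{x,y\}$ form a rhombus; $2\theta_{x,y}$ denotes the interior angle of this rhombus at $x$ (equivalently at $y$). $d_\Gamma$ is the graph distance. The process $Y$ waits at each vertex $x$ an exponential time with mean $1/\sum_{y\sim x}c_{x,y}$ and then jumps from $x$ to $y\sim x$ with probability $c_{x,y}/\sum_{z\sim x}c_{x,z}$. $\mathbb{P}_{x_0}$ is the law of $Y$ started at $x_0$; $|\cdot|$ of a finite set is its cardinality.
   Formalization: Isoradial is taken in the standard sense: straight edges, vertices without accumulation point, and each face's circle centre lies in the closed face; without the last condition the claim fails, e.g. for the lattice triangulation by 120-30-30 triangles (limit 1/(π√5)). *)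

(* Defs.v *)
From mathcomp Require Import all_boot all_order all_algebra.
From mathcomp Require Import finmap complex.
From mathcomp Require Import all_classical all_reals all_analysis.
Set Implicit Arguments.
Unset Strict Implicit.
Unset Printing Implicit Defensive.
Import Order.TTheory GRing.Theory Num.Theory.
Import numFieldNormedType.Exports.
Local Open Scope classical_set_scope.
Local Open Scope ring_scope.

Section Graph.
Variables (V : choiceType) (adj : rel V).

Definition walk_of_length (n : nat) (x y : V) : Prop :=
  exists p : seq V, [/\ path adj x p, last x p = y & size p = n].

Definition connected_graph : Prop :=
  forall x y, exists n, walk_of_length n x y.

(* Takes the default value 0 when no walk joins x to y. *)
Definition graph_dist (x y : V) : nat :=
  xget 0%N [set n | walk_of_length n x y /\
                    forall m, walk_of_length m x y -> (n <= m)%N].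

End Graph.

Section Isoradial.
Variables (R : realType) (V : choiceType) (adj : rel V) (pos : V -> R[i]).

(* The topological structure on R[i] is found through its numFieldType
   structure. *)
Let plane : numFieldType := R[i].

Definition edge_interior (x y : V) : set plane :=
  [set p | exists t : R, 0 < t < 1 /\
           p = (1 - t)%:C%C * pos x + t%:C%C * pos y].

Definition drawing : set plane :=
  [set p | (exists x, p = pos x) \/
           (exists x y, adj x y /\ edge_interior x y p)].

(* A planar simple graph drawn with straight edges (the edges of an isoradial
   graph are chords of circles), without accumulation point of vertices. *)
Definition planar_embedding : Prop :=
  [/\ symmetric adj,
      irreflexive adj,
      injective pos,
      (forall r : plane, finite_set [set x | `|pos x| <= r]) &
      (forall x y v, adj x y -> ~ edge_interior x y (pos v)) /\
      (forall x y x' y' p, adj x y -> adj x' y' ->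
         edge_interior x y p -> edge_interior x' y' p ->
         (x = x' /\ y = y') \/ (x = y' /\ y = x'))].

Definition is_face (F : set plane) : Prop :=
  exists2 p, (~` drawing) p & F = connected_component (~` drawing) p.

(* F is a polygon inscribed in the unit circle centred at c. As is standard for
   isoradial graphs, c lies in the closed polygon; without this, the lattice
   triangulation by translates and point reflections of an obtuse triangle would
   qualify, with the two circumcentres at its longest edges interchanged. *)
Definition is_circumcentre (F : set plane) (c : plane) : Prop :=
  [/\ forall p, F p -> `|p - c| <= 1,
      forall v, closure F (pos v) -> `|pos v - c| = 1 &
      closure F c].

Definition isoradial : Prop :=
  planar_embedding /\ forall F, is_face F -> exists c, is_circumcentre F c.

Definition face_of_edge (F : set plane) (x y : V) : Prop :=
  is_face F /\ edge_interior x y `<=` closure F.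

(* 2 * th is the interior angle at x of the rhombus x, c1, y, c2. The sides
   c1 - x and c2 - x are unit vectors, so the real part below, which is their
   Euclidean inner product, is the cosine of that angle. *)
Definition is_rhombus_half_angle (x y : V) (th : R) : Prop :=
  exists (F1 F2 : set plane) (c1 c2 : plane),
  [/\ F1 <> F2,
      face_of_edge F1 x y /\ face_of_edge F2 x y,
      is_circumcentre F1 c1 /\ is_circumcentre F2 c2 &
      2 * th = acos (complex.Re ((c1 - pos x) * ((c2 - pos x)^*)%C))].

End Isoradial.

Section JumpProcess.
Variables (R : realType) (V : choiceType) (adj : rel V) (c : V -> V -> R).

Definition jump_rate (x : V) : R := \sum_(y \in [set y | adj x y]) c x y.

Definition jump_prob (x y : V) : R :=
  if adj x y then c x y / jump_rate x else 0.

(* X is the embedded jump chain and H n is the n-th holding time. The second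
   clause says that X is a Markov chain started at x0 and that, given X, the
   holding times are independent, H i being exponential of rate
   jump_rate (X i). *)
Definition jump_process_from (d : measure_display) (Omega : measurableType d)
    (P : probability Omega R) (x0 : V) (Y : R -> Omega -> V) : Prop :=
  exists (X : nat -> Omega -> V) (H : nat -> {RV P >-> R}),
  [/\ forall n x, measurable [set w | X n w = x],
      forall (n : nat) (x : nat -> V) (B : nat -> set R),
        (forall i, measurable (B i)) ->
        P [set w | forall i, (i <= n)%N -> X i w = x i /\ B i (H i w)] =
        (((x 0%N == x0)%:R * \prod_(i < n) jump_prob (x i) (x i.+1))%:E *
         \prod_(i < n.+1) exponential_prob (jump_rate (x i)) (B i))%E &
      {ae P, forall w, forall (n : nat) (t : R),
        \sum_(i < n) H i w <= t < \sum_(i < n.+1) H i w -> Y t w = X n w}].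

End JumpProcess.

Section LocalTimes.
Variables (R : realType) (V : choiceType) (adj : rel V) (x0 : V).

Definition graph_ball (N : nat) : set V :=
  [set x | (graph_dist adj x x0 <= N)%N].

(* The functionals below are those of a single trajectory y; values of y at
   negative times are irrelevant. *)
Variable y : R -> V.

Definition exit_time (N : nat) : \bar R :=
  ereal_inf [set t%:E | t in [set t | 0 <= t /\ ~ graph_ball N (y t)]].

Definition local_time (x : V) (T : \bar R) : \bar R :=
  (\int[lebesgue_measure]_(s in [set s : R | (0 <= s)%R /\ s%:E <= T])
     (\1_[set u | y u = x] s)%:E)%E.

Definition max_local_time (N : nat) : \bar R :=
  \big[maxe/-oo%E]_(x <- enum_fset (fset_set (graph_ball N)))
    local_time x (exit_time N).

Definition thick_points (a : R) (N : nat) : set V :=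
  [set x | graph_ball N x /\
           ((a / pi * (ln N%:R) ^+ 2)%:E <= local_time x (exit_time N))%E].

End LocalTimes.

(* Main.v *)
Require Import Defs.
From mathcomp Require Import all_boot all_order all_algebra.
From mathcomp Require Import finmap complex.
From mathcomp Require Import all_classical all_reals all_analysis.
From mathcomp Require Import measurable_realfun ring lra.
Set Implicit Arguments.
Unset Strict Implicit.
Unset Printing Implicit Defensive.
Import Order.TTheory GRing.Theory Num.Theory.
Import numFieldNormedType.Exports.
Local Open Scope classical_set_scope.
Local Open Scope ring_scope.

(* The simple random walk is compared with the planar logarithmic potential. In an
   isoradial graph the circumcentres form a dual lattice, and the increments of the
   argument of c - x along dual edges show that ln |. - x| is harmonic up to an
   O(r^-3) error with total flux 2 pi; hence the Green function of a disc of radius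
   r is (ln (r / |x - y|) + o(ln r)) / 2 pi.

   Supersolutions of the discrete Laplacian bound exponential moments of local times
   (Chernoff). Applied to one point they give the upper bounds. For the lower bounds,
   a second moment is taken over the thick points whose average local times on annuli
   at all intermediate scales stay below their typical values; the truncated second
   moment is controlled by potentials with a positive charge at two points and a
   negative charge spread over the annulus at the scale of their distance. Independent
   attempts over successive time windows turn a success probability N^-eps into an
   almost sure statement.

   Holding times concentrate given the embedded walk, which transfers the estimates
   to the jump process; Borel-Cantelli along N = 2^k and monotonicity conclude. *)

(** * Calculus and planar topology *)

(** Once x is hit, the time spent there before leaving a disc of radius N is about exponential with
    mean log N / (2 pi). It exceeds a (log N)^2 / pi with probability about N^(-2a), and N^2
    vertices leave N^(2-2a) thick points. The plain second moment fails for a > 1/2: two points at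
    distance N^s are both thick with probability about N^(-4a/(2-s)), which is too large against the
    N^(2s) possible partners. Around a thick point, however, the mean local time at distance N^s is
    typically a (1-s)^2 (log N)^2 / pi: the square root of the profile is linear in s. Allowing
    hardly more than this lowers the pair probability to about N^(-2a(1+s)), and then the pairs at
    the largest distance dominate for every a < 1. Both exponents come out of explicit potentials,
    which require the Green function only up to an error o(log N). The walk is handled through
    finite recursions for its expectations; probability spaces appear only when the holding times
    are added. *)

Section Calculus.
Variable R : realType.
Implicit Types a b t x y : R.

(** The mean value theorem on the segment between 0 and t turns a quadratic bound on the derivative
    into a cubic one on [f]. Logarithm and arctangent are later compared with their linear terms to
    this order. *)
Lemma cubic_bound (f df : R -> R) (K t : R) : 0 <= K ->
  f 0 = 0 ->
  (forall x, `|x| <= `|t| -> is_derive x 1 f (df x)) ->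
  (forall x, `|x| <= `|t| -> `|df x| <= K * x ^+ 2) ->
  `|f t| <= K * `|t| ^+ 3.
Proof.
move=> K0 f0 fd fb.
suff [c ct ->] : exists2 c, `|c| <= `|t| & f t = df c * t.
  rewrite normrM (le_trans (ler_wpM2r (normr_ge0 t) (fb _ ct)))//.
  rewrite [in leRHS]exprSr [leRHS]mulrA ler_wpM2r// ler_wpM2l//.
  by rewrite -real_normK ?num_real// lerXn2r ?nnegrE.
have cf (a b : R) : (forall x, x \in `[a, b] -> `|x| <= `|t|) ->
    {within `[a, b], continuous f}.
  move=> h; refine (derivable_within_continuous _) => x xab.
  by have [] := fd x (h x xab).
have [t0|t0] := leP 0 t.
  have [||c] := @MVT_segment R f df 0 t t0.
  - move=> x; rewrite in_itv/= => /andP[x0 xt]; apply: fd.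
    by rewrite !ger0_norm // ltW.
  - refine (cf _ _ _) => x; rewrite in_itv/= => /andP[x0 xt]; by rewrite !ger0_norm.
  rewrite in_itv/= => /andP[c0 ct]; rewrite f0 !subr0 => ->.
  by exists c => //; rewrite !ger0_norm.
have [||c] := @MVT_segment R f df t 0 (ltW t0).
- move=> x; rewrite in_itv/= => /andP[x0 xt]; apply: fd.
  by rewrite !ler0_norm ?lerN2 // ltW.
- refine (cf _ _ _) => x; rewrite in_itv/= => /andP[x0 xt]; by rewrite !ler0_norm ?lerN2// ltW.
rewrite in_itv/= => /andP[c0 ct]; rewrite f0 !sub0r mulrN => /oppr_inj ->.
by exists c => //; rewrite !ler0_norm ?lerN2// ltW.
Qed.

Lemma atan_taylor t : `|atan t - t| <= `|t| ^+ 3.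
Proof.
rewrite -[leRHS]mul1r.
apply: (@cubic_bound (fun t => atan t - t) (fun x => (1 + x ^+ 2)^-1 - 1)) => //.
  by rewrite atan0 subrr.
move=> x _; have x2 : 0 < 1 + x ^+ 2 by have := sqr_ge0 x; lra.
have -> : (1 + x ^+ 2)^-1 - 1 = - (x ^+ 2 / (1 + x ^+ 2)).
  by field; rewrite gt_eqF.
rewrite normrN ger0_norm; last by rewrite divr_ge0 ?sqr_ge0 ?ltW.
by rewrite mul1r ler_pdivrMr// ler_peMr ?sqr_ge0// lerDl sqr_ge0.
Qed.

(** The half difference of the logarithms is the inverse hyperbolic tangent: being odd, it has no
    quadratic term. *)
Lemma lnratio_taylor t : `|t| <= 2^-1 ->
  `|(ln (1 + t) - ln (1 - t)) / 2 - t| <= 2 * `|t| ^+ 3.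
Proof.
move=> t2.
apply: (@cubic_bound (fun t => (ln (1 + t) - ln (1 - t)) / 2 - t)
  (fun x => ((1 + x)^-1 + (1 - x)^-1) / 2 - 1)) => //.
- by rewrite addr0 !subr0 ln1 subrr mul0r.
- move=> x xt; have : `|x| <= 2^-1 by apply: le_trans t2.
  rewrite ler_norml => /andP[x1 x2].
  have p1 : 0 < 1 + x by lra.
  have p2 : 0 < 1 - x by lra.
  have d1 : is_derive x 1 (fun x => ln (1 + x)) (1 + x)^-1.
    have := @is_derive1_comp R (@ln R) (fun x => 1 + x) x (1 + x)^-1 1 (is_derive1_ln p1).
    rewrite mulr1; apply.
    by apply: is_derive_eq; ring.
  have d2 : is_derive x 1 (fun x => ln (1 - x)) (- (1 - x)^-1).
    have := @is_derive1_comp R (@ln R) (fun x => 1 - x) x (1 - x)^-1 (-1) (is_derive1_ln p2).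
    rewrite mulrN1; apply.
    by apply: is_derive_eq; ring.
  apply: is_derive_eq; rewrite /GRing.scale/=; field.
  by rewrite !gt_eqF.
- move=> x xt; have : `|x| <= 2^-1 by apply: le_trans t2.
  rewrite ler_norml => /andP[x1 x2].
  have p1 : 0 < 1 + x by lra.
  have p2 : 0 < 1 - x by lra.
  have p3 : 0 < 1 - x ^+ 2 by nra.
  have -> : ((1 + x)^-1 + (1 - x)^-1) / 2 - 1 = x ^+ 2 / (1 - x ^+ 2).
    by field; rewrite !gt_eqF.
  rewrite ger0_norm; last by rewrite divr_ge0 ?sqr_ge0 ?ltW.
  rewrite ler_pdivrMr//.
  have h : x ^+ 2 <= 4^-1 by nra.
  by move: (x ^+ 2) (sqr_ge0 x) h => y y0 h; nra.
Qed.

(* The argument in ]-pi, pi[ of the complex number a + ib, for a + ib off the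
   half-line of nonpositive reals (on which the value is 0). *)
Definition oang a b := Num.sg b * acos (a / Num.sqrt (a ^+ 2 + b ^+ 2)).

Definition offcut a b := (b != 0) || (0 < a).

Lemma oangN a b : oang a (- b) = - oang a b.
Proof. by rewrite /oang sgrN sqrrN mulNr. Qed.

Lemma offcut_norm_gt0 a b : offcut a b -> 0 < a ^+ 2 + b ^+ 2.
Proof.
move=> /orP[b0|a0].
  by rewrite ltr_wpDl ?sqr_ge0// lt_def sqr_ge0 sqrf_eq0 b0.
by rewrite ltr_pwDl ?sqr_ge0// exprn_gt0.
Qed.

Lemma oang_spec a b : offcut a b ->
  [/\ cos (oang a b) = a / Num.sqrt (a ^+ 2 + b ^+ 2),
      sin (oang a b) = b / Num.sqrt (a ^+ 2 + b ^+ 2) &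
      - pi < oang a b < pi].
Proof.
move=> ab; have n0 := offcut_norm_gt0 ab.
set r := Num.sqrt _; have r0 : 0 < r by rewrite sqrtr_gt0.
have r2 : r ^+ 2 = a ^+ 2 + b ^+ 2 by rewrite sqr_sqrtr ?ltW.
have ar : -1 <= a / r <= 1.
  rewrite ler_pdivlMr// ler_pdivrMr// mulN1r mul1r -ler_norml.
  by rewrite -sqrtr_sqr ler_wsqrtr// lerDl sqr_ge0.
have sa : Num.sqrt (1 - (a / r) ^+ 2) = `|b| / r.
  have -> : 1 - (a / r) ^+ 2 = (`|b| / r) ^+ 2.
    rewrite !expr_div_n real_normK ?num_real// r2.
    by field; rewrite gt_eqF.
  by rewrite sqrtr_sqr ger0_norm ?divr_ge0 // ltW.
have ck := acosK ar; have sk := sin_acos ar.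
have [b0|b0|b0] := ltgtP b 0.
- rewrite /oang ltr0_sg// mulN1r cosN sinN -/r ck sk sa ltr0_norm//; split => //.
    by rewrite mulNr opprK.
  have h : acos (a / r) < pi.
    apply: acos_ltpi; move: ar => /andP[h1 ->]; rewrite andbT lt_neqAle h1 andbT.
    apply/eqP => h; move: sa; rewrite -h sqrrN expr1n subrr sqrtr0 => /esym/eqP.
    by rewrite mulf_eq0 invr_eq0 (gt_eqF r0) orbF normr_eq0 lt_eqF.
  have h2 := acos_ge0 ar; have := @pi_gt0 R; lra.
- rewrite /oang gtr0_sg// mul1r -/r ck sk sa gtr0_norm//; split => //.
  have h : acos (a / r) < pi.
    apply: acos_ltpi; move: ar => /andP[h1 ->]; rewrite andbT lt_neqAle h1 andbT.
    apply/eqP => h; move: sa; rewrite -h sqrrN expr1n subrr sqrtr0 => /esym/eqP.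
    by rewrite mulf_eq0 invr_eq0 (gt_eqF r0) orbF normr_eq0 gt_eqF.
  have h2 := acos_ge0 ar; have := @pi_gt0 R; lra.
- move: ab; rewrite /offcut b0 eqxx/= => a0.
  have ra : r = a by rewrite /r b0 expr0n addr0 sqrtr_sqr gtr0_norm.
  rewrite /oang sgr0 mul0r cos0 sin0 mul0r ra divff ?gt_eqF//; split => //.
  by rewrite oppr_lt0 pi_gt0.
Qed.

Lemma oang_uniq a b r t : 0 < r -> - pi < t < pi ->
  a = r * cos t -> b = r * sin t -> oang a b = t.
Proof.
move=> r0 tpi -> ->.
rewrite /oang.
have -> : (r * cos t) ^+ 2 + (r * sin t) ^+ 2 = r ^+ 2.
  by rewrite !exprMn -mulrDr cos2Dsin2 mulr1.
rewrite sqrtr_sqr gtr0_norm// mulrAC divff ?gt_eqF// mul1r.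
rewrite sgrM gtr0_sg// mul1r.
move: tpi => /andP[t1 t2].
have [t0|t0|->] := ltgtP t 0.
- have s0 : sin t < 0.
    by rewrite -[t]opprK sinN oppr_lt0 sin_gt0_pi// oppr_gt0 t0 ltrNl.
  by rewrite ltr0_sg// mulN1r cosKN ?opprK// !ltW.
- have s0 : 0 < sin t by rewrite sin_gt0_pi// t0.
  by rewrite gtr0_sg// mul1r cosK// in_itv/= !ltW.
- by rewrite sin0 sgr0 mul0r.
Qed.

(** The right side is the argument of the quotient of [c + i d] by [a + i b], up to a positive
    factor. The equality is clear modulo 2 pi, and the range hypothesis selects the
    representative. *)
Lemma oang_sub_spec a b c d : offcut a b -> offcut c d ->
  - pi < oang c d - oang a b < pi ->
  oang c d - oang a b = oang (a * c + b * d) (a * d - b * c).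
Proof.
move=> ab cd h.
have [c1 s1 _] := oang_spec ab; have [c2 s2 _] := oang_spec cd.
have := offcut_norm_gt0 ab; have := offcut_norm_gt0 cd.
rewrite -sqrtr_gt0 => r2; rewrite -sqrtr_gt0 => r1.
apply/esym; apply: (oang_uniq (mulr_gt0 r1 r2) h).
  by rewrite cosB c1 s1 c2 s2; field; rewrite !gt_eqF.
by rewrite sinB c1 s1 c2 s2; field; rewrite !gt_eqF.
Qed.

Lemma oang_gt0 a b : 0 < b -> 0 < oang a b.
Proof.
move=> b0; have ab : offcut a b by rewrite /offcut gt_eqF.
have [_ s /andP[h1 h2]] := oang_spec ab.
have r0 := offcut_norm_gt0 ab; rewrite -sqrtr_gt0 in r0.
have sp : 0 < sin (oang a b) by rewrite s divr_gt0.
rewrite ltNge; apply/negP => h; move: sp; rewrite ltNge => /negP; apply.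
have [->|hn] := eqVneq (oang a b) 0; first by rewrite sin0.
rewrite -[oang a b]opprK sinN oppr_le0 ltW// sin_gt0_pi// oppr_gt0.
by rewrite lt_neqAle hn h/= ltrNl.
Qed.

Lemma oang_lt0 a b : b < 0 -> oang a b < 0.
Proof. by move=> b0; rewrite -[b]opprK oangN oppr_lt0 oang_gt0// oppr_gt0. Qed.

Lemma oang_pos a : oang a 0 = 0.
Proof. by rewrite /oang sgr0 mul0r. Qed.

Lemma oang_half a b : 0 < a -> - (pi / 2) < oang a b < pi / 2.
Proof.
move=> a0; have ab : offcut a b by rewrite /offcut a0 orbT.
have [s _ /andP[h1 h2]] := oang_spec ab.
have r0 := offcut_norm_gt0 ab; rewrite -sqrtr_gt0 in r0.
have sp : 0 < cos (oang a b) by rewrite s divr_gt0.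
have pp := @pi_gt0 R.
rewrite -ltr_norml ltNge; apply/negP => h.
have : cos `|oang a b| <= 0.
  rewrite -[X in cos X](subrK (pi / 2)) cosDpihalf oppr_le0.
  have h3 : `|oang a b| < pi by rewrite ltr_norml h1.
  by apply: sin_ge0_pi; move: h3 h pp; set z := `|_|; lra.
have -> : cos `|oang a b| = cos (oang a b).
  by case: (ler0P (oang a b)) => _; rewrite ?cosN.
by rewrite leNgt sp.
Qed.

Lemma oang_sub_half a b c d : 0 < a -> 0 < c ->
  oang c d - oang a b = oang (a * c + b * d) (a * d - b * c).
Proof.
move=> a0 c0; apply: oang_sub_spec; rewrite /offcut ?a0 ?c0 ?orbT//.
have := oang_half b a0; have := oang_half d c0; lra.
Qed.

(** A positive cross product means a counterclockwise turn by less than pi. The difference of the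
    arguments could be off by 2 pi only if this turn passed over the cut, from the upper to the
    lower half-plane, which the last hypothesis excludes. *)
Lemma oang_sub_cut a b c d : offcut a b -> offcut c d ->
  0 < a * d - b * c -> ~ (d < 0 < b) ->
  oang c d - oang a b = oang (a * c + b * d) (a * d - b * c).
Proof.
move=> ab cd cr ncut; apply: oang_sub_spec => //.
have [c1 s1 /andP[p1 p2]] := oang_spec ab.
have [c2 s2 /andP[p3 p4]] := oang_spec cd.
have := offcut_norm_gt0 ab; have := offcut_norm_gt0 cd.
rewrite -sqrtr_gt0 => r2; rewrite -sqrtr_gt0 => r1.
have pp := @pi_gt0 R.
apply/andP; split.
  have [d0|d0] := ltP d 0.
    have b0 : b <= 0 by rewrite leNgt; apply/negP => b0; apply: ncut; rewrite d0.
    suff : oang a b <= 0 by lra.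
    by move: b0; rewrite le_eqVlt => /orP[/eqP ->|/oang_lt0/ltW//]; rewrite oang_pos.
  suff : 0 <= oang c d by lra.
  by move: d0; rewrite le_eqVlt => /orP[/eqP <-|/oang_gt0/ltW//]; rewrite oang_pos.
have s : 0 < sin (oang c d - oang a b).
  rewrite sinB c1 s1 c2 s2.
  set v := Num.sqrt _; set u := Num.sqrt _.
  have -> : d / v * (a / u) - c / v * (b / u) = (a * d - b * c) / (u * v).
    by field; rewrite !gt_eqF.
  by rewrite divr_gt0 ?mulr_gt0.
rewrite ltNge; apply/negP => h.
move: s; rewrite ltNge => /negP; apply.
rewrite -[_ - _](subrK pi) sinDpi oppr_le0.
by apply: sin_ge0_pi; lra.
Qed.

Lemma oang_atan a b : 0 < a -> oang a b = atan (b / a).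
Proof.
move=> a0.
have t1 := atan_gtNpi2 (b / a); have t2 := atan_ltpi2 (b / a).
have cp : 0 < cos (atan (b / a)) by apply: cos_gt0_pihalf; rewrite t1.
have := atanK (b / a); rewrite /tan => /(congr1 ( *%R^~ (cos (atan (b / a))))).
rewrite divfK ?gt_eqF// => st.
apply: (@oang_uniq _ _ (a / cos (atan (b / a)))); first by rewrite divr_gt0.
- have := @pi_gt0 R; lra.
- by rewrite divfK ?gt_eqF.
- by rewrite st; field; rewrite !gt_eqF.
Qed.

End Calculus.

(** * Half-planes, segments and squared distances in the plane *)

Section PlaneTopology.
Variable R : realType.
Local Notation plane := (R[i] : numFieldType).
Local Notation Re := complex.Re.
Local Notation Im := complex.Im.

(** Distances are kept squared, so that geometric inequalities are polynomial in the coordinates. *)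
Definition d2 (p q : R[i]) : R := (Re q - Re p) ^+ 2 + (Im q - Im p) ^+ 2.

Lemma complex_eta (p q : R[i]) : Re p = Re q -> Im p = Im q -> p = q.
Proof. by case: p q => a b [c d] /= -> ->. Qed.

Lemma d2_ge0 p q : 0 <= d2 p q.
Proof. by rewrite addr_ge0 ?sqr_ge0. Qed.

Lemma d2C p q : d2 p q = d2 q p.
Proof. by rewrite /d2; ring. Qed.

Lemma normc_sub (p q : R[i]) : `|p - q| = (Num.sqrt (d2 q p))%:C%C.
Proof.
case: p q => a b [c d].
by rewrite normc_def /d2.
Qed.

Lemma normc_sub_eq1 (p q : R[i]) : `|p - q| = 1 -> d2 q p = 1.
Proof.
rewrite normc_sub => -[h]; rewrite -[LHS]sqr_sqrtr ?d2_ge0// h.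
by rewrite expr1n.
Qed.

Lemma normc_sub_le1 (p q : R[i]) : `|p - q| <= 1 -> d2 q p <= 1.
Proof.
rewrite normc_sub lecE/= => /andP[_ h].
rewrite -[leLHS]sqr_sqrtr ?d2_ge0// -(expr1n _ 2).
by rewrite lerXn2r ?nnegrE ?sqrtr_ge0//.
Qed.

Lemma plane_nbhsP (p : plane) (A : set plane) :
  nbhs p A <-> exists e : R, 0 < e /\ forall q : R[i], d2 p q < e ^+ 2 -> A q.
Proof.
split.
  move/nbhs_normP => [e /= e0 h].
  move: e0; rewrite ltcE/= => /andP[/eqP Ie Re0].
  exists (Re e); split => // q pq; apply: h => /=.
  rewrite normc_sub ltcE/= Ie eqxx/= d2C.
  rewrite -(ltr_pXn2r (n := 2)) ?nnegrE ?sqrtr_ge0 ?ltW//.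
  by rewrite sqr_sqrtr ?d2_ge0.
move=> [e [e0 h]]; apply/nbhs_normP; exists (e%:C%C) => /=.
  by rewrite ltcE/= eqxx.
move=> q /=; rewrite normc_sub ltcE/= eqxx/= => pq; apply: h.
rewrite d2C -[ltLHS]sqr_sqrtr ?d2_ge0//.
by rewrite ltrXn2r ?nnegrE ?sqrtr_ge0// ltW.
Qed.

Lemma ball_coord (p q : R[i]) e : 0 < e -> d2 p q < e ^+ 2 ->
  `|Re q - Re p| < e /\ `|Im q - Im p| < e.
Proof.
move=> e0; rewrite /d2 => h; split;
rewrite -(ltr_pXn2r (n := 2)) ?nnegrE ?normr_ge0 ?ltW// real_normK ?num_real//;
apply: le_lt_trans h; rewrite ?lerDl ?lerDr sqr_ge0//.
Qed.

Lemma open_halfplane (a b c : R) :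
  open [set z : plane | 0 < a * Re z + b * Im z + c].
Proof.
rewrite openE => p /= hp; apply/plane_nbhsP.
set l := _ + c in hp.
have k0 : 0 < `|a| + `|b| + 1 by rewrite ltr_wpDl ?addr_ge0.
exists (l / (`|a| + `|b| + 1)); split; first by rewrite divr_gt0.
move=> q /ball_coord[|h1 h2]; first by rewrite divr_gt0.
set e := l / _ in h1 h2.
have el : l = e * (`|a| + `|b| + 1) by rewrite divfK ?gt_eqF.
have e0 : 0 < e by rewrite divr_gt0.
rewrite /=; have -> : a * Re q + b * Im q + c = l + a * (Re q - Re p) + b * (Im q - Im p).
  by rewrite /l; ring.
have h3 : - (`|a| * e) <= a * (Re q - Re p).
  have : `|a * (Re q - Re p)| <= `|a| * e by rewrite normrM ler_wpM2l// ltW.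
  by rewrite ler_norml => /andP[].
have h4 : - (`|b| * e) <= b * (Im q - Im p).
  have : `|b * (Im q - Im p)| <= `|b| * e by rewrite normrM ler_wpM2l// ltW.
  by rewrite ler_norml => /andP[].
by move: el h3 h4 e0; move: (`|a|) (`|b|) => A B; lra.
Qed.

Lemma closed_halfplane (a b c : R) :
  closed [set z : plane | 0 <= a * Re z + b * Im z + c].
Proof.
rewrite -[X in closed X]setCK; apply: open_closedC.
have -> : ~` [set z : plane | 0 <= a * Re z + b * Im z + c] =
  [set z | 0 < (- a) * Re z + (- b) * Im z + (- c)].
  apply/seteqP; split => z /=.
    by move=> /negP; rewrite -ltNge; lra.
  by move=> h; apply/negP; rewrite -ltNge; lra.
exact: open_halfplane.
Qed.

(** As F misses the line, the open and the closed half-plane cut out the same subset of F, which is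
    then both open and closed in F. *)
Lemma connected_side (F : set plane) (a b c : R) (p : plane) : connected F ->
  (forall q, F q -> a * Re q + b * Im q + c != 0) ->
  F p -> 0 < a * Re p + b * Im p + c ->
  forall q, F q -> 0 < a * Re q + b * Im q + c.
Proof.
move=> Fc F0 Fp lp q Fq.
suff : F `&` [set z | 0 < a * Re z + b * Im z + c] = F.
  by move=> /seteqP[_ /(_ q Fq)[]].
apply: Fc.
- by exists p.
- by exists [set z | 0 < a * Re z + b * Im z + c] => //; exact: open_halfplane.
- exists [set z | 0 <= a * Re z + b * Im z + c]; first exact: closed_halfplane.
  apply/seteqP; split => z /= [Fz h]; split => //; first exact: ltW.
  by rewrite lt_def F0.
Qed.

Lemma closure_side (F : set plane) (a b c : R) (p : plane) :
  (forall q, F q -> 0 < a * Re q + b * Im q + c) -> closure F p ->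
  0 <= a * Re p + b * Im p + c.
Proof.
move=> h; have := @closed_halfplane a b c => cl; move: p.
suff : closure F `<=` [set z : plane | 0 <= a * Re z + b * Im z + c] by [].
move/closure_id: cl => ->; apply: closureS => q /h /=; exact: ltW.
Qed.

Definition pmix (p q : R[i]) (t : R) : R[i] :=
  ((Re p + t * (Re q - Re p)) +i* (Im p + t * (Im q - Im p)))%C.

Lemma pmix0 p q : pmix p q 0 = p.
Proof. by apply: complex_eta => /=; rewrite mul0r addr0. Qed.

Lemma pmix1 p q : pmix p q 1 = q.
Proof. by apply: complex_eta => /=; ring. Qed.

Lemma pmix_rev p q t : pmix q p t = pmix p q (1 - t).
Proof. by apply: complex_eta => /=; ring. Qed.

Lemma d2_pmix p q s t : d2 (pmix p q s) (pmix p q t) = (t - s) ^+ 2 * d2 p q.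
Proof. by rewrite /d2/=; ring. Qed.

Lemma segment_connected_plane (p q : R[i]) :
  connected [set z : plane | exists2 t : R, 0 <= t <= 1 & z = pmix p q t].
Proof.
have -> : [set z : plane | exists2 t : R, 0 <= t <= 1 & z = pmix p q t] =
    [set (pmix p q t : plane) | t in `[0, 1]].
  apply/seteqP; split => z /=.
    by move=> [t t01 ->]; exists t => //=; rewrite in_itv.
  by move=> [t]; rewrite in_itv/= => t01 <-; exists t.
apply: connected_continuous_connected; first exact: segment_connected.
apply: continuous_subspaceT => t A /= /plane_nbhsP[e [e0 h]].
rewrite nbhs_simpl/=; apply/nbhs_ballP.
exists (e / (1 + d2 p q)) => /=; first by rewrite divr_gt0// ltr_pwDl// d2_ge0.
move=> s /=; rewrite /ball/= => ts; apply: h; rewrite d2_pmix.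
have D0 := d2_ge0 p q; have D1 : 0 < 1 + d2 p q by lra.
move: ts; rewrite ltr_pdivlMr// => ts.
have : (`|t - s| * (1 + d2 p q)) ^+ 2 < e ^+ 2.
  by rewrite ltrXn2r ?nnegrE ?mulr_ge0// ltW.
apply: le_lt_trans; rewrite exprMn real_normK ?num_real//.
have -> : (s - t) ^+ 2 = (t - s) ^+ 2 by ring.
rewrite ler_wpM2l ?sqr_ge0//; nra.
Qed.

Lemma exists_uniform (T : eqType) (s : seq T) (P : T -> R -> Prop) :
  (forall x e e', P x e -> 0 < e' -> e' <= e -> P x e') ->
  (forall x, x \in s -> exists2 e, 0 < e & P x e) ->
  exists2 e, 0 < e & forall x, x \in s -> P x e.
Proof.
move=> mono; elim: s => [|a s IH] h; first by exists 1.
have [|e e0 he] := IH.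
  by move=> x xs; apply: h; rewrite inE xs orbT.
have [|e' e'0 he'] := h a; first by rewrite inE eqxx.
exists (Num.min e e'); first by rewrite lt_min e0.
move=> x; rewrite inE => /orP[/eqP ->|xs].
  by apply: (mono _ e') => //; rewrite ?lt_min ?e0// ge_min lexx orbT.
by apply: (mono _ e); rewrite ?lt_min ?e0 ?ge_min ?lexx//; exact: he.
Qed.

Lemma exists_argmax (T : eqType) (s : seq T) (f : T -> R) (a : T) : a \in s ->
  exists2 m, m \in s & forall x, x \in s -> f x <= f m.
Proof.
elim: s a => [//|b s IH] a _.
case: s IH => [_|c s IH].
  by exists b; rewrite ?inE// => x; rewrite inE => /eqP ->.
have [|m ms hm] := IH c; first by rewrite inE eqxx.
have [bm|mb] := leP (f b) (f m).
  exists m; first by rewrite inE ms orbT.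
  by move=> x; rewrite inE => /orP[/eqP ->//|/hm].
exists b; first by rewrite inE eqxx.
move=> x; rewrite inE => /orP[/eqP ->//|/hm h].
by apply: (le_trans h); exact: ltW.
Qed.

(** Along the line ab the squared distance to p is a quadratic polynomial: [t0] is the parameter of
    the foot of the perpendicular and [k ^+ 2 / L] the squared distance to the line. Either [k] is
    nonzero, or [t0] lies outside [0, 1]. *)
Lemma dist_segment_gt0 (a b p : R[i]) : a != b ->
  ~ (exists2 t, 0 <= t <= 1 & p = pmix a b t) ->
  exists2 e, 0 < e & forall t, 0 <= t <= 1 -> e ^+ 2 <= d2 p (pmix a b t).
Proof.
move=> ab np.
have L0 : 0 < d2 a b.
  rewrite lt_def d2_ge0 andbT; apply: contra_neq ab => h.
  move: h; rewrite /d2 => /eqP; rewrite paddr_eq0 ?sqr_ge0// !sqrf_eq0 !subr_eq0.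
  by move=> /andP[/eqP h1 /eqP h2]; apply: complex_eta.
set L := d2 a b in L0.
pose k := (Re b - Re a) * (Im p - Im a) - (Im b - Im a) * (Re p - Re a).
pose N := (Re b - Re a) * (Re p - Re a) + (Im b - Im a) * (Im p - Im a).
pose t0 := N / L.
have key t : d2 p (pmix a b t) = (t - t0) ^+ 2 * L + k ^+ 2 / L.
  have Ln0 : L != 0 by rewrite gt_eqF.
  have -> : (t - t0) ^+ 2 * L + k ^+ 2 / L = ((t * L - N) ^+ 2 + k ^+ 2) / L.
    by rewrite /t0; field.
  by apply: (mulIf Ln0); rewrite divfK// /k /N /L /d2/=; ring.
have [k0|k0] := eqVneq k 0.
  have t0n : ~ (0 <= t0 <= 1).
    move=> h; apply: np; exists t0 => //.
    have : d2 p (pmix a b t0) = 0.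
      by rewrite key k0 subrr !expr0n/= mul0r mul0r addr0.
    move=> /eqP; rewrite paddr_eq0 ?sqr_ge0// !sqrf_eq0 !subr_eq0.
    by move=> /andP[/eqP h1 /eqP h2]; apply: complex_eta.
  pose e := if t0 < 0 then - t0 else t0 - 1.
  have e0 : 0 < e.
    rewrite /e; case: (ltP t0 0) => h; first by rewrite oppr_gt0.
    by rewrite subr_gt0 ltNge; apply/negP => h'; apply: t0n; rewrite h.
  (* [Num.min 1 L] stands in for the square root of L: its square is at most L. *)
  exists (e * Num.min 1 L); first by rewrite mulr_gt0// lt_min ltr01.
  move=> t t01; rewrite key k0 expr0n/= mul0r addr0 exprMn.
  have m0 : 0 < Num.min 1 L by rewrite lt_min ltr01.
  have mL : (Num.min 1 L) ^+ 2 <= L.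
    have m1 : Num.min 1 L <= 1 by rewrite ge_min lexx.
    have m2 : Num.min 1 L <= L by rewrite ge_min lexx orbT.
    by rewrite expr2; nra.
  rewrite ler_pM ?sqr_ge0//.
  have et : e <= `|t - t0|.
    rewrite /e; case: (ltP t0 0) => h.
      by rewrite ger0_norm; lra.
    have : 1 < t0 by rewrite ltNge; apply/negP => h'; apply: t0n; rewrite h.
    by move=> ?; rewrite ler0_norm; lra.
  by rewrite -[leRHS]real_normK ?num_real// lerXn2r ?nnegrE ?normr_ge0// ltW.
exists (`|k| / (1 + L)).
  by rewrite divr_gt0 ?normr_gt0//; lra.
move=> t _; rewrite key.
apply: (@le_trans _ _ (k ^+ 2 / L)); last by rewrite lerDr mulr_ge0 ?sqr_ge0// ltW.
rewrite expr_div_n real_normK ?num_real// ler_wpM2l ?sqr_ge0//.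
rewrite lef_pV2 ?posrE//; last by rewrite exprn_gt0//; lra.
by rewrite expr2; nra.
Qed.

End PlaneTopology.

(* Neighbours, half-angles and coordinates of an isoradial graph, with the
   metric facts about its dual vertices [dual G x y] (the centre of the face to
   the left of xy) that the probabilistic part relies on. *)
Record rhombic_graph (R : realType) (V : choiceType) := RhombicGraph {
  gx : V -> R;
  gy : V -> R;
  nb : V -> seq V;
  th : V -> V -> R;
  geta : R;
  gball : R -> R -> R -> seq V;
  dualx := fun x y => gx x + (gx y - gx x) / 2 - tan (th x y) / 2 * (gy y - gy x);
  dualy := fun x y => gy x + (gy y - gy x) / 2 + tan (th x y) / 2 * (gx y - gx x);
  gd2 := fun x y => (gx y - gx x) ^+ 2 + (gy y - gy x) ^+ 2;
  gpos_inj : forall x y, gx x = gx y -> gy x = gy y -> x = y;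
  geta_itv : 0 < geta < pi / 4;
  nb_uniq : forall x, uniq (nb x);
  nb_sym : forall x y, (y \in nb x) = (x \in nb y);
  nb_irr : forall x, x \notin nb x;
  nb_exists : forall x, exists y, y \in nb x;
  th_itv : forall x y, y \in nb x -> geta < th x y < pi / 2 - geta;
  th_symm : forall x y, y \in nb x -> th y x = th x y;
  nb_length : forall x y, y \in nb x -> gd2 x y = 4 * cos (th x y) ^+ 2;
  dual_telescope : forall x (phi : R -> R -> R),
    \sum_(y <- nb x) phi (dualx x y) (dualy x y) =
    \sum_(y <- nb x) phi (dualx y x) (dualy y x);
  dual_delaunay : forall x y z, y \in nb x ->
    1 <= (gx z - dualx x y) ^+ 2 + (gy z - dualy x y) ^+ 2;
  angle_total : forall x, \sum_(y <- nb x) (2 * th x y) = 2 * pi;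
  nb_towards : forall x a b D, a ^+ 2 + b ^+ 2 = 1 -> 1 < D ->
    exists2 w, w \in nb x & gd2 x w / 2 < D * (a * (gx w - gx x) + b * (gy w - gy x));
  nb_closer_strict : forall x z, x != z -> exists2 w, w \in nb x & gd2 w z < gd2 x z;
  gball_uniq : forall a b r, uniq (gball a b r);
  mem_gball : forall a b r v,
    (v \in gball a b r) = ((gx v - a) ^+ 2 + (gy v - b) ^+ 2 <= r ^+ 2) }.

(** * Geometry of isoradial graphs *)

Section IsoradialGeometry.
Variables (R : realType) (V : choiceType) (adj : rel V) (pos : V -> R[i]).
Hypotheses (Vinfinite : infinite_set [set: V])
  (adj_connected : connected_graph adj)
  (adj_isoradial : isoradial adj pos).
Variable theta : V -> V -> R.
Hypothesis thetaP : forall x y, adj x y ->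
  is_rhombus_half_angle adj pos x y (theta x y).
Variable eta : R.
Hypotheses (eta_itv : 0 < eta < pi / 4)
  (theta_itv : forall x y, adj x y -> eta < theta x y < pi / 2 - eta).
Tactic Notation "keep" ne_hyp_list(hs) := clear - R V adj pos Vinfinite
  adj_connected adj_isoradial theta thetaP eta eta_itv theta_itv
  hs.

Local Notation plane := (R[i] : numFieldType).
Local Notation Re := complex.Re.
Local Notation Im := complex.Im.
Local Notation D := (drawing adj pos).
Local Notation X v := (Re (pos v)).
Local Notation Y v := (Im (pos v)).

Lemma adj_sym : symmetric adj.
Proof. by case: adj_isoradial => -[]. Qed.

Lemma adj_irr : irreflexive adj.
Proof. by case: adj_isoradial => -[]. Qed.

Lemma pos_inj : injective pos.
Proof. by case: adj_isoradial => -[]. Qed.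

(** The cross product of y - x and p - x, positive to the left of the oriented line xy. *)
Definition crs (x y : V) (p : R[i]) : R :=
  (X y - X x) * (Im p - Y x) - (Y y - Y x) * (Re p - X x).

Lemma crsE x y p : crs x y p = (- (Y y - Y x)) * Re p + (X y - X x) * Im p +
  ((Y y - Y x) * X x - (X y - X x) * Y x).
Proof. by rewrite /crs; ring. Qed.

Lemma crs_sym x y p : crs y x p = - crs x y p.
Proof. by rewrite /crs; ring. Qed.

Lemma crs_pmix x y p q t :
  crs x y (pmix p q t) = (1 - t) * crs x y p + t * crs x y q.
Proof. by rewrite /crs/=; ring. Qed.

Lemma d2_pmix_r (p a b : R[i]) s :
  d2 p (pmix a b s) = (1 - s) * d2 p a + s * d2 p b - s * (1 - s) * d2 a b.
Proof. by rewrite /d2/=; ring. Qed.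

Lemma d2_pmix_lt (p a b : R[i]) s r : 0 <= s <= 1 -> d2 p a < r -> d2 p b < r ->
  d2 p (pmix a b s) < r.
Proof.
move=> /andP[s0 s1] pa pb; rewrite d2_pmix_r.
have : 0 <= s * (1 - s) * d2 a b by rewrite !mulr_ge0 ?d2_ge0 ?subr_ge0.
set u := _ * d2 a b => u0.
suff : 0 < (1 - s) * (r - d2 p a) + s * (r - d2 p b) by lra.
have [->|sn0] := eqVneq s 0; first lra.
have : 0 < s by rewrite lt_def sn0.
by nra.
Qed.

Lemma d2_eq0 (p q : R[i]) : d2 p q = 0 -> p = q.
Proof.
move/eqP; rewrite paddr_eq0 ?sqr_ge0// !sqrf_eq0 !subr_eq0.
by move=> /andP[/eqP h1 /eqP h2]; apply: complex_eta.
Qed.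

Lemma adj_neq x y : adj x y -> pos x != pos y.
Proof.
move=> xy; apply/eqP => /pos_inj h; move: xy; rewrite h.
by rewrite adj_irr.
Qed.

Lemma adj_d2_gt0 x y : adj x y -> 0 < d2 (pos x) (pos y).
Proof.
move=> /adj_neq h; rewrite lt_def d2_ge0 andbT.
by apply: contra_neq h => /d2_eq0.
Qed.

Lemma edge_interiorP x y p : edge_interior pos x y p <->
  exists2 t, 0 < t < 1 & p = pmix (pos x) (pos y) t.
Proof.
have E t : (1 - t)%:C%C * pos x + t%:C%C * pos y = pmix (pos x) (pos y) t.
  by apply: complex_eta; case: (pos x) => a b; case: (pos y) => c d /=; ring.
split; first by move=> [t [t01 ->]]; exists t.
by move=> [t t01 ->]; exists t; rewrite E.
Qed.

Lemma neighbour_exists x : exists y, adj x y.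
Proof.
have [y yx] : exists y, y <> x.
  apply: contrapT => h; apply: Vinfinite.
  apply: sub_finite_set (finite_set1 x) => y _ /=.
  by apply: contrapT => yx; apply: h; exists y.
have [n [p [px py _]]] := adj_connected x y.
case: p px py => [_ /= h|z p /= /andP[xz _] _]; last by exists z.
by case: yx.
Qed.

(** Every vertex has a neighbour, so the drawing is the union of the closed edges, vertices
    included. *)
Lemma drawing_pmix q : D q ->
  exists a b s, [/\ adj a b, 0 <= s <= 1 & q = pmix (pos a) (pos b) s].
Proof.
move=> [[a ->]|[a [b [ab /edge_interiorP[s /andP[s0 s1] ->]]]]].
  have [b ab] := neighbour_exists a.
  by exists a, b, 0; rewrite pmix0 lexx ler01.
by exists a, b, s; split => //; rewrite !ltW.
Qed.

Lemma pmix_drawing a b s : adj a b -> 0 <= s <= 1 -> D (pmix (pos a) (pos b) s).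
Proof.
move=> ab /andP[s0 s1].
have [->|sn0] := eqVneq s 0; first by rewrite pmix0; left; exists a.
have [->|sn1] := eqVneq s 1; first by rewrite pmix1; left; exists b.
right; exists a, b; split => //; apply/edge_interiorP; exists s => //.
by rewrite !lt_neqAle s0 s1 sn1 eq_sym sn0.
Qed.

Lemma face_not_drawing F p : is_face adj pos F -> F p -> ~ D p.
Proof. by move=> [p0 _ ->] /connected_component_sub. Qed.

Lemma face_segment F p q : is_face adj pos F -> F p ->
  (forall t, 0 <= t <= 1 -> ~ D (pmix p q t)) -> F q.
Proof.
move=> [p0 Dp0 ->] Fp h.
rewrite (same_connected_component Fp).
pose S := [set z : plane | exists2 t : R, 0 <= t <= 1 & z = pmix p q t].
have Sp : S p by exists 0; rewrite ?lexx ?ler01 ?pmix0.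
have Sq : S q by exists 1; rewrite ?lexx ?ler01 ?pmix1.
have SD : S `<=` ~` D by move=> z [t t01 ->]; exact: h.
exact: (connected_component_max Sp SD (@segment_connected_plane R p q) Sq).
Qed.

Lemma face_eq F1 F2 p : is_face adj pos F1 -> is_face adj pos F2 ->
  F1 p -> F2 p -> F1 = F2.
Proof.
move=> [p1 _ ->] [p2 _ ->] h1 h2.
by rewrite (same_connected_component h1) (same_connected_component h2).
Qed.

Lemma face_connected F : is_face adj pos F -> connected F.
Proof. by move=> [p _ ->]; exact: component_connected. Qed.

Lemma edge_closure_end x y (F : set plane) :
  edge_interior pos x y `<=` closure F -> closure F (pos x).
Proof.
move=> h B Bx.
have : nbhs (pos x : plane) (interior B) by apply: nbhs_interior.
move=> /plane_nbhsP[e [e0 he]].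
pose t := e / (1 + e + d2 (pos x) (pos y)).
have L0 := d2_ge0 (pos x) (pos y); set L := d2 _ _ in t L0.
have k0 : 0 < 1 + e + L by lra.
have t0 : 0 < t by rewrite divr_gt0.
have t1 : t < 1 by rewrite ltr_pdivrMr//; lra.
have te : t * (1 + e + L) = e by rewrite divfK// gt_eqF.
have : (interior B) (pmix (pos x) (pos y) t).
  apply: he; have -> : d2 (pos x) (pmix (pos x) (pos y) t) = t ^+ 2 * L.
    by rewrite /L /d2/=; ring.
  have -> : e ^+ 2 = t ^+ 2 * (1 + e + L) ^+ 2 by rewrite -exprMn te.
  by rewrite ltr_pM2l ?exprn_gt0//; nra.
by move=> /(h (pmix (pos x) (pos y) t) _ B); apply; apply/edge_interiorP; exists t; rewrite ?t0.
Qed.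

Lemma edge_interior_sym x y p : edge_interior pos x y p -> edge_interior pos y x p.
Proof.
move=> /edge_interiorP[t /andP[t0 t1] ->]; apply/edge_interiorP; exists (1 - t).
  by apply/andP; lra.
by rewrite pmix_rev; congr pmix; lra.
Qed.

Lemma circumcentre_d2 F c p : is_circumcentre pos F c -> F p -> d2 c p <= 1.
Proof. by move=> [h _ _] /h /normc_sub_le1. Qed.

Lemma circumcentre_vertex F c v : is_circumcentre pos F c -> closure F (pos v) ->
  d2 c (pos v) = 1.
Proof. by move=> [_ h _] /h /normc_sub_eq1. Qed.

(** An edge is a chord of a circle of radius 1. *)
Lemma edge_length_le x y : adj x y -> d2 (pos x) (pos y) <= 4.
Proof.
move=> /thetaP[F1 [F2 [c1 [c2 [_ [[_ h1] _] [hc1 _] _]]]]].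
have := circumcentre_vertex hc1 (edge_closure_end h1).
have := circumcentre_vertex hc1 (@edge_closure_end y x F1 _).
move=> /(_ (fun p h => h1 _ (edge_interior_sym h))).
rewrite /d2.
set a := Re c1; set b := Im c1 => h2 h3.
have := sqr_ge0 ((X y - a) + (X x - a)); have := sqr_ge0 ((Y y - b) + (Y x - b)).
nra.
Qed.

Lemma finite_ball (p : R[i]) (r : R) : finite_set [set v | d2 p (pos v) <= r ^+ 2].
Proof.
case: adj_isoradial => -[_ _ _ fin _] _.
apply: (@sub_finite_set _ _ [set v | `|pos v| <= (`|r| + Num.sqrt (d2 0 p))%:C%C]); last exact: fin.
move=> v /=; set s := Num.sqrt _ => h.
have s2 : s ^+ 2 = d2 0 p by rewrite sqr_sqrtr ?d2_ge0.
have s0 : 0 <= s by apply: sqrtr_ge0.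
rewrite -[pos v]subr0 normc_sub lecE/= eqxx/=.
rewrite -(ler_pXn2r (n := 2)) ?nnegrE ?sqrtr_ge0 ?addr_ge0//.
rewrite sqr_sqrtr ?d2_ge0//.
have r2 : `|r| ^+ 2 = r ^+ 2 by rewrite real_normK ?num_real.
have r0 := normr_ge0 r.
move: h; rewrite -r2; move: s2; rewrite /d2/= !subr0.
move: (`|r|) r0 => {r2}{}r r0.
set u := X v - Re p; set w := Y v - Im p => s2 h.
have -> : X v = Re p + u by rewrite /u; ring.
have -> : Y v = Im p + w by rewrite /w; ring.
have cs : Re p * u + Im p * w <= s * r.
  have [h0|h0] := leP (Re p * u + Im p * w) 0; first by rewrite (le_trans h0)// mulr_ge0.
  rewrite -(ler_pXn2r (n := 2)) ?nnegrE ?mulr_ge0 ?(ltW h0)//.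
  have hs := sqr_ge0 (Re p * w - Im p * u).
  apply: (@le_trans _ _ ((Re p ^+ 2 + Im p ^+ 2) * (u ^+ 2 + w ^+ 2))); first by nra.
  rewrite exprMn s2 ler_wpM2l// addr_ge0 ?sqr_ge0//.
nra.
Qed.

Definition vball (p : R[i]) (r : R) : seq V :=
  enum_fset (fset_set [set v | d2 p (pos v) <= r ^+ 2]).

Lemma mem_vball p r v : (v \in vball p r) = (d2 p (pos v) <= r ^+ 2).
Proof.
apply/idP/idP => h.
  by have : v \in fset_set [set v | d2 p (pos v) <= r ^+ 2] by []; rewrite in_fset_set ?inE//; exact: finite_ball.
by suff : v \in fset_set [set v | d2 p (pos v) <= r ^+ 2] by []; rewrite in_fset_set ?inE//; exact: finite_ball.
Qed.

(** An edge that meets the unit disc about p has both ends within distance 4 of p, so only finitely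
    many closed segments matter, and each one that misses p stays at a positive distance from it. *)
Lemma near_drawing (p : R[i]) : exists2 e, 0 < e & forall a b s, adj a b ->
  0 <= s <= 1 -> d2 p (pmix (pos a) (pos b) s) < e ^+ 2 ->
  exists2 t, 0 <= t <= 1 & p = pmix (pos a) (pos b) t.
Proof.
pose P (ab : V * V) e := adj ab.1 ab.2 -> forall s,
  0 <= s <= 1 -> d2 p (pmix (pos ab.1) (pos ab.2) s) < e ^+ 2 ->
  exists2 t, 0 <= t <= 1 & p = pmix (pos ab.1) (pos ab.2) t.
have [|[a b] _|e e0 he] := @exists_uniform R _ [seq (a, b) | a <- vball p 4, b <- vball p 4] P.
- move=> [a b] e e' h e'0 e'e ab s s01 hs; apply: (h ab s s01).
  by apply: (lt_le_trans hs); nra.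
- have [h|h] := pselect (exists2 t, 0 <= t <= 1 & p = pmix (pos a) (pos b) t).
    by exists 1.
  have [->|nab] := eqVneq a b.
    by exists 1 => //; rewrite /P/= adj_irr.
  have [|e e0 he] := @dist_segment_gt0 R (pos a) (pos b) p _ h.
    by apply: contra_neq nab => /pos_inj.
  by exists e => // _ s s01 /=; rewrite ltNge he.
exists (Num.min e 1); first by rewrite lt_min e0 ltr01.
move=> a b s ab s01 hs.
have m1 : Num.min e 1 <= 1 by rewrite ge_min lexx orbT.
have m2 : Num.min e 1 <= e by rewrite ge_min lexx.
have m0 : 0 < Num.min e 1 by rewrite lt_min e0 ltr01.
have hs1 : d2 p (pmix (pos a) (pos b) s) < 1.
  by apply: (lt_le_trans hs); nra.
have L := edge_length_le ab.
move: (s01) => /andP[s0 s1].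
have bnd (q r : R[i]) : d2 p q < 1 -> d2 q r <= 4 -> d2 p r <= 4 ^+ 2.
  rewrite /d2 => h1 h2.
  have := sqr_ge0 ((Re q - Re p) - (Re r - Re q)).
  have := sqr_ge0 ((Im q - Im p) - (Im r - Im q)).
  by nra.
apply: (he (a, b) _ ab s s01) => /=.
  apply/allpairsP; exists (a, b); split => //=; rewrite mem_vball.
    apply: (bnd _ _ hs1); rewrite -{2}(pmix0 (pos a) (pos b)) d2_pmix.
    have : (0 - s) ^+ 2 <= 1 by nra.
    by have := d2_ge0 (pos a) (pos b); nra.
  apply: (bnd _ _ hs1); rewrite -{2}(pmix1 (pos a) (pos b)) d2_pmix.
  have : (1 - s) ^+ 2 <= 1 by nra.
  by have := d2_ge0 (pos a) (pos b); nra.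
by apply: (lt_le_trans hs); nra.
Qed.

Lemma vertex_not_interior x y v : adj x y -> ~ edge_interior pos x y (pos v).
Proof. by case: adj_isoradial => -[_ _ _ _ [h _]] _; exact: h. Qed.

Lemma edge_interior_inj x y a b p : adj x y -> adj a b ->
  edge_interior pos x y p -> edge_interior pos a b p ->
  (x = a /\ y = b) \/ (x = b /\ y = a).
Proof. by case: adj_isoradial => -[_ _ _ _ [_ h]] _; exact: h. Qed.

Lemma near_edge x y t : adj x y -> 0 < t < 1 -> exists2 e, 0 < e &
  forall q, d2 (pmix (pos x) (pos y) t) q < e ^+ 2 -> D q -> crs x y q = 0.
Proof.
move=> xy t01; have [e e0 he] := near_drawing (pmix (pos x) (pos y) t).
exists e => // q pq /drawing_pmix[a [b [s [ab s01 qE]]]].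
move: pq; rewrite qE => /(he _ _ _ ab s01)[t' /andP[t'0 t'1] pE].
have pint : edge_interior pos x y (pmix (pos x) (pos y) t).
  by apply/edge_interiorP; exists t.
have := vertex_not_interior (v := _) xy.
have [z0|tn0] := eqVneq t' 0.
  by move: pint; rewrite pE z0 pmix0 => h /(_ a).
have [z1|tn1] := eqVneq t' 1.
  by move: pint; rewrite pE z1 pmix1 => h /(_ b).
move=> _; have : edge_interior pos a b (pmix (pos x) (pos y) t).
  apply/edge_interiorP; exists t' => //.
  by rewrite !lt_neqAle t'0 t'1 tn1 eq_sym tn0.
move=> /(edge_interior_inj xy ab pint)[][-> ->]; rewrite crs_pmix /crs; ring.
Qed.

Lemma near_vertex x : exists2 e, 0 < e & forall q, d2 (pos x) q < e ^+ 2 ->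
  D q -> exists w s, [/\ adj x w, 0 <= s <= 1 & q = pmix (pos x) (pos w) s].
Proof.
have [e e0 he] := near_drawing (pos x).
exists e => // q pq /drawing_pmix[a [b [s [ab s01 qE]]]].
move: pq; rewrite qE => /(he _ _ _ ab s01)[t' /andP[t'0 t'1] pE].
have [z0|tn0] := eqVneq t' 0.
  move: pE; rewrite z0 pmix0 => /pos_inj ->; by exists b, s.
have [z1|tn1] := eqVneq t' 1.
  move: pE; rewrite z1 pmix1 => /pos_inj ->; exists a, (1 - s); split.
  - by rewrite adj_sym.
  - by move: s01 => /andP[? ?]; apply/andP; lra.
  - exact: pmix_rev.
exfalso; apply: (vertex_not_interior ab (v := x)).
apply/edge_interiorP; exists t' => //.
by rewrite !lt_neqAle t'0 t'1 tn1 eq_sym tn0.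
Qed.

(** The line xy meets the circumscribed disc of F exactly in the chord from x to y, which belongs to
    the drawing. A face bordering an edge is therefore disjoint from the whole line. *)
Lemma face_off_line F c x y q : is_face adj pos F ->
  edge_interior pos x y `<=` closure F -> is_circumcentre pos F c -> adj x y ->
  F q -> crs x y q != 0.
Proof.
move=> hF hcl hc xy Fq; apply/negP => /eqP q0.
have cx := circumcentre_vertex hc (edge_closure_end hcl).
have cy := circumcentre_vertex hc (edge_closure_end (fun p h => hcl _ (@edge_interior_sym y x p h))).
have cq := circumcentre_d2 hc Fq.
have L0 := adj_d2_gt0 xy; set L := d2 (pos x) (pos y) in L0.
pose t := ((X y - X x) * (Re q - X x) + (Y y - Y x) * (Im q - Y x)) / L.
have tL : t * L = (X y - X x) * (Re q - X x) + (Y y - Y x) * (Im q - Y x).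
  by rewrite divfK// gt_eqF.
have qE : q = pmix (pos x) (pos y) t.
  apply: complex_eta => /=; apply: (mulfI (lt0r_neq0 L0)).
    have -> : L * (X x + t * (X y - X x)) = L * X x + (t * L) * (X y - X x) by ring.
    rewrite tL; apply/eqP; rewrite -subr_eq0; apply/eqP.
    transitivity (- (Y y - Y x) * crs x y q); last by rewrite q0 mulr0.
    by rewrite /L /d2 /crs; ring.
  have -> : L * (Y x + t * (Y y - Y x)) = L * Y x + (t * L) * (Y y - Y x) by ring.
  rewrite tL; apply/eqP; rewrite -subr_eq0; apply/eqP.
  transitivity ((X y - X x) * crs x y q); last by rewrite q0 mulr0.
  by rewrite /L /d2 /crs; ring.
apply: (face_not_drawing hF Fq); rewrite qE; apply: pmix_drawing => //.
move: cq; rewrite qE d2_pmix_r cx cy -/L => h.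
have : 0 <= t * (1 - t) by rewrite -(pmulr_lge0 _ L0); lra.
by move=> h1; apply/andP; split; nra.
Qed.

Definition left_face F x y := [/\ is_face adj pos F,
  edge_interior pos x y `<=` closure F & forall q, F q -> 0 < crs x y q].

Lemma face_side F c x y : is_face adj pos F ->
  edge_interior pos x y `<=` closure F -> is_circumcentre pos F c -> adj x y ->
  left_face F x y \/ left_face F y x.
Proof.
move=> hF hcl hc xy; have nz q : F q -> crs x y q != 0 by apply: face_off_line hF hcl hc xy.
have [p Fp] : exists p, F p.
  by case: hF => p Dp ->; exists p; apply: connected_component_refl.
have Fc := face_connected hF.
have [l|l|l] := ltgtP (crs x y p) 0; last by have := nz p Fp; rewrite l eqxx.
  right; split => //; first by move=> q /edge_interior_sym; exact: hcl.
  move=> q Fq; rewrite crsE; apply: (connected_side Fc _ Fp _ Fq).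
    by move=> z Fz; rewrite -crsE crs_sym oppr_eq0 nz.
  by rewrite -crsE crs_sym oppr_gt0.
left; split => // q Fq; rewrite crsE; apply: (connected_side Fc _ Fp _ Fq).
  by move=> z Fz; rewrite -crsE nz.
by rewrite -crsE.
Qed.

(** Near an interior point of xy the drawing is contained in the line xy, so a segment between two
    nearby points on the left avoids it. One such point lies in F because the edge is in the closure
    of F. *)
Lemma left_face_disc F x y t : adj x y -> left_face F x y -> 0 < t < 1 ->
  exists2 e, 0 < e & forall q, d2 (pmix (pos x) (pos y) t) q < e ^+ 2 ->
    0 < crs x y q -> F q.
Proof.
move=> xy [hF hcl hl] t01; have [e e0 he] := near_edge xy t01.
exists e => // q pq ql.
have pint : edge_interior pos x y (pmix (pos x) (pos y) t).
  by apply/edge_interiorP; exists t.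
have [|q' [Fq' /= pq']] := hcl _ pint [set q | d2 (pmix (pos x) (pos y) t) q < e ^+ 2].
  by apply/plane_nbhsP; exists e.
apply: (face_segment hF Fq') => s s01 Dq.
have := he _ (d2_pmix_lt s01 pq' pq) Dq.
rewrite crs_pmix; have := hl _ Fq'; move: s01 => /andP[s0 s1]; nra.
Qed.

Lemma left_face_unique F1 F2 x y : adj x y -> left_face F1 x y ->
  left_face F2 x y -> F1 = F2.
Proof.
move=> xy h1 [hF2 hcl2 hl2].
have t01 : 0 < (2^-1 : R) < 1 by apply/andP; lra.
have [e e0 he] := left_face_disc xy h1 t01.
have pint : edge_interior pos x y (pmix (pos x) (pos y) 2^-1).
  by apply/edge_interiorP; exists 2^-1.
have [|q [Fq /= pq]] := hcl2 _ pint [set q | d2 (pmix (pos x) (pos y) 2^-1) q < e ^+ 2].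
  by apply/plane_nbhsP; exists e.
case: h1 => hF1 _ _.
by apply: (face_eq hF1 hF2 _ Fq); apply: he => //; exact: hl2.
Qed.

(** Equal distances to x and y put the centre on the perpendicular bisector. It lies in the closure
    of F, hence weakly to the left of xy, and this is what gives [0 <= k]: without a condition on
    the position of the centre, the two centres of an edge could be interchanged. *)
Lemma left_circumcentre_spec F c x y : adj x y -> left_face F x y ->
  is_circumcentre pos F c -> exists k, [/\ 0 <= k,
  Re c = X x + (X y - X x) / 2 - k * (Y y - Y x),
  Im c = Y x + (Y y - Y x) / 2 + k * (X y - X x) &
  k ^+ 2 * d2 (pos x) (pos y) = 1 - d2 (pos x) (pos y) / 4].
Proof.
move=> xy [hF hcl hl] hc.
have cx := circumcentre_vertex hc (edge_closure_end hcl).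
have cy := circumcentre_vertex hc (edge_closure_end (fun p h => hcl _ (@edge_interior_sym y x p h))).
have L0 := adj_d2_gt0 xy; set L := d2 (pos x) (pos y) in L0 *.
have k0 : 0 <= crs x y c.
  rewrite crsE; apply: (closure_side (F := F)); last by case: hc.
  by move=> q /hl; rewrite crsE.
pose k := crs x y c / L.
have kL : k * L = crs x y c by rewrite divfK// gt_eqF.
have Ln0 := lt0r_neq0 L0.
have dt : (X y - X x) * (Re c - X x) + (Y y - Y x) * (Im c - Y x) = L / 2.
  by move: cx cy; rewrite /L /d2; lra.
have E1 : Re c = X x + (X y - X x) / 2 - k * (Y y - Y x).
  apply: (mulfI Ln0).
  have -> : L * (X x + (X y - X x) / 2 - k * (Y y - Y x)) =
    L * X x + (L / 2) * (X y - X x) - (k * L) * (Y y - Y x) by ring.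
  by rewrite kL -dt /L /d2 /crs; ring.
have E2 : Im c = Y x + (Y y - Y x) / 2 + k * (X y - X x).
  apply: (mulfI Ln0).
  have -> : L * (Y x + (Y y - Y x) / 2 + k * (X y - X x)) =
    L * Y x + (L / 2) * (Y y - Y x) + (k * L) * (X y - X x) by ring.
  by rewrite kL -dt /L /d2 /crs; ring.
exists k; split => //; first by rewrite divr_ge0// ltW.
by move: cx; rewrite /L /d2 E1 E2; lra.
Qed.

(** Two distinct faces along xy cannot lie on the same side, by uniqueness of the left face. *)
Lemma rhombus_theta x y : adj x y -> exists FL FR cL cR,
  [/\ left_face FL x y, left_face FR y x, is_circumcentre pos FL cL,
      is_circumcentre pos FR cR &
      2 * theta x y = acos ((Re cL - X x) * (Re cR - X x) +
                            (Im cL - Y x) * (Im cR - Y x))].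
Proof.
move=> xy; have yx : adj y x by rewrite adj_sym.
have [F1 [F2 [c1 [c2 [F12 [[hF1 h1] [hF2 h2]] [hc1 hc2] th]]]]] := thetaP xy.
have {}th : 2 * theta x y = acos ((Re c1 - X x) * (Re c2 - X x) +
                            (Im c1 - Y x) * (Im c2 - Y x)).
  rewrite th; congr acos; case: (pos x) => a b; case: c1 {hc1 th} => a1 b1.
  by case: c2 {hc2} => a2 b2 /=; ring.
have [l1|l1] := face_side hF1 h1 hc1 xy; have [l2|l2] := face_side hF2 h2 hc2 xy.
- by case: F12; exact: left_face_unique xy l1 l2.
- by exists F1, F2, c1, c2.
- by exists F2, F1, c2, c1; split => //; rewrite th; congr acos; ring.
- by case: F12; exact: left_face_unique yx l1 l2.
Qed.

Lemma theta_bounds x y : adj x y -> 0 < theta x y < pi / 2.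
Proof.
move=> /theta_itv; move: eta_itv => /andP[e0 e1] /andP[h1 h2].
by apply/andP; split; lra.
Qed.

Lemma cos_theta_gt0 x y : adj x y -> 0 < cos (theta x y).
Proof.
move=> /theta_bounds/andP[h1 h2]; apply: cos_gt0_pihalf; rewrite h2 andbT.
by apply: lt_trans h1; rewrite oppr_lt0 divr_gt0 ?pi_gt0.
Qed.

Lemma tan_theta_gt0 x y : adj x y -> 0 < tan (theta x y).
Proof.
move=> xy; rewrite /tan divr_gt0 ?cos_theta_gt0//.
by move: (theta_bounds xy) => /andP[h1 h2]; apply: sin_gt0_pihalf; rewrite h1.
Qed.

(** Both centres are at distance 1 from x and y, hence equally far from the edge on either side of
    it. The inner product that defines [2 * theta x y] then equals L / 2 - 1, where L is the squared
    edge length. *)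
Lemma edge_length_theta x y : adj x y -> d2 (pos x) (pos y) = 4 * cos (theta x y) ^+ 2.
Proof.
move=> xy; have yx : adj y x by rewrite adj_sym.
have [FL [FR [cL [cR [lL lR hL hR th]]]]] := rhombus_theta xy.
have [k [k0 E1 E2 E3]] := left_circumcentre_spec xy lL hL.
have [k' [k'0 E1' E2' E3']] := left_circumcentre_spec yx lR hR.
have L0 := adj_d2_gt0 xy.
have d2C' : d2 (pos y) (pos x) = d2 (pos x) (pos y) by rewrite d2C.
rewrite d2C' in E3'.
set L := d2 (pos x) (pos y) in L0 E3 E3' *.
have kk : k' = k.
  have : k' ^+ 2 = k ^+ 2 by apply: (mulIf (lt0r_neq0 L0)); rewrite E3 E3'.
  by move=> /eqP; rewrite eqrXn2// => /eqP.
have LE : L = (X y - X x) ^+ 2 + (Y y - Y x) ^+ 2 by [].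
have arg : (Re cL - X x) * (Re cR - X x) + (Im cL - Y x) * (Im cR - Y x) = L / 2 - 1.
  transitivity (L / 4 - k ^+ 2 * L); last by rewrite E3; field.
  by rewrite E1 E2 E1' E2' kk LE; field.
rewrite arg in th.
have L4 := edge_length_le xy; rewrite -/L in L4.
have : cos (2 * theta x y) = L / 2 - 1.
  by rewrite th acosK// in_itv/=; apply/andP; lra.
rewrite (_ : 2 * theta x y = theta x y *+ 2); last by rewrite mulr_natl.
rewrite cos_mulr2n => h.
have : cos (theta x y) ^+ 2 *+ 2 = L / 2 by lra.
by rewrite -mulr_natl; lra.
Qed.

Lemma theta_sym x y : adj x y -> theta y x = theta x y.
Proof.
move=> xy; have yx : adj y x by rewrite adj_sym.
have := edge_length_theta yx; rewrite d2C edge_length_theta// => h.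
have c : cos (theta y x) = cos (theta x y).
  have : cos (theta y x) ^+ 2 = cos (theta x y) ^+ 2 by lra.
  by move=> /eqP; rewrite eqrXn2 ?ltW ?cos_theta_gt0// => /eqP.
have pp := @pi_gt0 R.
have := theta_bounds xy; have := theta_bounds yx => /andP[? ?] /andP[? ?].
by apply: cos_inj => //; rewrite in_itv/=; apply/andP; lra.
Qed.

Definition dual_left x y : R[i] :=
  ((X x + (X y - X x) / 2 - tan (theta x y) / 2 * (Y y - Y x)) +i*
   (Y x + (Y y - Y x) / 2 + tan (theta x y) / 2 * (X y - X x)))%C.

Lemma left_circumcentre F c x y : adj x y -> left_face F x y ->
  is_circumcentre pos F c -> c = dual_left x y.
Proof.
move=> xy lF hc; have [k [k0 E1 E2 E3]] := left_circumcentre_spec xy lF hc.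
suff kt : k = tan (theta x y) / 2 by apply: complex_eta => /=; rewrite -?kt.
have t0 := tan_theta_gt0 xy.
have c0 := cos_theta_gt0 xy.
have tc : tan (theta x y) * cos (theta x y) = sin (theta x y).
  by rewrite /tan divfK// gt_eqF.
have cs := cos2Dsin2 (theta x y).
have : k ^+ 2 = (tan (theta x y) / 2) ^+ 2.
  have L0 := adj_d2_gt0 xy.
  apply: (mulIf (lt0r_neq0 L0)); rewrite E3 edge_length_theta//.
  transitivity ((tan (theta x y) * cos (theta x y)) ^+ 2); last by field.
  by rewrite tc; lra.
by move=> /eqP; rewrite eqrXn2//; [move=> /eqP|rewrite divr_ge0// ltW].
Qed.

Lemma left_face_exists x y : adj x y -> exists2 F, left_face F x y &
  is_circumcentre pos F (dual_left x y).
Proof.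
move=> xy; have [FL [FR [cL [cR [lL _ hL _ _]]]]] := rhombus_theta xy.
by move: (hL); rewrite (left_circumcentre xy lL hL) => hL'; exists FL.
Qed.

Lemma dual_left_d2 x y : adj x y ->
  d2 (dual_left x y) (pos x) = 1 /\ d2 (dual_left x y) (pos y) = 1.
Proof.
move=> xy; have [F [hF hcl _] hc] := left_face_exists xy; split.
  exact: circumcentre_vertex hc (edge_closure_end hcl).
exact: circumcentre_vertex hc (edge_closure_end (fun p h => hcl _ (@edge_interior_sym y x p h))).
Qed.

Definition neighbours x : seq V := enum_fset (fset_set [set y | adj x y]).

Lemma mem_neighbours x y : (y \in neighbours x) = adj x y.
Proof.
have fin : finite_set [set y | adj x y].
  apply: (sub_finite_set _ (finite_ball (pos x) 2)) => z /= /edge_length_le.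
  by rewrite expr2; lra.
apply/idP/idP => h.
  by have : y \in fset_set [set y | adj x y] by []; rewrite in_fset_set ?inE.
by suff : y \in fset_set [set y | adj x y] by []; rewrite in_fset_set ?inE.
Qed.

(* The angular sector at x swept counterclockwise from the edge xy meets
   another edge before it becomes a half-plane, for otherwise the left face of
   xy would leave its circumscribed disc near x; up to the first such edge xy',
   the sector lies in one face. *)
Lemma next_neighbour x y : adj x y -> exists y', [/\ adj x y',
  0 < crs x y (pos y') & dual_left x y = dual_left y' x].
Proof.
move=> xy; have [e e0 he] := near_vertex x.
pose dt w := (X y - X x) * (X w - X x) + (Y y - Y x) * (Y w - Y x).
pose T := [seq w <- neighbours x | 0 < crs x y (pos w)].
have [F lF hc] := left_face_exists xy.
have [hF hcl hl] := lF.
have [c1 c2] := dual_left_d2 xy.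
pose d := Num.min (e / 8) 2^-1.
have d0 : 0 < d by rewrite lt_min divr_gt0//= invr_gt0.
have de : d <= e / 8 by rewrite ge_min lexx.
have d1 : d <= 2^-1 by rewrite ge_min lexx orbT.
have d01 : 0 < d < 1 by apply/andP; lra.
have L0 := adj_d2_gt0 xy; have L4 := edge_length_le xy.
have smallE a b w : adj x w -> 0 <= a <= d -> 0 <= b <= d ->
    d2 (pos x) ((X x + a * (X y - X x) + b * (X w - X x)) +i*
                (Y x + a * (Y y - Y x) + b * (Y w - Y x)))%C < e ^+ 2.
  move=> /edge_length_le Lw /andP[a0 ad] /andP[b0 bd].
  move: L4 Lw; rewrite /d2/=.
  set u := X y - X x; set v := Y y - Y x; set u' := X w - X x; set v' := Y w - Y x.
  move=> Lu Lv.
  have -> : (X x + a * u + b * u' - X x) ^+ 2 + (Y x + a * v + b * v' - Y x) ^+ 2 =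
    a ^+ 2 * (u ^+ 2 + v ^+ 2) + b ^+ 2 * (u' ^+ 2 + v' ^+ 2) + 2 * (a * b) * (u * u' + v * v') by ring.
  have cs : u * u' + v * v' <= 4.
    have := sqr_ge0 (u - u'); have := sqr_ge0 (v - v'); nra.
  have a2 : a ^+ 2 <= d ^+ 2 by nra.
  have b2 : b ^+ 2 <= d ^+ 2 by nra.
  have ab0 : 0 <= a * b by rewrite mulr_ge0.
  have ab2 : a * b <= d ^+ 2 by nra.
  have t1 : a ^+ 2 * (u ^+ 2 + v ^+ 2) <= d ^+ 2 * 4.
    by rewrite ler_pM ?sqr_ge0 ?addr_ge0 ?sqr_ge0.
  have t2 : b ^+ 2 * (u' ^+ 2 + v' ^+ 2) <= d ^+ 2 * 4.
    by rewrite ler_pM ?sqr_ge0 ?addr_ge0 ?sqr_ge0.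
  have t3 : a * b * (u * u' + v * v') <= d ^+ 2 * 4 by nra.
  have : 16 * d ^+ 2 < e ^+ 2 by nra.
  by lra.
have [T0|[w0 w0T]] : (forall w, adj x w -> crs x y (pos w) <= 0) \/ exists a, a \in T.
  have [h|h] := pselect (exists a, a \in T); first by right.
  left => w xw; rewrite leNgt; apply/negP => hw; apply: h; exists w.
  by rewrite mem_filter hw mem_neighbours.
(* No edge leaves x strictly to the left of xy. The left face then contains all points near x on
   that side, including points behind x, and one of these is outside the circumscribed disc. *)
- exfalso.
  have [e1 e10 he1] := left_face_disc xy lF d01.
  have pint : edge_interior pos x y (pmix (pos x) (pos y) d).
    by apply/edge_interiorP; exists d.
  have [|q [Fq /= pq]] := hcl _ pint
      [set q | d2 (pmix (pos x) (pos y) d) q < (Num.min e1 (e / 8)) ^+ 2].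
    by apply/plane_nbhsP; exists (Num.min e1 (e / 8)); split => //; rewrite lt_min e10 divr_gt0.
  have me : Num.min e1 (e / 8) <= e / 8 by rewrite ge_min lexx orbT.
  have m0 : 0 < Num.min e1 (e / 8) by rewrite lt_min e10 divr_gt0.
  have qe : d2 (pos x) q < e ^+ 2.
    have h1 : d2 (pmix (pos x) (pos y) d) q < (e / 8) ^+ 2 by apply: (lt_le_trans pq); nra.
    move: h1 L4; rewrite /d2/=.
    set u := X y - X x; set v := Y y - Y x.
    set a := Re q; set b := Im q => h1 Lu.
    have h2 := sqr_ge0 ((a - (X x + d * u)) - d * u).
    have h3 := sqr_ge0 ((b - (Y x + d * v)) - d * v).
    have h4 : d ^+ 2 * (u ^+ 2 + v ^+ 2) <= d ^+ 2 * 4 by rewrite ler_wpM2l ?sqr_ge0.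
    have h5 : d ^+ 2 <= (e / 8) ^+ 2 by nra.
    have h6 : (e / 8) ^+ 2 = e ^+ 2 / 64 by field.
    have h7 : 0 < e ^+ 2 by rewrite exprn_gt0.
    nra.
  have inF z : d2 (pos x) z < e ^+ 2 -> 0 < crs x y z -> F z.
    move=> hz lz; apply: (face_segment hF Fq) => s s01 Ds.
    have [w [r [xw /andP[r0 r1] E]]] := he _ (d2_pmix_lt s01 qe hz) Ds.
    have : 0 < crs x y (pmix q z s).
      rewrite crs_pmix; have := hl _ Fq; move: s01 => /andP[s0 s1] hq.
      have [->|sn0] := eqVneq s 0; first lra.
      have : 0 < s by rewrite lt_def sn0.
      by nra.
    rewrite E crs_pmix; have := T0 _ xw; rewrite {1}/crs.
    have -> : crs x y (pos x) = 0 by rewrite /crs; ring.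
    by move=> h; rewrite /crs; nra.
  have t0 := tan_theta_gt0 xy; set t := tan (theta x y) in t0.
  have Ld : (X y - X x) ^+ 2 + (Y y - Y x) ^+ 2 = d2 (pos x) (pos y) by [].
  (* The point [z] is reached from x by moving away from y with a slight tilt [om] to the left. As
     [om * t < 1], the angle at x between z and the centre is obtuse, so z is at distance more than
     1 from the centre. *)
  pose om := (2 * t + 4)^-1.
  have om0 : 0 < om by rewrite invr_gt0; lra.
  have omt : om * (2 * t + 4) = 1 by rewrite mulVf// gt_eqF//; lra.
  pose ep := e / 8.
  pose z : R[i] := ((X x - ep * ((X y - X x) + om * (Y y - Y x))) +i*
            (Y x - ep * ((Y y - Y x) - om * (X y - X x))))%C.
  have ep0 : 0 < ep by rewrite divr_gt0.
  have omL : om <= 4^-1 by nra.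
  have zx : d2 (pos x) z = ep ^+ 2 * (1 + om ^+ 2) * d2 (pos x) (pos y).
    by rewrite /d2 /z/=; ring.
  have Fz : F z.
    apply: inF.
      rewrite zx.
      have h1 : 1 + om ^+ 2 <= 2 by nra.
      have h2 : (1 + om ^+ 2) * d2 (pos x) (pos y) <= 2 * 4.
        by rewrite ler_pM// ?ltW// ltr_wpDr ?sqr_ge0.
      have h3 : 0 < ep ^+ 2 by rewrite exprn_gt0.
      have h4 : e ^+ 2 = 64 * ep ^+ 2 by rewrite /ep; field.
      nra.
    have -> : crs x y z = ep * om * d2 (pos x) (pos y).
      by rewrite /crs /z /d2/=; ring.
    by rewrite !mulr_gt0.
  have := circumcentre_d2 hc Fz; apply/negP; rewrite -ltNge.
  have -> : d2 (dual_left x y) z = d2 (dual_left x y) (pos x) +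
     d2 (pos x) z + ep * (1 - om * t) * d2 (pos x) (pos y).
    by rewrite /d2 /dual_left /z/= -/t; field.
  rewrite c1 zx.
  have h1 : 0 < ep ^+ 2 * (1 + om ^+ 2) * d2 (pos x) (pos y).
    rewrite !mulr_gt0// ?exprn_gt0//; have := sqr_ge0 om; lra.
  have : 0 < ep * (1 - om * t) * d2 (pos x) (pos y).
    by rewrite !mulr_gt0//; nra.
  by lra.
(* [dt w / crs x y (pos w)] is the cotangent of the angle from xy to xw, decreasing on ]0, pi[, so
   its maximiser is the first edge met counterclockwise. *)
have [y' y'T hy'] := exists_argmax (fun w => dt w / crs x y (pos w)) w0T.
move: y'T; rewrite mem_filter mem_neighbours => /andP[ly' xy'].
exists y'; split => //.
have y'x : adj y' x by rewrite adj_sym.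
have [F' lF' hc'] := left_face_exists y'x.
have d01' : 0 < 1 - d < 1 by apply/andP; lra.
have [e1 e10 he1] := left_face_disc xy lF d01.
have [e2 e20 he2] := left_face_disc y'x lF' d01'.
(* Points of the sector at x between xy and xy'. Close to x none of them is on the drawing, because
   an edge through such a point would have a larger cotangent than xy'. *)
pose cone (a b : R) : R[i] := ((X x + a * (X y - X x) + b * (X y' - X x)) +i*
                (Y x + a * (Y y - Y x) + b * (Y y' - Y x)))%C.
have coneD a b : 0 < a <= d -> 0 < b <= d -> ~ D (cone a b).
  move=> /andP[a0 ad] /andP[b0 bd] Dc.
  have sm : d2 (pos x) (cone a b) < e ^+ 2 by apply: smallE => //; rewrite ltW.
  have [w [r [xw /andP[r0 r1] E]]] := he _ sm Dc.
  have E1 : a * (X y - X x) + b * (X y' - X x) = r * (X w - X x).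
    by have := congr1 (@complex.Re R) E => /=; lra.
  have E2 : a * (Y y - Y x) + b * (Y y' - Y x) = r * (Y w - Y x).
    by have := congr1 (@complex.Im R) E => /=; lra.
  have E3 : r * crs x y (pos w) = b * crs x y (pos y').
    transitivity ((X y - X x) * (r * (Y w - Y x)) - (Y y - Y x) * (r * (X w - X x))).
      by rewrite /crs; ring.
    by rewrite -E1 -E2 /crs; ring.
  have E4 : r * dt w = a * d2 (pos x) (pos y) + b * dt y'.
    transitivity ((X y - X x) * (r * (X w - X x)) + (Y y - Y x) * (r * (Y w - Y x))).
      by rewrite /dt; ring.
    by rewrite -E1 -E2 /dt /d2; ring.
  have bc : 0 < b * crs x y (pos y') by rewrite mulr_gt0.
  have rp : 0 < r.
    rewrite lt_def r0 andbT; apply/eqP => z; move: bc; rewrite -E3 z mul0r ltxx//.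
  have lw : 0 < crs x y (pos w) by rewrite -(pmulr_rgt0 _ rp) E3.
  have := hy' w; rewrite mem_filter lw mem_neighbours => /(_ xw).
  apply/negP; rewrite -ltNge ltr_pdivrMr// mulrAC ltr_pdivlMr//.
  rewrite -(ltr_pM2l rp).
  have -> : r * (dt y' * crs x y (pos w)) = dt y' * (r * crs x y (pos w)) by ring.
  rewrite E3 [r * (dt w * _)]mulrA E4.
  have : 0 < a * d2 (pos x) (pos y) * crs x y (pos y') by rewrite !mulr_gt0.
  by lra.
have inF s : 0 < s <= d -> s * 2 < e1 -> F (cone d s).
  move=> /andP[s0 sd] se; apply: he1; last first.
    have -> : crs x y (cone d s) = s * crs x y (pos y') by rewrite /crs/=; ring.
    by rewrite mulr_gt0.
  have -> : d2 (pmix (pos x) (pos y) d) (cone d s) = s ^+ 2 * d2 (pos x) (pos y').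
    by rewrite /d2/=; ring.
  have := edge_length_le xy'; have := d2_ge0 (pos x) (pos y').
  have : 0 <= s ^+ 2 by rewrite sqr_ge0.
  nra.
have inF' s : 0 < s <= d -> s * 2 < e2 -> F' (cone s d).
  move=> /andP[s0 sd] se; apply: he2; last first.
    have -> : crs y' x (cone s d) = s * crs x y (pos y') by rewrite /crs/=; ring.
    by rewrite mulr_gt0.
  have -> : d2 (pmix (pos y') (pos x) (1 - d)) (cone s d) = s ^+ 2 * d2 (pos x) (pos y).
    by rewrite /d2/=; ring.
  have := edge_length_le xy; have := d2_ge0 (pos x) (pos y).
  have : 0 <= s ^+ 2 by rewrite sqr_ge0.
  nra.
(* [cone d s1] is close to xy and lies in the left face of xy; [cone s2 d] is close to xy' and lies
   in the left face of y'x. The segment between them stays in the sector, so both faces coincide. *)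
pose s1 := Num.min d (e1 / 4); pose s2 := Num.min d (e2 / 4).
have s10 : 0 < s1 by rewrite lt_min d0 divr_gt0.
have s20 : 0 < s2 by rewrite lt_min d0 divr_gt0.
have s1d : s1 <= d by rewrite ge_min lexx.
have s2d : s2 <= d by rewrite ge_min lexx.
have s1e : s1 <= e1 / 4 by rewrite ge_min lexx orbT.
have s2e : s2 <= e2 / 4 by rewrite ge_min lexx orbT.
have Fc : F (cone d s1) by apply: inF; rewrite ?s10//; lra.
have F'c : F' (cone s2 d) by apply: inF'; rewrite ?s20//; lra.
have [hF' _ _] := lF'.
have Fc' : F (cone s2 d).
  apply: (face_segment hF Fc) => s /andP[h0 h1].
  have -> : pmix (cone d s1) (cone s2 d) s =
    cone (d + s * (s2 - d)) (s1 + s * (d - s1)).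
    by apply: complex_eta => /=; ring.
  by apply: coneD; apply/andP; split; nra.
have FF' := face_eq hF hF' Fc' F'c.
apply: (left_circumcentre y'x lF').
by rewrite -FF'.
Qed.

Lemma d2_triangle (p q r : R[i]) a b : 0 <= a -> 0 <= b ->
  d2 p q <= a ^+ 2 -> d2 q r <= b ^+ 2 -> d2 p r <= (a + b) ^+ 2.
Proof.
move=> a0 b0; rewrite /d2.
have -> : Re r - Re p = (Re q - Re p) + (Re r - Re q) by ring.
have -> : Im r - Im p = (Im q - Im p) + (Im r - Im q) by ring.
move: (Re q - Re p) (Im q - Im p) (Re r - Re q) (Im r - Im q) => u v u' v' h1 h2.
have cs : u * u' + v * v' <= a * b.
  have [h0|h0] := leP (u * u' + v * v') 0; first by rewrite (le_trans h0)// mulr_ge0.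
  rewrite -(ler_pXn2r (n := 2)) ?nnegrE ?mulr_ge0 ?(ltW h0)//.
  apply: (@le_trans _ _ ((u ^+ 2 + v ^+ 2) * (u' ^+ 2 + v' ^+ 2))).
    by have := sqr_ge0 (u * v' - v * u'); nra.
  by rewrite exprMn ler_pM// addr_ge0 ?sqr_ge0.
by nra.
Qed.

(** Used to choose an arbitrarily small perturbation in general position. *)
Lemma exists_small_notin (s : seq R) (h0 : R) : 0 < h0 ->
  exists2 h, 0 < h < h0 & h \notin s.
Proof.
move=> h00; pose P (x : R) e := 0 < x -> e < x.
have [|x _|e e0 he] := @exists_uniform R R s P.
- by move=> x e e' h _ e'e /h; exact: le_lt_trans.
- have [x0|x0] := ltP 0 x; last by exists 1 => // x1; move: x0; rewrite leNgt x1.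
  by exists (x / 2); [rewrite divr_gt0|move=> _; lra].
exists (Num.min e h0 / 2).
  have m0 : 0 < Num.min e h0 by rewrite lt_min e0.
  have m1 : Num.min e h0 <= h0 by rewrite ge_min lexx orbT.
  by apply/andP; lra.
have m0 : 0 < Num.min e h0 by rewrite lt_min e0.
have m1 : Num.min e h0 <= e by rewrite ge_min lexx.
by apply/negP => /he h; have := h _; lra.
Qed.

(* Along a line segment towards z avoiding the other vertices, the power of z
   with respect to the circumcircle of the current face does not increase when
   an edge is crossed, and it vanishes in the last face. *)
Lemma circumcentre_empty F c z : is_face adj pos F -> is_circumcentre pos F c ->
  1 <= d2 c (pos z).
Proof.
move=> hF hc.
have [p Fp] : exists p, F p.
  by case: hF => p Dp ->; exists p; apply: connected_component_refl.
have Dp := face_not_drawing hF Fp.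
have [e e0 he] := near_drawing p.
have d0 := d2_ge0 (pos z) p; set d := d2 (pos z) p in d0.
(* The path stays within 1 + 2 d of z and edges have length at most 2, so B contains both ends of
   every edge that meets the path. *)
pose Rb := 3 + 2 * d.
have Rb0 : 0 < Rb by rewrite /Rb; lra.
pose a0 := Re p - X z; pose b0 := Im p - Y z.
have dE : d = a0 ^+ 2 + b0 ^+ 2 by [].
have dp : 0 < d.
  rewrite lt_def d0 andbT; apply/eqP => /d2_eq0 zp; apply: Dp; rewrite -zp.
  by left; exists z.
pose B := vball (pos z) Rb.
(* The values of [h] for which the line qz would be parallel to a line through two vertices of B.
   Avoiding them keeps the path off all vertices before z and makes it cross edges transversally. *)
pose bad := [seq ((X ab.2 - X ab.1) * b0 - (Y ab.2 - Y ab.1) * a0) /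
    ((X ab.2 - X ab.1) * a0 + (Y ab.2 - Y ab.1) * b0) | ab <- [seq (a, b) | a <- B, b <- B]].
have h00 : 0 < Num.min 1 (e / (1 + d)) by rewrite lt_min ltr01 divr_gt0//; lra.
have [h /andP[h0 hlt] hbad] := exists_small_notin bad h00.
have h1 : h < 1 by apply: (lt_le_trans hlt); rewrite ge_min lexx.
have h2 : h * (1 + d) < e.
  rewrite -ltr_pdivlMr; last lra.
  by apply: (lt_le_trans hlt); rewrite ge_min lexx orbT.
pose q : R[i] := ((Re p + h * b0) +i* (Im p - h * a0))%C.
have Fq : F q.
  apply: (face_segment hF Fp) => t /andP[t0 t1] /drawing_pmix[a [b [s [ab s01 E]]]].
  apply: Dp; have [|r r01 ->] := he a b s ab s01; last exact: pmix_drawing.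
  rewrite -E; have -> : d2 p (pmix p q t) = t ^+ 2 * (h ^+ 2 * d).
    by rewrite dE /d2 /q/=; ring.
  have t2 : t ^+ 2 <= 1 by nra.
  have h3 : h ^+ 2 * d <= (h * (1 + d)) ^+ 2.
    rewrite exprMn ler_wpM2l ?sqr_ge0//; nra.
  have h4 : 0 <= h ^+ 2 * d by rewrite mulr_ge0 ?sqr_ge0.
  have h5 : (h * (1 + d)) ^+ 2 < e ^+ 2.
    have : 0 < h * (1 + d) by rewrite mulr_gt0//; lra.
    by nra.
  by nra.
have generic a b : a \in B -> b \in B -> a != b ->
    (X b - X a) * (Im q - Y z) - (Y b - Y a) * (Re q - X z) != 0.
  move=> aB bB ab; apply/negP => /eqP E.
  have E' : (X b - X a) * b0 - (Y b - Y a) * a0 =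
            h * ((X b - X a) * a0 + (Y b - Y a) * b0).
    by move: E; rewrite /q/= /a0 /b0; lra.
  have [k0|k0] := eqVneq ((X b - X a) * a0 + (Y b - Y a) * b0) 0.
    have E2 : ((X b - X a) ^+ 2 + (Y b - Y a) ^+ 2) * (a0 ^+ 2 + b0 ^+ 2) =
       ((X b - X a) * a0 + (Y b - Y a) * b0) ^+ 2 +
       ((X b - X a) * b0 - (Y b - Y a) * a0) ^+ 2 by ring.
    move: E2; rewrite E' k0 mulr0 expr0n addr0 => /eqP.
    rewrite mulf_eq0 -dE (gt_eqF dp) orbF => /eqP.
    by move/d2_eq0/pos_inj/eqP; rewrite (negbTE ab).
  move/negP: hbad; apply; apply/mapP; exists (a, b) => /=.
    by apply/allpairsP; exists (a, b).
  by rewrite E' mulfK.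
pose g t := pmix q (pos z) t.
have dq : d2 (pos z) q = (1 + h ^+ 2) * d by rewrite dE /d2 /q /a0 /b0/=; ring.
have dq0 : 0 < d2 q (pos z).
  by rewrite d2C dq mulr_gt0//; have := sqr_ge0 h; lra.
have gz t : 0 <= t <= 1 -> d2 (pos z) (g t) <= (1 + 2 * d) ^+ 2.
  move=> /andP[t0 t1]; have -> : d2 (pos z) (g t) = (1 - t) ^+ 2 * d2 (pos z) q.
    by rewrite /d2 /g/=; ring.
  rewrite dq.
  have t2 : (1 - t) ^+ 2 <= 1 by nra.
  have h3 : (1 + h ^+ 2) * d <= 2 * d by rewrite ler_wpM2r//; nra.
  have h4 : 0 <= (1 + h ^+ 2) * d by rewrite mulr_ge0//; have := sqr_ge0 h; lra.
  have : (1 - t) ^+ 2 * ((1 + h ^+ 2) * d) <= 1 * (2 * d) by rewrite ler_pM ?sqr_ge0.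
  by nra.
have edgeB t a b s : 0 <= t <= 1 -> adj a b -> 0 <= s <= 1 ->
    g t = pmix (pos a) (pos b) s -> a \in B.
  move=> t01 ab /andP[s0 s1] E; rewrite mem_vball.
  have -> : Rb = (1 + 2 * d) + 2 by rewrite /Rb; ring.
  apply: (d2_triangle _ _ (gz t t01)) => //; first lra.
  rewrite E -{2}(pmix0 (pos a) (pos b)) d2_pmix.
  have := edge_length_le ab; have := d2_ge0 (pos a) (pos b).
  have : (0 - s) ^+ 2 <= 1 by nra.
  have := sqr_ge0 (0 - s).
  nra.
have zB : z \in B.
  by rewrite mem_vball /d2 !subrr expr0n/= addr0 sqr_ge0.
have novertex t v : 0 <= t < 1 -> g t <> pos v.
  move=> /andP[t0 t1] E.
  have [w vw] := neighbour_exists v.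
  have vB : v \in B.
    apply: (@edgeB t v w 0) => //; first by rewrite t0 ltW.
      by rewrite lexx ler01.
    by rewrite pmix0.
  have E1 : X v - X z = (1 - t) * (Re q - X z).
    by rewrite -E /g/=; ring.
  have E2 : Y v - Y z = (1 - t) * (Im q - Y z).
    by rewrite -E /g/=; ring.
  have [vz|vz] := eqVneq z v.
    have : d2 q (pos z) = 0.
      have h3 : Re q - X z = 0.
        apply/eqP; move/eqP: E1; rewrite vz subrr eq_sym mulf_eq0 subr_eq0 (gt_eqF t1)//.
      have h4 : Im q - Y z = 0.
        apply/eqP; move/eqP: E2; rewrite vz subrr eq_sym mulf_eq0 subr_eq0 (gt_eqF t1)//.
      by rewrite d2C /d2 h3 h4 !expr0n/= addr0.
    by move=> h3; move: dq0; rewrite h3 ltxx.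
  have := generic _ _ zB vB vz; rewrite E1 E2 => /eqP; apply; ring.
(* The invariant: in the face reached by the path, the squared distance from the centre to z is at
   most the initial one. Points on the drawing are exempt. *)
pose P t := D (g t) \/ exists F' c', [/\ is_face adj pos F', F' (g t),
  is_circumcentre pos F' c' & d2 c' (pos z) <= d2 c (pos z)].
have gball t s r : 0 < r -> `|s - t| < r / (1 + d2 q (pos z)) -> d2 (g t) (g s) < r ^+ 2.
  move=> r0; rewrite ltr_pdivlMr; last lra.
  move=> h3; rewrite d2_pmix -[(s - t) ^+ 2]real_normK ?num_real//.
  have : (`|s - t| * (1 + d2 q (pos z))) ^+ 2 < r ^+ 2.
    have : 0 <= `|s - t| * (1 + d2 q (pos z)) by rewrite mulr_ge0//; lra.
    by move: h3; set w := `|s - t| * _ => h3 h4; nra.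
  apply: le_lt_trans; rewrite exprMn ler_wpM2l ?sqr_ge0//; nra.
have gseg s t u : pmix (g s) (g t) u = g (s + u * (t - s)).
  by apply: complex_eta => /=; ring.
have allP t : 0 <= t < 1 -> P t.
  move=> t01; apply: contrapT => nPt.
  (* Continuous induction: if the invariant fails somewhere, it is shown to hold on an interval that
     starts at the infimum [i] of the failures, whether [g i] is on an edge or in a face. *)
  pose Bs := [set t | 0 <= t < 1 /\ ~ P t].
  have Bs0 : Bs !=set0 by exists t.
  have Bsl : has_inf Bs by split => //; exists 0 => x [/andP[]].
  pose i := inf Bs.
  have iB x : Bs x -> i <= x by move=> Bx; apply: ge_inf => //; case: Bsl.
  have i0 : 0 <= i by apply: lb_le_inf => // x [/andP[]].
  have i1 : i < 1 by apply: (le_lt_trans (iB t _)) => //; case/andP: t01.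
  have belowP x : 0 <= x -> x < i -> P x.
    move=> x0 xi; apply: contrapT => nPx.
    have : i <= x by apply: iB; split => //; rewrite x0 (lt_trans xi i1).
    by rewrite leNgt xi.
  have aboveB r : 0 < r -> exists2 b, Bs b & i <= b < i + r.
    move=> r0; have [b Bb bi] := inf_adherent r0 Bsl.
    by exists b => //; rewrite iB.
  have [e1 e10 he1] := near_drawing (g i).
  have [Di|Di] := pselect (D (g i)).
    have [a [b [s [ab /andP[s0 s1] E]]]] := drawing_pmix Di.
    have i01 : 0 <= i < 1 by rewrite i0.
    have i01' : 0 <= i <= 1 by rewrite i0 ltW.
    have ba : adj b a by rewrite adj_sym.
    have ip : 0 < i.
      rewrite lt_def i0 andbT; apply/eqP => iz; apply: (face_not_drawing hF Fq).
      by move: Di; rewrite iz /g pmix0.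
    have sn0 : s != 0.
      by apply/eqP => sz; apply: (novertex _ a i01); rewrite E sz pmix0.
    have sn1 : s != 1.
      by apply/eqP => sz; apply: (novertex _ b i01); rewrite E sz pmix1.
    have s01 : 0 < s < 1 by rewrite !lt_neqAle s0 s1 sn1 eq_sym sn0.
    (* The edge is oriented so that z is on its left: the path then leaves the left face of b'a' and
       enters that of a'b'. *)
    have [a' [b' [s' [ab' ba' s01' E' k0]]]] : exists a b s, [/\ adj a b, adj b a, 0 < s < 1,
        g i = pmix (pos a) (pos b) s & 0 < crs a b (pos z)].
      have aB : a \in B by apply: (edgeB i a b s); rewrite ?s0.
      have bB : b \in B.
        apply: (edgeB i b a (1 - s)) => //; first by keep s01; apply/andP; lra.
        by rewrite E pmix_rev.
      have nab : a != b by apply/eqP => h3; move: ab; rewrite h3 adj_irr.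
      have := generic a b aB bB nab; set k := _ - _ => kn0.
      have kz : crs a b (pos z) = - (1 - i) * k.
        have : crs a b (g i) = 0 by rewrite E crs_pmix /crs; ring.
        by rewrite /g crs_pmix /k /crs; keep R; lra.
      have [kp|kp|kp] := ltgtP k 0; last by rewrite kp eqxx in kn0.
        exists a, b, s; split => //; rewrite kz; keep kp i1; nra.
      exists b, a, (1 - s); split => //; first by keep s01; apply/andP; lra.
        by rewrite E pmix_rev.
      by rewrite crs_sym kz; keep kp i1; nra.
    have s01'' : 0 < 1 - s' < 1 by keep s01'; apply/andP; lra.
    have [FL lL hL] := left_face_exists ab'.
    have [FR lR hR] := left_face_exists ba'.
    have [e2 e20 he2] := left_face_disc ab' lL s01'.
    have [e3 e30 he3] := left_face_disc ba' lR s01''.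
    rewrite -E' in he2; rewrite -pmix_rev -E' in he3.
    have lg x : crs a' b' (g x) = (x - i) / (1 - i) * crs a' b' (pos z).
      have h3 : crs a' b' (g i) = 0 by rewrite E' crs_pmix /crs; ring.
      move: h3; rewrite /g !crs_pmix => h3.
      have i1' : 1 - i != 0 by rewrite gt_eqF ?subr_gt0.
      have -> : crs a' b' q = - (i / (1 - i)) * crs a' b' (pos z).
        apply: (mulfI i1'); transitivity (- i * crs a' b' (pos z)); first by keep h3; lra.
        by field.
      by field.
    pose dl := Num.min e2 e3 / (1 + d2 q (pos z)).
    have m0 : 0 < Num.min e2 e3 by rewrite lt_min e20.
    have m2 : Num.min e2 e3 <= e2 by rewrite ge_min lexx.
    have m3 : Num.min e2 e3 <= e3 by rewrite ge_min lexx orbT.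
    have dl0 : 0 < dl by rewrite divr_gt0// ltr_pwDl// ltW.
    have near x : `|x - i| < dl -> d2 (g i) (g x) < Num.min e2 e3 ^+ 2.
      by move=> h3; apply: gball.
    have hcR : d2 (dual_left b' a') (pos z) <= d2 c (pos z).
      pose x := Num.max 0 (i - dl / 2).
      have x0 : 0 <= x by rewrite le_max lexx.
      have xi : x < i by rewrite gt_max ip/=; keep dl0; lra.
      have xd : i - dl / 2 <= x by rewrite le_max lexx orbT.
      have FRx : FR (g x).
        apply: he3.
          apply: (@lt_le_trans _ _ (Num.min e2 e3 ^+ 2)); last by keep m0 m2 m3; nra.
          by apply: near; keep xi xd dl0; rewrite ltr0_norm; lra.
        rewrite crs_sym lg -mulNr mulr_gt0//.
        by rewrite -mulNr opprB divr_gt0 ?subr_gt0.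
      have [hFR _ _] := lR.
      have [Dx|[F' [c' [hF' F'x hc' le]]]] := belowP x x0 xi.
        by case: (face_not_drawing hFR FRx).
      move: hc'; rewrite (face_eq hF' hFR F'x FRx) => hc'.
      by rewrite -(left_circumcentre ba' lR hc').
    have [b2 [b201 nPb]] := aboveB _ dl0.
    move=> /andP[ib]; apply/negP; rewrite -leNgt leNgt; apply/negP => bd.
    apply: nPb; move: ib; rewrite le_eqVlt => /orP[/eqP <-|ib]; first by left.
    right; exists FL, (dual_left a' b'); split => //.
    - by case: lL.
    - apply: he2.
        apply: (@lt_le_trans _ _ (Num.min e2 e3 ^+ 2)); last by keep m0 m2 m3; nra.
        by apply: near; keep ib bd; rewrite gtr0_norm; lra.
      by rewrite lg mulr_gt0// divr_gt0 ?subr_gt0.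
    apply: (le_trans _ hcR).
    (* The edge lies on the radical axis of the two circles, so the difference of the powers of z is
       a multiple of [crs a' b' (pos z)], and its sign favours the face on the side of z. *)
    have -> : d2 (dual_left a' b') (pos z) = d2 (dual_left b' a') (pos z)
        - 2 * (tan (theta a' b') * crs a' b' (pos z)).
      by rewrite /d2 /dual_left/= (theta_sym ab') /crs; field.
    by have := mulr_gt0 (tan_theta_gt0 ab') k0; move: (_ * _) (d2 _ _) => m1 m4; keep R; lra.
  have free x : `|x - i| < e1 / (1 + d2 q (pos z)) -> ~ D (g x).
    move=> h3 /drawing_pmix[a [b [s [ab s01 E]]]].
    have [|r r01 E'] := he1 a b s ab s01; first by rewrite -E; apply: gball.
    by apply: Di; rewrite E'; apply: pmix_drawing.
  set dl := e1 / _ in free.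
  have dl0 : 0 < dl by rewrite divr_gt0// ltr_pwDl// ltW.
  have [F' [c' [hF' F'i hc' le]]] : exists F' c', [/\ is_face adj pos F', F' (g i),
      is_circumcentre pos F' c' & d2 c' (pos z) <= d2 c (pos z)].
    have [iz|inz] := eqVneq i 0.
      by exists F, c; split; rewrite ?iz /g ?pmix0.
    have ip : 0 < i by rewrite lt_def inz.
    pose x := Num.max 0 (i - dl / 2).
    have x0 : 0 <= x by rewrite le_max lexx.
    have xi : x < i by rewrite gt_max ip/=; keep dl0; lra.
    have xd : i - dl / 2 <= x by rewrite le_max lexx orbT.
    have [Dx|[F' [c' [hF' F'x hc' le]]]] := belowP x x0 xi.
      by case: (free x) => //; keep xi xd dl0; rewrite ltr0_norm; lra.
    exists F', c'; split => //; apply: (face_segment hF' F'x) => u /andP[u0 u1].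
    by rewrite gseg; apply: free; keep u0 u1 xi xd dl0; rewrite ler0_norm; nra.
  have [b [b01 nPb] /andP[ib bd]] := aboveB _ dl0.
  apply: nPb; right; exists F', c'; split => //.
  apply: (face_segment hF' F'i) => u /andP[u0 u1].
  by rewrite gseg; apply: free; keep u0 u1 ib bd; rewrite ger0_norm; nra.
(* Near z the drawing consists of edges ending at z, and the path is parallel to none of them. Its
   last stretch therefore stays in one face, whose closure contains z, so that z is on the circle of
   this face. *)
have [e1 e10 he1] := near_vertex z.
have gz' x : d2 (pos z) (g x) = d2 (g 1) (g x) by rewrite /g pmix1.
have free x : 0 <= x < 1 -> `|x - 1| < e1 / (1 + d2 q (pos z)) -> ~ D (g x).
  move=> /andP[x0 x1] hx Dx.
  have [|w [s [zw /andP[s0 s1] E]]] := he1 (g x) _ Dx.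
    by rewrite gz'; apply: gball.
  have wB : w \in B.
    rewrite mem_vball; apply: (le_trans (edge_length_le zw)).
    by rewrite /Rb; keep d0; nra.
  have zw' : z != w by apply/eqP => h3; move: zw; rewrite h3 adj_irr.
  have := generic _ _ zB wB zw'.
  have E1 : (1 - x) * (Re q - X z) = s * (X w - X z).
    by have := congr1 (@complex.Re R) E; rewrite /g/=; keep R; lra.
  have E2 : (1 - x) * (Im q - Y z) = s * (Y w - Y z).
    by have := congr1 (@complex.Im R) E; rewrite /g/=; keep R; lra.
  move=> /negP; apply; rewrite -(mulrI_eq0 _ (mulfI (_ : 1 - x != 0))); last first.
    by rewrite gt_eqF ?subr_gt0.
  apply/eqP.
  transitivity ((X w - X z) * ((1 - x) * (Im q - Y z)) - (Y w - Y z) * ((1 - x) * (Re q - X z))).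
    by ring.
  by rewrite E1 E2; ring.
pose dl r := Num.min 1 (r / (1 + d2 q (pos z))).
have dlP r : 0 < r -> 0 < dl r /\ dl r <= 1 /\ dl r <= r / (1 + d2 q (pos z)).
  move=> r0; rewrite lt_min ltr01 divr_gt0//; last by rewrite ltr_pwDl// ltW.
  by rewrite !ge_min !lexx orbT.
have [l0 [l1 le1]] := dlP _ e10; set t := 1 - dl e1 / 2.
have t01 : 0 <= t < 1 by rewrite /t; keep l0 l1; apply/andP; lra.
have tfree x : t <= x < 1 -> ~ D (g x).
  move=> /andP[tx x1]; apply: free; first by case/andP: t01 => t0 _; rewrite (le_trans t0).
  by rewrite /t in tx; keep tx x1 l0 le1; rewrite ltr0_norm; lra.
have [Dt|[F' [c' [hF' F't hc' le]]]] := allP t t01.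
  by case: (tfree t) => //; rewrite lexx; case/andP: t01.
apply: (le_trans _ le); rewrite (circumcentre_vertex hc')//.
move=> A /plane_nbhsP[r [r0 hr]].
have [m0 [m1 mr]] := dlP _ r0.
pose x := Num.max t (1 - dl r / 2).
have xt : t <= x by rewrite le_max lexx.
have x1 : x < 1 by rewrite gt_max; case/andP: t01 => _ ->/=; keep m0; lra.
have xr : 1 - dl r / 2 <= x by rewrite le_max lexx orbT.
exists (g x); split.
  apply: (face_segment hF' F't) => u /andP[u0 u1].
  by rewrite gseg; apply: tfree; apply/andP; keep u0 u1 xt x1; split; nra.
apply: hr; rewrite gz'; apply: gball => //.
by keep x1 xr m0 mr; rewrite ltr0_norm; lra.
Qed.

Lemma delaunay x y z : adj x y -> 1 <= d2 (dual_left x y) (pos z).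
Proof.
by move=> xy; have [F [hF _ _] hc] := left_face_exists xy; exact: circumcentre_empty hF hc.
Qed.

Local Notation dx x y := (X y - X x).
Local Notation dy x y := (Y y - Y x).

Lemma dual_left_rel x y : adj x y ->
  [/\ Re (dual_left x y) - X x = dx x y / 2 - tan (theta x y) / 2 * dy x y,
      Im (dual_left x y) - Y x = dy x y / 2 + tan (theta x y) / 2 * dx x y,
      Re (dual_left y x) - X x = dx x y / 2 + tan (theta x y) / 2 * dy x y &
      Im (dual_left y x) - Y x = dy x y / 2 - tan (theta x y) / 2 * dx x y].
Proof.
by move=> xy; rewrite /dual_left/= (theta_sym xy); split; field.
Qed.

(** Expanding [|c - w|^2 >= 1] with [|c - x| = 1] makes the Delaunay condition linear in the centre
    c. *)
Lemma delaunay_dot x y w : adj x y ->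
  (Re (dual_left x y) - X x) * dx x w + (Im (dual_left x y) - Y x) * dy x w
    <= d2 (pos x) (pos w) / 2 /\
  (Re (dual_left y x) - X x) * dx x w + (Im (dual_left y x) - Y x) * dy x w
    <= d2 (pos x) (pos w) / 2.
Proof.
move=> xy; have yx : adj y x by rewrite adj_sym.
have [h1 _] := dual_left_d2 xy; have [_ h2] := dual_left_d2 yx.
have := delaunay w xy; have := delaunay w yx.
by move: h1 h2; rewrite /d2 => h1 h2 h3 h4; split; keep h1 h2 h3 h4; lra.
Qed.

Lemma dual_left_dot x y : adj x y ->
  (Re (dual_left x y) - X x) * dx x y + (Im (dual_left x y) - Y x) * dy x y
    = d2 (pos x) (pos y) / 2 /\
  (Re (dual_left y x) - X x) * dx x y + (Im (dual_left y x) - Y x) * dy x y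
    = d2 (pos x) (pos y) / 2.
Proof.
move=> xy; have [-> -> -> ->] := dual_left_rel xy.
by rewrite /d2; split; field.
Qed.

(** The Delaunay condition at y2 for the other centre of xy1, and the one at y1 for the other centre
    of xy2, bound the cross product of both edges from opposite sides; the edges are collinear. Both
    are chords from x of the same circle, hence equal. *)
Lemma dual_left_inj x y1 y2 : adj x y1 -> adj x y2 ->
  dual_left x y1 = dual_left x y2 -> y1 = y2.
Proof.
move=> h1 h2 E.
suff [U W] : dx x y2 = dx x y1 /\ dy x y2 = dy x y1.
  by apply: pos_inj; apply: complex_eta => /=; keep U W; lra.
have [_ r1] := delaunay_dot y2 h1; have [_ r2] := delaunay_dot y1 h2.
have [e1 _] := dual_left_dot h1; have [e2 _] := dual_left_dot h2.
have t1 := tan_theta_gt0 h1; have t2 := tan_theta_gt0 h2.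
have L1 := adj_d2_gt0 h1; have L2 := adj_d2_gt0 h2.
have [a1 b1 c1 f1] := dual_left_rel h1; have [a2 b2 c2 f2] := dual_left_rel h2.
move: r1 r2 e1 e2; rewrite -E.
rewrite c1 f1 c2 f2; rewrite -E in a2 b2.
set p := Re (dual_left x y1) - X x in a1 a2 *.
set q := Im (dual_left x y1) - Y x in b1 b2 *.
move: L1 L2; rewrite /d2.
move: (tan (theta x y1)) (tan (theta x y2)) t1 t2 a1 b1 a2 b2 => s1 s2 t1 t2.
have -> : X y1 = X x + dx x y1 by ring.
have -> : Y y1 = Y x + dy x y1 by ring.
have -> : X y2 = X x + dx x y2 by ring.
have -> : Y y2 = Y x + dy x y2 by ring.
move: (dx x y1) (dy x y1) (dx x y2) (dy x y2) => u1 v1 u2 v2.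
have sm (z w : R) : z + w - z = w by ring.
rewrite !sm => a1 b1 a2 b2 L1 L2 r1 r2 e1 e2.
have k1 : 0 <= u1 * v2 - v1 * u2.
  suff : 0 <= s1 * (u1 * v2 - v1 * u2) by rewrite pmulr_rge0.
  have -> : s1 * (u1 * v2 - v1 * u2) = (p * u2 + q * v2) -
     ((u1 / 2 + s1 / 2 * v1) * u2 + (v1 / 2 - s1 / 2 * u1) * v2).
    by rewrite a1 b1; field.
  by keep r1 e2; lra.
have k2 : 0 <= u2 * v1 - v2 * u1.
  suff : 0 <= s2 * (u2 * v1 - v2 * u1) by rewrite pmulr_rge0.
  have -> : s2 * (u2 * v1 - v2 * u1) = (p * u1 + q * v1) -
     ((u2 / 2 + s2 / 2 * v2) * u1 + (v2 / 2 - s2 / 2 * u2) * v1).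
    by rewrite a2 b2; field.
  by keep r2 e1; lra.
have k : u1 * v2 = v1 * u2 by keep k1 k2; lra.
pose tau := (u1 * u2 + v1 * v2) / (u1 ^+ 2 + v1 ^+ 2).
have L1n := lt0r_neq0 L1.
have U : u2 = tau * u1.
  apply: (mulfI L1n); rewrite mulrA [_ * tau]mulrC divfK//.
  transitivity (u1 * (u1 * u2) + v1 * (v1 * u2)); first by ring.
  by rewrite -k; ring.
have W : v2 = tau * v1.
  apply: (mulfI L1n); rewrite mulrA [_ * tau]mulrC divfK//.
  transitivity (u1 * (u1 * v2) + v1 * (v1 * v2)); first by ring.
  by rewrite k; ring.
have tt : tau * (tau - 1) = 0.
  apply: (mulIf L1n); rewrite mul0r.
  move: e1 e2; rewrite U W => e1 e2.
  have : tau * (p * u1 + q * v1) = (tau * u1) ^+ 2 / 2 + (tau * v1) ^+ 2 / 2.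
    by keep e2; lra.
  by rewrite e1; keep R; lra.
have tau1 : tau = 1.
  move/eqP: tt; rewrite mulf_eq0 subr_eq0 => /orP[/eqP t0|/eqP//].
  by move: L2; rewrite U W t0 !mul0r expr0n addr0 ltxx.
by rewrite U W tau1 !mul1r.
Qed.

(** The passage from a neighbour to the next one counterclockwise is injective by [dual_left_inj],
    hence a permutation of the finite set of neighbours, and it carries left centres to right
    centres. *)
Lemma dual_left_perm x :
  perm_eq [seq dual_left x y | y <- neighbours x] [seq dual_left y x | y <- neighbours x].
Proof.
have nuniq : uniq (neighbours x) by apply: fset_uniq.
have /choice[nx hnx] : forall y, exists y', adj x y ->
    adj x y' /\ dual_left x y = dual_left y' x.
  move=> y; have [xy|xy] := boolP (adj x y); last by exists y.
  by have [y' [h1 _ h2]] := next_neighbour xy; exists y'.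
have inj : {in neighbours x &, injective nx}.
  move=> y1 y2; rewrite !mem_neighbours => h1 h2 h.
  have [_ e1] := hnx _ h1; have [_ e2] := hnx _ h2.
  by apply: (dual_left_inj h1 h2); rewrite e1 e2 h.
have pe : perm_eq [seq nx y | y <- neighbours x] (neighbours x).
  apply: uniq_perm => //; first by rewrite map_inj_in_uniq.
  have sub : {subset [seq nx y | y <- neighbours x] <= neighbours x}.
    by move=> z /mapP[y]; rewrite mem_neighbours => xy ->; rewrite mem_neighbours; case: (hnx _ xy).
  have u1 : uniq [seq nx y | y <- neighbours x] by rewrite map_inj_in_uniq.
  by have [|_ h] := uniq_min_size u1 sub; first by rewrite size_map.
have -> : [seq dual_left x y | y <- neighbours x] =
    [seq dual_left y x | y <- [seq nx y | y <- neighbours x]].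
  rewrite -map_comp; apply/eq_in_map => y; rewrite mem_neighbours => xy /=.
  by case: (hnx _ xy).
exact: perm_map.
Qed.

Lemma dual_sum x (phi : R[i] -> R) : \sum_(y <- neighbours x) phi (dual_left x y) =
  \sum_(y <- neighbours x) phi (dual_left y x).
Proof.
rewrite -(big_map (dual_left x) xpredT phi) -(big_map (dual_left^~ x) xpredT phi).
exact: perm_big (dual_left_perm x).
Qed.

(* The direction (a, b) at x lies in the cone spanned by two consecutive edges,
   whose common face has centre [dual_left x w]. *)
Lemma consecutive_cone x (a b : R) : a ^+ 2 + b ^+ 2 = 1 ->
  exists w y', [/\ adj x w, adj x y' &
  forall D, (Re (dual_left x w) - X x) * a + (Im (dual_left x w) - Y x) * b < D ->
   d2 (pos x) (pos w) / 2 < D * (a * dx x w + b * dy x w) \/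
   d2 (pos x) (pos y') / 2 < D * (a * dx x y' + b * dy x y')].
Proof.
move=> ab1.
pose f (c : R[i]) := a * (Re c - X x) + b * (Im c - Y x).
have [y0 xy0] := neighbour_exists x.
(* The centre extending farthest in the direction (a, b) belongs to the face whose sector at x
   contains this direction: [k1] and [k2] say that (a, b) is between w and y'. *)
have [|w] := @exists_argmax R _ (neighbours x) (fun w => f (dual_left x w)) y0.
  by rewrite mem_neighbours.
rewrite mem_neighbours => xw hw.
have hw' c : c \in [seq dual_left y x | y <- neighbours x] -> f c <= f (dual_left x w).
  by rewrite -(perm_mem (dual_left_perm x)) => /mapP[y yn ->]; exact: hw.
have [y' [xy' cr E]] := next_neighbour xw.
exists w, y'; split => // D hD.
have [F1 F2] := dual_left_dot xw; have [F3 F4] := dual_left_dot xy'.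
have [a1 b1 c1 f1] := dual_left_rel xw; have [a2 b2 c2 f2] := dual_left_rel xy'.
have g1 : f (dual_left w x) <= f (dual_left x w).
  by apply: hw'; apply/mapP; exists w => //; rewrite mem_neighbours.
have g2 : f (dual_left x y') <= f (dual_left y' x).
  by rewrite -E; apply: hw; rewrite mem_neighbours.
have t1 := tan_theta_gt0 xw; have t2 := tan_theta_gt0 xy'.
apply: contrapT => /not_orP[/negP nw /negP nw'].
move: nw nw'; rewrite -!leNgt -F1 -F4.
move: g1 g2 hD; rewrite /f -E a1 b1 c1 f1.
have s1 : Re (dual_left x w) - X x = Re (dual_left y' x) - X x by rewrite E.
have s2 : Im (dual_left x w) - Y x = Im (dual_left y' x) - Y x by rewrite E.
rewrite a1 in s1; rewrite b1 in s2; rewrite c2 in s1; rewrite f2 in s2.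
rewrite a2 b2 => g1 g2.
move: cr; rewrite /crs.
move: (tan (theta x w)) (tan (theta x y')) t1 t2 s1 s2 g1 g2 => t t' t0 t'0.
move: (dx x w) (dy x w) (dx x y') (dy x y') => u v u' v'.
set p := u / 2 - t / 2 * v; set q := v / 2 + t / 2 * u => s1 s2 g1 g2 cr hD h1 h2.
have k1 : 0 <= u * b - v * a.
  suff : 0 <= t * (u * b - v * a) by rewrite pmulr_rge0.
  by move: g1; rewrite /p /q; keep R; lra.
have k2 : 0 <= a * v' - b * u'.
  suff : 0 <= t' * (a * v' - b * u') by rewrite pmulr_rge0.
  by move: g2; rewrite s1 s2; keep R; lra.
have h3 : (D * a - p) * u + (D * b - q) * v <= 0 by keep h1; lra.
have h4 : (D * a - p) * u' + (D * b - q) * v' <= 0 by keep h2; lra.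
have k3 : (u * v' - v * u') * ((D * a - p) * a + (D * b - q) * b) =
  (a * v' - b * u') * ((D * a - p) * u + (D * b - q) * v) +
  (u * b - v * a) * ((D * a - p) * u' + (D * b - q) * v') by ring.
have : (D * a - p) * a + (D * b - q) * b <= 0.
  rewrite -(pmulr_rle0 _ cr) k3; keep k1 k2 h3 h4; nra.
have -> : (D * a - p) * a + (D * b - q) * b = D * (a ^+ 2 + b ^+ 2) - (p * a + q * b) by ring.
by rewrite ab1 mulr1 subr_le0 leNgt hD.
Qed.

Lemma exists_neighbour_towards x (a b D : R) : a ^+ 2 + b ^+ 2 = 1 -> 1 < D ->
  exists2 w, adj x w & d2 (pos x) (pos w) / 2 < D * (a * dx x w + b * dy x w).
Proof.
move=> ab D1; have [w [y' [xw xy' h]]] := consecutive_cone x ab.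
case: (h D) => [|h'|h']; [|by exists w|by exists y'].
have [n1 _] := dual_left_d2 xw; move: n1; rewrite d2C /d2.
have := sqr_ge0 (Re (dual_left x w) - X x - a); have := sqr_ge0 (Im (dual_left x w) - Y x - b).
by keep ab D1; lra.
Qed.

(** Greedy routing in a Delaunay graph. Take the cone at x that contains the direction of z: the
    Delaunay condition at z bounds the component of the centre in this direction by half the
    distance, so one of the two edges spanning the cone gets closer. *)
Lemma exists_closer_neighbour x z : x != z -> exists2 w, adj x w &
  d2 (pos w) (pos z) < d2 (pos x) (pos z).
Proof.
move=> xz.
have L0 : 0 < d2 (pos x) (pos z).
  rewrite lt_def d2_ge0 andbT; apply: contra_neq xz => h; apply: pos_inj; exact: d2_eq0.
pose D := Num.sqrt (d2 (pos x) (pos z)).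
have D0 : 0 < D by rewrite sqrtr_gt0.
have D2 : D ^+ 2 = d2 (pos x) (pos z) by rewrite sqr_sqrtr// ltW.
have Dn := lt0r_neq0 D0.
have ab : (dx x z / D) ^+ 2 + (dy x z / D) ^+ 2 = 1.
  by rewrite !expr_div_n -mulrDl D2 divff// gt_eqF.
have [w [y' [xw xy' h]]] := consecutive_cone x ab.
have [r1 _] := delaunay_dot z xw.
have h0 : (Re (dual_left x w) - X x) * (dx x z / D) + (Im (dual_left x w) - Y x) * (dy x z / D) < D.
  rewrite !mulrA -mulrDl ltr_pdivrMr// -expr2 D2.
  by keep r1 L0; lra.
have conc v : d2 (pos x) (pos v) / 2 < D * (dx x z / D * dx x v + dy x z / D * dy x v) ->
    d2 (pos v) (pos z) < d2 (pos x) (pos z).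
  have -> : D * (dx x z / D * dx x v + dy x z / D * dy x v) = dx x z * dx x v + dy x z * dy x v.
    by field.
  by rewrite /d2; keep R; lra.
by have [h1|h1] := h _ h0; [exists w|exists y'] => //; exact: conc.
Qed.
(** Otherwise y - x is a nonnegative combination of the two centres of xw relative to x, and the
    Delaunay inequalities, at y for these centres and at w for those of xy, leave only y = w.
    Sectors of distinct edges thus do not contain each other's edge. *)
Lemma edge_sector x y w : adj x y -> adj x w -> y != w ->
  ~ (0 <= dx x y * (Im (dual_left x w) - Y x) - dy x y * (Re (dual_left x w) - X x) /\
     dx x y * (Im (dual_left w x) - Y x) - dy x y * (Re (dual_left w x) - X x) <= 0).
Proof.
move=> xy xw yw [A B]; move/eqP: yw; apply.
suff [U W] : dx x y = dx x w /\ dy x y = dy x w.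
  by apply: pos_inj; apply: complex_eta => /=; keep U W; lra.
have [r1 r2] := delaunay_dot y xw; have [r3 r4] := delaunay_dot w xy.
have [a1 b1 c1 f1] := dual_left_rel xw; have [a2 b2 c2 f2] := dual_left_rel xy.
have t1 := tan_theta_gt0 xw; have t2 := tan_theta_gt0 xy.
have L1 := adj_d2_gt0 xw; have L2 := adj_d2_gt0 xy.
move: A B r1 r2 r3 r4 L1 L2; rewrite a1 b1 c1 f1 a2 b2 c2 f2 /d2.
move: (tan (theta x w)) (tan (theta x y)) t1 t2 => t s t0 s0.
move: (dx x w) (dy x w) (dx x y) (dy x y) => {a1 b1 c1 f1 a2 b2 c2 f2} u v a b A B r1 r2 r3 r4 L1 L2.
(* [al] and [be] are the coordinates of y - x in the frame of the two dual
   vertices of xw, scaled by S = t |w - x|^2 / 2; both are shown to add up to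
   2 S. *)
set L := u ^+ 2 + v ^+ 2 in L1 r3 r4.
set M := a ^+ 2 + b ^+ 2 in L2 r1 r2.
set al := - (a * (v / 2 - t / 2 * u) - b * (u / 2 + t / 2 * v)) in B *.
have al0 : 0 <= al by rewrite oppr_ge0.
set be := a * (v / 2 + t / 2 * u) - b * (u / 2 - t / 2 * v) in A.
pose S := t / 2 * L.
have S0 : 0 < S by rewrite !mulr_gt0.
have ES : al + be = t * (a * u + b * v) by rewrite /al /be; field.
have EM : S * M = al * ((u / 2 - t / 2 * v) * a + (v / 2 + t / 2 * u) * b)
                + be * ((u / 2 + t / 2 * v) * a + (v / 2 - t / 2 * u) * b).
  by rewrite /S /al /be /M /L; field.
have k1 : S * M <= (al + be) * (M / 2).
  rewrite EM [leRHS]mulrDl; apply: lerD.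
    by apply: ler_wpM2l => //; keep r1; lra.
  by apply: ler_wpM2l => //; keep r2; lra.
have k2 : 2 * S <= al + be.
  by rewrite -(ler_pM2r L2); keep k1; lra.
have k3 : a * u + b * v <= L by keep r3 r4; lra.
have k4 : al + be <= t * L by rewrite ES ler_wpM2l// ltW.
have k5 : t * (a * u + b * v) = t * L by rewrite -ES; move: k2 k4; rewrite /S; keep R; lra.
have k6 : a * u + b * v = L by apply: (mulfI (lt0r_neq0 t0)).
have k7 : s * (a * v - b * u) = 0.
  by keep r3 r4 k6; lra.
have k8 : a * v - b * u = 0 by move/eqP: k7; rewrite mulf_eq0 (gt_eqF s0) => /eqP.
have Ln := lt0r_neq0 L1.
split; apply: (mulfI Ln); rewrite /L.
  transitivity ((a * u + b * v) * u + (a * v - b * u) * v); first by ring.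
  by rewrite k6 k8 /L; ring.
transitivity ((a * u + b * v) * v - (a * v - b * u) * u); first by ring.
by rewrite k6 k8 /L; ring.
Qed.

Lemma edge_len_tan x y : adj x y ->
  d2 (pos x) (pos y) * (1 - tan (theta x y) ^+ 2) = 4 * cos (2 * theta x y) /\
  d2 (pos x) (pos y) * tan (theta x y) = 2 * sin (2 * theta x y).
Proof.
move=> xy; have c0 := cos_theta_gt0 xy.
have tc : tan (theta x y) * cos (theta x y) = sin (theta x y).
  by rewrite /tan divfK// gt_eqF.
rewrite edge_length_theta//.
have -> : 2 * theta x y = theta x y + theta x y by ring.
rewrite cosD sinD -tc; split; ring.
Qed.

(** The argument of c - x, with its cut along a fixed edge xy0, grows by [2 * theta x w] from the
    right to the left centre of every xw. Only at w = y0 is the cut crossed, with a loss of 2 pi; by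
    [dual_sum] all increments together give 0. *)
Lemma angle_sum x : \sum_(y <- neighbours x) (2 * theta x y) = 2 * pi.
Proof.
have nuniq : uniq (neighbours x) by apply: fset_uniq.
have [y0 xy0] := neighbour_exists x.
have pp := @pi_gt0 R.
pose a := dx x y0; pose b := dy x y0.
have M0 : 0 < a ^+ 2 + b ^+ 2 by exact: adj_d2_gt0 xy0.
pose A (c : R[i]) := oang (- (a * (Re c - X x) + b * (Im c - Y x)))
  (- (a * (Im c - Y x) - b * (Re c - X x))).
have main w : adj x w -> w != y0 -> A (dual_left x w) - A (dual_left w x) = 2 * theta x w.
  move=> xw wy0; have y0w : y0 != w by rewrite eq_sym.
  have nS := edge_sector xy0 xw y0w.
  have [a1 b1 c1 f1] := dual_left_rel xw.
  have [E1 E2] := edge_len_tan xw.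
  move: (theta_bounds xw) => /andP[th1 th2].
  have sp : 0 < sin (2 * theta x w) by apply: sin_gt0_pi; keep th1 th2; lra.
  have L1 := adj_d2_gt0 xw; have t0 := tan_theta_gt0 xw.
  rewrite /A; rewrite a1 b1 c1 f1 in nS *.
  move: L1 E1 E2 nS; rewrite /d2 -/a -/b.
  move: (tan (theta x w)) t0 (dx x w) (dy x w) => t t0 u v {a1 b1 c1 f1} L1 E1 E2 nS.
  set p1 := u / 2 + t / 2 * v in nS *; set p2 := v / 2 - t / 2 * u in nS *.
  set q1 := u / 2 - t / 2 * v in nS *; set q2 := v / 2 + t / 2 * u in nS *.
  have cr : p1 * q2 - p2 * q1 = sin (2 * theta x w).
    by rewrite /p1 /p2 /q1 /q2; keep E2; lra.
  have dt : p1 * q1 + p2 * q2 = cos (2 * theta x w).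
    by rewrite /p1 /p2 /q1 /q2; keep E1; lra.
  have key : (a ^+ 2 + b ^+ 2) * (p1 * q2 - p2 * q1) =
    (a * p1 + b * p2) * (a * q2 - b * q1) - (a * p2 - b * p1) * (a * q1 + b * q2).
    by ring.
  have key0 : 0 < (a ^+ 2 + b ^+ 2) * (p1 * q2 - p2 * q1) by rewrite cr mulr_gt0.
  rewrite oang_sub_cut.
  - apply: (@oang_uniq _ _ _ (a ^+ 2 + b ^+ 2)) => //; first by keep th1 th2 pp; apply/andP; lra.
      by rewrite -dt; ring.
    by rewrite -cr; ring.
  - rewrite /offcut oppr_eq0; apply/negPn/negP; rewrite negb_or negbK -leNgt oppr_le0.
    move=> /andP[/eqP h1 h2]; apply: nS; rewrite h1; split => //.
    move: key0; rewrite key h1 mul0r subr0 => h3.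
    by rewrite leNgt; apply/negP => h4; keep h2 h3 h4; nra.
  - rewrite /offcut oppr_eq0; apply/negPn/negP; rewrite negb_or negbK -leNgt oppr_le0.
    move=> /andP[/eqP h1 h2]; apply: nS; rewrite h1; split => //.
    move: key0; rewrite key h1 mulr0 sub0r => h3.
    by rewrite leNgt; apply/negP => h4; keep h2 h3 h4; nra.
  - by move: key0; rewrite key !mulrNN.
  - by rewrite oppr_lt0 oppr_gt0 => /andP[h1 h2]; apply: nS; split; exact: ltW.
have th0 := theta_bounds xy0; move: (th0) => /andP[th1 th2].
have c0 := cos_theta_gt0 xy0.
have tc : tan (theta x y0) * cos (theta x y0) = sin (theta x y0).
  by rewrite /tan divfK// gt_eqF.
have EL : oang (- ((a ^+ 2 + b ^+ 2) / 2)) (- (tan (theta x y0) * (a ^+ 2 + b ^+ 2) / 2)) =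
    theta x y0 - pi.
  apply: (@oang_uniq _ _ _ ((a ^+ 2 + b ^+ 2) / (2 * cos (theta x y0)))).
  - by rewrite divr_gt0// mulr_gt0.
  - by keep th1 th2 pp; apply/andP; lra.
  - rewrite cosB cospi sinpi mulr0 addr0; field; exact: lt0r_neq0.
  - rewrite sinB cospi sinpi mulr0 subr0 -tc; field; exact: lt0r_neq0.
have main0 : A (dual_left x y0) - A (dual_left y0 x) = 2 * theta x y0 - 2 * pi.
  have [a1 b1 c1 f1] := dual_left_rel xy0.
  rewrite /A a1 b1 c1 f1 -/a -/b.
  have -> : - (a * (a / 2 - tan (theta x y0) / 2 * b) + b * (b / 2 + tan (theta x y0) / 2 * a)) =
    - ((a ^+ 2 + b ^+ 2) / 2) by field.
  have -> : - (a * (b / 2 + tan (theta x y0) / 2 * a) - b * (a / 2 - tan (theta x y0) / 2 * b)) =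
    - (tan (theta x y0) * (a ^+ 2 + b ^+ 2) / 2) by field.
  have -> : - (a * (a / 2 + tan (theta x y0) / 2 * b) + b * (b / 2 - tan (theta x y0) / 2 * a)) =
    - ((a ^+ 2 + b ^+ 2) / 2) by field.
  have -> : - (a * (b / 2 - tan (theta x y0) / 2 * a) - b * (a / 2 + tan (theta x y0) / 2 * b)) =
    - - (tan (theta x y0) * (a ^+ 2 + b ^+ 2) / 2) by field.
  by rewrite [oang _ (- - _)]oangN EL; ring.
have := dual_sum x A => /eqP; rewrite -subr_eq0 -sumrB => /eqP.
have y0n : y0 \in neighbours x by rewrite mem_neighbours.
rewrite !(bigD1_seq y0)//= main0 big_seq_cond.
rewrite (eq_bigr (fun w => 2 * theta x w)); last first.
  by move=> w /andP[]; rewrite mem_neighbours; exact: main.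
by rewrite -big_seq_cond; keep R; lra.
Qed.

Lemma isoradial_rhombic_graph : exists G : rhombic_graph R V,
  (forall x y, (y \in nb G x) = adj x y) /\ (forall x y, th G x y = theta x y).
Proof.
have nuniq x : uniq (neighbours x) by apply: fset_uniq.
unshelve eexists (@RhombicGraph R V (fun v => X v) (fun v => Y v) neighbours theta eta
  (fun a b r => vball (a +i* b)%C r) _ eta_itv nuniq _ _ _ _ _ _ _ _ _ _ _ _ _).
- by move=> x y h1 h2; apply: pos_inj; apply: complex_eta.
- by move=> x y; rewrite !mem_neighbours adj_sym.
- by move=> x; rewrite mem_neighbours adj_irr.
- by move=> x; have [y xy] := neighbour_exists x; exists y; rewrite mem_neighbours.
- by move=> x y; rewrite mem_neighbours; exact: theta_itv.
- by move=> x y; rewrite mem_neighbours; exact: theta_sym.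
- by move=> x y; rewrite mem_neighbours; exact: edge_length_theta.
- by move=> x phi; exact: (dual_sum x (fun c => phi (Re c) (Im c))).
- by move=> x y z; rewrite mem_neighbours; exact: delaunay.
- exact: angle_sum.
- move=> x a b D' ab D1; have [w xw h] := exists_neighbour_towards x ab D1.
  by exists w; rewrite ?mem_neighbours.
- move=> x z xz; have [w xw h] := exists_closer_neighbour xz.
  by exists w; rewrite ?mem_neighbours.
- by move=> a b r; exact: fset_uniq.
- by move=> a b r v; rewrite mem_vball.
split => //= x y; exact: mem_neighbours.
Qed.

End IsoradialGeometry.

(** * Logarithmic potential and Green functions *)

Lemma sin_incr (R : realType) (e t : R) : 0 < e -> e < t -> t < pi / 2 -> sin e <= sin t.
Proof.
move=> e0 et tp; have pp := @pi_gt0 R.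
have h1 : 0 < cos e by apply: cos_gt0_pihalf; apply/andP; lra.
have h2 : 0 < cos t by apply: cos_gt0_pihalf; apply/andP; lra.
have h3 : 0 < sin e by apply: sin_gt0_pi; apply/andP; lra.
have h4 : 0 < sin t by apply: sin_gt0_pi; apply/andP; lra.
have h5 : 0 < sin t * cos e - cos t * sin e.
  by rewrite -sinB; apply: sin_gt0_pi; apply/andP; lra.
have h6 := cos2Dsin2 e; have h7 := cos2Dsin2 t.
move: (sin t) (cos t) (sin e) (cos e) h1 h2 h3 h4 h5 h6 h7 => a b c d; clear=> h1 h2 h3 h4 h5 h6 h7.
rewrite leNgt; apply/negP => ac.
have db : d < b by rewrite ltNge; apply/negP => bd; nra.
nra.
Qed.

(** * Metric estimates: ellipticity, separation, covering and counting of vertices *)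

Section RhombicLattice.
Variables (R : realType) (V : choiceType) (G : rhombic_graph R V).
Local Notation gx := (gx G).
Local Notation gy := (gy G).
Local Notation nb := (nb G).
Local Notation th := (th G).
Local Notation gd2 := (gd2 G).
Local Notation dualx := (dualx G).
Local Notation dualy := (dualy G).
Local Notation gball := (gball G).
Implicit Types x y z w : V.

(** The ellipticity constant, a lower bound for the sines and cosines of all half-angles; the
    geometric constants below are powers of it. *)
Definition gs : R := sin (geta G).
Local Notation s0 := gs.
Definition cond x y : R := tan (th x y).
Definition dist x y : R := Num.sqrt (gd2 x y).

Lemma gs_itv : 0 < s0 < 1.
Proof.
move: (geta_itv G) => /andP[e0 e1]; have pp := @pi_gt0 R.
have h1 : 0 < s0 by apply: sin_gt0_pi; apply/andP; lra.
rewrite h1/=; have : 0 < cos (geta G) by apply: cos_gt0_pihalf; apply/andP; lra.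
have := cos2Dsin2 (geta G); rewrite -/s0; nra.
Qed.

Lemma gs_gt0 : 0 < s0. Proof. by case/andP: gs_itv. Qed.
Lemma gs_lt1 : s0 < 1. Proof. by case/andP: gs_itv. Qed.

Lemma sin_th x y : y \in nb x -> s0 <= sin (th x y).
Proof.
move=> /th_itv/andP[h1 h2]; move: (geta_itv G) => /andP[e0 e1].
by apply: sin_incr => //; lra.
Qed.

Lemma cos_th x y : y \in nb x -> s0 <= cos (th x y).
Proof.
move=> /th_itv/andP[h1 h2]; move: (geta_itv G) => /andP[e0 e1].
have -> : cos (th x y) = sin (pi / 2 - th x y).
  by rewrite sinB sin_pihalf cos_pihalf; ring.
by apply: sin_incr => //; lra.
Qed.

Lemma cond_bounds x y : y \in nb x -> s0 <= cond x y <= s0^-1.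
Proof.
move=> xy; have s := sin_th xy; have c := cos_th xy; have g0 := gs_gt0.
have c0 : 0 < cos (th x y) by apply: lt_le_trans c.
have cs := cos2Dsin2 (th x y).
rewrite /cond /tan; apply/andP; split.
  by rewrite ler_pdivlMr//; nra.
by rewrite ler_pdivrMr// mulrC ler_pdivlMr//; nra.
Qed.

Lemma cond_gt0 x y : y \in nb x -> 0 < cond x y.
Proof. by move=> /cond_bounds/andP[h _]; apply: lt_le_trans h; exact: gs_gt0. Qed.

Lemma cond_sym x y : y \in nb x -> cond y x = cond x y.
Proof. by rewrite /cond => /th_symm ->. Qed.

Lemma gd2_ge0 x y : 0 <= gd2 x y.
Proof. by rewrite addr_ge0 ?sqr_ge0. Qed.

Lemma gd2_sym x y : gd2 x y = gd2 y x.
Proof. by rewrite /gd2; ring. Qed.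

Lemma edge_d2 x y : y \in nb x -> 4 * s0 ^+ 2 <= gd2 x y <= 4.
Proof.
move=> xy; rewrite nb_length//; have c := cos_th xy; have g0 := gs_gt0.
have cs := cos2Dsin2 (th x y); have := sqr_ge0 (sin (th x y)).
by move=> h; apply/andP; nra.
Qed.

Lemma gd2_eq0 x y : gd2 x y = 0 -> x = y.
Proof.
move/eqP; rewrite paddr_eq0 ?sqr_ge0// !sqrf_eq0 !subr_eq0.
by move=> /andP[/eqP h1 /eqP h2]; apply: (@gpos_inj _ _ G); exact: esym.
Qed.

Lemma dual_rel x y : y \in nb x ->
  [/\ dualx x y - gx x = (gx y - gx x) / 2 - cond x y / 2 * (gy y - gy x),
      dualy x y - gy x = (gy y - gy x) / 2 + cond x y / 2 * (gx y - gx x),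
      dualx y x - gx x = (gx y - gx x) / 2 + cond x y / 2 * (gy y - gy x) &
      dualy y x - gy x = (gy y - gy x) / 2 - cond x y / 2 * (gx y - gx x)].
Proof.
by move=> xy; rewrite /dualx /dualy (th_symm xy) -/(cond x y); split; field.
Qed.

Lemma dual_unit x y : y \in nb x ->
  (dualx x y - gx x) ^+ 2 + (dualy x y - gy x) ^+ 2 = 1 /\
  (dualx y x - gx x) ^+ 2 + (dualy y x - gy x) ^+ 2 = 1.
Proof.
move=> xy; have [-> -> -> ->] := dual_rel xy.
have c0 : cos (th x y) != 0.
  by rewrite gt_eqF// (lt_le_trans gs_gt0)// cos_th.
have E : gd2 x y * (1 + cond x y ^+ 2) = 4.
  rewrite nb_length// /cond /tan.
  transitivity (4 * (cos (th x y) ^+ 2 + sin (th x y) ^+ 2)); first by field.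
  by rewrite cos2Dsin2 mulr1.
by move: E; rewrite /gd2 => E; split; lra.
Qed.

Lemma dual_dot x y w : y \in nb x ->
  (dualx x y - gx x) * (gx w - gx x) + (dualy x y - gy x) * (gy w - gy x) <= gd2 x w / 2 /\
  (dualx y x - gx x) * (gx w - gx x) + (dualy y x - gy x) * (gy w - gy x) <= gd2 x w / 2.
Proof.
move=> xy; have yx : x \in nb y by rewrite nb_sym.
have [h1 h2] := dual_unit xy.
have := dual_delaunay w xy; have := dual_delaunay w yx.
by rewrite /gd2 => h3 h4; split; lra.
Qed.

(** [cond x y] times y - x is the dual edge of xy turned by a right angle, and the dual edges around
    x close up; the coordinates are therefore harmonic. *)
Lemma cond_sum_x x : \sum_(y <- nb x) cond x y * (gx y - gx x) = 0.
Proof.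
have := dual_telescope G x (fun _ b => b) => /eqP; rewrite -subr_eq0 -sumrB => /eqP E.
rewrite -[RHS]E; apply: eq_big_seq => y xy.
by have [_ h2 _ h4] := dual_rel xy; lra.
Qed.

Lemma cond_sum_y x : \sum_(y <- nb x) cond x y * (gy y - gy x) = 0.
Proof.
have := dual_telescope G x (fun a _ => a) => /eqP; rewrite -subr_eq0 -sumrB => /eqP E.
apply: oppr_inj; rewrite oppr0 -[RHS]E -sumrN; apply: eq_big_seq => y xy.
by have [h2 _ h4 _] := dual_rel xy; lra.
Qed.

Lemma dist_ge0 x y : 0 <= dist x y.
Proof. exact: sqrtr_ge0. Qed.

Lemma dist_sqr x y : dist x y ^+ 2 = gd2 x y.
Proof. by rewrite sqr_sqrtr// gd2_ge0. Qed.

Lemma dist_sym x y : dist x y = dist y x.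
Proof. by rewrite /dist gd2_sym. Qed.

Lemma distxx x : dist x x = 0.
Proof. by rewrite /dist /gd2 !subrr expr0n addr0 sqrtr0. Qed.

Lemma dist_gt0 x y : x != y -> 0 < dist x y.
Proof.
move=> xy; rewrite lt_def dist_ge0 andbT; apply: contra_neq xy => h.
by apply: gd2_eq0; rewrite -dist_sqr h expr0n.
Qed.

Lemma cauchy_schwarz2 (a b c d p q : R) : 0 <= p -> 0 <= q ->
  a ^+ 2 + b ^+ 2 <= p ^+ 2 -> c ^+ 2 + d ^+ 2 <= q ^+ 2 -> a * c + b * d <= p * q.
Proof.
move=> p0 q0 h1 h2.
have [h0|h0] := leP (a * c + b * d) 0; first by rewrite (le_trans h0)// mulr_ge0.
rewrite -(ler_pXn2r (n := 2)) ?nnegrE ?mulr_ge0 ?(ltW h0)//.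
apply: (@le_trans _ _ ((a ^+ 2 + b ^+ 2) * (c ^+ 2 + d ^+ 2))).
  by have := sqr_ge0 (a * d - b * c); clear; nra.
by rewrite exprMn ler_pM// addr_ge0 ?sqr_ge0.
Qed.

Lemma plane_triangle (a b c d p q : R) : 0 <= p -> 0 <= q ->
  a ^+ 2 + b ^+ 2 <= p ^+ 2 -> c ^+ 2 + d ^+ 2 <= q ^+ 2 ->
  (a + c) ^+ 2 + (b + d) ^+ 2 <= (p + q) ^+ 2.
Proof.
move=> p0 q0 h1 h2; have := cauchy_schwarz2 p0 q0 h1 h2.
by move: h1 h2; clear; nra.
Qed.

Lemma dist_triangle x y z : dist x z <= dist x y + dist y z.
Proof.
rewrite -(ler_pXn2r (n := 2)) ?nnegrE ?addr_ge0 ?dist_ge0// dist_sqr.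
have := @plane_triangle (gx y - gx x) (gy y - gy x) (gx z - gx y) (gy z - gy y)
  _ _ (dist_ge0 x y) (dist_ge0 y z).
rewrite !dist_sqr => /(_ (lexx _) (lexx _)).
by congr (_ <= _); rewrite /gd2; ring.
Qed.

Lemma edge_dist x y : y \in nb x -> 2 * s0 <= dist x y <= 2.
Proof.
move=> /edge_d2; rewrite -dist_sqr => /andP[h1 h2].
have := dist_ge0 x y; have := gs_gt0 => g0 d0.
by apply/andP; split; nra.
Qed.

Lemma nb_direction x a b : a ^+ 2 + b ^+ 2 = 1 -> exists2 w, w \in nb x &
  gd2 x w / 2 <= 2 * (a * (gx w - gx x) + b * (gy w - gy x)).
Proof.
move=> ab; have [|w xw /ltW hw] := @nb_towards _ _ G x _ _ 2 ab; last by exists w.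
lra.
Qed.

(** Relative to x, the two centres of xw add up to w - x, so the two Delaunay conditions at z bound
    the inner product of w - x and z - x by the squared distance of x and z. Apply this to a
    neighbour w roughly in the direction of z, whose length is bounded below. *)
Lemma separated x z : x != z -> s0 ^+ 2 <= dist x z.
Proof.
move=> xz; have D0 := dist_gt0 xz; set D := dist x z in D0 *.
have [|w xw hw] := @nb_direction x ((gx z - gx x) / D) ((gy z - gy x) / D).
  rewrite !expr_div_n -mulrDl -/(gd2 x z) -dist_sqr divff//.
  by rewrite expf_neq0// gt_eqF.
have [r1 r2] := dual_dot z xw; have [a b c d] := dual_rel xw.
move: r1 r2; rewrite a b c d -dist_sqr -/D => r1 r2.
have : (gx w - gx x) * (gx z - gx x) + (gy w - gy x) * (gy z - gy x) <= D ^+ 2.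
  by move: r1 r2; clear; lra.
move: (edge_d2 xw) hw => /andP[h1 _].
rewrite mulrAC [X in _ + X]mulrAC -mulrDl mulrA ler_pdivlMr// => h2 h3.
have h4 : gd2 x w / 2 * D <= 2 * D ^+ 2 by lra.
have h5 : 2 * s0 ^+ 2 <= gd2 x w / 2 by lra.
have h6 : gd2 x w / 2 <= 2 * D by rewrite -(ler_pM2r D0); move: h4; clear; lra.
lra.
Qed.

Lemma nb_closer (a b : R) x (D : R) : 1 < D ->
  (a - gx x) ^+ 2 + (b - gy x) ^+ 2 = D ^+ 2 -> exists2 w, w \in nb x &
  (a - gx w) ^+ 2 + (b - gy w) ^+ 2 <= D ^+ 2 - (D - 1) / 2 * gd2 x w.
Proof.
move=> D1 E; have D0 : 0 < D by lra.
(* With this value the neighbour inequality says that twice the inner product of w - x with the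
   vector to the target exceeds (D + 1) / 2 times [gd2 x w], leaving a gain of (D - 1) / 2 times
   [gd2 x w]. *)
pose D' := 2 * D / (D + 1).
have D1' : 1 < D' by rewrite ltr_pdivlMr; lra.
have [||w xw hw] := @nb_towards _ _ G x ((a - gx x) / D) ((b - gy x) / D) D'.
- rewrite !expr_div_n -mulrDl E divff//.
  by rewrite expf_neq0// gt_eqF.
- by [].
exists w => //; move: hw.
have -> : D' * ((a - gx x) / D * (gx w - gx x) + (b - gy x) / D * (gy w - gy x)) =
  2 * ((a - gx x) * (gx w - gx x) + (b - gy x) * (gy w - gy x)) / (D + 1).
  by rewrite /D'; field; rewrite !gt_eqF//; lra.
rewrite ltr_pdivlMr; last lra.
by rewrite -E /gd2; move: D D0 {E D1 D' D1'} => D D0; clear; lra.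
Qed.

(** A vertex nearest to (a, b) is within distance 1, as otherwise [nb_closer] would provide a nearer
    one. *)
Lemma covering (a b : R) : inhabited V -> exists x, (gx x - a) ^+ 2 + (gy x - b) ^+ 2 <= 1.
Proof.
move=> [v]; pose f x := - ((gx x - a) ^+ 2 + (gy x - b) ^+ 2).
pose r := 1 + ((gx v - a) ^+ 2 + (gy v - b) ^+ 2).
have vB : v \in gball a b r.
  rewrite mem_gball /r; set t := _ + _.
  have : 0 <= t by rewrite addr_ge0 ?sqr_ge0.
  by clear; nra.
have [m mB hm] := @exists_argmax R _ _ f v vB.
have hm' y : (gx m - a) ^+ 2 + (gy m - b) ^+ 2 <= (gx y - a) ^+ 2 + (gy y - b) ^+ 2.
  have [yB|yB] := boolP (y \in gball a b r).
    by have := hm _ yB; rewrite /f; clear; lra.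
  move: yB; rewrite mem_gball -ltNge => yB; apply: (le_trans _ (ltW yB)).
  by rewrite -mem_gball.
exists m; rewrite leNgt; apply/negP => h.
pose D := Num.sqrt ((a - gx m) ^+ 2 + (b - gy m) ^+ 2).
have D2 : D ^+ 2 = (a - gx m) ^+ 2 + (b - gy m) ^+ 2.
  by rewrite sqr_sqrtr// addr_ge0 ?sqr_ge0.
have D1 : 1 < D.
  have : 1 < D ^+ 2 by rewrite D2; move: h; clear; lra.
  have : 0 <= D by apply: sqrtr_ge0.
  by clear; nra.
have [|w mw hw] := @nb_closer a b m D D1; first by rewrite D2.
have := hm' w.
have : 0 < (D - 1) / 2 * gd2 m w.
  rewrite mulr_gt0 ?divr_gt0 ?subr_gt0//; case/andP: (edge_d2 mw) => h1 _.
  by apply: lt_le_trans h1; rewrite mulr_gt0// exprn_gt0// gs_gt0.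
by move: hw; rewrite D2; clear; lra.
Qed.

(** By [separated], a square cell of side [s0 ^+ 2 / 2] holds at most one vertex. *)
Lemma gball_count_le : exists2 C : R, 0 < C & forall a b r, 0 <= r ->
  (size (gball a b r))%:R <= C * (1 + r) ^+ 2.
Proof.
pose e := s0 ^+ 2 / 2.
have e0 : 0 < e by rewrite divr_gt0// exprn_gt0// gs_gt0.
exists ((2 / e + 1) ^+ 2); first by rewrite exprn_gt0// addr_gt0// divr_gt0.
move=> a b r r0.
pose cell (x : R) := Num.trunc ((x + r) / e).
pose K := Num.trunc (2 * r / e).
have cellP (x : R) : - r <= x -> (cell x)%:R * e <= x + r < ((cell x)%:R + 1) * e.
  move=> xr; have : 0 <= (x + r) / e by apply: divr_ge0; [lra|exact: ltW].
  by move=> /truncn_itv; rewrite -/(cell x) ler_pdivlMr// ltr_pdivrMr// -natr1.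
pose f v := (cell (gx v - a), cell (gy v - b)).
have bnd v : v \in gball a b r -> (- r <= gx v - a <= r) /\ (- r <= gy v - b <= r).
  rewrite mem_gball => h; split; rewrite -ler_norml -(ler_pXn2r (n := 2)) ?nnegrE ?normr_ge0//
    real_normK ?num_real//; apply: le_trans h; rewrite ?lerDl ?lerDr sqr_ge0//.
have inj : {in gball a b r &, injective f}.
  move=> v w /bnd[/andP[v1 _] /andP[v2 _]] /bnd[/andP[w1 _] /andP[w2 _]] [E1 E2].
  apply/eqP; apply/negPn/negP => /separated; apply/negP; rewrite -ltNge.
  have := cellP _ v1; have := cellP _ v2; have := cellP _ w1; have := cellP _ w2.
  rewrite E1 E2 => /andP[a1 a2] /andP[a3 a4] /andP[a5 a6] /andP[a7 a8].
  suff : gd2 v w < (2 * e) ^+ 2.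
    rewrite (_ : s0 ^+ 2 = 2 * e); last by rewrite /e mulrC divfK.
    by rewrite -dist_sqr; have := dist_ge0 v w; move: (dist v w) e0; clear; move=> *; nra.
  rewrite /gd2.
  move: a1 a2 a3 a4 a5 a6 a7 a8.
  move: ((cell (gx w - a))%:R : R) ((cell (gy w - b))%:R : R) => c1 c2.
  move: (gx v) (gx w) (gy v) (gy w) => p1 p2 q1 q2; clear -e0; move=> *.
  have h1 : (p2 - p1) ^+ 2 <= e ^+ 2 by nra.
  have h2 : (q2 - q1) ^+ 2 <= e ^+ 2 by nra.
  nra.
have sub : {subset [seq f v | v <- gball a b r] <=
    [seq (i, j) | i <- iota 0 K.+1, j <- iota 0 K.+1]}.
  move=> pq /mapP[vv vB ->]; have [/andP[k1 k2] /andP[k3 k4]] := bnd _ vB.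
  apply/allpairsP; exists (f vv); split => //; rewrite mem_iota add0n ltnS;
  by apply: le_truncn; rewrite ler_pM2r ?invr_gt0//; lra.
have u : uniq [seq f v | v <- gball a b r] by rewrite (map_inj_in_uniq inj); exact: gball_uniq.
have := uniq_leq_size u sub; rewrite size_map size_allpairs !size_iota => h.
apply: (@le_trans _ _ ((K.+1 * K.+1)%:R)); first by rewrite ler_nat.
rewrite natrM -expr2 -exprMn lerXn2r ?nnegrE ?ler0n//.
  have e2 : 0 <= 2 / e by rewrite ltW// divr_gt0.
  by apply: mulr_ge0; lra.
have hK : K%:R <= 2 * r / e by rewrite truncn_le; apply: divr_ge0; [lra|exact: ltW].
rewrite -natr1.
have : 0 <= 2 / e by rewrite divr_ge0 ?ltW.
have -> : (2 / e + 1) * (1 + r) = 2 * r / e + 1 + (2 / e + r) by ring.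
lra.
Qed.

(** Points of a grid of mesh 3 have distinct vertices within distance 1, by [covering]. *)
Lemma gball_count_ge a b r : inhabited V -> 12 <= r ->
  (r / 12) ^+ 2 <= (size (gball a b r))%:R.
Proof.
move=> iV r12; pose m := Num.trunc (r / 6).
have : 0 <= r / 6 by lra.
move=> /truncn_itv.
rewrite -/m -[m.+1%:R]natr1 => /andP[m1 m2].
have /choice[f hf] : forall ij : nat * nat, exists x,
    (gx x - (a + 3 * ij.1%:R)) ^+ 2 + (gy x - (b + 3 * ij.2%:R)) ^+ 2 <= 1.
  by move=> ij; exact: covering.
pose S := [seq (i, j) | i <- iota 0 m, j <- iota 0 m].
have near (i j : nat) (c p : R) : (p - (c + 3 * i%:R)) ^+ 2 <= 1 ->
    (p - (c + 3 * j%:R)) ^+ 2 <= 1 -> i = j.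
  have sq (t : R) : t ^+ 2 <= 1 -> -1 <= t <= 1.
    by clear=> h; apply/andP; split; nra.
  move=> /sq/andP[h1 h2] /sq/andP[h3 h4].
  have [ij|ij|//] := ltngtP i j; exfalso;
    by move: ij; rewrite -(ler_nat R) -natr1 => ij; lra.
have finj : injective f.
  move=> [i j] [k l] E; have := hf (i, j); have := hf (k, l); rewrite -E /=.
  set p := gx _; set q := gy _ => h1 h2.
  have := near i k a p; have := near j l b q.
  have s1 := sqr_ge0 (p - (a + 3 * k%:R)); have s2 := sqr_ge0 (q - (b + 3 * l%:R)).
  have s3 := sqr_ge0 (p - (a + 3 * i%:R)); have s4 := sqr_ge0 (q - (b + 3 * j%:R)).
  by move=> -> //; [move=> -> //; lra|lra|lra].
have uS : uniq S.
  by apply: allpairs_uniq; rewrite ?iota_uniq// => -[? ?] [? ?] _ _ [-> ->].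
have uf : uniq [seq f v | v <- S] by rewrite map_inj_uniq.
have sub : {subset [seq f v | v <- S] <= gball a b r}.
  move=> _ /mapP[ij ijS ->]; rewrite mem_gball.
  move: ijS => /allpairsP[[i j] /= [iS jS ->]].
  move: iS jS; rewrite !mem_iota/= !add0n -!(ltr_nat R) => im jm.
  have := hf (i, j) => /=.
  set p := gx _; set q := gy _ => h1.
  have i0 : 0 <= i%:R :> R by [].
  have j0 : 0 <= j%:R :> R by [].
  have h2 := @plane_triangle (p - (a + 3 * i%:R)) (q - (b + 3 * j%:R)) (3 * i%:R) (3 * j%:R) 1 (r - 1).
  have -> : p - a = p - (a + 3 * i%:R) + 3 * i%:R by ring.
  have -> : q - b = q - (b + 3 * j%:R) + 3 * j%:R by ring.
  have -> : r ^+ 2 = (1 + (r - 1)) ^+ 2 by ring.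
  apply: h2 => //; first lra.
    by rewrite expr1n.
  have h3 : 3 * i%:R <= r / 2 by lra.
  have h4 : 3 * j%:R <= r / 2 by lra.
  have h5 : (3 * i%:R) ^+ 2 <= (r / 2) ^+ 2 by rewrite lerXn2r ?nnegrE//; lra.
  have h6 : (3 * j%:R) ^+ 2 <= (r / 2) ^+ 2 by rewrite lerXn2r ?nnegrE//; lra.
  have h7 : (r / 2) ^+ 2 + (r / 2) ^+ 2 <= (r - 1) ^+ 2 by move: r12; clear; nra.
  by move: h5 h6 h7; clear; lra.
have := uniq_leq_size uf sub; rewrite size_map size_allpairs !size_iota => h.
apply: (@le_trans _ _ ((m * m)%:R)); last by rewrite ler_nat.
rewrite natrM -expr2 lerXn2r ?nnegrE//; lra.
Qed.

End RhombicLattice.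

Lemma oang_scale (R : realType) (r a b : R) : 0 < r -> oang (r * a) (r * b) = oang a b.
Proof.
move=> r0; rewrite /oang sgrM gtr0_sg// mul1r !exprMn -mulrDr sqrtrM ?sqr_ge0//.
by rewrite sqrtr_sqr gtr0_norm// -mulf_div divff ?gt_eqF// mul1r.
Qed.

(** * The logarithm and its approximate discrete conjugate *)

Section LogPotential.
Variables (R : realType) (V : choiceType) (G : rhombic_graph R V).
Local Notation gx := (gx G).
Local Notation gy := (gy G).
Local Notation nb := (nb G).
Local Notation th := (th G).
Local Notation gd2 := (gd2 G).
Local Notation dualx := (dualx G).
Local Notation dualy := (dualy G).
Local Notation gball := (gball G).
Local Notation s0 := (gs G).
Local Notation cond := (cond G).
Local Notation dist := (dist G).
Implicit Types (x y z w : V) (f g : V -> R).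

Definition lap f y : R := \sum_(w <- nb y) cond y w * (f w - f y).

Lemma count_le : exists2 C : R, 0 < C & forall x r (s : seq V), 0 <= r -> uniq s ->
  (forall y, y \in s -> dist x y <= r) -> (size s)%:R <= C * (1 + r) ^+ 2.
Proof.
have [C C0 hC] := gball_count_le G; exists C => // x r s r0 us hs.
apply: le_trans (hC (gx x) (gy x) r r0); rewrite ler_nat.
apply: uniq_leq_size => // y /hs h; rewrite mem_gball.
rewrite -[_ + _]/(gd2 x y) -dist_sqr lerXn2r ?nnegrE//; exact: dist_ge0.
Qed.

Lemma degree_le : exists2 C : R, 0 < C & forall y, (size (nb y))%:R <= C.
Proof.
have [C C0 hC] := count_le; exists (C * (1 + 2) ^+ 2).
  by rewrite mulr_gt0// exprn_gt0.
move=> y; apply: (hC y) => //; first exact: nb_uniq.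
by move=> w /edge_dist/andP[].
Qed.

Lemma sum_le_size (s : seq V) f (M : R) : (forall y, y \in s -> f y <= M) ->
  \sum_(y <- s) f y <= (size s)%:R * M.
Proof.
elim: s => [|a s IH] h; first by rewrite big_nil mul0r.
rewrite big_cons /= -natr1 mulrDl mul1r addrC lerD//.
  by apply: IH => y ys; apply: h; rewrite inE ys orbT.
by apply: h; rewrite inE eqxx.
Qed.

Lemma sum_norm_le (s : seq V) f (M : R) : (forall y, y \in s -> `|f y| <= M) ->
  `|\sum_(y <- s) f y| <= (size s)%:R * M.
Proof. by move=> h; apply: (le_trans (ler_norm_sum _ _ _)); apply: sum_le_size. Qed.

(** Dyadic shells: the one between K and 2 K has at most 9 C K^2 vertices, each contributing at most
    K^-3, and the rest is the same sum for 2 K. *)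
Lemma tail_sum : exists2 C : R, 0 < C & forall x K (s : seq V), 1 <= K -> uniq s ->
  (forall y, y \in s -> K < dist x y) -> \sum_(y <- s) dist x y ^- 3 <= C / K.
Proof.
have [C C0 hC] := count_le; exists (18 * C) => [|x]; first by rewrite mulr_gt0.
suff main n : forall K (s : seq V), 1 <= K -> uniq s ->
    (forall y, y \in s -> K < dist x y /\ dist x y <= 2 ^+ n * K) ->
    \sum_(y <- s) dist x y ^- 3 <= 18 * C / K.
  move=> K s K1 us hs.
  have [n hn] : exists n, forall y, y \in s -> dist x y <= 2 ^+ n * K.
    elim: s {us} hs => [|a s IH] hs; first by exists 0%N => y; rewrite in_nil.
    have [|n hn] := IH; first by move=> y ys; apply: hs; rewrite inE ys orbT.
    pose m := Num.trunc (dist x a).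
    have hm : dist x a <= 2 ^+ m.+1.
      have := truncn_itv (dist_ge0 G x a) => /andP[_ h]; apply: (le_trans (ltW h)).
      by rewrite -natrX ler_nat -/m; apply: ltnW; exact: ltn_expl.
    exists (n + m.+1)%N => y; rewrite inE => /orP[/eqP ->|/hn h].
      apply: (le_trans hm); apply: (@le_trans _ _ (2 ^+ (n + m.+1))).
        by rewrite ler_weXn2l ?leq_addl// ler1n.
      by rewrite ler_peMr// exprn_ge0.
    apply: (le_trans h); rewrite ler_wpM2r//; first by apply: le_trans K1.
    by rewrite ler_weXn2l ?leq_addr// ler1n.
  by apply: (main n) => // y ys; split; [exact: hs|exact: hn].
elim: n => [|n IH] K s K1 us hs.
  rewrite big_seq big_pred0 ?divr_ge0 ?mulr_ge0 ?(ltW C0)//; first by apply: le_trans K1.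
  move=> y; apply/negP => /hs[h1 h2]; move: h1; rewrite ltNge (le_trans h2)//.
  by rewrite expr0 mul1r.
have K0 : 0 < K by apply: lt_le_trans K1.
rewrite (bigID (fun y => dist x y <= 2 * K))/= -[X in X + _]big_filter -[X in _ + X]big_filter.
have n1 : \sum_(y <- [seq y <- s | dist x y <= 2 * K]) dist x y ^- 3 <= 9 * C / K.
  set s' := [seq y <- s | _].
  have hs' y : y \in s' -> dist x y ^- 3 <= K ^- 3.
    rewrite mem_filter => /andP[_ /hs[h _]].
    rewrite lef_pV2 ?posrE ?exprn_gt0//; last exact: lt_trans h.
    by rewrite lerXn2r ?nnegrE ?ltW//; apply: lt_trans h.
  apply: (le_trans (sum_le_size hs')).
  have h1 : (size s')%:R <= C * (1 + 2 * K) ^+ 2.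
    apply: (hC x); first by rewrite mulr_ge0// ltW.
      by rewrite filter_uniq.
    by move=> y; rewrite mem_filter => /andP[].
  have h2 : C * (1 + 2 * K) ^+ 2 <= 9 * C * K ^+ 2.
    have : (1 + 2 * K) ^+ 2 <= 9 * K ^+ 2 by move: K1; clear; nra.
    by move: C0; clear; nra.
  have -> : 9 * C / K = 9 * C * K ^+ 2 * K ^- 3 by field; rewrite gt_eqF.
  apply: ler_wpM2r; first by rewrite invr_ge0 exprn_ge0 ?ltW.
  exact: le_trans h2.
have n2 : \sum_(y <- [seq y <- s | ~~ (dist x y <= 2 * K)]) dist x y ^- 3 <= 18 * C / (2 * K).
  apply: IH; [lra|by rewrite filter_uniq|].
  move=> y; rewrite mem_filter -ltNge => /andP[h1 /hs[_ h2]]; split => //.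
  by rewrite mulrA -exprSr.
have -> : 18 * C / K = 9 * C / K + 18 * C / (2 * K) by field; rewrite gt_eqF.
exact: lerD.
Qed.

(** The logarithmic potential with pole x; as [ln 0 = 0], its value at the pole is 0. *)
Definition flog x y : R := ln (gd2 x y) / 2.

Lemma flogxx x : flog x x = 0.
Proof. by rewrite /flog /gd2 !subrr expr0n addr0 ln0// mul0r. Qed.

Lemma flogE x y : x != y -> flog x y = ln (dist x y).
Proof.
by move=> xy; rewrite /flog -dist_sqr lnXn ?dist_gt0// mulr2n; field.
Qed.

(* The increment of the argument of c - x when the dual vertex c moves along the
   dual edge of yw; it is the discrete conjugate of the increment of log. *)
Definition dual_angle x y w : R :=
  oang ((dualx w y - gx x) * (dualx y w - gx x) + (dualy w y - gy x) * (dualy y w - gy x))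
       ((dualx w y - gx x) * (dualy y w - gy x) - (dualy w y - gy x) * (dualx y w - gx x)).

Lemma dual_angle_antisym x y w : dual_angle x w y = - dual_angle x y w.
Proof. by rewrite /dual_angle -oangN; congr oang; ring. Qed.

Lemma dual_angle_self x w : w \in nb x -> dual_angle x x w = 2 * th x w.
Proof.
move=> xw; have [a b c d] := dual_rel xw.
rewrite /dual_angle a b c d.
have c0 : cos (th x w) != 0 by rewrite gt_eqF// (lt_le_trans (gs_gt0 G))// cos_th.
have L := nb_length xw; have cs := cos2Dsin2 (th x w).
have tc : cond x w * cos (th x w) = sin (th x w) by rewrite /cond /tan divfK.
move: (th_itv xw) (geta_itv G) => /andP[t1 t2] /andP[e1 e2].
have E2 : 2 * th x w = th x w + th x w by ring.
apply: (@oang_uniq _ _ _ 1) => //; first by apply/andP; lra.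
  rewrite mul1r E2 cosD -tc.
  transitivity (gd2 x w / 4 * (1 - cond x w ^+ 2)); first by rewrite /gd2; field.
  by rewrite L; field.
rewrite mul1r E2 sinD -tc.
transitivity (gd2 x w / 2 * cond x w); first by rewrite /gd2; field.
by rewrite L; field.
Qed.

Lemma dual_angle_sum_self x : \sum_(w <- nb x) dual_angle x x w = 2 * pi.
Proof.
rewrite -(angle_total G x); apply: eq_big_seq => w xw; exact: dual_angle_self.
Qed.

(** By the Delaunay condition at x, all centres around y lie in the open half-plane of directions
    from x at an acute angle with y - x. There the argument is single-valued, and its increments
    telescope. *)
Lemma dual_angle_sum x y : x != y -> \sum_(w <- nb y) dual_angle x y w = 0.
Proof.
move=> xy.
pose a := gx y - gx x; pose b := gy y - gy x.
have M0 : 0 < a ^+ 2 + b ^+ 2.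
  by rewrite -[_ + _]/(gd2 x y) -dist_sqr exprn_gt0// dist_gt0.
pose A (p q : R) := oang (a * (p - gx x) + b * (q - gy x)) (a * (q - gy x) - b * (p - gx x)).
have main w : w \in nb y -> dual_angle x y w = A (dualx y w) (dualy y w) - A (dualx w y) (dualy w y).
  move=> yw; have [r1 r2] := dual_dot x yw.
  rewrite /A oang_sub_half.
  - rewrite /dual_angle -(oang_scale _ _ M0); congr oang; ring.
  - by move: r2 M0; rewrite /a /b /gd2; clear; lra.
  - by move: r1 M0; rewrite /a /b /gd2; clear; lra.
rewrite (eq_big_seq (fun w => A (dualx y w) (dualy y w) - A (dualx w y) (dualy w y))).
  by rewrite sumrB (dual_telescope G y A) subrr.
by move=> w yw; exact: main.
Qed.

(** The defect in the discrete Cauchy-Riemann equation on the edge yw. Being antisymmetric in the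
    edge, it contributes only boundary terms to sums of the Laplacian over finite sets. *)
Definition psi x y w : R := cond y w * (flog x w - flog x y) - dual_angle x y w.

Lemma psi_antisym x y w : w \in nb y -> psi x w y = - psi x y w.
Proof.
move=> yw; rewrite /psi dual_angle_antisym (cond_sym yw); ring.
Qed.

Lemma lap_flog x y : lap (flog x) y =
  \sum_(w <- nb y) psi x y w + (if x == y then 2 * pi else 0).
Proof.
rewrite /psi sumrB; case: eqVneq => [->|xy].
  by rewrite dual_angle_sum_self subrK.
by rewrite dual_angle_sum// subr0 addr0.
Qed.

(** In terms of the midpoint of yw, the increment of the logarithm is the inverse hyperbolic tangent
    of [tau], and the dual angle is the arctangent of [T]. Both functions are odd, so their
    corrections are cubic; [t * tau - T] is cubic as well, because the two denominators differ by
    [a + t ^+ 2 * a = 1]. *)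
Lemma psi_bound : exists C : R, 0 < C /\ forall x y w, w \in nb y -> 8 <= dist x y ->
  `|psi x y w| <= C * dist x y ^- 3.
Proof.
pose t0 := s0^-1.
have g0 := gs_gt0 G.
have t00 : 0 < t0 by rewrite invr_gt0.
exists (8 * (4 * t0 + 16 * t0 + 64 * t0 ^+ 3)); split.
  by rewrite mulr_gt0// addr_gt0 ?mulr_gt0 ?exprn_gt0// addr_gt0// mulr_gt0.
move=> x y w yw D8; set D := dist x y in D8 *.
have D0 : 0 < D by lra.
have /andP[t1 t2] := cond_bounds yw.
have tp := cond_gt0 yw.
pose m1 := (gx y + gx w) / 2 - gx x; pose m2 := (gy y + gy w) / 2 - gy x.
pose a1 := (gx w - gx y) / 2; pose a2 := (gy w - gy y) / 2.
pose M := m1 ^+ 2 + m2 ^+ 2; pose a := a1 ^+ 2 + a2 ^+ 2.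
pose N := Num.sqrt M.
have M0 : 0 <= M by rewrite addr_ge0 ?sqr_ge0.
have N2 : N ^+ 2 = M by rewrite sqr_sqrtr.
have N0 : 0 <= N by apply: sqrtr_ge0.
have aE : a = cos (th y w) ^+ 2.
  transitivity (gd2 y w / 4); first by rewrite /a /a1 /a2 /gd2; field.
  by rewrite nb_length//; field.
have tc : cond y w * cos (th y w) = sin (th y w).
  by rewrite /cond /tan divfK// gt_eqF// (lt_le_trans g0)// cos_th.
have cs := cos2Dsin2 (th y w).
set t := cond y w in t1 t2 tp tc *.
have ab : a + t ^+ 2 * a = 1 by rewrite aE -cs -tc; ring.
have a0 : 0 <= a by rewrite aE sqr_ge0.
have b0 : 0 <= t ^+ 2 * a by rewrite mulr_ge0 ?sqr_ge0.
have a1' : a <= 1 by lra.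
have ND : D <= N + 1.
  rewrite -(ler_pXn2r (n := 2)) ?nnegrE ?addr_ge0 ?(ltW D0)// dist_sqr.
  have := @plane_triangle _ m1 m2 (- a1) (- a2) N 1 N0 ler01.
  rewrite N2 expr1n !sqrrN => /(_ (lexx _) a1').
  by congr (_ <= _); rewrite /gd2 /m1 /m2 /a1 /a2; field.
have N7 : 7 <= N by lra.
have ND2 : D / 2 <= N by lra.
pose dt := a1 * m1 + a2 * m2.
have dtN : `|dt| <= N.
  have h (p q : R) : p ^+ 2 + q ^+ 2 <= 1 -> p * m1 + q * m2 <= N.
    move=> pq; rewrite -[leRHS]mul1r; apply: cauchy_schwarz2 => //; first by rewrite expr1n.
    by rewrite N2.
  rewrite ler_norml lerNl; apply/andP; split; last exact: h.
  by have := h (- a1) (- a2); rewrite !sqrrN => /(_ a1'); rewrite /dt; clear; lra.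
have Np : 0 < N by lra.
have Mp : 49 <= M by rewrite -N2; move: N7; clear; nra.
pose tau := 2 * dt / (M + a).
have Ma : 0 < M + a by lra.
have tauN : `|tau| <= 2 / N.
  rewrite normrM normrM (ger0_norm (ltW (_ : 0 < (2 : R))))// normfV (gtr0_norm Ma).
  rewrite ler_pdivrMr// mulrAC ler_pdivlMr//.
  have : N * N = M by rewrite -expr2.
  move: dtN a0 Np; move: (`|dt|) => d; clear=> *; nra.
have tau2 : `|tau| <= 2^-1.
  apply: (le_trans tauN); rewrite ler_pdivrMr//; lra.
have xy : x != y by apply/eqP => h; move: D8; rewrite /D h distxx; lra.
have xw : x != w.
  apply/eqP => h; have /andP[_] := edge_dist yw; rewrite -h dist_sym -/D; lra.
have E1 : flog x w - flog x y = (ln (1 + tau) - ln (1 - tau)) / 2.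
  have gw : gd2 x w = (M + a) * (1 + tau).
    rewrite /tau mulrDr mulr1 [_ * (_ / _)]mulrC divfK ?gt_eqF//.
    by rewrite /gd2 /M /a /dt /m1 /m2 /a1 /a2; field.
  have gy' : gd2 x y = (M + a) * (1 - tau).
    rewrite /tau mulrBr mulr1 [_ * (_ / _)]mulrC divfK ?gt_eqF//.
    by rewrite /gd2 /M /a /dt /m1 /m2 /a1 /a2; field.
  move: tau2; rewrite ler_norml => /andP[q1 q2].
  rewrite /flog gw gy' !lnM ?posrE//; [|lra|lra].
  by clear; lra.
have h1 := lnratio_taylor tau2; rewrite -E1 in h1.
pose T := 2 * t * dt / (M - t ^+ 2 * a).
have Mb : 0 < M - t ^+ 2 * a by lra.
have E2 : dual_angle x y w = atan T.
  have [e1 e2 e3 e4] := dual_rel yw; rewrite -/t in e1 e2 e3 e4.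
  have c1 : dualx y w - gx x = m1 - t * a2 by rewrite /m1 /a2; move: e1; clear; lra.
  have c2 : dualy y w - gy x = m2 + t * a1 by rewrite /m2 /a1; move: e2; clear; lra.
  have c3 : dualx w y - gx x = m1 + t * a2 by rewrite /m1 /a2; move: e3; clear; lra.
  have c4 : dualy w y - gy x = m2 - t * a1 by rewrite /m2 /a1; move: e4; clear; lra.
  rewrite /dual_angle c1 c2 c3 c4.
  have -> : (m1 + t * a2) * (m1 - t * a2) + (m2 - t * a1) * (m2 + t * a1) = M - t ^+ 2 * a.
    by rewrite /M /a; ring.
  have -> : (m1 + t * a2) * (m2 + t * a1) - (m2 - t * a1) * (m1 - t * a2) = 2 * t * dt.
    by rewrite /dt; ring.
  by rewrite oang_atan.
have h2 := atan_taylor T; rewrite -E2 in h2.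
have N3 : N ^- 3 <= 8 * D ^- 3.
  have -> : 8 * D ^- 3 = (D / 2) ^- 3 by field; rewrite gt_eqF.
  rewrite lef_pV2 ?posrE ?exprn_gt0// ?divr_gt0//.
  by rewrite lerXn2r ?nnegrE// ltW// divr_gt0.
have TN : `|T| <= 4 * t / N.
  rewrite normrM normfV (gtr0_norm Mb) normrM (gtr0_norm (mulr_gt0 _ tp))//.
  rewrite ler_pdivrMr// [leRHS]mulrAC ler_pdivlMr//.
  have h : N * N = M by rewrite -expr2.
  have h' : 2 * N * N <= 4 * (M - t ^+ 2 * a) by rewrite -mulrA h; lra.
  apply: (@le_trans _ _ (t * (2 * N * N))); last first.
    have -> : 4 * t * (M - t ^+ 2 * a) = t * (4 * (M - t ^+ 2 * a)) by ring.
    by rewrite ler_wpM2l ?(ltW tp).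
  have : t * `|dt| <= t * N by rewrite ler_wpM2l// ltW.
  by move=> h5; have := ler_wpM2r N0 h5; clear; lra.
have k1 : `|t * tau - T| <= 4 * t * N ^- 3.
  have -> : t * tau - T = - (2 * t * dt * (a + t ^+ 2 * a)) / ((M + a) * (M - t ^+ 2 * a)).
    by rewrite /tau /T; field; rewrite !gt_eqF.
  rewrite ab mulr1 normrM normrN normfV (gtr0_norm (mulr_gt0 Ma Mb)).
  rewrite normrM (gtr0_norm (mulr_gt0 _ tp))//.
  rewrite ler_pdivrMr ?mulr_gt0//.
  have -> : 4 * t * N ^- 3 * ((M + a) * (M - t ^+ 2 * a)) =
    (2 * t) * (2 * (M + a) * (M - t ^+ 2 * a) * N ^- 3) by ring.
  apply: ler_wpM2l; first by rewrite mulr_ge0// ltW.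
  apply: (le_trans dtN); rewrite ler_pdivlMr ?exprn_gt0//.
  have -> : N * N ^+ 3 = M * M by rewrite -N2; ring.
  by move: Mp a0 b0 ab; move: (t ^+ 2 * a) => b; clear=> *; nra.
have -> : psi x y w = t * (flog x w - flog x y - tau) + (t * tau - T) - (dual_angle x y w - T).
  by rewrite /psi -/t; ring.
have n1 : `|t * (flog x w - flog x y - tau)| <= 16 * t * N ^- 3.
  rewrite normrM (gtr0_norm tp).
  have -> : 16 * t * N ^- 3 = t * (2 * (2 / N) ^+ 3) by field; rewrite gt_eqF.
  rewrite ler_wpM2l ?(ltW tp)//; apply: (le_trans h1).
  by rewrite ler_wpM2l// lerXn2r ?nnegrE ?divr_ge0.
have n2 : `|dual_angle x y w - T| <= 64 * t ^+ 3 * N ^- 3.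
  apply: (le_trans h2).
  have -> : 64 * t ^+ 3 * N ^- 3 = (4 * t / N) ^+ 3 by field; rewrite gt_eqF.
  by apply: lerXn2r; rewrite ?nnegrE// divr_ge0// mulr_ge0// ltW.
apply: (le_trans (ler_normB _ _)); apply: (le_trans (lerD (ler_normD _ _) (lexx _))).
have t3 : t ^+ 3 <= t0 ^+ 3 by apply: lerXn2r => //; rewrite nnegrE ltW.
have t2' : t <= t0 by [].
have n3 : 0 < N ^- 3 by rewrite invr_gt0 exprn_gt0.
apply: (@le_trans _ _ ((4 * t0 + 16 * t0 + 64 * t0 ^+ 3) * N ^- 3)); last first.
  rewrite -[leRHS]mulrA [leRHS]mulrCA; apply: ler_wpM2l => //.
  apply: addr_ge0; [apply: addr_ge0|]; (apply: mulr_ge0; [exact: ler0n|]).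
  - exact: ltW.
  - exact: ltW.
  - by apply: exprn_ge0; exact: ltW.
have w1 : 16 * t * N ^- 3 <= 16 * t0 * N ^- 3 by rewrite ler_wpM2r ?(ltW n3)//; lra.
have w2 : 4 * t * N ^- 3 <= 4 * t0 * N ^- 3 by rewrite ler_wpM2r ?(ltW n3)//; lra.
have w3 : 64 * t ^+ 3 * N ^- 3 <= 64 * t0 ^+ 3 * N ^- 3 by rewrite ler_wpM2r ?(ltW n3)//; lra.
move: k1 n1 n2 w1 w2 w3; clear; lra.
Qed.

End LogPotential.

(** * Maximum principle and existence of killed Green functions *)

Section Green.
Variables (R : realType) (V : choiceType) (G : rhombic_graph R V).
Local Notation gx := (gx G).
Local Notation gy := (gy G).
Local Notation nb := (nb G).
Local Notation gd2 := (gd2 G).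
Local Notation s0 := (gs G).
Local Notation cond := (cond G).
Local Notation dist := (dist G).
Local Notation lap := (lap G).
Local Notation flog := (flog G).
Local Notation psi := (psi G).
Implicit Types (x y z w : V) (f g u h : V -> R) (A B : seq V).

Lemma lap_flog_far : exists2 C : R, 0 < C & forall x y, 8 <= dist x y ->
  `|lap (flog x) y| <= C * dist x y ^- 3.
Proof.
have [C [C0 hC]] := psi_bound G; have [d d0 hd] := degree_le G.
exists (d * C); first by rewrite mulr_gt0.
move=> x y D8; rewrite lap_flog; case: eqVneq => [xy|xy].
  by move: D8; rewrite xy distxx; lra.
rewrite addr0; apply: (le_trans (sum_norm_le (M := C * dist x y ^- 3) _)).
  by move=> w yw; exact: hC.
by rewrite -mulrA ler_wpM2r// mulr_ge0 ?(ltW C0)// invr_ge0 exprn_ge0// dist_ge0.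
Qed.

Lemma flog_bound (K : R) : 0 <= K -> exists2 F : R, 0 <= F & forall x y, dist x y <= K ->
  `|flog x y| <= F.
Proof.
move=> K0; exists (`|ln (s0 ^+ 2)| + `|ln (K + 1)|); first by rewrite addr_ge0.
move=> x y; have [->|xy] := eqVneq x y; first by rewrite flogxx normr0 addr_ge0.
move=> dK; rewrite flogE//.
have g2 : 0 < s0 ^+ 2 by rewrite exprn_gt0// gs_gt0.
have d0 := dist_gt0 G xy; have sp := separated G xy.
have h1 : ln (s0 ^+ 2) <= ln (dist x y) by rewrite ler_ln ?posrE.
have h2 : ln (dist x y) <= ln (K + 1) by rewrite ler_ln ?posrE; lra.
rewrite ler_norml; apply/andP; split.
  have := ler_norm (- ln (s0 ^+ 2)); rewrite normrN.
  by have := normr_ge0 (ln (K + 1)); move: h1; clear; lra.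
have := ler_norm (ln (K + 1)); have := normr_ge0 (ln (s0 ^+ 2)).
by move: h2; clear; lra.
Qed.

Lemma lap_flog_near (K : R) : 0 <= K -> exists2 C : R, 0 <= C & forall x y, dist x y <= K ->
  `|lap (flog x) y| <= C.
Proof.
move=> K0; have [|F F0 hF] := @flog_bound (K + 2); first lra.
have [d d0 hd] := degree_le G; have g0 := gs_gt0 G.
have M0 : 0 <= s0^-1 * (F + F) by rewrite mulr_ge0 ?invr_ge0 ?addr_ge0 ?(ltW g0).
exists (d * (s0^-1 * (F + F))); first by rewrite mulr_ge0// ltW.
move=> x y xy; apply: (le_trans (sum_norm_le (M := s0^-1 * (F + F)) _)); last first.
  by rewrite ler_wpM2r.
move=> w yw; have /andP[c1 c2] := cond_bounds yw.
rewrite normrM (gtr0_norm (cond_gt0 yw)); apply: ler_pM => //; first exact: ltW (cond_gt0 yw).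
apply: (le_trans (ler_normB _ _)); apply: lerD; apply: hF; last lra.
apply: (le_trans (dist_triangle G x y w)); have /andP[_ h] := edge_dist yw; lra.
Qed.

Lemma nb_restrict A y (F : V -> R) : uniq A ->
  \sum_(w <- nb y | w \in A) F w = \sum_(w <- A | w \in nb y) F w.
Proof.
move=> uA; rewrite -big_filter -[RHS]big_filter; apply: perm_big; apply: uniq_perm.
- by rewrite filter_uniq// nb_uniq.
- by rewrite filter_uniq.
by move=> w; rewrite !mem_filter andbC.
Qed.

Lemma antisym_sum A (g : V -> V -> R) : uniq A ->
  (forall y w, w \in nb y -> g w y = - g y w) ->
  \sum_(y <- A) \sum_(w <- nb y | w \in A) g y w = 0.
Proof.
move=> uA ga.
under eq_bigr do rewrite (nb_restrict _ _ uA) big_mkcond.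
set S := (X in X = _).
suff : S = - S by move=> h; lra.
rewrite {1}/S exchange_big /= -sumrN; apply: eq_bigr => y _.
rewrite -sumrN; apply: eq_bigr => w _.
rewrite nb_sym; case: ifP => h; last by rewrite oppr0.
by rewrite ga// opprK.
Qed.

Lemma symmetric_sum A (g : V -> V -> R) : uniq A ->
  \sum_(y <- A) \sum_(w <- nb y | w \in A) g y w =
  \sum_(y <- A) \sum_(w <- nb y | w \in A) g w y.
Proof.
move=> uA.
under eq_bigr do rewrite (nb_restrict _ _ uA) big_mkcond.
under [RHS]eq_bigr do rewrite (nb_restrict _ _ uA) big_mkcond.
rewrite exchange_big /=; apply: eq_bigr => y _; apply: eq_bigr => w _.
by rewrite nb_sym.
Qed.

(** Antisymmetry of [psi] cancels the inner edges. For the boundary it is enough to count all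
    vertices of the ball: at most order K^2 of them, each with defects of order K^-3. *)
Lemma lap_flog_total : exists2 C : R, 0 < C & forall x K A, 16 <= K -> uniq A ->
  (forall y, (y \in A) = (dist x y <= K)) ->
  `|\sum_(y <- A) lap (flog x) y - 2 * pi| <= C / K.
Proof.
have [C [C0 hC]] := psi_bound G; have [d d0 hd] := degree_le G.
have [c c0 hc] := count_le G.
exists (c * 4 * (d * (C * 8))); first by rewrite !mulr_gt0.
move=> x K A K16 uA hA; have K0 : 0 < K by lra.
have xA : x \in A by rewrite hA distxx ltW.
have -> : \sum_(y <- A) lap (flog x) y =
    \sum_(y <- A) \sum_(w <- nb y | w \notin A) psi x y w + 2 * pi.
  under eq_bigr do rewrite lap_flog.
  rewrite big_split/=; congr (_ + _).
    under eq_bigr do rewrite (bigID (mem A))/=.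
    by rewrite big_split/= (antisym_sum uA) ?add0r// => y w; exact: psi_antisym.
  rewrite (bigD1_seq x)//= eqxx big1 ?addr0// => y yx.
  by rewrite eq_sym (negbTE yx).
rewrite addrK.
have K3 : 0 < K ^- 3 by rewrite invr_gt0 exprn_gt0.
have M0 : 0 <= C * (8 * K ^- 3) by rewrite !mulr_ge0// ltW.
apply: (le_trans (sum_norm_le (M := d * (C * (8 * K ^- 3))) _)).
  move=> y yA; rewrite -big_filter.
  apply: (le_trans (sum_norm_le (M := C * (8 * K ^- 3)) _)); last first.
    rewrite ler_wpM2r//; apply: le_trans (hd y).
    by rewrite ler_nat size_filter count_size.
  move=> w; rewrite mem_filter hA -ltNge => /andP[wK yw].
  have /andP[_ e2] := edge_dist yw.
  have tr := dist_triangle G x y w.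
  have yK : K / 2 <= dist x y by lra.
  apply: (le_trans (hC _ _ _ yw _)); first lra.
  rewrite ler_wpM2l ?(ltW C0)//.
  have -> : 8 * K ^- 3 = (K / 2) ^- 3 by field; rewrite gt_eqF.
  rewrite lef_pV2 ?posrE ?exprn_gt0 ?divr_gt0//; last lra.
  by apply: lerXn2r => //; rewrite nnegrE; lra.
have : (size A)%:R <= c * (1 + K) ^+ 2.
  by apply: (hc x) => //; [exact: ltW|move=> y; rewrite hA].
have -> : c * 4 * (d * (C * 8)) / K = c * 4 * K ^+ 2 * (d * (C * (8 * K ^- 3))).
  by field; rewrite gt_eqF.
move=> h; apply: ler_wpM2r; first by rewrite mulr_ge0// ltW.
apply: (le_trans h); rewrite -mulrA ler_wpM2l ?(ltW c0)//.
by move: K16; clear; nra.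
Qed.

Lemma lap_lin f g (a b : R) y : lap (fun v => a * f v + b * g v) y = a * lap f y + b * lap g y.
Proof.
rewrite /lap !mulr_sumr -big_split/=; apply: eq_bigr => w _; ring.
Qed.

Lemma lap_const (c : R) y : lap (fun=> c) y = 0.
Proof. by rewrite /lap big1// => w _; rewrite subrr mulr0. Qed.

Lemma lap_sqr (a b : R) y : 0 < lap (fun v => (gx v - a) ^+ 2 + (gy v - b) ^+ 2) y /\
  lap (fun v => (gx v - a) ^+ 2 + (gy v - b) ^+ 2) y = \sum_(w <- nb y) cond y w * gd2 y w.
Proof.
have E : lap (fun v => (gx v - a) ^+ 2 + (gy v - b) ^+ 2) y = \sum_(w <- nb y) cond y w * gd2 y w.
  transitivity (\sum_(w <- nb y) (cond y w * gd2 y w +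
     (2 * (gx y - a) * (cond y w * (gx w - gx y)) + 2 * (gy y - b) * (cond y w * (gy w - gy y))))).
    by apply: eq_bigr => w _; rewrite /gd2; ring.
  rewrite !big_split/= -!mulr_sumr cond_sum_x cond_sum_y !mulr0 !addr0//.
split => //; rewrite E; have [w yw] := nb_exists G y.
rewrite (bigD1_seq w)//= ?nb_uniq//; apply: ltr_pwDl.
  rewrite mulr_gt0 ?cond_gt0//; have /andP[h _] := edge_d2 yw.
  by apply: lt_le_trans h; rewrite mulr_gt0// exprn_gt0// gs_gt0.
rewrite big_seq_cond; apply: sumr_ge0 => v /andP[yv _].
by rewrite mulr_ge0 ?gd2_ge0// ltW// cond_gt0.
Qed.

(** A small multiple [e] of the squared modulus makes [h] strictly subharmonic on the finite set B,
    so no point of B can maximise it. The choice of [e] keeps the perturbed values at neighbours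
    outside B below the value at x0. *)
Lemma max_principle B h (M : R) : (forall y, y \in B -> 0 <= lap h y) ->
  (forall y, y \notin B -> h y <= M) -> forall y, h y <= M.
Proof.
move=> hB hM x0; rewrite leNgt; apply/negP => h0.
have xB : x0 \in B by apply: contraT => /hM; rewrite leNgt h0.
pose q v := (gx v - 0) ^+ 2 + (gy v - 0) ^+ 2.
have q0 v : 0 <= q v by rewrite addr_ge0 ?sqr_ge0.
pose N := [seq w | y <- B, w <- nb y].
have [m mN hm] : exists2 Q : R, 0 <= Q & forall y w, y \in B -> w \in nb y -> q w <= Q.
  have [[a aN]|nN] := pselect (exists a, a \in N).
    have [m mN hm] := @exists_argmax R _ N q a aN; exists (q m) => // y w yB yw.
    by apply: hm; apply/allpairsPdep; exists y, w.
  exists 0 => // y w yB yw; case: nN; exists w.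
  by apply/allpairsPdep; exists y, w.
pose e := (h x0 - M) / (2 * (m + 1)).
have m1 : 0 < m + 1 by lra.
have e0 : 0 < e by rewrite divr_gt0 ?subr_gt0 ?mulr_gt0.
have em : e * (m + 1) * 2 = h x0 - M by rewrite /e; field; rewrite gt_eqF.
pose phi v := 1 * h v + e * q v.
have [y yB hy] := exists_argmax phi xB.
have : 0 < lap phi y.
  rewrite lap_lin mul1r; apply: ltr_wpDl; first exact: hB.
  by rewrite mulr_gt0//; have [] := lap_sqr 0 0 y.
apply/negP; rewrite -leNgt /lap big_seq; apply: sumr_le0 => w yw.
rewrite pmulr_rle0 ?cond_gt0// subr_le0.
have [wB|wB] := boolP (w \in B); first exact: hy.
apply: le_trans (hy _ xB); rewrite /phi !mul1r.
have h1 := hM _ wB; have h2 : e * q w <= e * m by rewrite ler_wpM2l ?(ltW e0)//; apply: hm yB yw.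
have h3 : 0 <= e * q x0 by rewrite mulr_ge0// ltW.
have h4 : 0 <= e * m by rewrite mulr_ge0// ltW.
by move: h1 h2 h3 h4 em e0; clear; lra.
Qed.

(** With this normalisation [u y] is the expected time, not the number of visits, that the jump
    process started at y spends at z before leaving B. *)
Definition is_green B z u := (forall y, y \notin B -> u y = 0) /\
  forall y, y \in B -> lap u y = - (y == z)%:R.

Definition rate y : R := \sum_(w <- nb y) cond y w.

Definition avg f y : R := (\sum_(w <- nb y) cond y w * f w) / rate y.

Lemma rate_ge y : s0 <= rate y.
Proof.
have [w yw] := nb_exists G y; rewrite /rate (bigD1_seq w) ?nb_uniq//=.
have /andP[h _] := cond_bounds yw; apply: (le_trans h); rewrite lerDl.
rewrite big_seq_cond; apply: sumr_ge0 => v /andP[yv _]; exact: ltW (cond_gt0 yv).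
Qed.

Lemma rate_gt0 y : 0 < rate y.
Proof. exact: lt_le_trans (gs_gt0 G) (rate_ge y). Qed.

Lemma avg_lap f y : avg f y = f y + lap f y / rate y.
Proof.
have r0 := rate_gt0 y.
apply: (mulIf (lt0r_neq0 r0)); rewrite divfK ?gt_eqF// mulrDl divfK ?gt_eqF//.
rewrite /rate mulr_sumr /lap -big_split/=; apply: eq_bigr => w _; ring.
Qed.

Lemma avg_le f g y : (forall w, w \in nb y -> f w <= g w) -> avg f y <= avg g y.
Proof.
move=> h; rewrite ler_wpM2r ?invr_ge0 ?(ltW (rate_gt0 y))// !big_seq.
by apply: ler_sum => w yw; rewrite ler_wpM2l ?h// ltW// cond_gt0.
Qed.

(** [gn n] is the expected time at z during the first n steps. It increases with n and stays below
    [U], a supersolution made from the squared modulus, whose Laplacian is at least [4 * s0 ^+ 3];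
    the limit solves the equation. *)
Lemma green_exists B z : z \in B -> exists u, is_green B z u.
Proof.
move=> zB; have g0 := gs_gt0 G.
pose d y : R := (y == z)%:R / rate y.
pose gn := fix gn n : V -> R := if n is n'.+1 then
  fun y => if y \in B then d y + avg (gn n') y else 0 else fun=> 0.
pose q v := (gx v - 0) ^+ 2 + (gy v - 0) ^+ 2.
have q0 v : 0 <= q v by rewrite addr_ge0 ?sqr_ge0.
pose N := B ++ [seq w | y <- B, w <- nb y].
have zN : z \in N by rewrite mem_cat zB.
have [m mN hm] := @exists_argmax R _ N q z zN.
pose k := (4 * s0 ^+ 3)^-1.
have k0 : 0 < k by rewrite invr_gt0 mulr_gt0// exprn_gt0.
pose U y := k * (q m - q y).
have lq y : k^-1 <= lap q y.
  have [_ ->] := lap_sqr 0 0 y; have [w yw] := nb_exists G y.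
  rewrite (bigD1_seq w)//= ?nb_uniq//.
  have h : 0 <= \sum_(i <- nb y | i != w) cond y i * gd2 y i.
    rewrite big_seq_cond; apply: sumr_ge0 => v /andP[yv _].
    by rewrite mulr_ge0 ?gd2_ge0// ltW// cond_gt0.
  have /andP[h1 _] := edge_d2 yw; have /andP[h2 _] := cond_bounds yw.
  apply: le_trans (_ : cond y w * gd2 y w <= _); last by rewrite lerDl.
  rewrite invrK.
  have -> : 4 * s0 ^+ 3 = s0 * (4 * s0 ^+ 2) by ring.
  by apply: ler_pM => //; [exact: ltW|rewrite mulr_ge0 ?sqr_ge0].
have Usup y : d y + avg U y <= U y.
  have EU : U = fun v => k * q m * 1 + (- k) * q v by apply/funext => v; rewrite /U; ring.
  rewrite avg_lap addrCA gerDl /d -mulrDl pmulr_lle0 ?invr_gt0 ?rate_gt0//.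
  rewrite EU (lap_lin (fun=> 1)) lap_const mulr0 add0r mulNr subr_le0.
  apply: (@le_trans _ _ 1); first by case: (y == z).
  by have := ler_wpM2l (ltW k0) (lq y); rewrite mulfV// gt_eqF.
have U0 y : y \in N -> 0 <= U y by move=> /hm h; rewrite mulr_ge0 ?(ltW k0)// subr_ge0.
have gnU n y : y \in N -> gn n y <= U y.
  elim: n y => [|n IH] y yN /=; first exact: U0.
  case: ifP => yB; last exact: U0.
  apply: le_trans (Usup y); rewrite lerD2l; apply: avg_le => w yw; apply: IH.
  by rewrite mem_cat; apply/orP; right; apply/allpairsPdep; exists y, w.
have d0 y : 0 <= d y by rewrite divr_ge0// ltW// rate_gt0.
have gnS n y : gn n y <= gn n.+1 y.
  elim: n y => [|n IH] y.
    rewrite /=; case: ifP => // _; rewrite addr_ge0// /avg big1 ?mul0r// => w _.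
    by rewrite mulr0.
  rewrite [leLHS]/= [leRHS]/=; case: ifP => // _.
  by rewrite lerD2l; apply: avg_le => w _; exact: IH.
have gn0 n y : y \notin B -> gn n y = 0 by case: n => //= n /negbTE ->.
have cv y : cvgn (fun n => gn n y).
  apply: nondecreasing_is_cvgn.
    by apply/nondecreasing_seqP => n; exact: gnS.
  have [yB|yB] := boolP (y \in B).
    by exists (U y) => _ [n _ <-]; apply: gnU; rewrite mem_cat yB.
  by exists 0 => _ [n _ <-]; rewrite gn0.
pose u y := limn (fun n => gn n y).
have uoff y : y \notin B -> u y = 0.
  by move=> yB; rewrite /u (_ : (fun n => gn n y) = fun=> 0) ?lim_cst//; apply/funext => n; rewrite gn0.
exists u; split => // y yB.
have eq1 : u y = d y + avg u y.
  have c1 : (fun n => gn n.+1 y) @ \oo --> u y.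
    by rewrite (cvg_shiftS (fun n => gn n y)); exact: cv.
  have c2 : (fun n => gn n.+1 y) @ \oo --> d y + avg u y.
    rewrite (_ : (fun n => gn n.+1 y) = fun n => d y + avg (gn n) y); last first.
      by apply/funext => n /=; rewrite yB.
    apply: cvgD; first exact: cvg_cst.
    apply: cvgMl; elim: (nb y) => [|w s IH].
      rewrite big_nil (_ : (fun n => _) = fun=> 0); first exact: cvg_cst.
      by apply/funext => n; rewrite big_nil.
    rewrite big_cons (_ : (fun n => _) =
      fun n => cond y w * gn n w + \sum_(v <- s) cond y v * gn n v); last first.
      by apply/funext => n; rewrite big_cons.
    apply: cvgD; last exact: IH.
    by apply: cvgMr; exact: cv.
  exact: cvg_unique c1 c2.
have r0 := rate_gt0 y.
move: eq1; rewrite avg_lap /d => h.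
have : ((y == z)%:R + lap u y) / rate y = 0 by rewrite mulrDl; lra.
by move/eqP; rewrite mulf_eq0 invr_eq0 (gt_eqF r0) orbF addrC addr_eq0 => /eqP.
Qed.

End Green.

(** * Representation by the Green function, gradient bound and first estimate *)

Section GreenEstimate.
Variables (R : realType) (V : choiceType) (G : rhombic_graph R V).
Local Notation gx := (gx G).
Local Notation gy := (gy G).
Local Notation nb := (nb G).
Local Notation gd2 := (gd2 G).
Local Notation gball := (gball G).
Local Notation s0 := (gs G).
Local Notation cond := (cond G).
Local Notation dist := (dist G).
Local Notation lap := (lap G).
Local Notation flog := (flog G).
Local Notation is_green := (is_green G).
Implicit Types (x y z w : V) (f g u h : V -> R) (A B : seq V).

Lemma lapB f g y : lap (fun v => f v - g v) y = lap f y - lap g y.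
Proof. by rewrite /lap -sumrB; apply: eq_bigr => w _; ring. Qed.

Lemma green_ge0 B z u y : is_green B z u -> 0 <= u y.
Proof.
move=> [u0 lu]; suff : 0 - u y <= 0 by lra.
move: y; apply: (@max_principle _ _ G B) => v vB; last by rewrite u0// subrr.
by rewrite (lapB (fun=> 0)) lap_const lu// sub0r opprK.
Qed.

Lemma green_le_self B z u y : is_green B z u -> u y <= u z.
Proof.
move=> gu; have u_ge v := green_ge0 v gu; case: gu => u0 lu; move: y.
apply: (@max_principle _ _ G [seq v <- B | v != z]) => v; rewrite mem_filter.
  by move=> /andP[vz vB]; rewrite lu// (negbTE vz) oppr0.
by rewrite negb_and negbK => /orP[/eqP ->//|/u0 ->].
Qed.

Lemma green_mono B B' z u u' y : {subset B <= B'} -> is_green B z u ->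
  is_green B' z u' -> u y <= u' y.
Proof.
move=> BB gu gu'; have u_ge v := green_ge0 v gu'.
case: gu => u0 lu; case: gu' => u0' lu'; rewrite -subr_le0; move: y.
apply: (@max_principle _ _ G B) => v vB.
  by rewrite lapB lu// lu' ?BB// subrr.
by rewrite u0// sub0r oppr_le0.
Qed.

Definition nb_closed B A := {subset B <= A} /\ forall y w, y \in B -> w \in nb y -> w \in A.

(** Green's second identity. Boundary terms vanish because u is 0 outside B and an edge leaving A
    starts outside B. *)
Lemma green_identity A B z u f : uniq A -> nb_closed B A -> is_green B z u ->
  \sum_(y <- A) u y * lap f y = \sum_(y <- A) f y * lap u y.
Proof.
move=> uA [BA BnA] [u0 _]; apply/eqP; rewrite -subr_eq0 -sumrB; apply/eqP.
pose g y w := cond y w * (u y * f w - f y * u w).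
transitivity (\sum_(y <- A) \sum_(w <- nb y | w \in A) g y w); last first.
  by apply: (antisym_sum uA) => y w yw; rewrite /g (cond_sym yw); ring.
apply: eq_big_seq => y yA.
transitivity (\sum_(w <- nb y) g y w).
  by rewrite /lap !mulr_sumr -sumrB; apply: eq_bigr => w _; rewrite /g; ring.
rewrite [RHS]big_mkcond/=; apply: eq_big_seq => w yw; case: ifP => // /negbT wA.
have yB : y \notin B by apply: contra wA => yB; exact: BnA yB yw.
have wB : w \notin B by apply: contra wA => /BA.
by rewrite /g !u0// mul0r mulr0 subrr mulr0.
Qed.

(** Outside B, [lap u] is the exit distribution of the walk started at z, so the first term on the
    right is the mean of [f] at the exit point. *)
Lemma green_rep A B z u f : uniq A -> nb_closed B A -> z \in B -> is_green B z u ->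
  \sum_(y <- A) u y * lap f y = \sum_(y <- A | y \notin B) f y * lap u y - f z.
Proof.
move=> uA BA zB gu; rewrite (green_identity _ uA BA gu).
rewrite (bigID (mem B))/= addrC; congr (_ + _).
case: gu => u0 lu; rewrite big_mkcond (bigD1_seq z)//=; last by case: BA => h _; exact: h.
rewrite zB lu// eqxx mulrN1 big1 ?addr0// => y yz.
by case: ifP => // yB; rewrite lu// (negbTE yz) oppr0 mulr0.
Qed.

Lemma green_outside A B z u y : is_green B z u -> y \notin B -> 0 <= lap u y.
Proof.
move=> gu yB; rewrite /lap big_seq; apply: sumr_ge0 => w yw.
case: (gu) => u0 _; rewrite (u0 y yB) subr0 mulr_ge0 ?(green_ge0 _ gu)// ltW// cond_gt0//.
Qed.

Lemma green_outside_total A B z u : uniq A -> nb_closed B A -> z \in B ->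
  is_green B z u -> \sum_(y <- A | y \notin B) lap u y = 1.
Proof.
move=> uA BA zB gu; have := green_rep (fun=> 1) uA BA zB gu.
rewrite big1 => [|y _]; last by rewrite lap_const mulr0.
by under eq_bigr do rewrite mul1r; move=> h; lra.
Qed.

(** Summation by parts: the Dirichlet energy of u over ordered pairs is [2 * u z], which bounds the
    contribution of any edge. *)
Lemma green_energy A B z u p q : uniq A -> nb_closed B A -> z \in B ->
  is_green B z u -> q \in nb p -> cond p q * (u p - u q) ^+ 2 <= 2 * u z.
Proof.
move=> uA BA zB gu pq.
wlog pB : p q pq / p \in B.
  move=> H; have [pB|pB] := boolP (p \in B); first exact: H.
  have [qB|qB] := boolP (q \in B).
    have qp : p \in nb q by rewrite nb_sym.
    have -> : cond p q * (u p - u q) ^+ 2 = cond q p * (u q - u p) ^+ 2.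
      by rewrite (cond_sym pq); ring.
    exact: H.
  case: (gu) => u0 _; rewrite (u0 p pB) (u0 q qB) subrr expr0n/= mulr0 mulr_ge0//.
  exact: green_ge0 gu.
pose F y := \sum_(w <- nb y | w \in A) cond y w * (u y - u w) ^+ 2.
have tot : \sum_(y <- A) F y = 2 * u z.
  pose e y w := cond y w * (u y - u w) * u y.
  have -> : \sum_(y <- A) F y = \sum_(y <- A) \sum_(w <- nb y | w \in A) (e y w + e w y).
    apply: eq_bigr => y _; rewrite /F big_seq_cond [RHS]big_seq_cond.
    apply: eq_bigr => w /andP[yw _].
    by rewrite /e (cond_sym yw); ring.
  under eq_bigr do rewrite big_split/=.
  rewrite big_split/= -(symmetric_sum G e uA).
  have -> : \sum_(y <- A) \sum_(w <- nb y | w \in A) e y w = \sum_(y <- A) (- u y) * lap u y.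
    apply: eq_bigr => y _; have [yB|yB] := boolP (y \in B); last first.
      case: (gu) => u0 _; rewrite u0// oppr0 mul0r big1// => w _.
      by rewrite /e u0// mulr0.
    rewrite /lap mulr_sumr big_mkcond/=; apply: eq_big_seq => w yw.
    case: BA => _ /(_ _ _ yB yw) ->; rewrite /e; ring.
  have := green_rep u uA BA zB gu.
  have -> : \sum_(y <- A | y \notin B) u y * lap u y = 0.
    by rewrite big1// => y yB; case: (gu) => u0 _; rewrite u0// mul0r.
  under [\sum_(y <- A) - u y * _]eq_bigr do rewrite mulNr.
  by rewrite sumrN => h; lra.
rewrite -tot; case: BA => BA BnA.
have F0 y : 0 <= F y.
  rewrite /F big_seq_cond; apply: sumr_ge0 => w /andP[yw _].
  by rewrite mulr_ge0 ?sqr_ge0// ltW// cond_gt0.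
rewrite (bigD1_seq p)//=; last exact: BA.
apply: (@le_trans _ _ (F p)); last by rewrite lerDl sumr_ge0.
rewrite /F big_mkcond (bigD1_seq q)//= ?nb_uniq// (BnA _ _ pB pq) lerDl.
rewrite big_seq_cond; apply: sumr_ge0 => w /andP[yw _]; case: ifP => // _.
by rewrite mulr_ge0 ?sqr_ge0// ltW// cond_gt0.
Qed.

Lemma green_gradient A B z u p q : uniq A -> nb_closed B A -> z \in B ->
  is_green B z u -> q \in nb p -> `|u p - u q| <= Num.sqrt (2 / s0) * Num.sqrt (u z).
Proof.
move=> uA BA zB gu pq; have h := green_energy uA BA zB gu pq.
have g0 := gs_gt0 G; have /andP[c1 _] := cond_bounds pq.
have uz := green_ge0 z gu.
have s20 : 0 <= 2 / s0 by rewrite divr_ge0// ltW.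
rewrite -sqrtrM// -sqrtr_sqr ler_wsqrtr//.
rewrite mulrAC ler_pdivlMr//; apply: le_trans h; rewrite mulrC.
by rewrite ler_wpM2r// sqr_ge0.
Qed.

(** A substitute for a Harnack inequality. Greedy steps towards y stay in the disc of radius K about
    y and never repeat a vertex, so their number is at most that of the vertices in it; each step
    changes u by at most a multiple of the square root of [u z]. *)
Lemma green_path : exists2 C : R, 0 < C & forall A B z u x y K, uniq A ->
  nb_closed B A -> z \in B -> is_green B z u -> 0 <= K -> dist x y <= K ->
  `|u x - u y| <= C * (1 + K) ^+ 2 * Num.sqrt (u z).
Proof.
have [C C0 hC] := gball_count_le G; have g0 := gs_gt0 G.
exists (C * Num.sqrt (2 / s0)); first by rewrite mulr_gt0// sqrtr_gt0 divr_gt0.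
move=> A B z u x y K uA BA zB gu K0 xyK.
set de := Num.sqrt (2 / s0); set sz := Num.sqrt (u z).
have d0 : 0 <= de * sz by rewrite mulr_ge0 ?sqrtr_ge0.
pose L := gball (gx y) (gy y) K.
pose S v := [seq w <- L | gd2 w y < gd2 v y].
have main n : forall v, dist v y <= K -> (size (S v) <= n)%N ->
    `|u v - u y| <= n%:R * (de * sz).
  elim: n => [|n IH] v vK sv.
    have [->|vy] := eqVneq v y; first by rewrite subrr normr0 mul0r.
    have [w vw wc] := nb_closer_strict G vy.
    have : w \in S v.
      rewrite mem_filter wc mem_gball.
      rewrite (_ : _ + _ = gd2 w y); last by rewrite /gd2; ring.
      apply: (le_trans (ltW wc)); rewrite -dist_sqr lerXn2r ?nnegrE// dist_ge0//.
    by move: sv; rewrite leqn0 size_eq0 => /eqP ->.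
  have [->|vy] := eqVneq v y; first by rewrite subrr normr0 mulr_ge0.
  have [w vw wc] := nb_closer_strict G vy.
  have wK : dist w y <= K.
    apply: le_trans vK; rewrite -(ler_pXn2r (n := 2)) ?nnegrE ?dist_ge0//.
    by rewrite !dist_sqr ltW.
  have wS : w \in S v.
    rewrite mem_filter wc mem_gball.
    rewrite (_ : _ + _ = gd2 w y); last by rewrite /gd2; ring.
    by rewrite -dist_sqr lerXn2r ?nnegrE// dist_ge0.
  have sw : (size (S w) <= n)%N.
    rewrite -ltnS; apply: leq_trans sv.
    have := @uniq_leq_size _ (w :: S w) (S v); apply.
      by rewrite /= mem_filter ltxx/= filter_uniq// gball_uniq.
    move=> a; rewrite inE => /orP[/eqP ->//|]; rewrite !mem_filter => /andP[h ->].
    by rewrite (lt_trans h wc).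
  have -> : u v - u y = (u v - u w) + (u w - u y) by ring.
  apply: (le_trans (ler_normD _ _)); rewrite -natr1 mulrDl mul1r addrC lerD ?IH//.
  exact: green_gradient uA BA zB gu vw.
apply: (le_trans (main _ x xyK (leqnn _))).
have -> : C * de * (1 + K) ^+ 2 * sz = C * (1 + K) ^+ 2 * (de * sz) by ring.
rewrite ler_wpM2r//; apply: le_trans (hC (gx y) (gy y) K K0).
by rewrite ler_nat size_filter count_size.
Qed.

Definition lnp (d : R) : R := ln (Num.max d 1).

Lemma lnp_flog : exists2 C : R, 0 <= C & forall x y, `|flog x y - lnp (dist x y)| <= C.
Proof.
have [F F0 hF] := @flog_bound _ _ G 1 ler01; exists F => // x y.
rewrite /lnp; have [d1|d1] := leP (dist x y) 1.
  by rewrite ln1 subr0; exact: hF.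
have xy : x != y by apply/eqP => h; move: d1; rewrite h distxx ltr10.
by rewrite flogE// subrr normr0.
Qed.

Lemma ball_nb_closed z0 (r : R) B : 0 <= r -> (forall y, (y \in B) = (dist z0 y <= r)) ->
  nb_closed B (gball (gx z0) (gy z0) (r + 2)).
Proof.
move=> r0 hB.
have mB y : (y \in gball (gx z0) (gy z0) (r + 2)) = (dist z0 y <= r + 2).
  rewrite mem_gball -[_ + _]/(gd2 z0 y) -dist_sqr ler_pXn2r ?nnegrE ?dist_ge0//.
  lra.
split => [y|y w]; rewrite hB => yB; first by rewrite mB; lra.
move=> /edge_dist/andP[_ h]; rewrite mB.
by apply: (le_trans (dist_triangle G z0 y w)); lra.
Qed.

(** [green_rep] is applied to [flog x]. The boundary term is ln r up to a constant, and the
    Laplacian has mass about 2 pi near x and a summable tail. Replacing u by [u x] within distance K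
    costs a multiple of the square root of [u z], the tail beyond K costs [u z / K]. The still
    unknown [u z] is bounded in [green_diag]. *)
Lemma green_estimate_pre : exists2 C1 : R, 0 < C1 & forall K, 16 <= K ->
  exists2 CK : R, 0 <= CK & forall z0 r B u x z, 2 * K <= r ->
  (forall y, (y \in B) = (dist z0 y <= r)) -> z \in B -> is_green B z u ->
  dist z0 x <= r / 2 ->
  `|2 * pi * u x - (ln r - lnp (dist x z))| <= C1 + C1 / K * u z + CK * Num.sqrt (u z).
Proof.
have [Ct Ct0 htot] := lap_flog_total G.
have [Cf Cf0 hfar] := lap_flog_far G.
have [Cs Cs0 hts] := tail_sum G.
have [Cp Cp0 hpath] := green_path.
have [Cl Cl0 hlnp] := lnp_flog.
have [Cc Cc0 hcnt] := count_le G.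
have ln30 : 0 < ln (3 : R) by rewrite ln_gt0// ltr1n.
have CC0 : 0 < Cf * Cs by rewrite mulr_gt0.
exists (ln 3 + Cl + Ct + Cf * Cs); first lra.
move=> K K16; have K0 : 0 < K by lra.
have [Cn Cn0 hnear] := lap_flog_near G (ltW K0).
exists (Cc * (1 + K) ^+ 2 * (Cp * (1 + K) ^+ 2 * Cn)).
  by rewrite !mulr_ge0 ?exprn_ge0 ?addr_ge0 ?(ltW Cc0) ?(ltW Cp0) ?(ltW K0).
move=> z0 r B u x z rK hB zB gu xr.
have r0 : 0 < r by lra.
pose A := gball (gx z0) (gy z0) (r + 2).
have uA : uniq A by apply: gball_uniq.
have cA : nb_closed B A := ball_nb_closed (ltW r0) hB.
have memA y : (y \in A) = (dist z0 y <= r + 2).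
  rewrite mem_gball -[_ + _]/(gd2 z0 y) -dist_sqr ler_pXn2r ?nnegrE ?dist_ge0//.
  lra.
have rep := green_rep (flog x) uA cA zB gu.
have tot := green_outside_total uA cA zB gu.
have uz0 := green_ge0 z gu.
set sz := Num.sqrt (u z).
have sz0 : 0 <= sz by apply: sqrtr_ge0.
have h1 : `|\sum_(y <- A | y \notin B) flog x y * lap u y - ln r| <= ln 3.
  have -> : \sum_(y <- A | y \notin B) flog x y * lap u y - ln r =
      \sum_(y <- A | y \notin B) (flog x y - ln r) * lap u y.
    under [RHS]eq_bigr do rewrite mulrBl.
    by rewrite sumrB -mulr_sumr tot mulr1.
  have -> : ln (3 : R) = \sum_(y <- A | y \notin B) ln 3 * lap u y by rewrite -mulr_sumr tot mulr1.
  apply: (le_trans (ler_norm_sum _ _ _)); rewrite big_seq_cond [leRHS]big_seq_cond.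
  apply: ler_sum => y /andP[yA yB].
  have o0 := green_outside A gu yB.
  rewrite normrM (ger0_norm o0) ler_wpM2r//.
  move: yA yB; rewrite memA hB -ltNge => y1 y2.
  have t1 := dist_triangle G z0 x y; have t2 := dist_triangle G x z0 y.
  rewrite (dist_sym G x z0) in t2.
  have d1 : r / 2 <= dist x y by lra.
  have d2 : dist x y <= 3 * r by lra.
  have dp : 0 < dist x y by lra.
  have xy : x != y by apply/eqP => h; move: dp; rewrite h distxx ltxx.
  have l1 : ln r - ln 3 <= ln (dist x y).
    rewrite -ln_div ?posrE// ler_ln ?posrE ?divr_gt0//; lra.
  have l2 : ln (dist x y) <= ln 3 + ln r.
    by rewrite -lnM ?posrE// ler_ln ?posrE ?mulr_gt0.
  by rewrite flogE// ler_norml; apply/andP; move: l1 l2; clear; split; lra.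
pose near y := dist x y <= K.
have rep2 : \sum_(y <- A) u y * lap (flog x) y =
   u x * \sum_(y <- A | near y) lap (flog x) y
   + \sum_(y <- A | near y) (u y - u x) * lap (flog x) y
   + \sum_(y <- A | ~~ near y) u y * lap (flog x) y.
  rewrite (bigID near)/=; congr (_ + _).
  by rewrite mulr_sumr -big_split/=; apply: eq_bigr => y _; ring.
have h2 : `|\sum_(y <- A | near y) lap (flog x) y - 2 * pi| <= Ct / K.
  rewrite -big_filter; apply: htot => //; first by rewrite filter_uniq.
  move=> y; rewrite mem_filter /near; case: leP => //= xyK.
  rewrite memA; apply: (le_trans (dist_triangle G z0 x y)); lra.
have h3 : `|\sum_(y <- A | near y) (u y - u x) * lap (flog x) y| <=
    Cc * (1 + K) ^+ 2 * (Cp * (1 + K) ^+ 2 * Cn) * sz.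
  have M0 : 0 <= Cp * (1 + K) ^+ 2 * sz * Cn.
    by rewrite !mulr_ge0 ?exprn_ge0 ?addr_ge0 ?(ltW Cp0) ?(ltW K0).
  rewrite -big_filter; apply: (le_trans (sum_norm_le (M := Cp * (1 + K) ^+ 2 * sz * Cn) _)).
    move=> y; rewrite mem_filter /near => /andP[ny _]; rewrite normrM ler_pM//.
      by apply: (hpath A B z) => //; rewrite ?(ltW K0)// dist_sym.
    exact: hnear.
  have -> : Cc * (1 + K) ^+ 2 * (Cp * (1 + K) ^+ 2 * Cn) * sz =
    Cc * (1 + K) ^+ 2 * (Cp * (1 + K) ^+ 2 * sz * Cn) by ring.
  rewrite ler_wpM2r//; apply: (hcnt x); rewrite ?(ltW K0) ?filter_uniq//.
  by move=> y; rewrite mem_filter => /andP[].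
have h4 : `|\sum_(y <- A | ~~ near y) u y * lap (flog x) y| <= Cf * Cs / K * u z.
  rewrite -big_filter; set A' := [seq y <- A | _].
  apply: (le_trans (ler_norm_sum _ _ _)).
  apply: (@le_trans _ _ (\sum_(y <- A') u z * Cf * dist x y ^- 3)).
    rewrite !big_seq; apply: ler_sum => y; rewrite mem_filter /near -ltNge => /andP[ny _].
    rewrite normrM (ger0_norm (green_ge0 y gu)) -mulrA ler_pM ?(green_ge0 _ gu)//.
      exact: green_le_self gu.
    by apply: hfar; lra.
  rewrite -mulr_sumr; have hs := hts x K A'.
  have -> : Cf * Cs / K * u z = u z * Cf * (Cs / K) by ring.
  rewrite ler_wpM2l ?mulr_ge0 ?(ltW Cf0)//; apply: hs; first lra.
    by rewrite filter_uniq.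
  by move=> y; rewrite mem_filter /near -ltNge => /andP[].
have h5 := hlnp x z.
have ux := green_le_self x gu; have ux0 := green_ge0 x gu.
set S1 := \sum_(y <- A | near y) lap (flog x) y in rep2 h2.
have h6 : `|u x * S1 - u x * (2 * pi)| <= Ct / K * u z.
  by rewrite -mulrBr normrM (ger0_norm ux0) mulrC ler_pM// normr_ge0.
rewrite rep in rep2.
have K1 : ln 3 / K * u z >= 0 by rewrite mulr_ge0// ltW// divr_gt0.
have K2 : Cl / K * u z >= 0 by rewrite mulr_ge0// mulr_ge0// invr_ge0 ltW.
have -> : (ln 3 + Cl + Ct + Cf * Cs) / K * u z =
  ln 3 / K * u z + Cl / K * u z + Ct / K * u z + Cf * Cs / K * u z by ring.
move: h1 h3 h4 h5 h6 K1 K2 rep2.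
move: (\sum_(y <- A | y \notin B) _) (\sum_(y <- A | near y) _) (\sum_(y <- A | ~~ near y) _) => s1 s2 s3.
move: (_ * sz) (ln 3 / K * u z) (Cl / K * u z) (Ct / K * u z) (Cf * Cs / K * u z) => e1 e2 e3 e4 e5.
rewrite !ler_norml => /andP[? ?] /andP[? ?] /andP[? ?] /andP[? ?] /andP[? ?] ? ? ?.
by apply/andP; move: Ct0 CC0; split; lra.
Qed.

End GreenEstimate.

Lemma young_sqrt (R : realType) (a b u : R) : 0 < b -> 0 <= u ->
  a * Num.sqrt u <= b * u + a ^+ 2 / (4 * b).
Proof.
move=> b0 u0; rewrite -{2}(sqr_sqrtr u0); set v := Num.sqrt u.
rewrite -subr_ge0.
have -> : b * v ^+ 2 + a ^+ 2 / (4 * b) - a * v = (2 * b * v - a) ^+ 2 / (4 * b).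
  by field; rewrite gt_eqF.
by rewrite divr_ge0 ?sqr_ge0// mulr_ge0// ltW.
Qed.

(** * Absorbing the error terms *)

Section GreenAsymptotics.
Variables (R : realType) (V : choiceType) (G : rhombic_graph R V).
Local Notation gx := (gx G).
Local Notation gy := (gy G).
Local Notation nb := (nb G).
Local Notation dist := (dist G).
Local Notation is_green := (is_green G).
Implicit Types (x y z w : V) (u : V -> R) (B : seq V).

Definition vb z0 (r : R) : seq V := gball G (gx z0) (gy z0) r.

Lemma mem_vb z0 r y : 0 <= r -> (y \in vb z0 r) = (dist z0 y <= r).
Proof.
move=> r0; rewrite mem_gball -[_ + _]/(gd2 G z0 y) -dist_sqr.
by rewrite ler_pXn2r ?nnegrE ?dist_ge0.
Qed.

Lemma vb_uniq z0 r : uniq (vb z0 r). Proof. exact: gball_uniq. Qed.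

Lemma lnp_le1 d : d <= 1 -> @lnp R d = 0.
Proof. by move=> d1; rewrite /lnp; have [h|h] := leP d 1; rewrite ?ln1//; move: h; rewrite ltNge d1. Qed.

(** Enlarging the disc to radius 2 r about z increases the Green function and makes z the centre.
    The estimate then applies with x = z, and as [C1 <= K] its error is absorbed by
    [2 * pi * u' z]. *)
Lemma green_diag : exists2 R1 : R, 1 <= R1 & forall z0 r u z, R1 <= r ->
  z \in vb z0 r -> is_green (vb z0 r) z u -> u z <= 2 * ln r.
Proof.
have [C1 C10 hpre] := green_estimate_pre G.
pose K : R := Num.max 16 C1.
have K16 : 16 <= K by rewrite le_max lexx.
have KC : C1 <= K by rewrite le_max lexx orbT.
have K0 : 0 < K by lra.
have [CK CK0 hK] := hpre K K16.
pose R1 := Num.max (2 * K) (expR (C1 + CK ^+ 2 / 4)).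
have R1K : 2 * K <= R1 by rewrite le_max lexx.
have R1e : expR (C1 + CK ^+ 2 / 4) <= R1 by rewrite le_max lexx orbT.
exists R1; first lra.
move=> z0 r u z rR zB gu.
have r0 : 0 < r by lra.
have r20 : 0 < 2 * r by lra.
have zB2 : z \in vb z (2 * r) by rewrite mem_vb ?distxx ltW.
have [u' gu'] := green_exists G zB2.
have uu' : u z <= u' z.
  apply: green_mono gu gu' => y; move: zB; rewrite !mem_vb ?(ltW r0) ?(ltW r20)// => h1 h2.
  by have := dist_triangle G z z0 y; rewrite (dist_sym G z z0); lra.
have u0 := green_ge0 z gu'.
have := hK z (2 * r) (vb z (2 * r)) u' z z _ _ zB2 gu' _.
rewrite distxx lnp_le1 // subr0 => h.
have {}h : `|2 * pi * u' z - ln (2 * r)| <= C1 + C1 / K * u' z + CK * Num.sqrt (u' z).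
  by apply: h; [lra|move=> y; rewrite mem_vb// ltW|lra].
have yg := @young_sqrt R CK 1 (u' z) ltr01 u0.
have c1 : C1 / K * u' z <= u' z.
  by rewrite -[leRHS]mul1r ler_wpM2r// ler_pdivrMr// mul1r.
have p2 : 2 * u' z <= pi * u' z by rewrite ler_wpM2r// pi_ge2.
have l2 : ln (2 * r) <= 2 * ln r.
  by rewrite lnM ?posrE// [leRHS]mulr_natl mulr2n lerD2r ler_ln ?posrE//; lra.
have lR : C1 + CK ^+ 2 / 4 <= ln r.
  by rewrite -[leLHS]expRK ler_ln ?posrE ?expR_gt0// (le_trans R1e).
move: h; rewrite ler_norml => /andP[_ h].
rewrite !mul1r mulr1 in yg.
by lra.
Qed.

(** K is fixed first, so large that the linear error is a small multiple of [u z], which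
    [green_diag] bounds by 2 ln r. The square root is split by Young's inequality, and the remaining
    constants are absorbed by taking r large. *)
Theorem green_estimate (eps : R) : 0 < eps -> exists2 R0 : R, 1 <= R0 &
  forall z0 r u x z, R0 <= r -> z \in vb z0 r -> is_green (vb z0 r) z u ->
  dist z0 x <= r / 2 -> `|2 * pi * u x - (ln r - lnp (dist x z))| <= eps * ln r.
Proof.
move=> e0; have [C1 C10 hpre] := green_estimate_pre G.
have [R1 R11 hR1] := green_diag.
pose K : R := Num.max 16 (8 * C1 / eps).
have K16 : 16 <= K by rewrite le_max lexx.
have KC : 8 * C1 / eps <= K by rewrite le_max lexx orbT.
have K0 : 0 < K by lra.
have [CK CK0 hK] := hpre K K16.
pose a := (C1 + 2 * CK ^+ 2 / eps) * 4 / eps.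
pose R0 := Num.max (Num.max R1 (2 * K)) (expR a).
have R0e : expR a <= R0 by rewrite le_max lexx orbT.
have R0m : Num.max R1 (2 * K) <= R0 by rewrite le_max lexx.
have R0K : 2 * K <= R0 by apply: le_trans R0m; rewrite le_max lexx orbT.
have R01 : R1 <= R0 by apply: le_trans R0m; rewrite le_max lexx.
exists R0; first lra.
move=> z0 r u x z rR zB gu xr.
have r0 : 0 < r by lra.
have ud : u z <= 2 * ln r by apply: (hR1 z0) => //; lra.
have u0 := green_ge0 z gu.
have lnr : a <= ln r by rewrite -[leLHS]expRK ler_ln ?posrE ?expR_gt0// (le_trans R0e).
have := hK z0 r (vb z0 r) u x z _ _ zB gu xr.
move=> h; apply: (le_trans (h _ _)); [lra|by move=> y; rewrite mem_vb// ltW|].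
have e8 : 0 < eps / 8 by rewrite divr_gt0.
have yg := @young_sqrt R CK _ (u z) e8 u0.
have c1 : C1 / K * u z <= eps / 8 * u z.
  rewrite ler_wpM2r// ler_pdivrMr// mulrC -ler_pdivrMr//.
  apply: le_trans KC; rewrite le_eqVlt; apply/orP; left; apply/eqP; field.
  by rewrite gt_eqF.
have E : C1 + 2 * CK ^+ 2 / eps <= eps / 4 * ln r.
  have -> : C1 + 2 * CK ^+ 2 / eps = eps / 4 * a by rewrite /a; field; rewrite gt_eqF.
  by rewrite ler_wpM2l// ltW// divr_gt0.
have E2 : CK ^+ 2 / (4 * (eps / 8)) = 2 * CK ^+ 2 / eps by field; rewrite gt_eqF.
rewrite E2 in yg.
have E3 : eps / 8 * u z <= eps / 4 * ln r.
  have -> : eps / 4 * ln r = eps / 8 * (2 * ln r) by field.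
  by rewrite ler_wpM2l// ltW.
have E4 : eps * ln r = eps / 4 * ln r + eps / 4 * ln r + eps / 4 * ln r + eps / 4 * ln r by field.
have m0 : 0 <= eps / 8 * u z by rewrite mulr_ge0// ltW.
rewrite E4; move: c1 yg E E3 m0; move: (eps / 4 * ln r) (eps / 8 * u z) (C1 / K * _) (CK * _).
by clear=> *; lra.
Qed.

End GreenAsymptotics.

(** * The embedded walk *)

Section Chain.
Variables (R : realType) (V : choiceType) (G : rhombic_graph R V).
Local Notation nb := (nb G).
Local Notation gd2 := (gd2 G).
Local Notation s0 := (gs G).
Local Notation cond := (cond G).
Local Notation dist := (dist G).
Local Notation is_green := (is_green G).
Implicit Types (x y z w : V) (f u : V -> R) (B s p : seq V) (F : seq V -> R).

Lemma avg_lin f g (a b : R) y : avg G (fun v => a * f v + b * g v) y = a * avg G f y + b * avg G g y.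
Proof.
rewrite /avg !mulrA -mulrDl !mulr_sumr -big_split/=; congr (_ / _).
by apply: eq_bigr => w _; ring.
Qed.

Lemma avg_const (c : R) y : avg G (fun=> c) y = c.
Proof. by rewrite avg_lap lap_const mul0r addr0. Qed.

Lemma eq_avg f g y : (forall w, w \in nb y -> f w = g w) -> avg G f y = avg G g y.
Proof. by move=> h; congr (_ / _); apply: eq_big_seq => w yw; rewrite h. Qed.

(* Expectation over the n steps of the walk; the paths exclude the start z. *)
Fixpoint EX n z F : R :=
  if n is m.+1 then avg G (fun w => EX m w (fun p => F (w :: p))) z else F [::].

Lemma EX_le n z F F' : (forall p, size p = n -> F p <= F' p) -> EX n z F <= EX n z F'.
Proof.
elim: n z F F' => [|n IH] z F F' h /=; first exact: h.
by apply: avg_le => w _; apply: IH => p pn; apply: h; rewrite /= pn.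
Qed.

Lemma eq_EX n z F F' : (forall p, size p = n -> F p = F' p) -> EX n z F = EX n z F'.
Proof. by move=> h; apply/le_anti/andP; split; apply: EX_le => p /h ->. Qed.

Lemma EX_const n z (c : R) : EX n z (fun=> c) = c.
Proof.
elim: n z => [//|n IH] z /=; rewrite -[RHS](avg_const c z).
by apply: eq_avg => w _; rewrite IH.
Qed.

Lemma EX_lin n z F F' (a b : R) :
  EX n z (fun p => a * F p + b * F' p) = a * EX n z F + b * EX n z F'.
Proof.
elim: n z F F' => [//|n IH] z F F' /=; rewrite -avg_lin.
by apply: eq_avg => w _; rewrite IH.
Qed.

Lemma EX_ge0 n z F : (forall p, size p = n -> 0 <= F p) -> 0 <= EX n z F.
Proof. by move=> h; rewrite -[leLHS](EX_const n z); exact: EX_le. Qed.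

Lemma EX_sum (I : eqType) n z (r : seq I) (F : I -> seq V -> R) :
  EX n z (fun p => \sum_(i <- r) F i p) = \sum_(i <- r) EX n z (F i).
Proof.
elim: r => [|i r IH].
  by rewrite big_nil -[RHS](EX_const n z); apply: eq_EX => p _; rewrite big_nil.
rewrite big_cons -IH -[EX n z (F i)]mul1r -[X in _ + X]mul1r -EX_lin.
by apply: eq_EX => p _; rewrite big_cons !mul1r.
Qed.

Lemma EX_cat n m z F :
  EX (n + m) z F = EX n z (fun p => EX m (last z p) (fun q => F (p ++ q))).
Proof. by elim: n z F => [//|n IH] z F /=; apply: eq_avg => w _; exact: IH. Qed.

Fixpoint killed B s : seq V :=
  if s is a :: s' then if a \in B then a :: killed B s' else [::] else [::].

(** The mean of the time integral of [v] given the embedded path: a visit to y lasts [1 / rate G y]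
    on average. *)
Definition occ v s : R := \sum_(y <- s) v y / rate G y.

(* Multiplying by the supersolution u turns the exponential into a
   supermartingale. *)
Lemma exponential_moment B v u (k : R) n z : 0 < k -> (forall y, k <= u y) ->
  (forall y, y \in B -> v y * u y <= - lap G u y) ->
  EX n z (fun p => expR (occ v (killed B (belast z p)))) <= u z / k.
Proof.
move=> k0 uk hu; elim: n z => [|n IH] z.
  by rewrite /= /occ big_nil expR0 ler_pdivlMr// mul1r.
have [zB|zB] := boolP (z \in B); last first.
  rewrite (_ : EX _ _ _ = 1); first by rewrite ler_pdivlMr// mul1r.
  rewrite -[RHS](EX_const n.+1 z); apply: eq_EX => -[//|w p] _ /=.
  by rewrite (negbTE zB) /occ big_nil expR0.
rewrite (_ : EX _ _ _ = expR (v z / rate G z) *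
    avg G (fun w => EX n w (fun p => expR (occ v (killed B (belast w p))))) z); last first.
  rewrite /= -[X in _ = _ * X]addr0 -[0](mul0r (avg G (fun=> 0) z)) -[X in _ = _ * (X + _)]mul1r -avg_lin.
  rewrite -[RHS]addr0 -[X in _ + X](mul0r (avg G (fun=> 0) z)) -avg_lin.
  apply: eq_avg => w _; rewrite !mul0r !addr0 mul1r.
  rewrite -[RHS]addr0 -[X in _ + X](mul0r (EX n w (fun=> 0))) -EX_lin.
  apply: eq_EX => p _; rewrite zB mul0r addr0 /occ big_cons expRD//.
have r0 := rate_gt0 G z.
apply: (@le_trans _ _ (expR (v z / rate G z) * avg G (fun w => u w / k) z)).
  by rewrite ler_wpM2l ?expR_ge0//; apply: avg_le => w _; exact: IH.
have -> : avg G (fun w => u w / k) z = avg G u z / k.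
  transitivity (avg G (fun w => k^-1 * u w + 0 * 0) z); first by apply: eq_avg => w _; ring.
  by rewrite (avg_lin _ (fun=> 0)) mul0r addr0 mulrC.
rewrite mulrA ler_wpM2r ?invr_ge0 ?(ltW k0)// avg_lap.
have h : u z + lap G u z / rate G z <= u z * expR (- (v z / rate G z)).
  have h1 := expR_ge1Dx (- (v z / rate G z)).
  have u0 : 0 <= u z by apply: le_trans (uk z); exact: ltW.
  apply: le_trans (ler_wpM2l u0 h1).
  rewrite mulrDr mulr1 lerD2l mulrN mulrA -[leRHS]mulNr ler_wpM2r ?invr_ge0 ?(ltW r0)//.
  by have := hu z zB; rewrite mulrC; lra.
apply: (le_trans (ler_wpM2l (expR_ge0 _) h)).
by rewrite mulrCA -expRD subrr expR0 mulr1.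
Qed.

Definition survival B n z : R := EX n z (fun p => (all (mem B) (belast z p))%:R).

Lemma survivalS B n z :
  survival B n.+1 z = if z \in B then avg G (survival B n) z else 0.
Proof.
rewrite /survival; case: ifP => zB.
  by apply: eq_avg => w _; apply: eq_EX => p _ /=; rewrite zB.
rewrite -[RHS](EX_const n.+1 z); apply: eq_EX => -[//|w p] _ /=.
by rewrite zB.
Qed.

Lemma survival_itv B n z : 0 <= survival B n z <= 1.
Proof.
rewrite EX_ge0//=; apply: (@le_trans _ _ (EX n z (fun=> 1))); last by rewrite EX_const.
by apply: EX_le => p _; case: all.
Qed.

(** [U] dominates the expected exit time, and n times the probability of surviving n steps is at
    most that expectation. *)
Lemma survival_bound B U n z :
  (forall y, y \in B -> avg G U y + 1 <= U y) ->
  (forall y w, y \in B -> w \in nb y -> 0 <= U w) -> 0 <= U z ->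
  n%:R * survival B n z <= U z.
Proof.
move=> hU hN; elim: n z => [|n IH] z Uz; first by rewrite mul0r.
rewrite survivalS; case: ifP => zB; last by rewrite mulr0.
apply: le_trans (hU z zB).
have -> : n.+1%:R * avg G (survival B n) z =
    avg G (fun w => n%:R * survival B n w + 1 * survival B n w) z.
  by rewrite avg_lin mul1r -natr1 mulrDl mul1r.
rewrite avg_lin mul1r.
have -> : n%:R * avg G (survival B n) z = avg G (fun w => n%:R * survival B n w) z.
  transitivity (avg G (fun w => n%:R * survival B n w + 0 * 0) z).
    by rewrite (avg_lin _ (fun=> 0)) mul0r addr0.
  by apply: eq_avg => w _; rewrite mul0r addr0.
apply: lerD.
  by apply: avg_le => w zw; apply: IH; exact: hN zB zw.
rewrite -[leRHS](avg_const 1 z); apply: avg_le => w _.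
by case/andP: (survival_itv B n w).
Qed.

Lemma lap_gd2 z0 y : 4 * s0 ^+ 2 * rate G y <= lap G (gd2 z0) y <= 4 * rate G y.
Proof.
have [_ ->] := lap_sqr G (gx G z0) (gy G z0) y.
rewrite /rate !mulr_sumr !big_seq; apply/andP; split; apply: ler_sum => w yw;
  have /andP[h1 h2] := edge_d2 yw; have c0 := ltW (cond_gt0 yw); rewrite mulrC.
  exact: ler_wpM2l.
exact: ler_wpM2r.
Qed.

Lemma avg_gd2 z0 y : gd2 z0 y + 4 * s0 ^+ 2 <= avg G (gd2 z0) y <= gd2 z0 y + 4.
Proof.
have /andP[h1 h2] := lap_gd2 z0 y; have r0 := rate_gt0 G y.
by rewrite avg_lap !lerD2l ler_pdivlMr// ler_pdivrMr// h1 h2.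
Qed.

Lemma survival_ball z0 (r : R) n : 0 <= r -> (0 < n)%N ->
  survival (vb G z0 r) n z0 <= (r + 2) ^+ 2 / (4 * s0 ^+ 2) / n%:R.
Proof.
move=> r0 n0; have g0 := gs_gt0 G.
have k0 : 0 < 4 * s0 ^+ 2 by rewrite mulr_gt0// exprn_gt0.
rewrite ler_pdivlMr ?ltr0n// mulrC.
(* The squared modulus gains at least [4 * s0 ^+ 2] per step on average. The radius r + 2 keeps [U]
   nonnegative at the neighbours of the ball, as edges have length at most 2. *)
pose U y := (r + 2) ^+ 2 / (4 * s0 ^+ 2) * 1 + (- (4 * s0 ^+ 2)^-1) * gd2 z0 y.
have -> : (r + 2) ^+ 2 / (4 * s0 ^+ 2) = U z0.
  by rewrite /U -dist_sqr distxx expr0n mulr0 addr0 mulr1.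
apply: survival_bound.
- move=> y yB; rewrite /U (avg_lin (fun=> 1)) avg_const.
  have /andP[h _] := avg_gd2 z0 y.
  have ik : 0 <= (4 * s0 ^+ 2)^-1 by rewrite invr_ge0 ltW.
  have := ler_wpM2l ik h; rewrite mulrDr mulVf ?gt_eqF// => h'.
  by move: h'; rewrite !mulNr; move: (_^-1 * gd2 z0 y) (_^-1 * avg G _ _) (_ * 1) => *; lra.
- move=> y w; rewrite mem_vb// => yB /edge_dist/andP[_ h].
  have hw : dist z0 w <= r + 2 by have := dist_triangle G z0 y w; lra.
  rewrite /U mulr1 mulNr [X in _ - X]mulrC -mulrBl divr_ge0 ?(ltW k0)// subr_ge0.
  by rewrite -dist_sqr lerXn2r ?nnegrE ?dist_ge0// addr_ge0.
- rewrite /U mulr1 mulNr [X in _ - X]mulrC -mulrBl divr_ge0 ?(ltW k0)// subr_ge0.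
  by rewrite -dist_sqr distxx expr0n sqr_ge0.
Qed.

(* The number of visits before leaving B is geometric: [u x / u x] is the
   probability of a visit, [1 - (rate G x * u x)^-1] that of a return. *)
Lemma visits_lower_bound B x u n z (k : nat) : x \in B -> is_green B x u ->
  u z / u x * (1 - (rate G x * u x)^-1) ^+ k - survival B n z <=
  EX n z (fun p => (k.+1 <= count_mem x (killed B (belast z p)))%N%:R).
Proof.
move=> xB gu; have ux y := green_le_self y gu; have u_ge y := green_ge0 y gu.
have [u0 lu] := gu; have r0 := rate_gt0 G x.
have h1 : 1 <= rate G x * u x.
  have := lu x xB; rewrite eqxx /= => h.
  have : rate G x * u x - 1 = \sum_(w <- nb x) cond x w * u w.
    have : lap G u x = \sum_(w <- nb x) cond x w * u w - rate G x * u x.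
      rewrite /lap /rate mulr_suml -sumrB.
      by apply: eq_bigr => w _; ring.
    by rewrite h => ?; lra.
  move=> E; rewrite -subr_ge0 E big_seq; apply: sumr_ge0 => w xw.
  by rewrite mulr_ge0// ltW// cond_gt0.
have uxp : 0 < u x by rewrite -(pmulr_rgt0 _ r0); lra.
set rho := 1 - _.
have rho0 : 0 <= rho by rewrite subr_ge0 invf_le1//; lra.
have rho1 : rho <= 1 by rewrite lerBlDr lerDl invr_ge0; lra.
have hx y : avg G (fun v => u v / u x) y = avg G u y / u x.
  transitivity (avg G (fun w => (u x)^-1 * u w + 0 * 0) y).
    by apply: eq_avg => w _; ring.
  by rewrite (avg_lin _ (fun=> 0)) mul0r addr0 mulrC.
have avgx : avg G u x / u x = rho.
  rewrite avg_lap lu// eqxx /rho mulNr mul1r mulrBl divff ?gt_eqF// invfM.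
  by [].
have avgy y : y \in B -> y != x -> avg G u y = u y.
  by move=> yB yx; rewrite avg_lap lu// (negbTE yx) oppr0 mul0r addr0.
elim: n z k => [|n IH] z k.
  rewrite /survival /= subr_le0; apply: (@le_trans _ _ (1 * 1)); last by rewrite mulr1.
  apply: ler_pM; rewrite ?divr_ge0 ?exprn_ge0//; last by rewrite exprn_ile1.
  by rewrite ler_pdivrMr// mul1r.
rewrite survivalS; case: (boolP (z \in B)) => zB; last first.
  rewrite u0// !mul0r subr0; apply: EX_ge0 => p _; exact: ler0n.
have [zx|zx] := eqVneq z x; last first.
  have -> : EX n.+1 z (fun p => (k.+1 <= count_mem x (killed B (belast z p)))%N%:R) =
     avg G (fun w => EX n w (fun p => (k.+1 <= count_mem x (killed B (belast w p)))%N%:R)) z.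
    by apply: eq_avg => w _; apply: eq_EX => p _ /=; rewrite zB /= (negbTE zx).
  have -> : u z / u x * rho ^+ k - avg G (survival B n) z =
    avg G (fun w => u w / u x * rho ^+ k - survival B n w) z.
    transitivity (avg G (fun w => rho ^+ k * (u w / u x) + (- 1) * survival B n w) z).
      by rewrite (avg_lin (fun w => u w / u x)) hx avgy//; ring.
    by apply: eq_avg => w _; ring.
  by apply: avg_le => w _; exact: IH.
rewrite zx divff ?gt_eqF// mul1r.
have -> : EX n.+1 x (fun p => (k.+1 <= count_mem x (killed B (belast x p)))%N%:R) =
     avg G (fun w => EX n w (fun p => (k <= count_mem x (killed B (belast w p)))%N%:R)) x.
  by apply: eq_avg => w _; apply: eq_EX => p _ /=; rewrite xB /= eqxx.
case: k => [|k].
  rewrite expr0 (_ : avg G (fun w => EX _ _ _) x = 1).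
    rewrite lerBlDr lerDl -[leLHS](avg_const 0 x); apply: avg_le => w _.
    by case/andP: (survival_itv B n w).
  by rewrite -[RHS](avg_const 1 x); apply: eq_avg => w _; rewrite -[RHS](EX_const n w).
have -> : rho ^+ k.+1 - avg G (survival B n) x =
    avg G (fun w => u w / u x * rho ^+ k - survival B n w) x.
  transitivity (avg G (fun w => rho ^+ k * (u w / u x) + (- 1) * survival B n w) x).
    by rewrite (avg_lin (fun w => u w / u x)) hx avgx exprS; ring.
  by apply: eq_avg => w _; ring.
by apply: avg_le => w _; exact: IH.
Qed.

(** The squared distance from x0 plus 4 times the number of remaining steps is a supermartingale;
    this is its maximal inequality. *)
Lemma exit_bound x0 (r : R) n z : 0 < r ->
  EX n z (fun p => (has (fun v => r < dist x0 v) (z :: p))%:R) <=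
  (gd2 x0 z + 4 * n%:R) / r ^+ 2.
Proof.
move=> r0; have r2 : 0 < r ^+ 2 by rewrite exprn_gt0.
elim: n z => [|n IH] z; rewrite ler_pdivlMr//.
  rewrite /= mulr0 addr0 orbF; case: ltP => h; last by rewrite mul0r gd2_ge0.
  by rewrite mul1r -dist_sqr lerXn2r ?nnegrE ?dist_ge0 ?ltW.
have [h|h] := ltP r (dist x0 z).
  apply: (@le_trans _ _ (1 * r ^+ 2)).
    apply: ler_wpM2r; first exact: ltW.
    by rewrite -[leRHS](EX_const n.+1 z); apply: EX_le => p _; case: has.
  rewrite mul1r; apply: (@le_trans _ _ (gd2 x0 z)); last by rewrite lerDl mulr_ge0.
  by rewrite -dist_sqr lerXn2r ?nnegrE ?dist_ge0 ?ltW.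
have -> : EX n.+1 z (fun p => (has (fun v => r < dist x0 v) (z :: p))%:R) =
   avg G (fun w => EX n w (fun p => (has (fun v => r < dist x0 v) (w :: p))%:R)) z.
  apply: eq_avg => w _; apply: eq_EX => p _.
  by rewrite [has _ (z :: _)]/= ltNge h.
rewrite -ler_pdivlMr//.
apply: (@le_trans _ _ (avg G (fun w => (gd2 x0 w + 4 * n%:R) / r ^+ 2) z)).
  by apply: avg_le => w _; exact: IH.
have -> : avg G (fun w => (gd2 x0 w + 4 * n%:R) / r ^+ 2) z =
    (avg G (gd2 x0) z + 4 * n%:R) / r ^+ 2.
  transitivity (avg G (fun w => (r ^+ 2)^-1 * gd2 x0 w + (4 * n%:R / r ^+ 2) * 1) z).
    by apply: eq_avg => w _; ring.
  by rewrite (avg_lin _ (fun=> 1)) avg_const; ring.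
rewrite ler_wpM2r ?invr_ge0 ?(ltW r2)//.
have /andP[_ h'] := avg_gd2 x0 z; rewrite -natr1; lra.
Qed.

Fixpoint window_success (suc : pred (seq V)) (T m : nat) s : bool :=
  if m is m'.+1 then suc (take T s) || window_success suc T m' (drop T s) else false.

(** The Markov property at multiples of T: a window fails with probability at most q wherever it
    starts. [belast] gives each window its first vertex and leaves its last one to the next
    window. *)
Lemma window_failure (suc : pred (seq V)) (T m : nat) (q : R) z : 0 <= q ->
  (forall y, EX T y (fun p => (~~ suc (belast y p))%:R) <= q) ->
  EX (m * T) z (fun p => (~~ window_success suc T m (belast z p))%:R) <= q ^+ m.
Proof.
move=> q0 hq; elim: m z => [|m IH] z; first by rewrite expr0 mul0n.
rewrite mulSn EX_cat.
apply: (@le_trans _ _ (EX T z (fun p => (~~ suc (belast z p))%:R * q ^+ m))).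
  apply: EX_le => p pT.
  have E r : belast z (p ++ r) = belast z p ++ belast (last z p) r.
    by elim: p z {pT IH} => //= a p IH z; rewrite IH.
  case: (boolP (suc (belast z p))) => sp.
    rewrite mul0r -[leRHS](EX_const (m * T) (last z p)); apply: EX_le => r _.
    by rewrite E /= take_size_cat ?size_belast// sp.
  rewrite mul1r; apply: le_trans (IH (last z p)); apply: EX_le => r _.
  rewrite E /= take_size_cat ?size_belast// drop_size_cat ?size_belast//.
  by rewrite (negbTE sp).
rewrite exprS -[X in X <= _]addr0 -[X in _ + X](mul0r (EX T z (fun=> 0))).
have -> : EX T z (fun p => (~~ suc (belast z p))%:R * q ^+ m) =
    q ^+ m * EX T z (fun p => (~~ suc (belast z p))%:R) + 0 * EX T z (fun=> 0).
  by rewrite -EX_lin; apply: eq_EX => p _; ring.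
by rewrite !mul0r !addr0 mulrC ler_wpM2r// exprn_ge0.
Qed.

End Chain.

(** * Moments of local times *)

Section GreenFunction.
Variables (R : realType) (V : choiceType) (G : rhombic_graph R V).
Local Notation nb := (nb G).
Local Notation gd2 := (gd2 G).
Local Notation s0 := (gs G).
Local Notation cond := (cond G).
Local Notation rate := (rate G).
Local Notation avg := (avg G).
Local Notation dist := (dist G).
Local Notation lap := (lap G).
Local Notation is_green := (is_green G).
Local Notation vb := (vb G).
Implicit Types (x y z w p : V) (f u : V -> R) (B D : seq V).

Definition gr B z : V -> R := xget (fun=> 0) [set u | is_green B z u].

Lemma grP B z : z \in B -> is_green B z (gr B z).
Proof.
by move=> zB; rewrite /gr; case: xgetP => [u -> //|h]; have [u /h] := green_exists G zB.
Qed.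

Lemma gr_ge0 B z y : z \in B -> 0 <= gr B z y.
Proof. by move=> zB; exact: green_ge0 (grP zB). Qed.

(** The leading order of the Green function on the diagonal, in a disc of radius [expR L]. *)
Definition scale (L : R) : R := L / (2 * pi).

Lemma scale_gt0 (L : R) : 0 < L -> 0 < scale L.
Proof. by move=> L0; rewrite divr_gt0// mulr_gt0// pi_gt0. Qed.

(** [green_estimate] on the logarithmic scale, with distances written as [expR (s * L)]. The upper
    bound with s = 0 asks for no distance, as [lnp] is nonnegative; factors such as 4 disappear in
    [e]. *)
Lemma gr_bounds (e : R) : 0 < e -> exists2 L0, 1 <= L0 & forall L z0 z p,
  L0 <= L -> z \in vb z0 (expR L) -> dist z0 p <= expR L / 2 ->
  (forall s, 0 <= s -> s = 0 \/ expR (s * L) <= dist p z ->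
     gr (vb z0 (expR L)) z p <= (1 - s + e) * scale L) /\
  (forall s, 0 <= s -> dist p z <= 4 * expR (s * L) ->
     (1 - s - e) * scale L <= gr (vb z0 (expR L)) z p).
Proof.
move=> e0; have e2 : 0 < e / 2 by rewrite divr_gt0.
have [R0 R01 hR] := green_estimate G e2.
have pi2 : 0 < 2 * pi :> R by rewrite mulr_gt0// pi_gt0.
have ln4 : 0 <= ln 4 :> R by rewrite ln_ge0//; lra.
exists (1 + ln R0 + 2 * ln 4 / e) => [|L z0 z p hL zB zp].
  have : 0 <= ln R0 by rewrite ln_ge0.
  have : 0 <= 2 * ln 4 / e by rewrite divr_ge0 ?mulr_ge0// ltW.
  lra.
have lR0 : 0 <= ln R0 by rewrite ln_ge0.
have l4e : 0 <= 2 * ln 4 / e by rewrite divr_ge0 ?mulr_ge0// ltW.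
have L0 : 0 < L by lra.
have he : ln 4 <= e / 2 * L.
  have : 2 * ln 4 / e <= L by lra.
  by rewrite ler_pdivrMr//; lra.
have RL : R0 <= expR L.
  have R00 : 0 < R0 by lra.
  by rewrite -[leLHS]lnK ?posrE// ler_expR; lra.
have := hR z0 (expR L) _ p z RL zB (grP zB) zp.
set u := gr _ _ _; rewrite expRK ler_distl => /andP[h1 h2].
have E (c : R) : c * scale L = c * L / (2 * pi) by rewrite /scale mulrA.
split=> s s00 hs; rewrite E.
  rewrite ler_pdivlMr// mulrC; apply: (le_trans h2).
  suff : s * L <= lnp (dist p z) by lra.
  case: hs => [->|hs].
    by rewrite mul0r /lnp ln_ge0// le_max lexx orbT.
  rewrite -[leLHS]expRK /lnp ler_ln ?posrE ?expR_gt0//.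
    by rewrite le_max hs.
  by rewrite lt_max ltr01 orbT.
rewrite ler_pdivrMr// mulrC mulrC [leRHS]mulrC; apply: le_trans h1.
suff : lnp (dist p z) <= s * L + ln 4 by lra.
have -> : s * L + ln 4 = ln (4 * expR (s * L)).
  by rewrite lnM ?posrE ?expR_gt0// expRK addrC.
rewrite /lnp ler_ln ?posrE ?mulr_gt0 ?expR_gt0//; last by rewrite lt_max ltr01 orbT.
rewrite ge_max hs/=; have : 1 <= expR (s * L) by rewrite -expR0 ler_expR mulr_ge0// ltW.
lra.
Qed.

Definition annulus x (L s e : R) : seq V :=
  [seq y <- vb x (expR (s * L)) | expR ((s - e) * L) < dist x y].

Definition mean D f : R := (\sum_(y <- D) f y) / (size D)%:R.

Lemma mean_ge D f (M : R) : (0 < size D)%N -> (forall y, y \in D -> M <= f y) -> M <= mean D f.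
Proof.
move=> D0 h; rewrite /mean ler_pdivlMr ?ltr0n//.
rewrite mulrC -lerN2 -sumrN -mulrN.
by apply: sum_le_size => y yD; rewrite lerN2; exact: h.
Qed.

(** A disc of radius [expR ((s - e) * L)] is smaller than the annulus by a factor of order
    [expR (- (2 * e * L))]. The vertices of the annulus near a given p are thus too few for the
    singularity at p to affect means. *)
Lemma annulus_size (s e : R) : inhabited V -> 0 < e < s -> e < 1 -> exists2 L0, 1 <= L0 & forall L x p,
  L0 <= L -> 0 < (size (annulus x L s e))%:R :> R /\
  (size [seq y <- annulus x L s e | dist p y < expR ((s - e) * L)])%:R <=
    e * (size (annulus x L s e))%:R.
Proof.
move=> iV /andP[e0 es] e1; have s00 := lt_trans e0 es; have [C C0 hC] := count_le G.
have h1 : 0 <= 12 / s by rewrite divr_ge0// ltW.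
have h2 : 0 <= 1152 * C / e / (2 * e).
  apply: divr_ge0; [apply: divr_ge0; [|exact: ltW]|by rewrite mulr_ge0// ltW].
  by apply: mulr_ge0; [exact: ler0n|exact: ltW].
exists (1 + 12 / s + 1152 * C / e / (2 * e)) => [|L x p hL]; first lra.
have L0 : 0 < L by lra.
set X := expR (s * L); set Y := expR ((s - e) * L).
have X12 : 12 <= X.
  apply: le_trans (expR_ge1Dx _).
  have : 12 / s <= L by lra.
  by rewrite ler_pdivrMr//; lra.
have X0 : 0 < X := expR_gt0 _; have Y0 : 0 < Y := expR_gt0 _.
have XY : X = Y * expR (e * L) by rewrite -expRD -mulrDl subrK.
have hXY : 1152 * C * (Y ^+ 2) <= e * X ^+ 2.
  rewrite XY exprMn [leRHS]mulrCA [leLHS]mulrC; apply: ler_wpM2l; first exact: sqr_ge0.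
  rewrite [leRHS]mulrC -ler_pdivrMr// -expRM_natl.
  apply: le_trans (expR_ge1Dx _).
  have : 1152 * C / e / (2 * e) <= L by lra.
  rewrite ler_pdivrMr ?mulr_gt0// mulrC => h.
  have -> : 2%:R * (e * L) = 2 * e * L by ring.
  lra.
have nX := @gball_count_ge _ _ G (gx G x) (gy G x) X iV X12; rewrite -/(vb x X) in nX.
have Y1 : 1 <= Y by rewrite -expR0 ler_expR mulr_ge0 ?(ltW L0)// subr_ge0 ltW.
have small q (r : seq V) : uniq r -> (forall y, y \in r -> dist q y <= Y) ->
    (size r)%:R <= 4 * C * Y ^+ 2.
  move=> ur hr; apply: le_trans (hC q Y r (ltW Y0) ur hr) _.
  have -> : 4 * C * Y ^+ 2 = C * (2 * Y) ^+ 2 by ring.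
  by rewrite ler_wpM2l ?(ltW C0)// lerXn2r ?nnegrE//; move: Y1; clear; lra.
set D := annulus x L s e.
have hD : X ^+ 2 / 288 <= (size D)%:R.
  have := size_filter (fun y => expR ((s - e) * L) < dist x y) (vb x X).
  have := count_predC (fun y => expR ((s - e) * L) < dist x y) (vb x X).
  rewrite -!size_filter -/D -/(annulus x L s e) -/D => E _.
  have := small x [seq y <- vb x X | predC (fun y => expR ((s - e) * L) < dist x y) y].
  rewrite filter_uniq ?vb_uniq// => /(_ isT) h.
  have {}h : (size [seq y <- vb x X | predC (fun y => expR ((s - e) * L) < dist x y) y])%:R <= 4 * C * Y ^+ 2.
    by apply: h => y; rewrite mem_filter /= -leNgt => /andP[].
  move: nX; rewrite -E natrD => nX.
  have h5 : e * X ^+ 2 <= X ^+ 2 by rewrite ler_piMl ?sqr_ge0// ltW.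
  move: nX h hXY h5; rewrite expr_div_n (_ : 12 ^+ 2 = 144); last by ring.
  rewrite -(mulrA 4) -(mulrA 1152); move: (X ^+ 2) (C * Y ^+ 2) => *; lra.
split.
  by apply: lt_le_trans hD; apply: divr_gt0; [exact: exprn_gt0|rewrite ltr0n].
apply: (@le_trans _ _ (4 * C * Y ^+ 2)).
  apply: (small p); first by rewrite filter_uniq// filter_uniq// vb_uniq.
  by move=> y; rewrite mem_filter => /andP[/ltW].
apply: (@le_trans _ _ (e * (X ^+ 2 / 288))); last by rewrite ler_wpM2l// ltW.
move: hXY; rewrite (mulrA e) -(mulrA 4) -(mulrA 1152); move: (C * Y ^+ 2) => k h; lra.
Qed.

Lemma scale_shrink (c d : R) : c < d -> exists2 L0, 1 <= L0 & forall L, L0 <= L ->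
  8 * expR (c * L) <= expR (d * L).
Proof.
move=> cd; have dc : 0 < d - c by rewrite subr_gt0.
exists (1 + 8 / (d - c)) => [|L hL]; first by rewrite lerDl divr_ge0// ltW.
have -> : expR (d * L) = expR ((d - c) * L) * expR (c * L) by rewrite -expRD -mulrDl subrK.
rewrite ler_wpM2r ?expR_ge0//; apply: le_trans (expR_ge1Dx _).
have : 8 / (d - c) <= L by lra.
by rewrite ler_pdivrMr//; lra.
Qed.

Lemma mem_annulus x (L s e : R) y :
  (y \in annulus x L s e) = (expR ((s - e) * L) < dist x y) && (dist x y <= expR (s * L)).
Proof. by rewrite mem_filter mem_vb// expR_ge0. Qed.

(** Averaging over the annulus at scale s caps the Green function at about 1 - s times [scale L],
    even close to the annulus: the few near points, at most a fraction [e], have Green value at most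
    1 + e in this unit, and e (1 + e) + 2 e is at most 4 e. *)
Lemma annulus_green (s sigma e : R) : inhabited V -> 0 < e < s -> s <= sigma < 1 ->
  exists2 L0, 1 <= L0 & forall L z0 x, L0 <= L -> dist z0 x <= expR (sigma * L) ->
  let B := vb z0 (expR L) in let D := annulus x L s e in
  [/\ (0 < size D)%N,
      forall y, y \in D -> y \in B /\ dist z0 y <= expR L / 2,
      forall p, dist z0 p <= expR L / 2 ->
        mean D (fun y => gr B y p) <= (1 - s + 4 * e) * scale L &
      [/\ forall p, dist z0 p <= expR L / 2 -> dist x p <= expR (s * L) ->
        (1 - s - e) * scale L <= mean D (fun y => gr B y p),
      forall y, y \in D -> gr B x y <= (1 - s + 2 * e) * scale L &
      forall x' y, x' \in B -> dist x x' <= expR (s * L) -> y \in D ->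
        (1 - s - e) * scale L <= gr B x' y]].
Proof.
move=> iV /andP[e0 es] /andP[ss s1]; have e1 : e < 1 by lra.
have [L1 L11 h1] := annulus_size iV (introT andP (conj e0 es)) e1.
have [L2 L21 h2] := gr_bounds e0.
have [L3 L31 h3] := scale_shrink s1.
exists (L1 + L2 + L3) => [|L z0 x hL zx B D]; first lra.
have L0 : 0 < L by lra.
have [|D0 _] := h1 L x x; first lra.
have {}h1 p : (size [seq y <- D | dist p y < expR ((s - e) * L)])%:R <= e * (size D)%:R.
  by apply: (h1 L x p _).2; lra.
have {}h3 : 8 * expR (sigma * L) <= expR L by rewrite -[in leRHS](mul1r L); apply: h3; lra.
have hs : expR (s * L) <= expR (sigma * L) by rewrite ler_expR ler_pM2r.
have eL0 := expR_gt0 (sigma * L).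
have g0 := scale_gt0 L0.
have s00 : 0 <= s by lra.
have se0 : 0 <= s - e by lra.
have hin y : dist x y <= expR (s * L) -> y \in B /\ dist z0 y <= expR L / 2.
  move=> h; have h' : dist z0 y <= expR L / 2.
    by have := dist_triangle G z0 x y; lra.
  by split => //; rewrite mem_vb ?expR_ge0//; have := expR_gt0 L; lra.
have DB y : y \in D -> y \in B /\ dist z0 y <= expR L / 2.
  by rewrite mem_annulus => /andP[_]; exact: hin.
have hx : x \in B /\ dist z0 x <= expR L / 2 by apply: hin; rewrite distxx expR_ge0.
have L2L : L2 <= L by lra.
split=> //; first by rewrite -(ltr0n R).
- move=> p zp; rewrite /mean ler_pdivrMr//.
  rewrite (bigID (fun y => dist p y < expR ((s - e) * L)))/=.
  have A1 : \sum_(y <- D | dist p y < expR ((s - e) * L)) gr B y p <=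
      e * (size D)%:R * ((1 + e) * scale L).
    rewrite -big_filter; apply: (@le_trans _ _ ((size [seq y <- D | dist p y < expR ((s - e) * L)])%:R * ((1 + e) * scale L))).
      apply: sum_le_size => y; rewrite mem_filter => /andP[_ yD].
      have [+ _] := @h2 L z0 y p L2L (DB y yD).1 zp.
      by move=> /(_ 0 (lexx _) (or_introl erefl)); rewrite subr0.
    by apply: ler_wpM2r => //; rewrite mulr_ge0 ?(ltW g0)//; lra.
  have A2 : \sum_(y <- D | ~~ (dist p y < expR ((s - e) * L))) gr B y p <=
      (size D)%:R * ((1 - s + 2 * e) * scale L).
    rewrite -big_filter; apply: (@le_trans _ _ ((size [seq y <- D | ~~ (dist p y < expR ((s - e) * L))])%:R * ((1 - s + 2 * e) * scale L))).
      apply: sum_le_size => y; rewrite mem_filter -leNgt => /andP[py yD].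
      have [+ _] := @h2 L z0 y p L2L (DB y yD).1 zp.
      move=> /(_ (s - e) se0 (or_intror py)).
      by rewrite (_ : 1 - (s - e) + e = 1 - s + 2 * e)//; ring.
    apply: ler_wpM2r; first by rewrite mulr_ge0 ?(ltW g0)//; lra.
    by rewrite ler_nat size_filter count_size.
  apply: le_trans (lerD A1 A2) _.
  have -> : e * (size D)%:R * ((1 + e) * scale L) + (size D)%:R * ((1 - s + 2 * e) * scale L)
     = (e * (1 + e) + (1 - s + 2 * e)) * scale L * (size D)%:R by ring.
  rewrite ler_pM2r// ler_pM2r//; have : e * e <= e * 1 by rewrite ler_wpM2l// ltW.
  by move: e0; clear; lra.
- split.
  + move=> p zp xp; apply: mean_ge; first by rewrite -(ltr0n R).
    move=> y yD; have [_ +] := h2 L z0 y p L2L (DB y yD).1 zp; apply => //.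
    have := dist_triangle G p x y; rewrite (dist_sym G p x).
    by move: yD; rewrite mem_annulus => /andP[_]; have := expR_gt0 (s * L); lra.
  + move=> y yD; have [+ _] := @h2 L z0 x y L2L hx.1 (DB y yD).2.
    move=> /(_ (s - e) se0 (or_intror _)); rewrite dist_sym.
    rewrite (_ : 1 - (s - e) + e = 1 - s + 2 * e); last by ring.
    by apply; move: yD; rewrite mem_annulus => /andP[/ltW].
  + move=> x' y x'B xx' yD; have [_ +] := h2 L z0 x' y L2L x'B (DB y yD).2; apply => //.
    have := dist_triangle G y x x'; rewrite (dist_sym G y x).
    by move: yD; rewrite mem_annulus => /andP[_]; have := expR_gt0 (s * L); lra.
Qed.

End GreenFunction.

(** * Exponential moments from potentials of point charges and an annulus *)

Section Moments.
Variables (R : realType) (V : choiceType) (G : rhombic_graph R V).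
Local Notation nb := (nb G).
Local Notation gd2 := (gd2 G).
Local Notation s0 := (gs G).
Local Notation rate := (rate G).
Local Notation avg := (avg G).
Local Notation dist := (dist G).
Local Notation is_green := (is_green G).
Local Notation vb := (vb G).
Local Notation gr := (gr G).
Local Notation EX := (EX G).
Local Notation annulus := (annulus G).
Implicit Types (x y z w : V) (f u : V -> R) (B D r : seq V) (Q : pred (seq V)).

(** The mean local time at x given the embedded path: the number of visits divided by the rate. *)
Definition ltime x r : R := occ G (fun y => (y == x)%:R) r.

Lemma ltime_count x r : ltime x r = (count_mem x r)%:R / rate x.
Proof.
rewrite /ltime /occ; elim: r => [|y r IH]; first by rewrite big_nil mul0r.
rewrite big_cons IH/= natrD mulrDl; by have [->|_] := eqVneq y x; rewrite ?mul0r.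
Qed.

Lemma ltime_ge0 x r : 0 <= ltime x r.
Proof. by rewrite ltime_count divr_ge0// ltW// rate_gt0. Qed.

Definition PX B n z Q : R := EX n z (fun p => (Q (killed B (belast z p)))%:R).

Lemma mean_lap D (F : V -> V -> R) p : lap G (fun q => mean D (F ^~ q)) p = mean D (fun y => lap G (F y) p).
Proof.
rewrite /mean /lap [in RHS]exchange_big/= [RHS]mulr_suml; apply: eq_bigr => w _.
by rewrite -mulrBl -sumrB -mulr_sumr !mulrA.
Qed.

Lemma mean_ge0 D f : (forall y, y \in D -> 0 <= f y) -> 0 <= mean D f.
Proof. by move=> h; rewrite divr_ge0// big_seq sumr_ge0. Qed.

(** The potential of charges c at x and x' and of a charge b spread evenly over D. The constant
    makes its value 1 outside B. *)
Definition pot B D x x' (c b : R) (p : V) : R :=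
  1 + c * (gr B x p + gr B x' p) + b * mean D (fun y => gr B y p).

Lemma lap_pot B D x x' (c b : R) p : x \in B -> x' \in B -> {subset D <= B} -> p \in B ->
  lap G (pot B D x x' c b) p = - (c * ((p == x)%:R + (p == x')%:R) + b * mean D (fun y => (p == y)%:R)).
Proof.
move=> xB x'B DB pB.
have lg y : y \in B -> lap G (gr B y) p = - (p == y)%:R by move=> yB; have [_ ->] := grP G yB.
transitivity (lap G (fun q => 1 * 1 + 1 * (c * (1 * gr B x q + 1 * gr B x' q) + b * mean D (fun y => gr B y q))) p).
  by apply: eq_bigr => w _; rewrite /pot !mul1r !addrA.
rewrite (lap_lin G (fun=> 1)) lap_const (lap_lin G (fun q => 1 * gr B x q + 1 * gr B x' q)) (lap_lin G (gr B x)).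
rewrite !lg// mean_lap (_ : mean D _ = - mean D (fun y => (p == y)%:R)); first by ring.
rewrite /mean -mulNr -sumrN; congr (_ / _); apply: eq_big_seq => y /DB; exact: lg.
Qed.

(* A negative [v2] uses an upper bound on the local times in [D], which is how
   the truncation enters the second moment. *)
Lemma pot_moment B D x x' (c b v1 v2 k : R) n z Q (E : R) : x \in B -> x' \in B ->
  {subset D <= B} -> 0 < k -> (forall p, k <= pot B D x x' c b p) ->
  v1 * pot B D x x' c b x <= c -> v1 * pot B D x x' c b x' <= c ->
  (forall y, y \in D -> v2 * pot B D x x' c b y <= b) ->
  (forall r, Q r -> E <= v1 * (ltime x r + ltime x' r) + v2 * mean D (ltime^~ r)) ->
  PX B n z Q <= pot B D x x' c b z / k * expR (- E).
Proof.
move=> xB x'B DB k0 uk h1 h2 hD hQ; set u := pot _ _ _ _ _ _ in uk h1 h2 hD *.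
pose v p := v1 * ((p == x)%:R + (p == x')%:R) + v2 * mean D (fun y => (p == y)%:R).
have vE r : occ G v r = v1 * (ltime x r + ltime x' r) + v2 * mean D (ltime^~ r).
  rewrite /mean (eq_big_seq (fun y => \sum_(q <- r) (q == y)%:R / rate q))//.
  rewrite exchange_big/= mulr_suml /ltime /occ -big_split/= !mulr_sumr -big_split/=.
  apply: eq_bigr => q _; rewrite /v /mean -mulr_suml; ring.
have hE : EX n z (fun p => expR (occ G v (killed B (belast z p)))) <= u z / k.
  apply: exponential_moment => // y yB.
  rewrite lap_pot// opprK /v mulrDl; apply: lerD.
    rewrite -mulrA mulrDl mulrDr [leRHS]mulrDr; apply: lerD.
      by have [->|_] := eqVneq y x; rewrite ?mul0r ?mulr0// mul1r mulr1.
    by have [->|_] := eqVneq y x'; rewrite ?mul0r ?mulr0// mul1r mulr1.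
  rewrite mulrAC; have [yD|yD] := boolP (y \in D).
    by apply: ler_wpM2r; [apply: mean_ge0 => *; exact: ler0n|exact: hD].
  rewrite (_ : mean D _ = 0) ?mulr0// /mean big_seq big1 ?mul0r// => d dD.
  by case: eqP => // yd; rewrite yd dD in yD.
rewrite expRN ler_pdivlMr ?expR_gt0//; apply: le_trans hE.
rewrite /PX mulrC.
apply: (@le_trans _ _ (EX n z (fun p => expR E * (Q (killed B (belast z p)))%:R + 0 * 0))).
  by rewrite (EX_lin G n z _ (fun=> 0)) mul0r addr0.
apply: EX_le => p _; rewrite mul0r addr0; case: (boolP (Q _)) => hp.
  by rewrite mulr1 ler_expR vE; exact: hQ.
by rewrite mulr0 expR_ge0.
Qed.

End Moments.

(** * Chernoff bounds for one point, for a pair and for atypical annuli *)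

Section Bounds.
Variables (R : realType) (V : choiceType) (G : rhombic_graph R V).
Local Notation nb := (nb G).
Local Notation dist := (dist G).
Local Notation vb := (vb G).
Local Notation gr := (gr G).
Local Notation annulus := (annulus G).
Local Notation ltime := (ltime G).
Local Notation PX := (PX G).
Implicit Types (x y z w : V) (B D r : seq V) (Q : pred (seq V)).

(** Equal to [a / pi * L ^+ 2]. In this form an exponential variable of mean [scale L] exceeds it
    with probability [expR (- (2 * a * L))]. *)
Definition level (a L : R) : R := 2 * a * L * scale L.

(** A charge so large that the constant 1 in the potential hardly counts brings the Chernoff
    parameter close to its critical value 1 / [gr B x x]: the total charge is [e^-1 / scale L], and
    with M the bound on the potential, M e = 1 + 2 e. Both points of [pot_moment] are x. *)
Lemma single_bound (a e : R) : 0 <= a -> 0 < e -> exists C, exists2 L0, 1 <= L0 &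
  forall L z0 z x n Q, L0 <= L -> dist z0 x <= expR L / 2 ->
  (forall r, Q r -> level a L <= ltime x r) ->
  PX (vb z0 (expR L)) n z Q <= C * expR (- (2 * a * (1 - 2 * e) * L)).
Proof.
move=> a0 e0; have [L0 L01 hL0] := gr_bounds G e0.
exists (1 + e^-1 * (1 + e)); exists L0 => // L z0 z x n Q LL zx hQ.
have L0' : 0 < L by lra.
have g0 := scale_gt0 L0'; set B := vb z0 (expR L).
have xB : x \in B by rewrite mem_vb ?expR_ge0//; have := expR_gt0 L; lra.
have gxx : gr B x x <= (1 + e) * scale L.
  have [+ _] := hL0 L z0 x x LL xB zx.
  by move=> /(_ 0 (lexx _) (or_introl erefl)); rewrite subr0.
pose c := e^-1 / (2 * scale L).
have c0 : 0 < c by rewrite divr_gt0 ?invr_gt0// mulr_gt0.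
have hc : c * (2 * scale L) = e^-1 by rewrite divfK// gt_eqF// mulr_gt0.
have potE w : pot G B [::] x x c 0 w = 1 + 2 * c * gr B x w.
  by rewrite /pot mul0r addr0; ring.
have potU w : pot G B [::] x x c 0 w <= 1 + e^-1 * (1 + e).
  rewrite potE lerD2l (_ : e^-1 * _ = 2 * c * ((1 + e) * scale L)); last first.
    by rewrite -hc; ring.
  apply: ler_wpM2l; first by rewrite mulr_ge0// ltW.
  by apply: le_trans gxx; exact: green_le_self (grP G xB).
pose M := 1 + e^-1 * (1 + e).
have M0 : 0 < M by rewrite ltr_wpDr// mulr_ge0 ?invr_ge0 ?ltW//; lra.
have hM : M * e = 1 + 2 * e.
  by rewrite /M mulrDl mul1r mulrAC mulVf ?gt_eqF//; ring.
apply: le_trans (@pot_moment _ _ G B [::] x x c 0 (c / M) 0 1 n z Q (2 * a * (1 - 2 * e) * L) xB xB _ ltr01 _ _ _ _ _) _ => //.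
- by move=> p; rewrite potE lerDl; apply: mulr_ge0; [rewrite mulr_ge0 ?(ltW c0)|exact: gr_ge0].
- by rewrite -mulrA ger_pMr// ler_pdivrMl// mulr1; exact: potU.
- by rewrite -mulrA ger_pMr// ler_pdivrMl// mulr1; exact: potU.
- move=> r /hQ h; rewrite mul0r addr0.
  apply: (@le_trans _ _ (c / M * (level a L + level a L))); last first.
    by apply: ler_wpM2l; [rewrite divr_ge0// ltW|exact: lerD].
  have -> : c / M * (level a L + level a L) = c * (2 * scale L) / M * (2 * a * L).
    by rewrite /level; ring.
  rewrite hc -invfM mulrC mulrC (mulrC e) hM mulrC [leLHS](_ : _ = (1 - 2 * e) * (2 * a * L)); last by ring.
  rewrite ler_wpM2r ?mulr_ge0 ?(ltW L0')//.
  by rewrite -[leRHS]mul1r ler_pdivlMr; [nra|lra].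
- by rewrite divr1 ler_wpM2r ?expR_ge0//; exact: potU.
Qed.

(** Write q = 1 - s and measure in units of [scale L]. Charges 1 at x and x' and -1 on the annulus
    give the potential 1 + q - q = 1 at both points and q + q - q = q on the annulus. The parameters
    are thus 1 and -1 / q, and the exponent per L is 4 a - 2 a q = 2 a (1 + s). *)
Lemma pair_bound (a s sigma rho e1 : R) : inhabited V -> 0 < a <= 1 -> 0 < s -> s <= sigma < 1 ->
  0 < rho -> 0 < e1 -> exists2 e0, 0 < e0 & forall e, 0 < e <= e0 ->
  exists C, exists2 L0, 1 <= L0 & forall L z0 x x' n Q (s' : R), L0 <= L ->
  dist z0 x <= expR (sigma * L) -> dist z0 x' <= expR (sigma * L) ->
  dist x x' <= expR (s * L) -> 0 <= s' -> s <= s' + rho -> s' = 0 \/ expR (s' * L) <= dist x x' ->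
  (forall r, Q r -> [/\ level a L <= ltime x r, level a L <= ltime x' r &
     mean (annulus x L s e) (ltime^~ r) <= level (a * (1 - s) ^+ 2 + e1) L]) ->
  PX (vb z0 (expR L)) n z0 Q <= C * expR (- ((2 * a * (1 + s) - 8 * rho - 2 * e1 / (1 - s)) * L)).
Proof.
move=> iV /andP[a0 a1] s00 ss rho0 e10; have /andP[ss1 ss2] := ss.
pose q := 1 - s; have q0 : 0 < q by rewrite /q; lra.
(* The strength of the charges: [gam * rho >= 2] pays for the constant 1 and for the errors at x and
   x', and [gam * q >= 1] keeps the potential at least 1 on D. *)
pose gam := 2 / rho + 1 / q; have gam0 : 0 < gam by rewrite addr_gt0// divr_gt0.
have gamr : 2 <= gam * rho by rewrite /gam mulrDl divfK ?gt_eqF// lerDl mulr_ge0 ?divr_ge0 ?ltW.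
have gamq : 1 <= gam * q.
  rewrite /gam mulrDl [1 / q * q]divfK ?gt_eqF// lerDr mulr_ge0 ?divr_ge0//; exact: ltW.
have g6 : 0 < (6 * gam)^-1 by rewrite invr_gt0 mulr_gt0.
exists (Num.min (s / 2) (Num.min (rho / 6) (6 * gam)^-1)) => [|e].
  by rewrite !lt_min g6 !divr_gt0.
rewrite !le_min => /andP[e0 /and3P[e2 e3 e4]].
have e4' : e * (6 * gam) <= 1 by rewrite -[leRHS](mulVf (lt0r_neq0 (_ : 0 < 6 * gam))) ?ler_wpM2r ?mulr_ge0 ?mulr_gt0 ?(ltW gam0).
have es : 0 < e < s by rewrite e0; move: e2 s00; clear; lra.
have [L1 L11 hA] := annulus_green G iV es ss.
have [L2 L21 hB] := gr_bounds G e0.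
have [L3 L31 hS] := scale_shrink ss2.
exists (1 + 2 * gam * (1 + e)); exists (L1 + L2 + L3) => [|L z0 x x' n Q s' hL zx zx' xx' s'0 s's hs' hQ].
  by move: L11 L21 L31; clear; lra.
have L0 : 0 < L by move: L11 L21 L31 hL; clear; lra.
have hL2 : L2 <= L by move: L11 L21 L31 hL; clear; lra.
have g0 := scale_gt0 L0; set g := scale L in g0 *.
have [|D0 DB hm [hm' _ hlo]] := hA L z0 x _ zx; first by move: L11 L21 L31 hL; clear; lra.
rewrite -/q -/g in hm hm' hlo.
set B := vb z0 (expR L) in DB hm hm' hlo *; set D := annulus x L s e in D0 DB hm hm' hlo hQ *.
have half y : dist z0 y <= expR (sigma * L) -> y \in B /\ dist z0 y <= expR L / 2.
  have h8 : 8 * expR (sigma * L) <= expR L.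
    by rewrite -[in leRHS](mul1r L); apply: hS; move: L11 L21 L31 hL; clear; lra.
  have := expR_gt0 (sigma * L); move: h8; rewrite mem_vb ?expR_ge0// => h1 h2 h3.
  by split; move: h1 h2 h3; clear; lra.
have [xB xh] := half x zx; have [x'B x'h] := half x' zx'.
have self y : y \in B -> dist z0 y <= expR L / 2 -> forall w, gr B y w <= (1 + e) * g.
  move=> yB yh w; apply: (le_trans (green_le_self w (grP G yB))).
  have [+ _] := hB L z0 y y hL2 yB yh.
  by move=> /(_ 0 (lexx _) (or_introl erefl)); rewrite subr0.
have cross : gr B x' x <= (q + rho + e) * g /\ gr B x x' <= (q + rho + e) * g.
  have h : (1 - s' + e) * g <= (q + rho + e) * g by rewrite ler_pM2r// /q; move: s's; clear; lra.
  have [h1 _] := hB L z0 x' x hL2 x'B xh; have [h2 _] := hB L z0 x x' hL2 xB x'h.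
  split; apply: le_trans h; [exact: h1|apply: h2 => //; by rewrite dist_sym].
pose c := gam / g; have c0 : 0 < c by rewrite divr_gt0.
have hc : c * g = gam by rewrite divfK// gt_eqF.
have mul_c (k d : R) : d <= k * g -> c * d <= gam * k.
  by move=> h; apply: (le_trans (ler_wpM2l (ltW c0) h)); rewrite mulrCA hc mulrC.
have mul_c' (k d : R) : k * g <= d -> gam * k <= c * d.
  by move=> h; apply: le_trans (ler_wpM2l (ltW c0) h); rewrite mulrCA hc mulrC.
set u := pot G B D x x' c (- c).
have uE p : u p = 1 + (c * gr B x p + c * gr B x' p) - c * mean D (fun y => gr B y p).
  by rewrite /u /pot mulrDr mulNr.
have DB' : {subset D <= B} by move=> y /DB[].
have ux p : p \in [:: x; x'] -> u p <= gam * (1 + 2 * rho).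
  have bound d1 d2 d3 : d1 <= (1 + e) * g -> d2 <= (q + rho + e) * g -> (q - e) * g <= d3 ->
      1 + (c * d1 + c * d2) - c * d3 <= gam * (1 + 2 * rho).
    move=> /mul_c h1 /mul_c h2 /mul_c' h3.
    have h4 : gam * (6 * e) <= gam * rho by rewrite ler_pM2l//; move: e3; clear; lra.
    move: h1 h2 h3 h4 gamr; rewrite !mulrDr !mulrN !mulr1; clear.
    by move: (c * d1) (c * d2) (c * d3) (gam * q) => *; lra.
  rewrite !inE => /orP[|] /eqP ->; rewrite uE.
    by apply: bound; [exact: self|exact: cross.1|apply: hm' => //; rewrite distxx expR_ge0].
  rewrite [X in 1 + X]addrC.
  by apply: bound; [exact: self|exact: cross.2|exact: hm'].
have uD y : y \in D -> gam * q <= u y.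
  move=> yD; have [yB yh] := DB y yD; rewrite uE.
  have h1 : gam * (q - e) <= c * gr B x y.
    by apply: mul_c'; apply: hlo => //; rewrite distxx expR_ge0.
  have h2 : gam * (q - e) <= c * gr B x' y by apply: mul_c'; exact: hlo.
  have h3 : c * mean D (fun d => gr B d y) <= gam * (q + 4 * e) by apply: mul_c; exact: hm.
  move: h1 h2 h3 e4'; clear; move: (c * gr B x y) (c * gr B x' y) (c * mean _ _) (q) (gam) => d1 d2 d3 k1 k2.
  by rewrite !mulrDr !mulrN => *; lra.
(* The negative charge sits on D only, so u is superharmonic elsewhere in B. It is at least 1 on D
   by [uD] and equal to 1 outside B. *)
have u1 p : 1 <= u p.
  rewrite -lerN2; apply: (@max_principle _ _ G [seq y <- B | y \notin D] (fun w => - u w)) => y.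
    rewrite mem_filter => /andP[yD yB].
    have -> : lap G (fun w => - u w) y = - lap G u y.
      by rewrite /lap -sumrN; apply: eq_bigr => w _; ring.
    rewrite (@lap_pot _ _ G B D x x' c (- c) y xB x'B DB' yB) opprK (_ : mean D _ = 0).
      by rewrite mulr0 addr0 mulr_ge0 ?(ltW c0)// addr_ge0.
    rewrite /mean big_seq big1 ?mul0r// => d dD.
    by case: eqP => // yd; rewrite yd dD in yD.
  rewrite mem_filter negb_and negbK => /orP[yD|yB]; rewrite lerN2.
    exact: le_trans gamq (uD y yD).
  have z d : d \in B -> gr B d y = 0 by move=> dB; have [-> //] := grP G dB.
  rewrite uE !z// (_ : mean D _ = 0); first by rewrite !mulr0 !addr0 subr0.
  by rewrite /mean big_seq big1 ?mul0r// => d /DB' /z.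
have r1 : 0 < 1 + 2 * rho by move: rho0; clear; lra.
pose v1 := (g * (1 + 2 * rho))^-1; have gr1 := mulr_gt0 g0 r1; have gq0 := mulr_gt0 g0 q0.
have v10 : 0 < v1 by rewrite invr_gt0.
have hv1 p : p \in [:: x; x'] -> v1 * u p <= c.
  move=> /ux h; rewrite /v1 (ler_pdivrMl _ _ gr1); apply: (le_trans h).
  by rewrite mulrAC (mulrC g) hc.
pose E := (2 * a * (1 + s) - 8 * rho - 2 * e1 / (1 - s)) * L.
apply: le_trans (@pot_moment _ _ G B D x x' c (- c) v1 (- (g * q)^-1) 1 n z0 Q E xB x'B DB' ltr01 _ _ _ _ _) _.
- exact: u1.
- by apply: hv1; rewrite inE eqxx.
- by apply: hv1; rewrite !inE eqxx orbT.
- move=> y /uD h; rewrite mulNr lerN2 (ler_pdivlMl _ _ gq0).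
  by rewrite mulrAC (mulrC g) hc.
- move=> r /hQ[h1 h2 h3].
  apply: (@le_trans _ _ (v1 * (level a L + level a L) - (g * q)^-1 * level (a * q ^+ 2 + e1) L)); last first.
    rewrite mulNr; apply: lerB.
      by apply: ler_wpM2l; [exact: ltW|exact: lerD].
    by apply: ler_wpM2l; [rewrite invr_ge0; exact: ltW|exact: h3].
  have -> : v1 * (level a L + level a L) = 4 * a * L / (1 + 2 * rho).
    rewrite /v1 /level -/g invfM (_ : _ * _ = (g^-1 * g) * (4 * a * L / (1 + 2 * rho))); last by ring.
    by rewrite mulVf ?gt_eqF// mul1r.
  have -> : (g * q)^-1 * level (a * q ^+ 2 + e1) L = (2 * a * q + 2 * e1 / q) * L.
    rewrite /level -/g invfM (_ : _ * _ = (g^-1 * g) * ((q^-1 * q) * (2 * a * q) * L + 2 * e1 / q * L)); last by ring.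
    by rewrite (mulVf (lt0r_neq0 g0)) (mulVf (lt0r_neq0 q0)) !mul1r [RHS]mulrDl.
  have h4 : (4 * a - 8 * rho) * L <= 4 * a * L / (1 + 2 * rho).
    rewrite -[X in _ <= X]mulrAC ler_pM2r// ler_pdivlMr//.
    have h5 : a * rho <= rho by rewrite ler_piMl// ltW.
    have h6 := sqr_ge0 rho; rewrite expr2 in h6.
    by move: h5 h6; clear; nra.
  rewrite /E -/q; apply: le_trans _ (lerB h4 (lexx _)).
  rewrite -mulrBl ler_pM2r// /q; clear.
  by move: (2 * e1 / (1 - s)) => k; nra.
- rewrite divr1 ler_wpM2r ?expR_ge0//.
  rewrite -/u uE -addrA lerD2l; apply: (@le_trans _ _ (gam * (1 + e) + gam * (1 + e))); last by rewrite le_eqVlt; apply/orP; left; apply/eqP; ring.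
  have m0 : 0 <= c * mean D (fun y => gr B y z0).
    by rewrite mulr_ge0 ?(ltW c0)// mean_ge0// => y /DB' yB; exact: gr_ge0.
  have := mul_c _ _ (self x xB xh z0); have := mul_c _ _ (self x' x'B x'h z0).
  by move: m0; clear; move: (c * mean _ _) (c * gr B x z0) => *; lra.
Qed.

(** To first order in [kap] the right side is a - kap a q + kap (a q + e1 / q) = a + kap e1 / q.
    Half of this gain pays for the terms of second order. *)
Lemma bad_exponent (a q e1 kap : R) : 0 < a <= 1 -> 0 < q <= 1 -> 0 < e1 ->
  0 < kap -> kap <= q -> kap * (6 * q + 4 * e1) <= e1 ->
  a + kap * e1 / (2 * q) <=
  a / (1 + kap * q + kap ^+ 2) + kap * (a * q ^+ 2 + e1) / (q + kap * q + kap ^+ 2).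
Proof.
move=> /andP[a0 a1] /andP[q0 q1] e10 k0 kq hk.
have inv1 (x : R) : 0 < x -> 1 - x <= (1 + x)^-1.
  move=> x0; rewrite -[leRHS]mul1r ler_pdivlMr ?addr_gt0//.
  by have := sqr_ge0 x; rewrite expr2; nra.
have kk0 : 0 < kap * q by rewrite mulr_gt0.
have k2 : 0 < kap ^+ 2 by rewrite exprn_gt0.
have h1 : a * (1 - (kap * q + kap ^+ 2)) <= a / (1 + kap * q + kap ^+ 2).
  by rewrite -addrA ler_pM2l// inv1// addr_gt0.
pose W := a * q + e1 / q; have W0 : 0 < W by apply: addr_gt0; [exact: mulr_gt0|exact: divr_gt0].
have E2 : kap * (a * q ^+ 2 + e1) / (q + kap * q + kap ^+ 2) = kap * W / (1 + (kap + kap ^+ 2 / q)).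
  have -> : q + kap * q + kap ^+ 2 = q * (1 + (kap + kap ^+ 2 / q)) by field; rewrite gt_eqF.
  have -> : a * q ^+ 2 + e1 = W * q by rewrite /W; field; rewrite gt_eqF.
  move: (1 + _) => K; rewrite invfM (_ : _ * _ = kap * W / K * (q^-1 * q)); last by ring.
  by rewrite (mulVf (lt0r_neq0 q0)) mulr1.
have h2 : kap * W * (1 - 2 * kap) <= kap * (a * q ^+ 2 + e1) / (q + kap * q + kap ^+ 2).
  rewrite E2 ler_pM2l ?mulr_gt0//; apply: le_trans (inv1 _ _); last by rewrite addr_gt0// divr_gt0.
  have : kap ^+ 2 / q <= kap by rewrite ler_pdivrMr// expr2 ler_pM2l.
  by move: (_ / q) => k; lra.
apply: le_trans (lerD h1 h2).
pose d := e1 / q; have E1 : e1 = d * q by rewrite /d divfK// gt_eqF.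
have d0 : 0 < d by rewrite divr_gt0.
have -> : kap * e1 / (2 * q) = kap * d / 2 by rewrite /d; field; rewrite gt_eqF.
have hk' : kap * (6 + 4 * d) <= d.
  by rewrite -(ler_pM2r q0) -E1 -mulrA mulrDl -(mulrA 4) -E1.
rewrite /W -/d.
have h3 : kap * (kap * (6 + 4 * d)) <= kap * d by rewrite ler_pM2l.
have h4 : a * kap ^+ 2 <= kap ^+ 2 by rewrite ler_piMl// ltW.
have h5 : a * q * kap ^+ 2 <= kap ^+ 2.
  by rewrite ler_piMl ?(ltW k2)// -[leRHS]mulr1 ler_pM// ltW.
move: h3 h4 h5; clear; nra.
Qed.

(** The profile a (1 - s)^2 is the typical mean at scale s around a thick point. An excess [e1] is
    detected by a small positive charge [kap] on the annulus, which raises the exponent strictly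
    above 2 a; compared with the first moment such points are negligible. *)
Lemma bad_bound (a s sigma e1 : R) : inhabited V -> 0 < a <= 1 -> 0 < s -> s <= sigma < 1 ->
  0 < e1 -> exists2 m, 0 < m & exists2 e0, 0 < e0 & forall e, 0 < e <= e0 ->
  exists C, exists2 L0, 1 <= L0 & forall L z0 x n Q, L0 <= L ->
  dist z0 x <= expR (sigma * L) ->
  (forall r, Q r -> level a L <= ltime x r /\
     level (a * (1 - s) ^+ 2 + e1) L <= mean (annulus x L s e) (ltime^~ r)) ->
  PX (vb z0 (expR L)) n z0 Q <= C * expR (- ((2 * a + m) * L)).
Proof.
move=> iV a01 s00 ss e10; have /andP[ss1 ss2] := ss; have /andP[a0 a1] := a01.
pose q := 1 - s; have q0 : 0 < q by rewrite /q; move: ss1 ss2; clear; lra.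
have q1 : q <= 1 by rewrite /q; move: s00; clear; lra.
(* Small enough for the quadratic terms of [bad_exponent], since the gain is linear in [kap]. *)
pose kap := q * (e1 / (6 + 4 * e1)).
have d0 : 0 < 6 + 4 * e1 by move: e10; clear; lra.
have d1 : e1 / (6 + 4 * e1) <= 1 by rewrite ler_pdivrMr//; move: e10; clear; lra.
have k0 : 0 < kap by rewrite mulr_gt0// divr_gt0.
have kq : kap <= q by rewrite ler_piMr// ltW.
have hk : kap * (6 * q + 4 * e1) <= e1.
  apply: (@le_trans _ _ (q * (e1 / (6 + 4 * e1)) * (6 + 4 * e1))).
    apply: ler_wpM2l; first exact: ltW.
    by move: q1; clear; lra.
  by rewrite -mulrA divfK ?gt_eqF// ler_piMl// ltW.
have hexp := bad_exponent a01 (introT andP (conj q0 q1)) e10 k0 kq hk.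
have k2 : 0 < kap ^+ 2 by rewrite exprn_gt0.
exists (kap * e1 / q); first by rewrite divr_gt0// mulr_gt0.
exists (Num.min (s / 2) (kap ^+ 2 / 12)) => [|e]; first by rewrite lt_min !divr_gt0.
rewrite le_min => /andP[e0 /andP[e2 e3]].
have es : 0 < e < s by rewrite e0; move: e2 s00; clear; lra.
(* [gam * kap ^+ 2 = 2] covers the constant 1 of the potential and the errors of size at most
   [gam * (6 * e)], itself at most 1. *)
pose gam := 2 / kap ^+ 2; have gam0 : 0 < gam by rewrite divr_gt0.
have gk : gam * kap ^+ 2 = 2 by rewrite divfK// gt_eqF.
have [L1 L11 hA] := annulus_green G iV es ss.
have [L2 L21 hB] := gr_bounds G e0.
have [L3 L31 hS] := scale_shrink ss2.
exists (1 + gam * (1 + e) + kap * gam * (q + 4 * e)); exists (L1 + L2 + L3) => [|L z0 x n Q hL zx hQ].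
  by move: L11 L21 L31; clear; lra.
have L0 : 0 < L by move: L11 L21 L31 hL; clear; lra.
have hL2 : L2 <= L by move: L11 L21 L31 hL; clear; lra.
have g0 := scale_gt0 L0; set g := scale L in g0 *.
have [|D0 DB hm [_ hup _]] := hA L z0 x _ zx; first by move: L11 L21 L31 hL; clear; lra.
rewrite -/q -/g in hm hup.
set B := vb z0 (expR L) in DB hm hup *; set D := annulus x L s e in D0 DB hm hup hQ *.
have h8 : 8 * expR (sigma * L) <= expR L.
  by rewrite -[in leRHS](mul1r L); apply: hS; move: L11 L21 L31 hL; clear; lra.
have eL := expR_gt0 (sigma * L).
have xh : dist z0 x <= expR L / 2 by move: h8 eL zx; clear; lra.
have xB : x \in B by rewrite mem_vb ?expR_ge0//; move: h8 eL zx; clear; lra.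
have self w : gr B x w <= (1 + e) * g.
  apply: (le_trans (green_le_self w (grP G xB))).
  have [+ _] := hB L z0 x x hL2 xB xh.
  by move=> /(_ 0 (lexx _) (or_introl erefl)); rewrite subr0.
pose c := gam / g; have c0 : 0 < c by rewrite divr_gt0.
have hc : c * g = gam by rewrite divfK// gt_eqF.
have mul_c (k d : R) : d <= k * g -> c * d <= gam * k.
  by move=> h; apply: (le_trans (ler_wpM2l (ltW c0) h)); rewrite mulrCA hc mulrC.
set u := pot G B D x x (c / 2) (kap * c).
have uE p : u p = 1 + c * gr B x p + kap * (c * mean D (fun y => gr B y p)).
  by rewrite /u /pot -(mulrA kap); congr (_ + _ + _); field.
have DB' : {subset D <= B} by move=> y /DB[].
have mean_pos p : 0 <= c * mean D (fun y => gr B y p).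
  by rewrite mulr_ge0 ?(ltW c0)// mean_ge0// => y /DB' yB; exact: gr_ge0.
have u1 p : 1 <= u p.
  rewrite uE -addrA lerDl; apply: addr_ge0; apply: mulr_ge0; [exact: ltW|exact: gr_ge0|exact: ltW|exact: mean_pos].
have ge3 : gam * (12 * e) <= 2 by rewrite -gk ler_pM2l//; move: e3; clear; lra.
have kap1 : kap <= 1 := le_trans kq q1.
have bound (k1 : R) p : c * gr B x p <= gam * (k1 + 2 * e) -> dist z0 p <= expR L / 2 ->
    u p <= gam * (k1 + kap * q + kap ^+ 2).
  move=> h1 hp; rewrite uE.
  have h2 : c * mean D (fun d => gr B d p) <= gam * (q + 4 * e) by apply: mul_c; exact: hm.
  have h3 : kap * (c * mean D (fun d => gr B d p)) <= kap * (gam * q) + gam * (4 * e).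
    apply: (le_trans (ler_wpM2l (ltW k0) h2)); rewrite mulrDr mulrDr lerD2l.
    by rewrite ler_piMl// mulr_ge0 ?(ltW gam0)// mulr_ge0 ?(ltW e0).
  rewrite (_ : gam * (k1 + kap * q + kap ^+ 2) = gam * k1 + kap * (gam * q) + gam * kap ^+ 2); last by ring.
  rewrite gk; move: h1 h3 ge3; rewrite (mulrDr gam k1 (2 * e)); clear.
  by move: (c * gr B x p) (kap * (c * _)) (kap * (gam * q)) (gam * k1) => *; nra.
have ux : u x <= gam * (1 + kap * q + kap ^+ 2).
  apply: bound => //; apply: (le_trans (mul_c _ _ (self x))).
  by rewrite ler_pM2l//; move: e0; clear; lra.
have uD y : y \in D -> u y <= gam * (q + kap * q + kap ^+ 2).
  by move=> yD; apply: bound; [apply: mul_c; exact: hup|have [] := DB y yD].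
have kq0 : 0 < kap * q by rewrite mulr_gt0.
have w10 : 0 < 1 + kap * q + kap ^+ 2 by apply: addr_gt0 => //; exact: addr_gt0.
have w20 : 0 < q + kap * q + kap ^+ 2 by apply: addr_gt0 => //; exact: addr_gt0.
pose v1 := (2 * g * (1 + kap * q + kap ^+ 2))^-1.
pose v2 := kap / (g * (q + kap * q + kap ^+ 2)).
have g2 : 0 < 2 * g by rewrite pmulr_rgt0.
have gw1 := mulr_gt0 g2 w10; have gw2 := mulr_gt0 g0 w20.
have v10 : 0 < v1 by rewrite invr_gt0.
have v20 : 0 < v2 by rewrite divr_gt0.
have hx : v1 * u x <= c / 2.
  rewrite /v1 (ler_pdivrMl _ _ gw1); apply: (le_trans ux).
  by rewrite -hc le_eqVlt; apply/orP; left; apply/eqP; field.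
have hD y : y \in D -> v2 * u y <= kap * c.
  move=> /uD h; rewrite /v2 -mulrA ler_pM2l// (ler_pdivrMl _ _ gw2); apply: (le_trans h).
  by rewrite -hc le_eqVlt; apply/orP; left; apply/eqP; ring.
pose E := (2 * a + kap * e1 / q) * L.
apply: le_trans (@pot_moment _ _ G B D x x (c / 2) (kap * c) v1 v2 1 n z0 Q E xB xB DB' ltr01 u1 hx hx hD _) _.
  move=> r /hQ[h1 h2].
  apply: (@le_trans _ _ (v1 * (level a L + level a L) + v2 * level (a * q ^+ 2 + e1) L)); last first.
    apply: lerD; apply: ler_wpM2l; [exact: ltW|exact: lerD|exact: ltW|exact: h2].
  have -> : v1 * (level a L + level a L) = 2 * L * (a / (1 + kap * q + kap ^+ 2)).
    rewrite /v1 /level -/g; field; rewrite !gt_eqF//.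
  have -> : v2 * level (a * q ^+ 2 + e1) L = 2 * L * (kap * (a * q ^+ 2 + e1) / (q + kap * q + kap ^+ 2)).
    rewrite /v2 /level -/g; field; rewrite !gt_eqF//.
  rewrite -mulrDr (_ : E = 2 * L * (a + kap * e1 / (2 * q))); first by rewrite ler_pM2l ?mulr_gt0.
  by rewrite /E; field; rewrite gt_eqF.
rewrite divr1 ler_wpM2r ?expR_ge0//.
have z00 : dist z0 z0 <= expR L / 2 by rewrite distxx divr_ge0 ?expR_ge0.
rewrite -/u uE; apply: lerD; first by rewrite lerD2l; exact: mul_c _ _ (self z0).
by rewrite -mulrA ler_pM2l//; apply: mul_c; exact: hm.
Qed.

End Bounds.

(** * Thick points of the embedded walk *)

(** Minima and maxima over finitely many scales. The gain m and the threshold on e precede the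
    choice of e, while C and L0 may depend on it. *)
Lemma uniform_list (R : realType) (T : eqType) (ss : seq T) (P : T -> R -> R -> R -> R -> Prop) :
  (forall s m m' e C C' L, 0 <= L -> m' <= m -> C <= C' -> P s m e C L -> P s m' e C' L) ->
  (forall s, s \in ss -> exists2 m, 0 < m & exists2 e0, 0 < e0 & forall e, 0 < e <= e0 ->
     exists C, exists2 L0, 1 <= L0 & forall L, L0 <= L -> P s m e C L) ->
  exists2 m, 0 < m & exists2 e0, 0 < e0 & forall e, 0 < e <= e0 ->
     exists C, exists2 L0, 1 <= L0 & forall L s, L0 <= L -> s \in ss -> P s m e C L.
Proof.
move=> mono; elim: ss => [|s ss IH] h.
  by exists 1 => //; exists 1 => // e _; exists 0; exists 1 => // L s _; rewrite in_nil.
have [m1 m10 [e1 e10 h1]] := h s (mem_head _ _).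
have [t st|m2 m20 [e2 e20 h2]] := IH; first by apply: h; rewrite inE st orbT.
exists (Num.min m1 m2); first by rewrite lt_min m10.
exists (Num.min e1 e2) => [|e]; first by rewrite lt_min e10.
rewrite le_min => /andP[e0 /andP[le1 le2]].
have [|C1 [L1 L11 {}h1]] := h1 e; first by rewrite e0.
have [|C2 [L2 L21 {}h2]] := h2 e; first by rewrite e0.
exists (Num.max C1 C2); exists (Num.max L1 L2) => [|L t]; first by rewrite le_max L11.
rewrite ge_max => /andP[hL1 hL2]; rewrite inE => /orP[/eqP ->|ts].
  by apply: (mono s m1 _ _ C1); [lra|rewrite ge_min lexx|rewrite le_max lexx|exact: h1].
by apply: (mono t m2 _ _ C2); [lra|rewrite ge_min lexx orbT|rewrite le_max lexx orbT|exact: h2].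
Qed.

Lemma expR_dominates (R : realType) (C c : R) : 0 < c ->
  exists2 L0, 1 <= L0 & forall L, L0 <= L -> C <= expR (c * L).
Proof.
move=> c0; exists (1 + `|C| / c) => [|L hL]; first by rewrite lerDl divr_ge0// ltW.
apply: le_trans (expR_ge1Dx _).
have : `|C| / c <= L by lra.
by rewrite ler_pdivrMr// mulrC; have := ler_norm C; lra.
Qed.

(** * First moment and Paley-Zygmund inequality *)

Section Trial.
Variables (R : realType) (V : choiceType) (G : rhombic_graph R V).
Local Notation dist := (dist G).
Local Notation rate := (rate G).
Local Notation vb := (vb G).
Local Notation gr := (gr G).
Local Notation annulus := (annulus G).
Local Notation ltime := (ltime G).
Local Notation PX := (PX G).
Local Notation EX := (EX G).
Local Notation survival := (survival G).
Implicit Types (x y z w : V) (B D r : seq V) (Q : pred (seq V)) (F : seq V -> R).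

(** From z0 the vertex x is hit with probability bounded below, and the number of visits is then
    geometric with ratio 1 - 1 / q, where q = [rate x * gr B x x]. The finite horizon n costs at
    most the survival probability. *)
Lemma first_moment (a sigma eta : R) : 0 < a <= 1 -> 0 < sigma < 1 -> 0 < eta ->
  exists2 c, 0 < c & exists2 L0, 1 <= L0 & forall L z0 x n, L0 <= L ->
  dist z0 x <= expR (sigma * L) ->
  c * expR (- ((2 * a + eta) * L)) - survival (vb z0 (expR L)) n z0 <=
  PX (vb z0 (expR L)) n z0 (fun r => level a L <= ltime x r).
Proof.
move=> /andP[a0 a1] /andP[si0 si1] eta0; have sg0 := gs_gt0 G.
pose e := Num.min (1 / 4) (Num.min (eta / 8) ((1 - sigma) / 2)).
have [e0 e4 e8 es] : [/\ 0 < e, e <= 1 / 4, e <= eta / 8 & e <= (1 - sigma) / 2].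
  by rewrite /e !lt_min !ge_min !lexx !orbT !divr_gt0// subr_gt0.
have [L1 L11 hB] := gr_bounds G e0.
have [L2 L21 hS] := scale_shrink si1.
exists ((1 - sigma - e) / (1 + e)); first by rewrite divr_gt0//; move: es si1 e0; clear; lra.
have pi2 : 0 < 2 * pi :> R by rewrite mulr_gt0// pi_gt0.
have hL' : 0 < 2 * pi / (e * gs G) by rewrite divr_gt0// mulr_gt0.
exists (L1 + L2 + 2 * pi / (e * gs G)) => [|L z0 x n hL zx].
  by move: hL' L11 L21; clear; lra.
have L0 : 0 < L by move: hL hL' L11 L21; clear; lra.
have hL1 : L1 <= L by move: hL hL' L11 L21; clear; lra.
have h8 : 8 * expR (sigma * L) <= expR L.
  by rewrite -[in leRHS](mul1r L); apply: hS; move: hL hL' L11 L21; clear; lra.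
have g0 := scale_gt0 L0.
have gbig : 1 <= e * gs G * scale L.
  have : 2 * pi / (e * gs G) <= L by move: hL L11 L21; clear; lra.
  rewrite ler_pdivrMr ?mulr_gt0// => h.
  by rewrite (_ : _ * scale L = L * (e * gs G) / (2 * pi)) ?ler_pdivlMr ?mul1r// /scale; ring.
have [g gE] : exists g, scale L = g by exists (scale L).
rewrite gE in g0 gbig.
have eL := expR_gt0 (sigma * L).
set B := vb z0 (expR L).
have xh : dist z0 x <= expR L / 2 by move: h8 eL zx; clear; lra.
have xB : x \in B by rewrite mem_vb ?expR_ge0//; move: h8 eL zx; clear; lra.
have z0h : dist z0 z0 <= expR L / 2 by rewrite distxx divr_ge0 ?expR_ge0.
have [hu hl] := hB L z0 x x hL1 xB xh.
have [_ hz] := hB L z0 x z0 hL1 xB z0h.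
have uxU : gr B x x <= (1 + e) * g.
  by rewrite -gE; have := hu 0 (lexx _) (or_introl erefl); rewrite subr0.
have uxL : (1 - e) * g <= gr B x x.
  rewrite -gE; have := hl 0 (lexx _); rewrite subr0; apply.
  by rewrite distxx mulr_ge0 ?expR_ge0.
have uz : (1 - sigma - e) * g <= gr B x z0.
  rewrite -gE; apply: hz; first exact: ltW.
  by move: zx eL; clear; lra.
have r0 := rate_gt0 G x; have r1 := rate_ge G x.
have ux0 : 0 < gr B x x.
  by apply: lt_le_trans uxL; rewrite mulr_gt0//; move: e4; clear; lra.
pose k := Num.trunc (rate x * level a L).
have lev0 : 0 <= rate x * level a L.
  by rewrite mulr_ge0 ?(ltW r0)// /level gE !mulr_ge0// ltW.
have /andP[k1 k2] := truncn_itv lev0; rewrite -/k in k1 k2.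
have := @visits_lower_bound _ _ G B x (gr B x) n z0 k xB (grP G xB).
move=> h; apply: le_trans (le_trans h _); last first.
  apply: EX_le => p _; case: (ltnP k) => hk; last by rewrite ler0n.
  suff -> : level a L <= ltime x (killed B (belast z0 p)) by [].
  rewrite ltime_count ler_pdivlMr// mulrC; apply: (le_trans (ltW k2)).
  by rewrite ler_nat.
rewrite lerD2r; apply: ler_pM; rewrite ?expR_ge0//.
- by rewrite divr_ge0//; move: es si1 e0; clear; lra.
- rewrite ler_pdivlMr//; apply: (le_trans (ler_wpM2l _ uxU)).
    by rewrite divr_ge0//; move: es si1 e0; clear; lra.
  by rewrite mulrA divfK// gt_eqF//; move: e0; clear; lra.
set q := rate x * gr B x x.
have ex1 : 1 <= e * rate x * g.
  apply: (le_trans gbig); rewrite ler_pM2r// ler_pM2l//.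
have hq : rate x * (1 - 2 * e) * g <= q - 1.
  have : rate x * ((1 - e) * g) <= q by rewrite ler_pM2l.
  by move: ex1; clear; nra.
have q1 : 0 < q - 1.
  apply: lt_le_trans hq; rewrite !mulr_gt0//; move: e4; clear; lra.
(* The inverse of [1 - q^-1] is [1 + (q - 1)^-1], at most the exponential of [(q - 1)^-1]. *)
have hq1 : expR (- (q - 1)^-1) <= 1 - q^-1.
  rewrite expRN -[leRHS]invrK lef_pV2 ?posrE ?expR_gt0 ?invr_gt0//; last first.
    by rewrite subr_gt0 invf_lt1; move: q1; clear; lra.
  apply: le_trans (expR_ge1Dx _).
  by rewrite le_eqVlt; apply/orP; left; apply/eqP; field; rewrite !gt_eqF//; move: q1; clear; lra.
apply: le_trans (lerXn2r k _ _ hq1); rewrite ?nnegrE ?expR_ge0//; last first.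
  exact: le_trans (expR_ge0 _) hq1.
rewrite -expRM_natl ler_expR mulrN lerN2 ler_pdivrMr//.
apply: (le_trans k1); rewrite /level gE.
apply: (@le_trans _ _ ((2 * a + eta) * L * (rate x * (1 - 2 * e) * g))).
  have -> : rate x * (2 * a * L * g) = 2 * a * (rate x * L * g) by ring.
  have -> : (2 * a + eta) * L * (rate x * (1 - 2 * e) * g) = (2 * a + eta) * (1 - 2 * e) * (rate x * L * g) by ring.
  apply: ler_wpM2r; first by rewrite !mulr_ge0// ltW.
  have : eta * e <= eta / 4 by rewrite ler_pM2l// -[leRHS]mul1r.
  have : a * e <= e by rewrite ler_piMl// ltW.
  by move: e8; clear; nra.
apply: ler_wpM2l hq; rewrite mulr_ge0 ?(ltW L0)//; move: a0 eta0; clear; lra.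
Qed.

(** Young's inequality in place of that of Cauchy and Schwarz: pointwise, F is at most mu / 2 plus
    lam F^2 / 2, plus 1 / (2 lam) where F is at least mu / 2; [lam] is chosen so that the quadratic
    term takes half of what remains. *)
Lemma paley_zygmund n z F (mu M : R) : 0 < mu -> 0 < M -> (forall p, 0 <= F p) ->
  mu <= EX n z F -> EX n z (fun p => F p ^+ 2) <= M ->
  mu ^+ 2 / (4 * M) <= EX n z (fun p => (mu / 2 <= F p)%R%:R).
Proof.
move=> mu0 M0 F0 h1 h2; set P := EX _ _ (fun p => _%:R).
pose lam := mu / (2 * M).
have lam0 : 0 < lam by rewrite divr_gt0// mulr_gt0.
have : mu <= mu / 2 + (lam / 2 * EX n z (fun p => F p ^+ 2) + (2 * lam)^-1 * P).
  apply: (le_trans h1).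
  have -> : mu / 2 + (lam / 2 * EX n z (fun p => F p ^+ 2) + (2 * lam)^-1 * P) =
     EX n z (fun p => 1 * (mu / 2) + 1 * (lam / 2 * F p ^+ 2 + (2 * lam)^-1 * (mu / 2 <= F p)%R%:R)).
    by rewrite (EX_lin G n z (fun=> mu / 2)) EX_const !mul1r EX_lin.
  apply: EX_le => p _; rewrite !mul1r.
  have [h|h] := leP (mu / 2) (F p); last first.
    rewrite mulr0 addr0; apply: (le_trans (ltW h)); rewrite lerDl mulr_ge0 ?sqr_ge0//.
    by rewrite divr_ge0// ltW.
  rewrite mulr1; apply: (@le_trans _ _ (lam / 2 * F p ^+ 2 + (2 * lam)^-1)); last first.
    by rewrite lerDr divr_ge0// ltW.
  rewrite -subr_ge0 (_ : _ - _ = (lam * F p - 1) ^+ 2 / (2 * lam)).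
    by rewrite divr_ge0 ?sqr_ge0// mulr_ge0// ltW.
  by field; rewrite gt_eqF.
have h3 : lam / 2 * EX n z (fun p => F p ^+ 2) <= mu / 4.
  apply: (le_trans (ler_wpM2l _ h2)); first by rewrite divr_ge0// ltW.
  by rewrite le_eqVlt; apply/orP; left; apply/eqP; rewrite /lam; field; rewrite gt_eqF.
move=> h4; have : mu / 4 <= (2 * lam)^-1 * P by move: h3 h4; clear; lra.
have l2 : 0 < 2 * lam by rewrite pmulr_rgt0.
rewrite (ler_pdivlMl _ _ l2) => h5; apply: le_trans h5.
by rewrite le_eqVlt; apply/orP; left; apply/eqP; rewrite /lam; field; rewrite gt_eqF.
Qed.

End Trial.

(** * The truncated second moment *)

Section TrialSuccess.
Variables (R : realType) (V : choiceType) (G : rhombic_graph R V).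
Local Notation dist := (dist G).
Local Notation rate := (rate G).
Local Notation vb := (vb G).
Local Notation annulus := (annulus G).
Local Notation ltime := (ltime G).
Local Notation PX := (PX G).
Local Notation EX := (EX G).
Local Notation survival := (survival G).
Implicit Types (x y z w : V) (B D r : seq V) (Q : pred (seq V)) (F : seq V -> R).

Lemma belast_cat z (p q : seq V) : belast z (p ++ q) = belast z p ++ belast (last z p) q.
Proof. by elim: p z => //= a p IH z; rewrite IH. Qed.

Lemma killed_cat B (p q : seq V) : ~~ all (mem B) p -> killed B (p ++ q) = killed B p.
Proof. by elim: p => //= a p IH; case: ifP => //= aB /IH ->. Qed.

(** Once the walk has left B, further steps do not change the killed path. *)
Lemma PX_prefix B T n z Q : PX B (T + n) z Q <= PX B T z Q + survival B T z.
Proof.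
rewrite /PX EX_cat.
apply: (@le_trans _ _ (EX T z (fun p => 1 * (Q (killed B (belast z p)))%:R +
    1 * (all (mem B) (belast z p))%:R))); last by rewrite EX_lin !mul1r.
apply: EX_le => p pT; rewrite !mul1r.
have [h|h] := boolP (all (mem B) (belast z p)).
  apply: (@le_trans _ _ 1); last by rewrite lerDr.
  rewrite -[leRHS](EX_const G n (last z p)); by apply: EX_le => q _; case: (Q _).
rewrite addr0 -[leRHS](EX_const G n (last z p)); apply: EX_le => q _.
by rewrite belast_cat killed_cat.
Qed.

Definition thick B (lvl : R) r : seq V := [seq x <- B | lvl <= ltime x r].

(** The disc is centred at the first vertex of the window, so that the success probability has a
    lower bound that is uniform in the starting point. *)
Definition success (a eps L : R) (s : seq V) : bool :=
  if s is z :: _ then let B := vb z (expR L) in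
    (expR ((2 - 2 * a - eps) * L) <= (size (thick B (level a L) (killed B s)))%:R)%R
  else false.

Lemma killed_sub B B' s : {subset B <= B'} -> subseq (killed B s) (killed B' s).
Proof.
move=> BB'; elim: s => //= a s IH; case: ifP => aB; last exact: sub0seq.
by rewrite (BB' _ aB) /= eqxx.
Qed.

Lemma sum_indicator (I : Type) (s : seq I) (b : pred I) :
  \sum_(x <- s) (b x)%:R = (size [seq x <- s | b x])%:R :> R.
Proof.
elim: s => [|x s IH]; first by rewrite big_nil.
by rewrite big_cons IH /=; case: (b x); rewrite ?add0r//= -[RHS]natr1 addrC.
Qed.

Definition scales (sigma : R) (K : nat) : seq R := [seq sigma * i.+1%:R / K%:R | i <- iota 0 K].

Lemma scalesP (sigma : R) K s : (0 < K)%N -> 0 < sigma -> s \in scales sigma K -> 0 < s <= sigma.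
Proof.
move=> K_gt0 si0; have K0 : 0 < K%:R :> R by rewrite ltr0n.
case/mapP => i; rewrite mem_iota add0n => /andP[_ iK] ->.
by rewrite divr_gt0 ?mulr_gt0//= ler_pdivrMr// ler_pM2l// ler_nat.
Qed.

(** [s] is the least grid scale that reaches d. At the first grid scale [s'] is 0 and nothing is
    claimed about d from below, which covers close pairs and d = 0. *)
Lemma scales_cover (sigma : R) K (d L : R) : (0 < K)%N -> 0 < sigma -> d <= expR (sigma * L) ->
  exists s s', [/\ s \in scales sigma K, d <= expR (s * L), 0 <= s', s = s' + sigma / K%:R &
    s' = 0 \/ expR (s' * L) <= d].
Proof.
move=> K_gt0 si0 dL; have K0 : 0 < K%:R :> R by rewrite ltr0n.
pose P i := d <= expR (sigma * i.+1%:R / K%:R * L).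
have exP : exists i, P i by exists K.-1; rewrite /P prednK// mulfK// gt_eqF.
case: (ex_minnP exP) => i Pi imin.
have iK : (i < K)%N.
  by rewrite -[K in leqRHS]prednK// ltnS; apply: imin; rewrite /P prednK// mulfK// gt_eqF.
exists (sigma * i.+1%:R / K%:R), (sigma * i%:R / K%:R); split=> //.
- by apply/mapP; exists i => //; rewrite mem_iota.
- by rewrite divr_ge0 ?mulr_ge0// ltW.
- by rewrite -natr1 mulrDr mulrDl mulr1.
- case: i {Pi iK} imin => [|i] imin; first by left; rewrite mulr0 mul0r.
  by right; rewrite ltW// ltNge; apply/negP => /imin; rewrite ltnn.
Qed.

Lemma bad_all (a sigma e1 : R) (ss : seq R) : inhabited V -> 0 < a <= 1 -> sigma < 1 -> 0 < e1 ->
  (forall s, s \in ss -> 0 < s <= sigma) ->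
  exists2 m, 0 < m & exists2 e0, 0 < e0 & forall e, 0 < e <= e0 ->
  exists2 C, 0 <= C & exists2 L0, 1 <= L0 & forall L s, L0 <= L -> s \in ss -> forall z0 x n Q,
    dist z0 x <= expR (sigma * L) ->
    (forall r, Q r -> level a L <= ltime x r /\
       level (a * (1 - s) ^+ 2 + e1) L <= mean (annulus x L s e) (ltime^~ r)) ->
    PX (vb z0 (expR L)) n z0 Q <= C * expR (- ((2 * a + m) * L)).
Proof.
move=> iV a01 si1 e10 ssP.
have [||m m0 [e0 e00 h]] := @uniform_list R _ ss (fun s m e C L => forall z0 x n Q,
    dist z0 x <= expR (sigma * L) ->
    (forall r, Q r -> level a L <= ltime x r /\
       level (a * (1 - s) ^+ 2 + e1) L <= mean (annulus x L s e) (ltime^~ r)) ->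
    PX (vb z0 (expR L)) n z0 Q <= Num.max C 0 * expR (- ((2 * a + m) * L))).
- move=> s m m' e C C' L L0 mm CC h z0 x n Q zx hQ; apply: le_trans (h z0 x n Q zx hQ) _.
  apply: (@le_trans _ _ (Num.max C' 0 * expR (- ((2 * a + m) * L)))).
    by apply: ler_wpM2r; [exact: expR_ge0|rewrite ge_max !le_max CC lexx orbT].
  apply: ler_wpM2l; first by rewrite le_max lexx orbT.
  by rewrite ler_expR lerN2 ler_wpM2r// lerD2l.
- move=> s /ssP /andP[s0 ssi]; have ssi' : s <= sigma < 1 by rewrite ssi si1.
  have [m m0 [e0 e00 h]] := bad_bound G iV a01 s0 ssi' e10.
  exists m => //; exists e0 => // e he; have [C [L0 L01 hC]] := h e he.
  exists C; exists L0 => // L LL z0 x n Q zx hQ; apply: le_trans (hC L z0 x n Q LL zx hQ) _.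
  by apply: ler_wpM2r; [exact: expR_ge0|rewrite le_max lexx].
exists m => //; exists e0 => // e /h[C [L0 L01 hC]].
by exists (Num.max C 0); [rewrite le_max lexx orbT|exists L0].
Qed.

Lemma pair_all (a sigma e1 rho err : R) (ss : seq R) : inhabited V -> 0 < a <= 1 -> sigma < 1 -> 0 < e1 ->
  0 < rho -> 8 * rho + 2 * e1 / (1 - sigma) <= err ->
  (forall s, s \in ss -> 0 < s <= sigma) ->
  exists2 e0, 0 < e0 & forall e, 0 < e <= e0 ->
  exists2 C, 0 < C & exists2 L0, 1 <= L0 & forall L s, L0 <= L -> s \in ss -> forall z0 x x' n Q (s' : R),
    dist z0 x <= expR (sigma * L) -> dist z0 x' <= expR (sigma * L) ->
    dist x x' <= expR (s * L) -> 0 <= s' -> s <= s' + rho -> s' = 0 \/ expR (s' * L) <= dist x x' ->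
    (forall r, Q r -> [/\ level a L <= ltime x r, level a L <= ltime x' r &
       mean (annulus x L s e) (ltime^~ r) <= level (a * (1 - s) ^+ 2 + e1) L]) ->
    PX (vb z0 (expR L)) n z0 Q <= C * expR (- ((2 * a * (1 + s) - err) * L)).
Proof.
move=> iV a01 si1 e10 rho0 herr ssP.
have [||_ _ [e0 e00 h]] := @uniform_list R _ ss (fun s _ e C L => forall z0 x x' n Q (s' : R),
    dist z0 x <= expR (sigma * L) -> dist z0 x' <= expR (sigma * L) ->
    dist x x' <= expR (s * L) -> 0 <= s' -> s <= s' + rho -> s' = 0 \/ expR (s' * L) <= dist x x' ->
    (forall r, Q r -> [/\ level a L <= ltime x r, level a L <= ltime x' r &
       mean (annulus x L s e) (ltime^~ r) <= level (a * (1 - s) ^+ 2 + e1) L]) ->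
    PX (vb z0 (expR L)) n z0 Q <= C * expR (- ((2 * a * (1 + s) - err) * L))).
- move=> s m m' e C C' L L0 mm CC h z0 x x' n Q s' h1 h2 h3 h4 h5 h6 hQ.
  apply: le_trans (h z0 x x' n Q s' h1 h2 h3 h4 h5 h6 hQ) _.
  by apply: ler_wpM2r; [exact: expR_ge0|].
- move=> s /ssP /andP[s0 ssi]; have ssi' : s <= sigma < 1 by rewrite ssi si1.
  have [e0 e00 h] := pair_bound G iV a01 s0 ssi' rho0 e10.
  exists 1 => //; exists e0 => // e he; have [C [L0 L01 hC]] := h e he.
  exists (Num.max C 0); exists L0 => // L LL z0 x x' n Q s' h1 h2 h3 h4 h5 h6 hQ.
  apply: le_trans (hC L z0 x x' n Q s' LL h1 h2 h3 h4 h5 h6 hQ) _.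
  apply: (@le_trans _ _ (Num.max C 0 * expR (- ((2 * a * (1 + s) - 8 * rho - 2 * e1 / (1 - s)) * L)))).
    by apply: ler_wpM2r; [exact: expR_ge0|rewrite le_max lexx].
  apply: ler_wpM2l; first by rewrite le_max lexx orbT.
  rewrite ler_expR lerN2; apply: ler_wpM2r; first by move: L01 LL; clear; lra.
  have : 2 * e1 / (1 - s) <= 2 * e1 / (1 - sigma).
    apply: ler_wpM2l; first by rewrite mulr_ge0// ltW.
    rewrite lef_pV2 ?posrE ?subr_gt0//; last exact: le_lt_trans ssi si1.
    by rewrite lerD2l lerN2.
  by move: herr; clear; move: (_ / (1 - s)) (_ / (1 - sigma)) => *; lra.
exists e0 => // e /h[C [L0 L01 hC]].
exists (Num.max C 1); first by rewrite lt_max ltr01 orbT.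
exists L0 => // L s LL sss z0 x x' n Q s' h1 h2 h3 h4 h5 h6 hQ.
apply: le_trans (hC L s LL sss z0 x x' n Q s' h1 h2 h3 h4 h5 h6 hQ) _.
by apply: ler_wpM2r; [exact: expR_ge0|rewrite le_max lexx].
Qed.

(** Paley-Zygmund for the number of vertices near z that are thick and respect the profile at every
    scale of a finite grid. The pairs at the largest scale dominate, so the second moment exceeds
    the squared first moment by at most a factor of order [expR (eps / 2 * L)]. *)
Theorem thick_trial (a eps : R) : inhabited V -> 0 < a < 1 -> 0 < eps <= 1 ->
  exists2 L0, 1 <= L0 & forall L z (T : nat), L0 <= L -> expR ((2 + eps) * L) <= T%:R ->
  EX T z (fun p => (~~ success a eps L (belast z p))%:R) <= 1 - expR (- (eps * L)).
Proof.
move=> iV /andP[a0 a1] /andP[eps0 eps1].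
have a01 : 0 < a <= 1 by rewrite a0 ltW.
(* [e1] is quadratic in eps because the pair bound loses 2 e1 / (1 - sigma), with 1 - sigma = eps /
   16. This loss and the one from the grid step, 8 eps / 128, are then both eps / 16. *)
have [sigma sigmaE] : exists sigma, sigma = 1 - eps / 16 by exists (1 - eps / 16).
have [e1 e1E] : exists e1, e1 = eps ^+ 2 / 512 by exists (eps ^+ 2 / 512).
have si0 : 0 < sigma by rewrite sigmaE; move: eps1; clear; lra.
have si1 : sigma < 1 by rewrite sigmaE; move: eps0; clear; lra.
have e10 : 0 < e1.
  by rewrite e1E; apply: divr_gt0; [exact: exprn_gt0|rewrite ltr0n].
have rho0 : 0 < eps / 128 by rewrite divr_gt0.
have [K K0 sK] : exists2 K, (0 < K)%N & sigma / K%:R <= eps / 128.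
  exists (Num.trunc (128 / eps)).+1 => //.
  have h : 0 <= 128 / eps by rewrite divr_ge0// ltW.
  have /andP[_ h'] := truncn_itv h.
  rewrite ler_pdivrMr ?ltr0n// -ler_pdivrMl// invf_div.
  by apply: le_trans (ltW h'); rewrite ler_piMr// ltW.
have KR : 0 < K%:R :> R by rewrite ltr0n.
have herr : 8 * (eps / 128) + 2 * e1 / (1 - sigma) <= eps / 8.
  have -> : 2 * e1 / (1 - sigma) = eps / 16.
    by rewrite e1E sigmaE opprB addrC subrK; field; rewrite gt_eqF.
  by clear; lra.
pose ss := scales sigma K.
have ssP s : s \in ss -> 0 < s <= sigma by exact: scalesP.
have [m m0 [eb eb0 hb]] := bad_all iV a01 si1 e10 ssP.
have [ep ep0 hp] := pair_all iV a01 si1 e10 rho0 herr ssP.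
pose e := Num.min eb ep.
have e0 : 0 < e by rewrite lt_min eb0.
have [|Cb Cb0 [Lb Lb1 {}hb]] := hb e; first by rewrite e0 ge_min lexx.
have [|Cp Cp0 [Lp Lp1 {}hp]] := hp e; first by rewrite e0 ge_min lexx orbT.
pose eta := Num.min (eps / 16) (m / 2).
have eta0 : 0 < eta by rewrite lt_min !divr_gt0.
have [eta1 eta2] : eta <= eps / 16 /\ eta <= m / 2 by rewrite !ge_min !lexx orbT.
have si01 : 0 < sigma < 1 by rewrite si0.
have [c c0 [Lf Lf1 hf]] := first_moment G a01 si01 eta0.
have [Cn Cn0 hn] := count_le G.
have [L3 L31 hL3] := expR_dominates (2 * (K%:R * Cb) / c) (divr_gt0 m0 (ltr0n R 2 : 0 < 2)).
have [L4 L41 hL4] := scale_shrink si1.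
have [L5 L51 hL5] := expR_dominates 24 si0.
have sg0 := gs_gt0 G.
pose kap := c ^+ 2 / (576 * 64 * (K%:R * (4 * Cn * Cp))).
have kap0 : 0 < kap.
  rewrite /kap; apply: divr_gt0; first exact: exprn_gt0.
  apply: mulr_gt0; first by apply: mulr_gt0; rewrite ltr0n.
  by rewrite !mulr_gt0.
pose Cs := 9 / (4 * gs G ^+ 2).
have Cs0 : 0 < Cs by rewrite divr_gt0// mulr_gt0// exprn_gt0.
have [L6 L61 hL6] := expR_dominates ((1 + Cs) / kap) (divr_gt0 eps0 (ltr0n R 2 : 0 < 2)).
have [L7 L71 hL7] := expR_dominates (576 * 8 / c) (divr_gt0 eps0 (ltr0n R 2 : 0 < 2)).
exists (Lb + Lp + Lf + L3 + L4 + L5 + L6 + L7) => [|L z T hL hT].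
  by move: Lb1 Lp1 Lf1 L31 L41 L51 L61 L71; clear; lra.
have [L0 LLb LLp LLf] : [/\ 0 < L, Lb <= L, Lp <= L & Lf <= L].
  by move: hL Lb1 Lp1 Lf1 L31 L41 L51 L61 L71; clear => *; split; lra.
have [LL3 LL4 LL5 LL6] : [/\ L3 <= L, L4 <= L, L5 <= L & L6 <= L].
  by move: hL Lb1 Lp1 Lf1 L31 L41 L51 L61 L71; clear => *; split; lra.
have LL7 : L7 <= L by move: hL Lb1 Lp1 Lf1 L31 L41 L51 L61 L71; clear => *; lra.
have {}hL3 := hL3 L LL3; have {}hL4 := hL4 L LL4; have {}hL5 := hL5 L LL5.
have {}hL6 := hL6 L LL6; have {}hL7 := hL7 L LL7.
rewrite mul1r in hL4.
set B := vb z (expR L).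
pose X := expR (- ((2 * a + eta) * L)); have X0 : 0 < X := expR_gt0 _.
pose S := vb z (expR (sigma * L) / 2).
have eS : 0 < expR (sigma * L) / 2 by rewrite divr_gt0// expR_gt0.
have memS x : x \in S -> dist z x <= expR (sigma * L) / 2 by rewrite mem_vb// ltW.
have memS' x : x \in S -> dist z x <= expR (sigma * L).
  by move=> /memS; move: eS; clear; lra.
pose E x r := (level a L <= ltime x r) && all (fun s =>
  mean (annulus x L s e) (ltime^~ r) <= level (a * (1 - s) ^+ 2 + e1) L) ss.
(* Violating the truncation costs an additional exponent m by [bad_all], and [eta <= m / 2], so it
   removes at most half of the first moment; survival removes another quarter. *)
have step1 n x : survival B n z <= c / 4 * X -> x \in S -> c / 4 * X <= PX B n z (E x).
  move=> hs /memS' xS; have := hf L z x n LLf xS; rewrite -/X -/B => h1.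
  have h2 : PX B n z (fun r => level a L <= ltime x r) <= PX B n z (E x) +
      \sum_(s <- ss) PX B n z (fun r => (level a L <= ltime x r) &&
         ~~ (mean (annulus x L s e) (ltime^~ r) <= level (a * (1 - s) ^+ 2 + e1) L)).
    rewrite /PX -EX_sum -[X in X + _]mul1r -[X in _ + X]mul1r -EX_lin.
    apply: EX_le => p _; rewrite !mul1r /E; set r := killed _ _.
    case: (level a L <= ltime x r) => //=; last by rewrite add0r sumr_ge0.
    have [_|/allPn[s sss hs']] := boolP (all _ _).
      by rewrite lerDl sumr_ge0.
    rewrite add0r (perm_big _ (perm_to_rem sss)) big_cons hs' lerDl sumr_ge0//.
  have h3 : \sum_(s <- ss) PX B n z (fun r => (level a L <= ltime x r) &&
         ~~ (mean (annulus x L s e) (ltime^~ r) <= level (a * (1 - s) ^+ 2 + e1) L)) <=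
      K%:R * (Cb * expR (- ((2 * a + m) * L))).
    have -> : K = size ss by rewrite size_map size_iota.
    apply: sum_le_size => s sss; apply: (hb L s LLb sss z x n _ xS) => r /andP[-> /=].
    by rewrite -ltNge => /ltW.
  have h4 : K%:R * (Cb * expR (- ((2 * a + m) * L))) <= c / 2 * X.
    have -> : - ((2 * a + m) * L) = - ((2 * a + eta) * L) + - ((m - eta) * L) by ring.
    rewrite expRD -/X mulrA mulrA mulrAC ler_pM2r//.
    rewrite expRN ler_pdivrMr ?expR_gt0//.
    apply: (@le_trans _ _ (c / 2 * expR (m / 2 * L))); last first.
      rewrite ler_pM2l ?divr_gt0// ler_expR ler_pM2r//; move: eta2; clear; lra.
    by rewrite [leRHS]mulrAC ler_pdivlMr ?ltr0n// [leLHS]mulrC [leRHS]mulrC -ler_pdivrMr.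
  move: h1 h2 h3 h4 hs; clear; move: (\sum_(s <- ss) _) (PX B n z (E x)) => *; lra.
pose F (p : seq V) : R := \sum_(x <- S) (E x (killed B (belast z p)))%:R.
have cS : expR (sigma * L) ^+ 2 / 576 <= (size S)%:R.
  have h12 : 12 <= expR (sigma * L) / 2 by move: hL5; clear; lra.
  apply: le_trans (@gball_count_ge _ _ G (gx G z) (gy G z) (expR (sigma * L) / 2) iV h12).
  by rewrite !expr_div_n le_eqVlt; apply/orP; left; apply/eqP; field.
have nS0 : 0 < (size S)%:R :> R by apply: lt_le_trans cS; apply: divr_gt0; [rewrite exprn_gt0// expR_gt0|rewrite ltr0n].
(* Number of partners times pair probability at s = sigma: the exponent 2 s (1 - a) - 2 a increases
   with s because a < 1. *)
pose Y := expR ((2 * sigma * (1 - a) - 2 * a + eps / 8) * L); have Y0 : 0 < Y := expR_gt0 _.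
have second n : EX n z (fun p => F p ^+ 2) <= (size S)%:R * (K%:R * (4 * Cn * Cp * Y)).
  have -> : EX n z (fun p => F p ^+ 2) =
      \sum_(x <- S) \sum_(x' <- S) PX B n z (fun r => E x r && E x' r).
    transitivity (EX n z (fun p => \sum_(x <- S) \sum_(x' <- S)
        (E x (killed B (belast z p)) && E x' (killed B (belast z p)))%:R)).
      apply: eq_EX => p _; rewrite /F expr2 mulr_suml; apply: eq_bigr => x _.
      by rewrite mulr_sumr; apply: eq_bigr => x' _; rewrite -natrM mulnb.
    by rewrite EX_sum; apply: eq_bigr => x _; rewrite EX_sum.
  apply: sum_le_size => x xS.
  pose W s := Cp * expR (- ((2 * a * (1 + s) - eps / 8) * L)).
  have W0 s : 0 <= W s by rewrite mulr_ge0 ?expR_ge0// ltW.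
  apply: (@le_trans _ _ (\sum_(x' <- S) \sum_(s <- ss) (dist x x' <= expR (s * L))%R%:R * W s)).
    rewrite !big_seq; apply: ler_sum => x' x'S.
    have xx' : dist x x' <= expR (sigma * L).
      have := dist_triangle G x z x'; rewrite (dist_sym G x z).
      by have := memS x xS; have := memS x' x'S; clear; lra.
    have [s [s' [sss h1 h2 h3 h4]]] := scales_cover K0 si0 xx'.
    rewrite (perm_big _ (perm_to_rem sss)) big_cons h1 mul1r.
    apply: (@le_trans _ _ (W s)); last by rewrite lerDl sumr_ge0// => t _; rewrite mulr_ge0.
    apply: (hp L s LLp sss z x x' n _ s' (memS' x xS) (memS' x' x'S) h1 h2 _ h4) => [|r].
      by rewrite h3 lerD2l.
    move=> /andP[/andP[l1 a1'] /andP[l2 _]]; split=> //.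
    by have /allP/(_ s sss) := a1'.
  rewrite exchange_big/=; have -> : K = size ss by rewrite size_map size_iota.
  apply: sum_le_size => s sss; have /andP[s00 ssi] := ssP s sss.
  rewrite -mulr_suml sum_indicator.
  have sL : 0 <= s * L by rewrite mulr_ge0 ?(ltW s00)// ltW.
  have es1 : 1 <= expR (s * L) by rewrite -expR0 ler_expR.
  apply: (@le_trans _ _ (4 * Cn * expR (s * L) ^+ 2 * W s)).
    apply: ler_wpM2r => //; apply: le_trans (hn x (expR (s * L)) _ (expR_ge0 _) _ _) _.
    - by rewrite filter_uniq// vb_uniq.
    - by move=> y; rewrite mem_filter => /andP[].
    rewrite (_ : 4 * Cn * _ = Cn * (2 * expR (s * L)) ^+ 2); last by ring.
    rewrite ler_pM2l// lerXn2r ?nnegrE ?addr_ge0 ?mulr_ge0 ?expR_ge0//.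
    by move: es1; clear; lra.
  rewrite /W (_ : _ * _ = 4 * Cn * Cp * (expR (s * L) ^+ 2 * expR (- ((2 * a * (1 + s) - eps / 8) * L)))); last by ring.
  rewrite ler_pM2l ?mulr_gt0// -expRM_natl -expRD ler_expR.
  rewrite [leLHS](_ : _ = (2 * s * (1 - a) - 2 * a + eps / 8) * L); last by ring.
  rewrite ler_pM2r// lerD2r lerD2r ler_pM2r ?subr_gt0// ler_pM2l//.
pose A := (expR L + 2) ^+ 2 / (4 * gs G ^+ 2).
have A0 : 0 <= A by rewrite divr_ge0 ?sqr_ge0// mulr_ge0// sqr_ge0.
have T0 : (0 < T)%N by rewrite -(ltr0n R); apply: lt_le_trans hT; exact: expR_gt0.
have surv n : (0 < n)%N -> survival B n z <= A / n%:R.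
  by move=> n0; apply: survival_ball => //; exact: expR_ge0.
have cX : 0 < c / 4 * X by rewrite mulr_gt0// divr_gt0.
(* The first moment asks for a horizon so long that survival is negligible beside [X]; [PX_prefix]
   returns to the horizon T afterwards. *)
have [n' hn'] : exists n', survival B (T + n') z <= c / 4 * X.
  exists (Num.trunc (A / (c / 4 * X))).+1.
  apply: (le_trans (surv _ _)); first by rewrite addnS.
  have h : 0 <= A / (c / 4 * X) by rewrite divr_ge0// ltW.
  have /andP[_ h'] := truncn_itv h.
  rewrite ler_pdivrMr; last by rewrite ltr0n addnS.
  rewrite -ler_pdivrMl// mulrC; apply: (le_trans (ltW h')).
  by rewrite ler_nat leq_addl.
pose N : R := (size S)%:R; pose M := N * (K%:R * (4 * Cn * Cp * Y)).
have M0 : 0 < M by rewrite !mulr_gt0.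
pose mu := N * (c / 4 * X); have mu0 : 0 < mu by rewrite mulr_gt0.
have first : mu <= EX (T + n') z F.
  rewrite EX_sum (_ : mu = \sum_(x <- S) (c / 4 * X)).
    by rewrite !big_seq; apply: ler_sum => x xS; exact: step1.
  by rewrite /mu /N mulr_natl big_const_seq count_predT iter_addr_0.
have F0 p : 0 <= F p by rewrite sumr_ge0.
have := paley_zygmund mu0 M0 F0 first (second _).
have hmu : kap * expR (- (eps / 2 * L)) <= mu ^+ 2 / (4 * M).
  have -> : mu ^+ 2 / (4 * M) = (c ^+ 2 / (64 * (K%:R * (4 * Cn * Cp)))) * (N * (X ^+ 2 / Y)).
    by rewrite /mu /M; field; rewrite !gt_eqF.
  have -> : kap * expR (- (eps / 2 * L)) = (c ^+ 2 / (64 * (K%:R * (4 * Cn * Cp)))) * (expR (- (eps / 2 * L)) / 576).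
    by rewrite /kap; field; rewrite !gt_eqF.
  apply: ler_wpM2l; first by rewrite divr_ge0 ?sqr_ge0// !mulr_ge0// ltW.
  apply: (@le_trans _ _ (expR (sigma * L) ^+ 2 / 576 * (X ^+ 2 / Y))); last first.
    by apply: ler_wpM2r cS; rewrite divr_ge0 ?sqr_ge0// ltW.
  rewrite [leRHS]mulrAC ler_pM2r ?invr_gt0 ?ltr0n// /X /Y -!expRM_natl -expRN -!expRD ler_expR.
  rewrite [leRHS](_ : _ = (2 * sigma - 2 * (2 * a + eta) - (2 * sigma * (1 - a) - 2 * a + eps / 8)) * L); last by ring.
  rewrite -mulNr ler_pM2r//.
  have h : a * (1 - sigma) <= 1 - sigma by rewrite ler_piMl ?subr_ge0 ?ltW.
  by move: h eta1; rewrite {2}sigmaE; clear -eps0; nra.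
move=> /(le_trans hmu) hZ.
pose Q r : bool := expR ((2 - 2 * a - eps) * L) <= (size (thick B (level a L) r))%:R.
have hQ : EX (T + n') z (fun p => (mu / 2 <= F p)%R%:R) <= PX B (T + n') z Q.
  apply: EX_le => p _; have [h|h] := leP (mu / 2) (F p); last exact: ler0n.
  suff -> : Q (killed B (belast z p)) by [].
  apply: (@le_trans _ _ (mu / 2)).
    apply: (@le_trans _ _ (expR (sigma * L) ^+ 2 / 576 * (c / 4 * X) / 2)).
      rewrite (_ : _ / 2 = c / (576 * 8) * (expR (sigma * L) ^+ 2 * X)); last by field.
      rewrite /X -expRM_natl -expRD.
      apply: (@le_trans _ _ (c / (576 * 8) * (expR (eps / 2 * L) * expR ((2 - 2 * a - eps) * L)))).
        rewrite mulrA; apply: ler_peMl; first exact: expR_ge0.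
        by rewrite -ler_pdivrMl ?divr_gt0 ?mulr_gt0 ?ltr0n// mulr1 invf_div.
      rewrite ler_pM2l ?divr_gt0 ?mulr_gt0 ?ltr0n// -expRD ler_expR -mulrDl.
      rewrite [leRHS](_ : _ = (2 * sigma - (2 * a + eta)) * L); last by ring.
      by rewrite ler_pM2r// sigmaE; move: eta1 eps0; clear; lra.
    by rewrite ler_pM2r ?invr_gt0// ler_pM2r.
  apply: (le_trans h); rewrite /F sum_indicator ler_nat.
  apply: uniq_leq_size; first by rewrite filter_uniq// vb_uniq.
  move=> x; rewrite !mem_filter => /andP[/andP[-> _] xS] /=.
  rewrite mem_vb ?expR_ge0//; have := memS' x xS; move: hL4; have := expR_gt0 (sigma * L).
  by clear; lra.
have hT' : survival B T z <= Cs * expR (- (eps * L)).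
  apply: (le_trans (surv T T0)); rewrite ler_pdivrMr ?ltr0n//.
  apply: (@le_trans _ _ (Cs * expR (- (eps * L)) * expR ((2 + eps) * L))); last first.
    by rewrite ler_pM2l// mulr_gt0// expR_gt0.
  rewrite -mulrA -expRD (_ : - (eps * L) + (2 + eps) * L = 2%:R * L); last by ring.
  rewrite expRM_natl /A /Cs [leRHS]mulrAC; apply: ler_wpM2r.
    by rewrite invr_ge0 mulr_ge0// sqr_ge0.
  rewrite (_ : 9 * _ = (3 * expR L) ^+ 2); last by ring.
  rewrite lerXn2r ?nnegrE ?addr_ge0 ?mulr_ge0 ?expR_ge0//.
  have : 1 <= expR L by rewrite -expR0 ler_expR ltW.
  by clear; lra.
have hP : expR (- (eps * L)) <= PX B T z Q.
  have h1 : (1 + Cs) * expR (- (eps * L)) <= kap * expR (- (eps / 2 * L)).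
    rewrite (_ : - (eps / 2 * L) = eps / 2 * L - eps * L); last by field.
    rewrite expRD mulrA ler_pM2r ?expR_gt0// -ler_pdivrMl// mulrC; exact: hL6.
  by have := PX_prefix B T n' z Q; move: h1 hZ hQ hT'; clear => *; lra.
have -> : EX T z (fun p => (~~ success a eps L (belast z p))%:R) = 1 - PX B T z Q.
  transitivity (EX T z (fun p => 1 * 1 + (- 1) * (Q (killed B (belast z p)))%:R)).
    apply: eq_EX => -[|w p] pT; first by rewrite -pT in T0.
    have -> : success a eps L (belast z (w :: p)) = Q (killed B (belast z (w :: p))) by [].
    by case: (Q _); rewrite /= ?mulr0 ?mulr1 ?addr0 ?subrr.
  by rewrite (EX_lin G T z (fun=> 1)) EX_const !mul1r mulN1r.
by rewrite lerD2l lerN2.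
Qed.

End TrialSuccess.

(** * Estimates for the embedded walk with small failure probability *)

Section Discrete.
Variables (R : realType) (V : choiceType) (G : rhombic_graph R V).
Local Notation dist := (dist G).
Local Notation rate := (rate G).
Local Notation vb := (vb G).
Local Notation ltime := (ltime G).
Local Notation PX := (PX G).
Local Notation EX := (EX G).
Local Notation survival := (survival G).
Local Notation thick := (thick G).
Local Notation success := (success G).
Implicit Types (x y z w : V) (B D r s : seq V) (Q : pred (seq V)) (F : seq V -> R).

Lemma ltime_subseq x r r' : subseq r r' -> ltime x r <= ltime x r'.
Proof.
move=> h; rewrite !ltime_count ler_wpM2r ?invr_ge0 ?(ltW (rate_gt0 G x))//.
by rewrite ler_nat leq_count_subseq.
Qed.

Lemma thick_size B B' (lv lv' : R) r r' : uniq B -> {subset B <= B'} -> lv' <= lv -> subseq r r' ->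
  (size (thick B lv r) <= size (thick B' lv' r'))%N.
Proof.
move=> uB BB' hl rr'; apply: uniq_leq_size; first by rewrite filter_uniq.
move=> x; rewrite !mem_filter => /andP[h /BB' ->]; rewrite andbT.
exact: le_trans hl (le_trans h (ltime_subseq x rr')).
Qed.

Lemma killed_id B s : all (mem B) s -> killed B s = s.
Proof. by elim: s => //= a s IH /andP[-> /IH ->]. Qed.

Lemma killed_prefix B s t : subseq (killed B s) (killed B (s ++ t)).
Proof.
elim: s => [|a s IH] /=; first exact: sub0seq.
by case: ifP => // _; rewrite /= eqxx.
Qed.

Lemma killed_subseq B s : subseq (killed B s) s.
Proof. by elim: s => //= a s IH; case: ifP => //= _; rewrite eqxx. Qed.

Lemma window_successP (suc : pred (seq V)) T m s : window_success suc T m s ->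
  exists s1 r s2, s = s1 ++ r ++ s2 /\ suc r.
Proof.
elim: m s => //= m IH s /orP[h|/IH[s1 [r [s2 [E h]]]]].
  by exists [::], (take T s), (drop T s); rewrite cat_take_drop.
by exists (take T s ++ s1), r, s2; rewrite -catA -E cat_take_drop.
Qed.

Lemma EX_markov n z F (t : R) : 0 < t -> (forall p, 0 <= F p) ->
  EX n z (fun p => (t <= F p)%R%:R) <= EX n z F / t.
Proof.
move=> t0 F0; have -> : EX n z F / t = EX n z (fun p => t^-1 * F p + 0 * 0).
  by rewrite (EX_lin G n z F (fun=> 0)) mul0r addr0 mulrC.
apply: EX_le => p _; rewrite mul0r addr0.
have [h|h] := leP t (F p); first by rewrite ler_pdivlMl// mulr1.
by rewrite mulr_ge0// invr_ge0 ltW.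
Qed.

(** One trial succeeds with probability at least [expR (- (e * L'))] only, so about
    [expR (2 * e * L)] windows are run in slightly smaller discs, of radius [expR L']. All of them
    together take at most [2 * expR ((2 - d) * L)] steps, during which the walk hardly ever gets to
    distance of order [expR L]. *)
Lemma discrete_lower (a eps c : R) : inhabited V -> 0 < a < 1 -> 0 < eps -> 0 < c ->
  exists2 kap, 0 < kap & exists2 L0, 1 <= L0 & forall L x0 B n, L0 <= L ->
  {subset vb x0 (c * expR L) <= B} -> expR (3 * L) <= n%:R ->
  EX n x0 (fun p => (~~ (expR ((2 - 2 * a - eps) * L) <=
     (size (thick B (level a L) (killed B (belast x0 p))))%:R)%R)%:R) <= expR (- (kap * L)).
Proof.
move=> iV /andP[a0 a1] eps0 c0.
pose d := Num.min (1 / 4) (Num.min (eps / 8) ((1 - a) / 4)).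
have [d0 d4 de da] : [/\ 0 < d, d <= 1 / 4, d <= eps / 8 & d <= (1 - a) / 4].
  by rewrite /d !lt_min !ge_min !lexx !orbT !divr_gt0// subr_gt0.
have d1 : 0 < 1 - d by move: d4; clear; lra.
(* The level is quadratic in L, so level a' in the disc of exponent (1 - d) L is level a at L. *)
pose a' := a / (1 - d) ^+ 2.
have a'E : a' * (1 - d) ^+ 2 = a by rewrite /a' divfK// gt_eqF// exprn_gt0.
have a'01 : 0 < a' < 1.
  rewrite divr_gt0 ?exprn_gt0//= ltr_pdivrMr ?exprn_gt0// mul1r expr2.
  by move: da d0 a1; clear; nra.
(* Small enough for 2 e + (2 + e) (1 - d) to be at most 2 - d, which bounds the total duration of
   the windows. *)
pose e := d / 4.
have e01 : 0 < e <= 1 by rewrite /e; move: d0 d4; clear; lra.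
have /andP[e0 e1] := e01.
have [L1 L11 hL1] := thick_trial G iV a'01 e01.
have [L2 L21 hL2] := expR_dominates (8 / c) d0.
have [L3 L31 hL3] := expR_dominates (16 : R) e0.
have [L4 L41 hL4] := expR_dominates (64 / c ^+ 2) (divr_gt0 d0 (ltr0n R 2 : 0 < 2)).
have [L5 L51 hL5] := expR_dominates (2 : R) (ltr01 : (0 : R) < 1).
exists e => //.
exists (L1 / (1 - d) + L2 + L3 + L4 + L5 + 2 / e) => [|L x0 B n hL hB hn].
  have : 0 <= L1 / (1 - d) by rewrite divr_ge0 ?(ltW d1)//; move: L11; clear; lra.
  have : 0 <= 2 / e by rewrite divr_ge0// ltW.
  by move: L21 L31 L41 L51; clear; lra.
have hpos : 0 <= L1 / (1 - d) by rewrite divr_ge0 ?(ltW d1)//; move: L11; clear; lra.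
have hpos' : 0 <= 2 / e by rewrite divr_ge0// ltW.
have [L0 LL2 LL3 LL4] : [/\ 0 < L, L2 <= L, L3 <= L & L4 <= L].
  by move: hL hpos hpos' L21 L31 L41 L51; clear => *; split; lra.
have [LL1 LL5 LLe] : [/\ L1 / (1 - d) <= L, L5 <= L & 2 / e <= L].
  by move: hL hpos hpos' L21 L31 L41 L51; clear => *; split; lra.
have {}hL2 := hL2 L LL2; have {}hL3 := hL3 L LL3; have {}hL4 := hL4 L LL4.
have {}hL5 := hL5 L LL5; rewrite mul1r in hL5.
pose L' := (1 - d) * L.
have LL1' : L1 <= L' by rewrite /L' mulrC -ler_pdivrMr.
have L'0 : 0 < L' by rewrite mulr_gt0.
pose T := (Num.trunc (expR ((2 + e) * L'))).+1.
pose m := Num.trunc (expR (2 * e * L)).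
have /andP[T1 T2] := truncn_itv (expR_ge0 ((2 + e) * L')).
have /andP[m1 m2] := truncn_itv (expR_ge0 (2 * e * L)).
rewrite -/T in T2; rewrite -/m in m1 m2.
have hT : forall z, EX T z (fun p => (~~ success a' e L' (belast z p))%:R) <= 1 - expR (- (e * L')).
  by move=> z; apply: hL1 => //; exact: ltW.
have E1 : 1 <= expR ((2 + e) * L').
  by rewrite -expR0 ler_expR mulr_ge0 ?(ltW L'0)// addr_ge0// ltW.
have TU : T%:R <= 2 * expR ((2 + e) * L').
  by move: T1 E1; rewrite /T -natr1 ; clear; lra.
have EmT : expR (2 * e * L) * expR ((2 + e) * L') <= expR ((2 - d) * L).
  rewrite -expRD ler_expR /L' [leLHS](_ : _ = (2 * e + (2 + e) * (1 - d)) * L); last by ring.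
  by rewrite ler_pM2r// /e; move: d0 d4; clear; nra.
have mT : (m * T)%:R <= 2 * expR ((2 - d) * L).
  rewrite natrM; apply: le_trans (ler_pM _ _ m1 TU) _ => //.
  by rewrite mulrCA ler_pM2l.
have mTn : (m * T <= n)%N.
  rewrite -(ler_nat R); apply: (le_trans mT); apply: le_trans hn.
  apply: (le_trans (ler_wpM2r (expR_ge0 _) hL5)); rewrite -expRD ler_expR.
  by rewrite -[X in X + _]mul1r -mulrDl ler_pM2r//; move: d0; clear; lra.
have q0 : 0 <= 1 - expR (- (e * L')) by rewrite subr_ge0 -expR0 ler_expR oppr_le0 mulr_ge0// ltW.
have fail := window_failure m x0 q0 hT.
have failU : (1 - expR (- (e * L'))) ^+ m <= expR (- (e * L)) / 2.
  have h1 : 1 - expR (- (e * L')) <= expR (- expR (- (e * L'))) by exact: expR_ge1Dx.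
  apply: le_trans (lerXn2r m _ _ h1) _; rewrite ?nnegrE ?expR_ge0//.
  rewrite -expRM_natl mulrN.
  have h2 : expR (2 * e * L) / 2 <= m%:R.
    have : expR (e * L) <= expR (2 * e * L).
      by rewrite ler_expR ler_pM2r//; move: e0; clear; lra.
    by move: hL3 m2; rewrite -natr1; clear; lra.
  have h3 : expR (e * L) / 2 <= m%:R * expR (- (e * L')).
    apply: (@le_trans _ _ (expR (2 * e * L) / 2 * expR (- (e * L)))).
      rewrite [leRHS]mulrAC -expRD (_ : 2 * e * L + - (e * L) = e * L)//; ring.
    apply: ler_pM => //; rewrite ?divr_ge0 ?expR_ge0// ler_expR lerN2 ler_pM2l// /L'.
    by rewrite ler_piMl ?(ltW L0)//; move: d0; clear; lra.
  have h4 (y : R) : 16 <= y -> 2 * y <= expR (y / 2).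
    move=> y16; have h : 0 <= y / 2 by move: y16; clear; lra.
    apply: le_trans (expR_ge1Dxn 1 h).
    rewrite (_ : 2`!%:R = 2 :> R)//; move: y16; clear; nra.
  apply: (@le_trans _ _ (expR (- (expR (e * L) / 2)))); first by rewrite ler_expR lerN2.
  rewrite expRN (expRN (e * L)) -invfM lef_pV2 ?posrE ?mulr_gt0 ?expR_gt0//.
  by rewrite mulrC; exact: h4.
pose r := c / 2 * expR L; have r0 : 0 < r by rewrite mulr_gt0 ?expR_gt0// divr_gt0.
have ex := exit_bound G x0 (m * T) x0 r0.
have exU : (gd2 G x0 x0 + 4 * (m * T)%:R) / r ^+ 2 <= expR (- (e * L)) / 2.
  rewrite -dist_sqr distxx expr0n add0r ler_pdivrMr ?exprn_gt0//.
  apply: (@le_trans _ _ (8 * expR ((2 - d) * L))); first by move: mT; clear; lra.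
  have -> : expR (- (e * L)) / 2 * r ^+ 2 = c ^+ 2 / 8 * (expR (- (e * L)) * expR L ^+ 2).
    by rewrite /r; field.
  have cc : 0 < c ^+ 2 by rewrite exprn_gt0.
  rewrite -expRM_natl -expRD; apply: (@le_trans _ _ (c ^+ 2 / 8 * (expR (d / 2 * L) * expR ((2 - d) * L)))).
    rewrite mulrA ler_pM2r ?expR_gt0//; move: hL4.
    rewrite ler_pdivrMr// => h; move: h; clear; move: (expR _) (c ^+ 2) => *; lra.
  apply: ler_wpM2l; first by rewrite divr_ge0// ltW.
  rewrite -expRD ler_expR -mulrDl [leRHS](_ : _ = (2 - e) * L); last by ring.
  by rewrite ler_pM2r// /e; move: d0; clear; lra.
have eL' : expR L' <= r.
  rewrite /L' mulrBl mul1r expRD mulrC /r ler_pM2r ?expR_gt0// expRN.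
  rewrite -[leRHS]invrK lef_pV2 ?posrE ?invr_gt0 ?divr_gt0 ?expR_gt0// invf_div.
  by apply: le_trans hL2; rewrite ler_pM2r ?invr_gt0// ler_nat.
have levE : level a L = level a' L' by rewrite /level /scale /L' -a'E; ring.
have thr : expR ((2 - 2 * a - eps) * L) <= expR ((2 - 2 * a' - e) * L').
  rewrite ler_expR /L' mulrA ler_pM2r//.
  have : a' * (1 - d) <= a + 2 * d.
    rewrite -(ler_pM2r d1) -mulrA -expr2 a'E; move: a1 d4 d0; clear; nra.
  by rewrite /e; move: de d0 e0; clear; nra.
have claim p q : window_success (success a' e L') T m (belast x0 p) ->
    ~~ has (fun v => r < dist x0 v) (x0 :: p) ->
    expR ((2 - 2 * a - eps) * L) <=
     (size (thick B (level a L) (killed B (belast x0 (p ++ q)))))%:R.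
  move=> /window_successP[s1 [w [s2 [E hw]]]] hex.
  have hall v : v \in belast x0 p -> dist x0 v <= r.
    move=> vp; rewrite leNgt; apply: contraNN hex => h; apply/hasP; exists v => //.
    exact: mem_belast vp.
  have inB v : dist x0 v <= 2 * r -> v \in B.
    move=> h; apply: hB; rewrite mem_vb ?mulr_ge0 ?expR_ge0 ?(ltW c0)//.
    by move: h; rewrite /r; move: (expR L) => y; clear; lra.
  case: w hw E => // z w hw E.
  have zr : dist x0 z <= r by apply: hall; rewrite E mem_cat inE eqxx orbT.
  apply: (le_trans thr); apply: (le_trans hw); rewrite ler_nat.
  apply: thick_size; first exact: vb_uniq.
  - move=> y; rewrite mem_vb ?expR_ge0// => h; apply: inB.
    by have := dist_triangle G x0 z y; move: h zr eL'; clear; lra.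
  - by rewrite levE.
  - apply: subseq_trans (killed_subseq _ _) _.
    rewrite belast_cat; apply: subseq_trans (killed_prefix B _ _).
    rewrite killed_id; last first.
      by apply/allP => v /hall h; apply: inB; move: h r0; clear; lra.
    rewrite E; apply: subseq_trans (suffix_subseq s1 _).
    exact: prefix_subseq.
rewrite -(subnKC mTn) EX_cat.
apply: (@le_trans _ _ (EX (m * T) x0 (fun p =>
    1 * (~~ window_success (success a' e L') T m (belast x0 p))%:R +
    1 * (has (fun v => r < dist x0 v) (x0 :: p))%:R))); last first.
  rewrite EX_lin !mul1r; apply: (le_trans (lerD (le_trans fail failU) (le_trans ex exU))).
  by rewrite -splitr.
apply: EX_le => p _; rewrite !mul1r.
case: (boolP (has _ _)) => hex.
  apply: (@le_trans _ _ 1); last by rewrite lerDr.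
  rewrite -[leRHS](EX_const G (n - m * T) (last x0 p)); apply: EX_le => q _.
  by case: (expR _ <= _)%R.
case: (boolP (window_success _ _ _ _)) => hw.
  rewrite -[leRHS](EX_const G (n - m * T) (last x0 p)); apply: EX_le => q _.
  by rewrite (claim p q hw hex)/= addr0.
apply: (@le_trans _ _ 1); last by rewrite lerDl.
rewrite -[leRHS](EX_const G (n - m * T) (last x0 p)); apply: EX_le => q _.
by case: (expR _ <= _)%R.
Qed.

(** Markov's inequality for the number of thick points, with [single_bound] at each vertex. *)
Lemma discrete_upper (a eps : R) : 0 <= a -> 0 < eps ->
  exists2 kap, 0 < kap & exists2 L0, 1 <= L0 & forall L x0 B n, L0 <= L -> uniq B ->
  {subset B <= vb x0 (2 * expR L)} ->
  EX n x0 (fun p => (expR ((2 - 2 * a + eps) * L) <=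
     (size (thick B (level a L) (killed B (belast x0 p))))%:R)%R%:R) <= expR (- (kap * L)).
Proof.
move=> a0 eps0.
have [e [e0 e1 ea]] : exists e, [/\ 0 < e, e <= 1 / 4 & 6 * a * e <= eps / 4].
  exists (Num.min (1 / 4) (eps / (24 * (a + 1)))); rewrite lt_min ge_min lexx.
  have a1 : 0 < 24 * (a + 1) by move: a0; clear; lra.
  split; rewrite ?divr_gt0//.
  apply: (@le_trans _ _ (6 * a * (eps / (24 * (a + 1))))).
    by rewrite ler_wpM2l ?mulr_ge0// ge_min lexx orbT.
  rewrite mulrA ler_pdivrMr//; move: a0 eps0; clear; nra.
have a'0 : 0 <= a * (1 - e) by rewrite mulr_ge0// ; move: e1; clear; lra.
have [C [L1 L11 hC]] := single_bound G a'0 e0.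
have [Cn Cn0 hn] := count_le G.
have [L2 L21 hL2] := expR_dominates (9 * Cn * `|C|) (divr_gt0 eps0 (ltr0n R 4 : 0 < 4)).
exists (eps / 2); first by rewrite divr_gt0.
have ln4 : 0 <= ln 4 :> R by rewrite ln_ge0// ler1n.
exists (L1 + L2 + 8 * ln 4 / e) => [|L x0 B n hL uB hB].
  have : 0 <= 8 * ln 4 / e by rewrite divr_ge0 ?(ltW e0)// mulr_ge0.
  by move: L11 L21; clear; lra.
have hl : 0 <= 8 * ln 4 / e by rewrite divr_ge0 ?(ltW e0)// mulr_ge0.
have [L0 LL1 LL2 LL3] : [/\ 0 < L, L1 <= L, L2 <= L & 8 * ln 4 / e <= L].
  by move: hL hl L11 L21; clear => *; split; lra.
have {}hL2 := hL2 L LL2.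
(* Each x in B gets a disc of radius [4 * expR L] about itself, which contains B. *)
pose L' := L + ln 4.
have eL' : expR L' = 4 * expR L by rewrite expRD lnK ?posrE// mulrC.
have lev : level (a * (1 - e)) L' <= level a L.
  have h : L' * L' * (1 - e) <= L * L.
    have : 8 * ln 4 <= e * L by rewrite [leRHS]mulrC -ler_pdivrMr.
    by rewrite /L'; move: ln4 e0 e1 L0; clear; move: (ln 4) => l l0 e0 e1 L0 h; nra.
  rewrite /level /scale !mulrA ler_wpM2r ?invr_ge0 ?mulr_ge0 ?pi_ge0//.
  rewrite [leLHS](_ : _ = 2 * a * (L' * L' * (1 - e))); last by ring.
  by rewrite -[leRHS]mulrA ler_wpM2l// mulr_ge0.
have one x : x \in B -> EX n x0 (fun p => (level a L <= ltime x (killed B (belast x0 p)))%R%:R) <=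
    `|C| * expR (- ((2 * a - 6 * a * e) * L)).
  move=> xB; have xx0 := hB x xB; rewrite mem_vb ?mulr_ge0 ?expR_ge0// in xx0.
  apply: (@le_trans _ _ (PX (vb x (expR L')) n x0 (fun r => level (a * (1 - e)) L' <= ltime x r))).
    apply: EX_le => p _; case: (boolP (level a L <= _)) => h; last exact: ler0n.
    suff -> : level (a * (1 - e)) L' <= ltime x (killed (vb x (expR L')) (belast x0 p)) by [].
    apply: le_trans lev (le_trans h _); apply: ltime_subseq; apply: killed_sub => y /hB.
    rewrite !mem_vb ?mulr_ge0 ?expR_ge0// eL' => hy.
    by have := dist_triangle G x x0 y; rewrite (dist_sym G x x0); move: xx0 hy; clear; lra.
  apply: le_trans (hC L' x x0 x n _ _ _ _) _ => //.
  - by rewrite /L'; move: LL1 ln4; clear; lra.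
  - by rewrite distxx divr_ge0 ?expR_ge0.
  apply: (le_trans (ler_wpM2r (expR_ge0 _) (ler_norm C))).
  apply: ler_wpM2l => //; rewrite ler_expR lerN2.
  apply: (@le_trans _ _ (2 * (a * (1 - e)) * (1 - 2 * e) * L)).
    rewrite ler_pM2r//; have : 0 <= a * e ^+ 2 by rewrite mulr_ge0 ?sqr_ge0.
    by clear; move: a => a; nra.
  apply: ler_wpM2l; last by rewrite lerDl.
  by rewrite !mulr_ge0//; move: e1; clear; lra.
have nB : (size B)%:R <= 9 * Cn * expR L ^+ 2.
  apply: le_trans (hn x0 (2 * expR L) B _ uB _) _.
  - by rewrite mulr_ge0 ?expR_ge0.
  - by move=> y /hB; rewrite mem_vb// mulr_ge0 ?expR_ge0.
  rewrite (_ : 9 * Cn * _ = Cn * (3 * expR L) ^+ 2); last by ring.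
  rewrite ler_pM2l// lerXn2r ?nnegrE ?addr_ge0 ?mulr_ge0 ?expR_ge0//.
  have : 1 <= expR L by rewrite -expR0 ler_expR ltW.
  by clear; lra.
apply: le_trans (@EX_markov n x0 (fun p => (size (thick B (level a L) (killed B (belast x0 p))))%:R) _ (expR_gt0 _) _) _ => //.
rewrite ler_pdivrMr ?expR_gt0//.
have -> : EX n x0 (fun p => (size (thick B (level a L) (killed B (belast x0 p))))%:R) =
    \sum_(x <- B) EX n x0 (fun p => (level a L <= ltime x (killed B (belast x0 p)))%R%:R).
  by rewrite -EX_sum; apply: eq_EX => p _; rewrite sum_indicator.
apply: le_trans (sum_le_size one) _.
apply: le_trans (ler_wpM2r _ nB) _; first by rewrite mulr_ge0 ?expR_ge0.
rewrite -expRM_natl -expRD.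
rewrite [leLHS](_ : _ = 9 * Cn * `|C| * (expR (2%:R * L) * expR (- ((2 * a - 6 * a * e) * L)))); last by ring.
apply: le_trans (ler_wpM2r _ hL2) _; first by rewrite mulr_ge0 ?expR_ge0.
rewrite -!expRD ler_expR [leLHS](_ : _ = (eps / 4 + 2 - 2 * a + 6 * a * e) * L); last by ring.
rewrite [leRHS](_ : _ = (2 - 2 * a + eps / 2) * L); last by field.
by rewrite ler_pM2r//; move: ea; clear; lra.
Qed.

Lemma survival_mono B B' n z : {subset B <= B'} -> survival B n z <= survival B' n z.
Proof.
move=> BB; apply: EX_le => p _; case: (boolP (all _ _)) => // h.
by rewrite (sub_all _ h).
Qed.

Lemma discrete_survival : exists2 L0, 1 <= L0 & forall (L : R) x0 B n, L0 <= L ->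
  {subset B <= vb x0 (2 * expR L)} -> expR (3 * L) <= n%:R ->
  survival B n x0 <= expR (- (L / 2)).
Proof.
have sg0 := gs_gt0 G; have sg2 : 0 < gs G ^+ 2 by rewrite exprn_gt0.
have [L1 L11 hL1] := expR_dominates (4 / gs G ^+ 2) (divr_gt0 (ltr01 : 0 < 1) (ltr0n R 2 : 0 < 2)).
have [L2 L21 hL2] := expR_dominates (2 : R) (ltr01 : (0 : R) < 1).
exists (L1 + L2) => [|L x0 B n hL hB hn]; first lra.
have L0 : 0 < L by lra.
have {}hL1 : 4 / gs G ^+ 2 <= expR (1 / 2 * L) by apply: hL1; lra.
have {}hL2 : 2 <= expR (1 * L) by apply: hL2; lra.
rewrite mul1r in hL2.
have n0 : (0 < n)%N by rewrite -(ltr0n R); apply: lt_le_trans hn; exact: expR_gt0.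
apply: (le_trans (survival_mono n x0 hB)).
apply: (le_trans (survival_ball _ _ _ n0)); first by rewrite mulr_ge0 ?expR_ge0.
rewrite ler_pdivrMr ?ltr0n// ler_pdivrMr ?mulr_gt0//.
apply: (@le_trans _ _ (expR (- (L / 2)) * expR (3 * L) * (4 * gs G ^+ 2))); last first.
  by rewrite ler_pM2r ?mulr_gt0// ler_pM2l ?expR_gt0.
rewrite -expRD (_ : - (L / 2) + 3 * L = 2%:R * L + 1 / 2 * L); last by field.
rewrite expRD expRM_natl.
apply: (@le_trans _ _ (16 * expR L ^+ 2)).
  by rewrite (_ : 16 * _ = (4 * expR L) ^+ 2) ?lerXn2r ?nnegrE ?addr_ge0 ?mulr_ge0 ?expR_ge0//; [lra|ring].
rewrite -mulrA mulrC; have e20 : 0 <= expR L ^+ 2 by rewrite sqr_ge0.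
rewrite mulrC [leRHS]mulrC; apply: ler_wpM2r => //.
by move: hL1; rewrite ler_pdivrMr//; lra.
Qed.

End Discrete.

(** * Comparison of graph balls with Euclidean discs *)

Section GraphBall.
Variables (R : realType) (V : choiceType) (G : rhombic_graph R V) (adj : rel V).
Hypotheses (nb_adj : forall x y, (y \in nb G x) = adj x y) (adj_connected : connected_graph adj).
Local Notation dist := (dist G).
Local Notation vb := (vb G).
Implicit Types x y z : V.

Lemma graph_dist_le x y N :
  (graph_dist adj x y <= N)%N <-> exists2 n, (n <= N)%N & walk_of_length adj n x y.
Proof.
have [n0 w0] := adj_connected x y.
have exmin : exists n, walk_of_length adj n x y /\ forall m, walk_of_length adj m x y -> (n <= m)%N.
  have h : exists n, `[< walk_of_length adj n x y >] by exists n0; apply/asboolP.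
  case: (ex_minnP h) => n /asboolP wn nmin; exists n; split=> // m wm.
  by apply: nmin; apply/asboolP.
rewrite /graph_dist; case: xgetP => [d _ [wd dmin]|h]; last by case: exmin => n /h.
by split=> [dN|[n nN /dmin dn]]; [exists d|exact: leq_trans nN].
Qed.

Lemma walk_cat n m x y z : walk_of_length adj n x y -> walk_of_length adj m y z ->
  walk_of_length adj (n + m) x z.
Proof.
move=> [p [pp pl <-]] [q [qp ql <-]]; exists (p ++ q).
by rewrite cat_path last_cat pl pp qp ql size_cat.
Qed.

Lemma walk_dist n x y : walk_of_length adj n x y -> dist x y <= 2 * n%:R.
Proof.
move=> [p [pp pl <-]]; elim: p x pp pl => [x _ /= ->|w p IH x /= /andP[xw wp] pl].
  by rewrite distxx mulr0.
have := IH w wp pl; have := dist_triangle G x w y.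
move: xw; rewrite -nb_adj => /edge_dist/andP[_]; rewrite -natr1; lra.
Qed.

Lemma graph_ball_sub x0 N x : graph_ball adj x0 N x -> dist x0 x <= 2 * N%:R.
Proof.
move=> /graph_dist_le[n nN /walk_dist]; rewrite dist_sym => h; apply: (le_trans h).
by rewrite ler_pM2l// ler_nat.
Qed.

(** At distance more than 2, a suitable neighbour is closer by at least [gs G ^+ 2 / 2]. *)
Lemma approach x0 n x : dist x0 x <= 2 + n%:R * (gs G ^+ 2 / 2) ->
  exists y m, [/\ (m <= n)%N, walk_of_length adj m x y & dist x0 y <= 2].
Proof.
have g2 : 0 < gs G ^+ 2 by rewrite exprn_gt0// gs_gt0.
elim: n x => [|n IH] x h.
  by exists x, 0%N; split=> //; [exists [::]|move: h; rewrite mul0r addr0].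
have [D2|D2] := leP (dist x0 x) 2; first by exists x, 0%N; split=> //; exists [::].
have D1 : 1 < dist x0 x by lra.
have E : (gx G x0 - gx G x) ^+ 2 + (gy G x0 - gy G x) ^+ 2 = dist x0 x ^+ 2.
  by rewrite dist_sym dist_sqr.
have [w xw hw] := nb_closer D1 E.
have hd : dist x0 w <= dist x0 x - gs G ^+ 2 / 2.
  have Ew : (gx G x0 - gx G w) ^+ 2 + (gy G x0 - gy G w) ^+ 2 = dist x0 w ^+ 2.
    by rewrite dist_sym dist_sqr.
  rewrite Ew in hw; have /andP[h1 _] := edge_d2 xw.
  have g1 := gs_lt1 G; have g21 : gs G ^+ 2 <= 1 by rewrite expr_le1// ?ltW// gs_gt0.
  rewrite -(ler_pXn2r (n := 2)) ?nnegrE ?dist_ge0//; last lra.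
  apply: (le_trans hw); move: h1 g21 g2 D2; clear; move: (gs G ^+ 2) => g.
  by move: (gd2 G x w) (dist x0 x) => e D; nra.
have [|y [m [mn wy yd]]] := IH w; first by move: hd h; rewrite -natr1; lra.
exists y, m.+1; split=> //.
case: wy => p [pp pl pn]; exists (w :: p); rewrite /= pn; split=> //.
by rewrite -nb_adj xw.
Qed.

(** [approach] ends within distance 2 of x0. Finitely many vertices are left there, and
    connectedness joins each of them to x0 by a walk of length at most [M], negligible for large
    N. *)
Lemma graph_ball_sup x0 : exists2 N0 : nat, (0 < N0)%N & forall N x, (N0 <= N)%N ->
  dist x0 x <= gs G ^+ 2 / 4 * N%:R -> graph_ball adj x0 N x.
Proof.
have g2 : 0 < gs G ^+ 2 by rewrite exprn_gt0// gs_gt0.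
have [M hM] : exists M, forall y, dist x0 y <= 2 -> exists2 m, (m <= M)%N & walk_of_length adj m y x0.
  suff [M hM] : exists M, forall y, y \in vb x0 2 -> exists2 m, (m <= M)%N & walk_of_length adj m y x0.
    by exists M => y h; apply: hM; rewrite mem_vb.
  elim: (vb x0 2) => [|y s [M hM]]; first by exists 0%N.
  have [m wm] := adj_connected y x0; exists (maxn m M) => t; rewrite inE => /orP[/eqP ->|ts].
    by exists m => //; exact: leq_maxl.
  by have [k kM wk] := hM t ts; exists k => //; exact: leq_trans kM (leq_maxr _ _).
exists (M * 2).+1 => // N x hN hx.
have MN : (M <= N)%N by rewrite (leq_trans _ hN)// leqW// leq_pmulr.
have [|y [m [mN wm yd]]] := @approach x0 (N - M)%N x.
  apply: (le_trans hx); rewrite natrB//.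
  have h : (M * 2)%:R <= N%:R :> R by rewrite ler_nat ltnW.
  have : gs G ^+ 2 * (M * 2)%:R <= gs G ^+ 2 * N%:R by rewrite ler_pM2l.
  by rewrite natrM; lra.
have [k kM wk] := hM y yd; apply/graph_dist_le; exists (m + k)%N; last exact: walk_cat wm wk.
by rewrite -(subnK MN) leq_add.
Qed.

Lemma graph_ball_finite x0 N : finite_set (graph_ball adj x0 N).
Proof.
apply: (@sub_finite_set _ _ [set` vb x0 (2 * N%:R)]); last exact: finite_seq.
by move=> x /graph_ball_sub h /=; rewrite mem_vb// mulr_ge0.
Qed.

Definition ballseq x0 N : seq V := enum_fset (fset_set (graph_ball adj x0 N)).

Lemma mem_ballseq x0 N x : (x \in ballseq x0 N) <-> graph_ball adj x0 N x.
Proof.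
rewrite /ballseq -[x \in _]/(x \in fset_set (graph_ball adj x0 N)) in_fset_set; last exact: graph_ball_finite.
by split=> [|h]; rewrite ?inE// mem_set.
Qed.

Lemma ballseq_uniq x0 N : uniq (ballseq x0 N). Proof. exact: fset_uniq. Qed.

Lemma ballseq0 x0 N : x0 \in ballseq x0 N.
Proof. by apply/mem_ballseq/graph_dist_le; exists 0%N => //; exists [::]. Qed.

End GraphBall.

(** * Holding times *)

Section Transfer.
Context (R : realType).
Import HBNNSimple.

Lemma integral_layers d (T : measurableType d) (mu : {measure set T -> \bar R}) (g : T -> R) (h : T -> R)
    (phi : {nnsfun R >-> R}) : measurable_fun setT g -> measurable_fun setT h -> (forall x, 0 <= g x) ->
  (\int[mu]_x (g x * phi (h x))%:E = \sum_(r <- enum_fset (fset_set (range phi)))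
     (`|r|%:E * \int[mu]_x (g x * \1_(phi @^-1` [set r]) (h x))%:E))%E.
Proof.
move=> mg mh g0; set s := enum_fset _.
have mi r : measurable_fun setT (fun x => g x * \1_(phi @^-1` [set r]) (h x)).
  have mI : measurable_fun setT (\1_(phi @^-1` [set r]) : R -> R).
    by apply: measurable_indic; exact: measurable_funPTI.
  by apply: measurable_funM => //; exact: measurableT_comp mI mh.
have phiE y : phi y = \sum_(r <- s) `|r| * \1_(phi @^-1` [set r]) y.
  rewrite {1}fimfunE fsbig_finite//=; apply: eq_big_seq => r.
  rewrite in_fset_set// inE => -[z _ <-]; rewrite ger0_norm//.
transitivity (\int[mu]_x \sum_(r <- s) (`|r|%:E * (g x * \1_(phi @^-1` [set r]) (h x))%:E))%E.
  apply: eq_integral => x _; rewrite phiE mulr_sumr -sumEFin; apply: eq_bigr => r _.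
  by rewrite -EFinM mulrCA.
rewrite ge0_integral_sum//.
- apply: eq_bigr => r _; rewrite ge0_integralZl_EFin//.
  + by move=> x _; rewrite lee_fin mulr_ge0.
  + exact/measurable_EFinP.
- by move=> r; apply: measurable_funeM; exact/measurable_EFinP.
- by move=> r x _; rewrite -EFinM lee_fin !mulr_ge0.
Qed.

Lemma integral_approx d (T : measurableType d) (mu : {measure set T -> \bar R}) (g : T -> R) (h : T -> R)
    (f : R -> R) (mf : measurable_fun setT (EFin \o f)) :
  measurable_fun setT g -> measurable_fun setT h -> (forall x, 0 <= g x) -> (forall y, 0 <= f y) ->
  (\int[mu]_x (g x * f (h x))%:E =
   limn (fun n => \int[mu]_x (g x * nnsfun_approx measurableT mf n (h x))%:E))%E.
Proof.
move=> mg mh g0 f0; rewrite -monotone_convergence//.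
- apply: eq_integral => x _; apply/esym/cvg_lim => //.
  have f0' y : setT y -> (0 <= (EFin \o f) y)%E by rewrite lee_fin.
  exact: (@cvgeZl _ _ _ _ _ (g x)%:E isT (@cvg_nnsfun_approx _ _ _ _ measurableT _ mf f0' (h x) I)).
- move=> n; apply/measurable_EFinP; apply: measurable_funM => //.
  have mp : measurable_fun setT (nnsfun_approx measurableT mf n) by exact: measurable_funP.
  exact: measurableT_comp mp mh.
- by move=> n x _; rewrite lee_fin mulr_ge0.
- move=> x _ m n mn; rewrite lee_fin ler_wpM2l//.
  exact/lefP/nd_nnsfun_approx.
Qed.

(** Nonnegative measurable functions are increasing limits of simple ones. The weights [g1] and [g2]
    carry the factors of a product that are held fixed. *)
Lemma transfer d1 d2 (T1 : measurableType d1) (T2 : measurableType d2)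
    (mu1 : {measure set T1 -> \bar R}) (mu2 : {measure set T2 -> \bar R})
    (g1 : T1 -> R) (h1 : T1 -> R) (g2 : T2 -> R) (h2 : T2 -> R) (f : R -> R) :
  measurable_fun setT g1 -> measurable_fun setT h1 -> (forall x, 0 <= g1 x) ->
  measurable_fun setT g2 -> measurable_fun setT h2 -> (forall x, 0 <= g2 x) ->
  measurable_fun setT f -> (forall y, 0 <= f y) ->
  (forall A, measurable A -> (\int[mu1]_x (g1 x * \1_A (h1 x))%:E = \int[mu2]_x (g2 x * \1_A (h2 x))%:E)%E) ->
  (\int[mu1]_x (g1 x * f (h1 x))%:E = \int[mu2]_x (g2 x * f (h2 x))%:E)%E.
Proof.
move=> mg1 mh1 g10 mg2 mh2 g20 mf f0 H.
have mf' : measurable_fun setT (EFin \o f) by exact/measurable_EFinP.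
rewrite (integral_approx _ mf')// (integral_approx _ mf')//.
congr (limn _); apply/funext => n; rewrite !integral_layers//.
by apply: eq_bigr => r _; rewrite H//; exact: measurable_funPTI.
Qed.

(** Tilting by [expR (v * y)] turns the density of rate l into l / (l - v) times that of rate l -
    v. *)
Lemma exponential_moment_generating (l v : R) : 0 < l -> v < l ->
  (\int[lebesgue_measure]_y (exponential_pdf l y * expR (v * y))%:E = (l / (l - v))%:E)%E.
Proof.
move=> l0 vl; have lv : 0 < l - v by rewrite subr_gt0.
have -> : (l / (l - v))%:E = ((l / (l - v))%:E * \int[lebesgue_measure]_y (exponential_pdf (l - v) y)%:E)%E.
  by rewrite integral_exponential_pdf// mule1.
rewrite -ge0_integralZl_EFin//; last 3 first.
- by move=> y _; rewrite lee_fin exponential_pdf_ge0// ltW.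
- by apply/measurable_EFinP; exact: measurable_exponential_pdf.
- by rewrite divr_ge0// ltW.
apply: eq_integral => y _; rewrite -EFinM; congr EFin.
have [y0|y0] := ltP y 0; first by rewrite !lt0_exponential_pdf// mul0r mulr0.
rewrite !exponential_pdfE// -mulrA -expRD mulrA divfK ?gt_eqF//.
by congr (_ * expR _); ring.
Qed.

End Transfer.

Section Product.
Context (R : realType) d (T : measurableType d) (P : probability T R).
Variables (S : set T) (H : nat -> {RV P >-> R}) (rt : nat -> R) (n : nat) (C : R).
Hypotheses (mS : measurable S) (rt0 : forall i, 0 < rt i) (C0 : 0 <= C).
Hypothesis law : forall B : nat -> set R, (forall i, measurable (B i)) ->
  P (S `&` [set w | forall i, (i <= n)%N -> B i (H i w)]) =
  (C%:E * \prod_(i < n.+1) exponential_prob (rt i) (B i))%E.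

Lemma exponential_prob_indic (l : R) (A : set R) : 0 < l -> measurable A -> exists2 r, 0 <= r &
  exponential_prob l A = r%:E /\
  (\int[lebesgue_measure]_y (exponential_pdf l y * \1_A y)%:E = r%:E)%E.
Proof.
move=> l0 mA; have E : exponential_prob l A =
    (\int[lebesgue_measure]_y (exponential_pdf l y * \1_A y)%:E)%E.
  rewrite /exponential_prob integral_mkcond epatch_indic.
  by apply: eq_integral => y _; rewrite /= EFinM.
have mp : measurable_fun setT (EFin \o exponential_pdf l).
  by apply/measurable_EFinP; exact: measurable_exponential_pdf.
have pos : (0 <= exponential_prob l A)%E.
  by apply: integral_ge0 => y _; rewrite lee_fin exponential_pdf_ge0// ltW.
have le1 : (exponential_prob l A <= 1)%E.
  rewrite -(integral_exponential_pdf l0); apply: ge0_subset_integral => //.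
  by move=> y _; rewrite lee_fin exponential_pdf_ge0// ltW.
have fin : exponential_prob l A \is a fin_num.
  by rewrite ge0_fin_numE// (le_lt_trans le1)// ltry.
exists (fine (exponential_prob l A)); first exact: fine_ge0.
by rewrite -E fineK.
Qed.

Let mH i : measurable_fun setT (H i : T -> R).
Proof. exact: measurable_funP. Qed.

Let mE (B : nat -> set R) : (forall i, measurable (B i)) ->
  measurable (S `&` [set w | forall i, (i <= n)%N -> B i (H i w)]).
Proof.
move=> mB; apply: measurableI => //.
rewrite (_ : mkset _ = \bigcap_(i in [set i | (i <= n)%N]) (H i @^-1` B i)); last first.
  by apply/seteqP; split=> w h i; [exact: h|move=> /h].
by apply: bigcap_measurable => [|i _]; [exists 0%N|exact: measurable_funPTI].
Qed.

(** The hypothesis speaks of rectangles. Indicators are replaced by functions one coordinate at a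
    time, each time by [transfer] with the other coordinates as weight. *)
Lemma product_law (f : nat -> R -> R) (m : nat -> R) :
  (forall i, measurable_fun setT (f i)) -> (forall i y, 0 <= f i y) ->
  (forall i, \int[lebesgue_measure]_y (exponential_pdf (rt i) y * f i y)%:E = (m i)%:E)%E ->
  (\int[P]_w (\1_S w * \prod_(i < n.+1) f i (H i w))%:E = (C * \prod_(i < n.+1) m i)%:E)%E.
Proof.
(* In [claim k] the coordinates below k are arbitrary and the others are still indicators. *)
suff claim k : (k <= n.+1)%N -> forall (f : nat -> R -> R) (m : nat -> R),
  (forall i, measurable_fun setT (f i)) -> (forall i y, 0 <= f i y) ->
  (forall i, \int[lebesgue_measure]_y (exponential_pdf (rt i) y * f i y)%:E = (m i)%:E)%E ->
  (forall i, (k <= i <= n)%N -> exists2 A, measurable A & f i = \1_A) ->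
  (\int[P]_w (\1_S w * \prod_(i < n.+1) f i (H i w))%:E = (C * \prod_(i < n.+1) m i)%:E)%E.
  move=> mf f0 fm; apply: (claim n.+1) => // i /andP[h1 h2].
  by have := leq_trans h1 h2; rewrite ltnn.
elim: k => [_|k IH kn] {}f {}m mf f0 fm fA.
  (* The law asks for one sequence of sets; they are recovered from the functions as fibres over
     1. *)
  pose A i := if (i <= n)%N then f i @^-1` [set 1] else set0.
  have hA i : measurable (A i) /\ ((i <= n)%N -> f i = \1_(A i)).
    rewrite /A; case: leqP => // iN; have [B mB E] := fA i iN.
    have -> : f i @^-1` [set 1] = B.
      apply/seteqP; split=> y /=; rewrite E indicE; last by move=> h; rewrite mem_set.
      by case: (boolP (y \in B)) => [|_ /eqP]; rewrite ?inE// eq_sym oner_eq0.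
    by [].
  transitivity (\int[P]_w (\1_(S `&` [set w | forall i, (i <= n)%N -> A i (H i w)]) w)%:E)%E.
    apply: eq_integral => w _; congr EFin.
    rewrite !indicE in_setI -[in RHS]mulnb natrM; congr (_ * _).
    have [|h] := boolP (w \in _); rewrite ?inE /=.
      move=> h; apply: big1 => i _; rewrite (hA i).2; last by rewrite -ltnS.
      by rewrite indicE mem_set//; apply: h; rewrite -ltnS.
    have [i iA] : exists i : 'I_n.+1, ~ A i (H i w).
      apply: contrapT => hn; move/negP: h; apply; rewrite inE /= => i iN.
      by apply: contrapT => hi; apply: hn; exists (Ordinal (iN : (i < n.+1)%N)).
    rewrite (bigD1 i)//= (hA i).2; last by rewrite -ltnS.
    by rewrite indicE memNset// mul0r.
  rewrite integral_indic//; last by apply: mE => i; exact: (hA i).1.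
  rewrite setIT; apply: (etrans (law (fun i => (hA i).1))).
  rewrite EFinM (big_morph EFin (@EFinM R) (erefl _)); congr (_ * _)%E.
  apply: eq_bigr => i _; rewrite -fm (hA i).2; last by rewrite -ltnS.
  have [r _ [-> <-]] := exponential_prob_indic (rt0 i) (hA i).1.
  by [].
have m0 i : 0 <= m i.
  rewrite -lee_fin -fm; apply: integral_ge0 => y _.
  by rewrite lee_fin mulr_ge0// exponential_pdf_ge0// ltW.
pose K := C * \prod_(i < n.+1 | i != Ordinal kn) m i.
have K0 : 0 <= K by rewrite mulr_ge0// prodr_ge0.
pose g w := \1_S w * \prod_(i < n.+1 | i != Ordinal kn) f i (H i w).
have mfH i : measurable_fun setT (fun w => f i (H i w)).
  exact: measurableT_comp (mf i) (mH i).
have mg : measurable_fun setT g.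
  apply: measurable_funM; first exact: measurable_indic.
  rewrite [X in measurable_fun _ X](_ : _ = fun w => \prod_(i < n.+1) (if i != Ordinal kn then f i (H i w) else 1)).
    by apply: measurable_prod => i _; case: (i != _).
  by apply/funext => w; rewrite big_mkcond.
have g0 w : 0 <= g w by rewrite mulr_ge0// prodr_ge0.
have mpdf : measurable_fun setT (fun y => K * exponential_pdf (rt k) y).
  by apply: measurable_funM => //; exact: measurable_exponential_pdf.
have pdf0 y : 0 <= K * exponential_pdf (rt k) y.
  by rewrite mulr_ge0// exponential_pdf_ge0// ltW.
have cK (u : R -> R) : measurable_fun setT u -> (forall y, 0 <= u y) ->
    (\int[lebesgue_measure]_y (K * exponential_pdf (rt k) y * u y)%:E =
     K%:E * \int[lebesgue_measure]_y (exponential_pdf (rt k) y * u y)%:E)%E.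
  move=> mu u0; rewrite -ge0_integralZl_EFin//.
  - by apply: eq_integral => y _; rewrite -EFinM mulrA.
  - by move=> y _; rewrite lee_fin mulr_ge0// exponential_pdf_ge0// ltW.
  - apply/measurable_EFinP; apply: measurable_funM => //; exact: measurable_exponential_pdf.
transitivity (\int[P]_w (g w * f k (H k w))%:E)%E.
  apply: eq_integral => w _; congr EFin.
  by rewrite (bigD1 (Ordinal kn))//= /g; ring.
rewrite (@transfer R _ _ T (measurableTypeR R) P lebesgue_measure g (H k) (fun y => K * exponential_pdf (rt k) y) id (f k))//.
  by rewrite cK// fm -EFinM (bigD1 (Ordinal kn))//= /K; congr EFin; ring.
move=> A mA; rewrite cK//; have [r r0 [_ rE]] := exponential_prob_indic (rt0 k) mA.
rewrite rE -EFinM.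
pose f' i := if i == k then (\1_A : R -> R) else f i.
pose m' i := if i == k then r else m i.
transitivity (\int[P]_w (\1_S w * \prod_(i < n.+1) f' i (H i w))%:E)%E.
  apply: eq_integral => w _; congr EFin.
  rewrite (bigD1 (Ordinal kn))//= /f' eqxx /g mulrC [RHS]mulrCA; congr (_ * (_ * _)).
  by apply: eq_bigr => i; rewrite -val_eqE/= => /negbTE ->.
rewrite (IH (ltnW kn) f' m').
- rewrite (bigD1 (Ordinal kn))//= /m' eqxx /K; congr EFin.
  rewrite mulrCA mulrC; congr (_ * _ * _).
  by apply: eq_bigr => i; rewrite -val_eqE/= => /negbTE ->.
- by move=> i; rewrite /f'; case: ifP => // _; exact: measurable_indic.
- by move=> i y; rewrite /f'; case: ifP.
- by move=> i; rewrite /f' /m'; case: eqP => [->|_]; [exact: rE|exact: fm].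
- move=> i /andP[ki iN]; rewrite /f'; case: eqP => [_|/eqP ik]; first by exists A.
  by apply: fA; rewrite iN andbT ltn_neqAle eq_sym ik.
Qed.

Lemma exponential_tail (v : nat -> R) (s : R) : (forall i, v i < rt i) ->
  (P (S `&` [set w | (s <= \sum_(i < n.+1) v i * H i w)%R]) <=
   (C * (expR (- s) * \prod_(i < n.+1) (rt i / (rt i - v i))))%:E)%E.
Proof.
move=> vr.
have mf i : measurable_fun setT (fun y : R => expR (v i * y)).
  by apply: measurableT_comp => //; exact: measurable_funM.
have f0 i y : 0 <= expR (v i * y) by exact: expR_ge0.
have := product_law mf f0 (fun i => exponential_moment_generating (rt0 i) (vr i)).
move=> E; set A := S `&` _.
have msum : measurable_fun setT (fun w => \sum_(i < n.+1) v i * H i w).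
  by apply: measurable_sum => i; apply: measurable_funM.
have mA : measurable A.
  apply: measurableI => //; rewrite -[X in measurable X]setTI.
  rewrite (_ : [set w | _] = (fun w => \sum_(i < n.+1) v i * H i w) @^-1` `[s, +oo[); last first.
    by apply/seteqP; split=> w /=; rewrite in_itv/= andbT.
  exact: msum.
have mg : measurable_fun setT (fun w => \1_S w * \prod_(i < n.+1) expR (v i * H i w)).
  apply: measurable_funM; first exact: measurable_indic.
  apply: measurable_prod => i _; exact: measurableT_comp (mf i) (mH i).
rewrite mulrCA EFinM -E -ge0_integralZl_EFin ?expR_ge0//; last 2 first.
- by move=> w _; rewrite lee_fin mulr_ge0// prodr_ge0// => *; exact: expR_ge0.
- exact/measurable_EFinP.
rewrite -[A]setIT -integral_indic//; apply: ge0_le_integral => //.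
- by apply/measurable_EFinP; exact: measurable_indic.
- by apply: measurable_funeM; exact/measurable_EFinP.
- move=> w _; rewrite -EFinM lee_fin /A indicE in_setI -mulnb natrM -indicE mulrCA.
  apply: ler_wpM2l => //; rewrite -expR_sum -expRD.
  have [|_] := boolP (_ \in _); last exact: expR_ge0.
  by rewrite inE/= => h; rewrite -expR0 ler_expR addrC subr_ge0.
Qed.

End Product.

(** * Exit times and local times of a step function *)

Section Trajectory.
Variables (R : realType) (V : choiceType) (adj : rel V) (x0 : V) (y : R -> V) (Xs : nat -> V) (hs : nat -> R).
Hypothesis hs0 : forall i, 0 < hs i.
Hypothesis hY : forall (n : nat) (t : R), \sum_(i < n) hs i <= t < \sum_(i < n.+1) hs i -> y t = Xs n.
Local Notation S m := (\sum_(i < m) hs i).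

Lemma time_step m : S m < S m.+1.
Proof. by rewrite big_ord_recr/= ltrDl. Qed.

Lemma time_ge0 m : 0 <= S m.
Proof. by apply: sumr_ge0 => i _; exact: ltW. Qed.

Lemma exit_time_trajectory N j : (forall i, (i < j)%N -> graph_ball adj x0 N (Xs i)) ->
  ~ graph_ball adj x0 N (Xs j) -> exit_time adj x0 y N = (S j)%:E.
Proof.
move=> hin hout; apply/le_anti/andP; split.
  apply: ereal_inf_lbound; exists (S j) => //; split; first exact: time_ge0.
  by rewrite (hY (n := j))// lexx time_step.
apply: le_ereal_inf_tmp => _ [t [t0 ht] <-]; rewrite lee_fin leNgt; apply/negP => tj; apply: ht.
elim: j hin {hout} tj => [|j IH] hin tj; first by move: tj; rewrite big_ord0 ltNge t0.
have [h|h] := ltP t (S j); first by apply: IH => // i ij; apply: hin; exact: ltnW.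
by rewrite (hY (n := j)) ?h//; exact: hin.
Qed.

Lemma local_time_trajectory x j :
  local_time y x (S j)%:E = (\sum_(i < j) (Xs i == x)%:R * hs i)%:E.
Proof.
have step m : measurable_fun `[S m, S m.+1[%classic (fun s => (\1_[set u | y u = x] s)%:E : \bar R) /\
    (\int[lebesgue_measure]_(s in `[S m, S m.+1[%classic) (\1_[set u | y u = x] s)%:E = ((Xs m == x)%:R * hs m)%:E)%E.
  have E s : `[S m, S m.+1[%classic s -> (\1_[set u | y u = x] s)%:E = (Xs m == x)%:R%:E :> \bar R.
    rewrite /= in_itv/= => /hY ys; congr EFin; rewrite indicE; congr (nat_of_bool _)%:R.
    by apply/idP/eqP; rewrite inE/= ys.
  split.
    apply: (@eq_measurable_fun _ _ _ _ _ (cst (Xs m == x)%:R%:E)) => [s|]; last exact: measurable_cst.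
    by rewrite inE => /E.
  transitivity (\int[lebesgue_measure]_(s in `[S m, S m.+1[%classic) (cst (Xs m == x)%:R%:E s))%E.
    by apply: eq_integral => s; rewrite inE => /E.
  rewrite integral_cst//= lebesgue_measure_itv/= lte_fin time_step -EFinB -EFinM.
  by rewrite big_ord_recr/= addrAC subrr add0r.
have claim m : measurable_fun `[0, S m[%classic (fun s => (\1_[set u | y u = x] s)%:E : \bar R) /\
    (\int[lebesgue_measure]_(s in `[0%R, S m[%classic) (\1_[set u | y u = x] s)%:E =
     (\sum_(i < m) (Xs i == x)%:R * hs i)%:E)%E.
  elim: m => [|m [IH1 IH2]].
    by rewrite !big_ord0 set_itvco0; split; [exact: measurable_fun_set0|rewrite integral_set0].
  have -> : `[0, S m.+1[%classic = `[0, S m[ `|` `[S m, S m.+1[.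
    apply: itv_bndbnd_setU; rewrite bnd_simp; first exact: time_ge0.
    exact/ltW/time_step.
  have [h1 h2] := step m.
  have mU : measurable_fun (`[0, S m[ `|` `[S m, S m.+1[)%classic (fun s => (\1_[set u | y u = x] s)%:E : \bar R).
    by apply/measurable_funU.
  split=> //; rewrite ge0_integral_setU//.
  - by rewrite IH2 h2 -EFinD [in RHS]big_ord_recr.
  - apply/eqP/seteqP; split=> // s [/=]; rewrite !in_itv/= => /andP[_ h] /andP[h' _].
    by move: (lt_le_trans h h'); rewrite ltxx.
(* [local_time] integrates up to and including the exit time; this endpoint is a null set. *)
rewrite /local_time (_ : mkset _ = `[0, S j[ `|` [set S j])%classic; last first.
  apply/seteqP; split=> s /=.
    move=> [s0]; rewrite lee_fin le_eqVlt => /orP[/eqP ->|sj]; first by right.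
    by left; rewrite in_itv/= s0.
  by rewrite in_itv/= => -[/andP[s0 sj]|->]; rewrite lee_fin ?lexx ?time_ge0// s0 ltW.
have [h1 h2] := claim j.
rewrite ge0_integral_setU//.
- by rewrite integral_set1 adde0 h2.
- by apply/measurable_funU => //; split => //; exact: measurable_fun_set1.
- by apply/eqP/seteqP; split=> // s [/=]; rewrite in_itv/= => /andP[_ h] E; rewrite E ltxx in h.
Qed.

End Trajectory.

Section Killed.
Variables (V : choiceType) (z0 : V) (B : seq V).

Lemma killed_take s : killed B s = take (size (killed B s)) s.
Proof. by elim: s => //= a s IH; case: ifP => //= _; rewrite -IH. Qed.

Lemma killed_size s : (size (killed B s) <= size s)%N.
Proof. by elim: s => //= a s IH; case: ifP. Qed.

Lemma killed_in s i : (i < size (killed B s))%N -> nth z0 s i \in B.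
Proof. by elim: s i => //= a s IH; case: ifP => // aB [|i]//=; exact: IH. Qed.

Lemma killed_out s : ~~ all (mem B) s -> (size (killed B s) < size s)%N /\
  nth z0 s (size (killed B s)) \notin B.
Proof.
elim: s => //= a s IH; case: (boolP (a \in B)) => [aB|aB _] //=.
Qed.

Lemma killed_count x s n : (size s <= n)%N ->
  (\sum_(i < n) ((i < size (killed B s)) && (nth z0 s i == x)) = count_mem x (killed B s))%N.
Proof.
move=> sn; rewrite -(big_mkord xpredT (fun i => ((i < size (killed B s))%N && (nth z0 s i == x) : nat))).
rewrite (big_cat_nat (n := size (killed B s)))//=; last exact: leq_trans (killed_size s) sn.
rewrite [X in (_ + X)%N](_ : _ = 0%N); last first.
  by rewrite big_nat; apply: big1 => i /andP[h _]; rewrite ltnNge h.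
rewrite addn0.
rewrite -sum1_count [RHS]big_mkcond (big_nth z0) !big_nat; apply: eq_bigr => i /andP[_ ik].
by rewrite ik/= [in RHS]killed_take nth_take//; case: eqP.
Qed.

End Killed.

(** * Expectations of the walk as finite sums over paths *)

Section Walks.
Variables (R : realType) (V : choiceType) (G : rhombic_graph R V).
Implicit Types (x y z w : V) (p q : seq V).

Fixpoint walks n z : seq (seq V) :=
  if n is m.+1 then [seq w :: p | w <- nb G z, p <- walks m w] else [:: [::]].

Fixpoint wt z p : R := if p is w :: p' then cond G z w / rate G z * wt w p' else 1.

Lemma EX_walks n z (F : seq V -> R) : EX G n z F = \sum_(p <- walks n z) wt z p * F p.
Proof.
elim: n z F => [|n IH] z F /=; first by rewrite big_seq1 mul1r.
rewrite /avg mulr_suml big_allpairs_dep/=; apply: eq_bigr => w _.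
by rewrite IH mulr_sumr mulr_suml; apply: eq_bigr => p _; ring.
Qed.

Lemma mem_walks n z p : p \in walks n z -> size p = n /\ path (fun x y => y \in nb G x) z p.
Proof.
elim: n z p => [|n IH] z p /=; first by rewrite inE => /eqP ->.
by move=> /allpairsPdep[w [q [zw /IH[<- qp] ->]]] /=; rewrite zw.
Qed.

Lemma walks_uniq n z : uniq (walks n z).
Proof.
elim: n z => [//|n IH] z /=; apply: allpairs_uniq_dep => [|w _|]; [exact: nb_uniq|exact: IH|].
by move=> [w p] [w' p'] _ _ /= [-> ->].
Qed.

Lemma wt_ge0 n z p : p \in walks n z -> 0 <= wt z p.
Proof.
elim: n z p => [|n IH] z p /=; first by rewrite inE => /eqP ->.
move=> /allpairsPdep[w [q [zw qw ->]]] /=; rewrite mulr_ge0 ?IH// divr_ge0// ltW//.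
  exact: cond_gt0.
exact: rate_gt0.
Qed.

Variable adj : rel V.
Hypothesis nb_adj : forall x y, (y \in nb G x) = adj x y.

Lemma jump_rateE x : jump_rate adj (cond G) x = rate G x.
Proof.
rewrite /jump_rate /rate (_ : mkset _ = [set` nb G x]); last by apply/seteqP; split=> y /=; rewrite nb_adj.
by rewrite -fsbig_seq// nb_uniq.
Qed.

Lemma jump_prod n z p d : p \in walks n z ->
  \prod_(i < n) jump_prob adj (cond G) (nth d (z :: p) i) (nth d (z :: p) i.+1) = wt z p.
Proof.
elim: n z p => [|n IH] z p /=; first by rewrite inE => /eqP ->; rewrite big_ord0.
move=> /allpairsPdep[w [q [zw qw ->]]] /=; rewrite big_ord_recl/= -(IH w q qw).
by rewrite /jump_prob -nb_adj zw jump_rateE.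
Qed.

End Walks.

(** * Concentration of the holding times along a given path *)

Section Process.
Variables (R : realType) (V : choiceType) (G : rhombic_graph R V) (adj : rel V).
Hypothesis nb_adj : forall x y, (y \in nb G x) = adj x y.
Variables (d : measure_display) (Omega : measurableType d) (P : probability Omega R) (x0 : V).
Variables (X : nat -> Omega -> V) (H : nat -> {RV P >-> R}).
Hypothesis mX : forall n x, measurable [set w | X n w = x].
Hypothesis law : forall (n : nat) (x : nat -> V) (B : nat -> set R), (forall i, measurable (B i)) ->
  P [set w | forall i, (i <= n)%N -> X i w = x i /\ B i (H i w)] =
  (((x 0%N == x0)%:R * \prod_(i < n) jump_prob adj (cond G) (x i) (x i.+1))%:E *
   \prod_(i < n.+1) exponential_prob (jump_rate adj (cond G) (x i)) (B i))%E.
Local Notation walks := (walks G).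
Local Notation wt := (wt G).
Local Notation rate := (rate G).
Local Notation ltime := (ltime G).
Local Notation EX := (EX G).
Implicit Types (p : seq V) (B : seq V).

Definition pr (A : set Omega) : R := fine (P A).

Lemma prE A : measurable A -> P A = (pr A)%:E.
Proof. by move=> mA; rewrite /pr fineK// fin_num_measure. Qed.

Lemma pr_ge0 A : 0 <= pr A. Proof. exact: fine_ge0. Qed.

Lemma pr_le (A B : set Omega) : measurable A -> measurable B -> A `<=` B -> pr A <= pr B.
Proof. by move=> mA mB AB; rewrite -lee_fin -!prE//; apply: le_measure; rewrite ?inE. Qed.

Lemma prU_le (A B : set Omega) : measurable A -> measurable B -> pr (A `|` B) <= pr A + pr B.
Proof.
move=> mA mB; rewrite -lee_fin EFinD -!prE//; last exact: measurableU.
exact: measureU2.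
Qed.

Lemma prU (A B : set Omega) : measurable A -> measurable B -> A `&` B = set0 -> pr (A `|` B) = pr A + pr B.
Proof.
move=> mA mB AB; apply: EFin_inj; rewrite EFinD -!prE//; last exact: measurableU.
exact: measureU.
Qed.

Lemma prC A : measurable A -> pr (~` A) = 1 - pr A.
Proof.
by move=> mA; apply: EFin_inj; rewrite EFinB -!prE ?probability_setC//; exact: measurableC.
Qed.

Lemma pr_bigU_le (I : choiceType) (s : seq I) (F : I -> set Omega) (b : R) :
  (forall i, measurable (F i)) -> (forall i, i \in s -> pr (F i) <= b) ->
  measurable (\big[setU/set0]_(i <- s) F i) /\ pr (\big[setU/set0]_(i <- s) F i) <= (size s)%:R * b.
Proof.
move=> mF; elim: s => [|i s IH] hb; first by rewrite big_nil /pr measure0 mul0r.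
rewrite big_cons; have [j js|m h] := IH; first by apply: hb; rewrite inE js orbT.
split; first exact: measurableU.
apply: (le_trans (prU_le (mF i) m)); rewrite -natr1 mulrDl mul1r addrC lerD//.
by apply: hb; rewrite inE eqxx.
Qed.

Lemma pr_bigU (I : choiceType) (s : seq I) (F : I -> set Omega) : uniq s -> (forall i, measurable (F i)) ->
  (forall i j w, i \in s -> j \in s -> F i w -> F j w -> i = j) ->
  measurable (\big[setU/set0]_(i <- s) F i) /\ pr (\big[setU/set0]_(i <- s) F i) = \sum_(i <- s) pr (F i).
Proof.
move=> us mF; elim: s us => [|i s IH] /=; first by rewrite !big_nil /pr measure0.
move=> /andP[is_ us] h; rewrite !big_cons.
have [j k w js ks|m E] := IH us; first by apply: h; rewrite inE ?js ?ks orbT.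
split; first exact: measurableU.
rewrite prU ?E//; apply/seteqP; split=> // w [Fi]; rewrite -bigcup_seq => -[j /= js Fj].
by move: is_; rewrite (h i j w) ?js//; rewrite inE ?eqxx ?js ?orbT.
Qed.

Definition pathE p : set Omega := [set w | forall i, (i <= size p)%N -> X i w = nth x0 (x0 :: p) i].

Lemma pathE_measurable p : measurable (pathE p).
Proof.
rewrite (_ : pathE p = \bigcap_(i in [set i | (i <= size p)%N]) [set w | X i w = nth x0 (x0 :: p) i]); last first.
  by apply/seteqP; split=> w h i; [exact: h|move=> /h].
by apply: bigcap_measurable => [|i _]; [exists 0%N|exact: mX].
Qed.

Lemma pathE_law n p (B : nat -> set R) : p \in walks n x0 -> (forall i, measurable (B i)) ->
  P (pathE p `&` [set w | forall i, (i <= n)%N -> B i (H i w)]) =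
  ((wt x0 p)%:E * \prod_(i < n.+1) exponential_prob (rate (nth x0 (x0 :: p) i)) (B i))%E.
Proof.
move=> pw mB; have [pn _] := mem_walks pw.
rewrite (_ : _ `&` _ = [set w | forall i, (i <= n)%N -> X i w = nth x0 (x0 :: p) i /\ B i (H i w)]); last first.
  rewrite /pathE pn; apply/seteqP; split=> w /= => [[h1 h2] i iN|h]; first by split; [exact: h1|exact: h2].
  by split=> i /h[].
rewrite (@law n (nth x0 (x0 :: p)) B mB) [nth x0 (x0 :: p) 0]/= eqxx mul1r (jump_prod nb_adj _ pw); congr (_ * _)%E.
by apply: eq_bigr => i _; rewrite (jump_rateE nb_adj).
Qed.

Lemma pr_pathE n p : p \in walks n x0 -> pr (pathE p) = wt x0 p.
Proof.
move=> pw; apply: EFin_inj; rewrite -prE; last exact: pathE_measurable.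
have := @pathE_law n p (fun=> setT) pw (fun=> measurableT).
rewrite (_ : _ `&` _ = pathE p); last by apply/seteqP; split=> w //= [].
move=> ->; rewrite big1 ?mule1// => i _.
by rewrite /exponential_prob integral_exponential_pdf// rate_gt0.
Qed.

Lemma pathE_inj n p q w : p \in walks n x0 -> q \in walks n x0 -> pathE p w -> pathE q w -> p = q.
Proof.
move=> /mem_walks[pn _] /mem_walks[qn _] hp hq; apply: (@eq_from_nth _ x0); first by rewrite pn qn.
by move=> i ip; have := hp i.+1 ip; rewrite hq/= ?qn -?pn.
Qed.

Lemma paths_total n : measurable (\big[setU/set0]_(p <- walks n x0) pathE p) /\
  pr (\big[setU/set0]_(p <- walks n x0) pathE p) = 1.
Proof.
have [m ->] := pr_bigU (walks_uniq G n x0) pathE_measurable (fun p q w => @pathE_inj n p q w).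
split=> //; rewrite -[RHS](EX_const G n x0 1) EX_walks !big_seq.
by apply: eq_bigr => p pw; rewrite mulr1 (pr_pathE pw).
Qed.

(** Holding times are known only jointly with the path, so the event is split over the finitely many
    paths of length n, which carry the total mass 1. *)
Lemma holding_negligible n (A : set R) : measurable A ->
  (forall l : R, 0 < l -> exponential_prob l A = 0%E) -> P.-negligible [set w | A (H n w)].
Proof.
move=> mA hA; have mHA : measurable [set w | A (H n w)] by exact: measurable_funPTI.
apply/negligibleP => //; apply: (etrans (prE mHA)); congr EFin.
pose F p := pathE p `&` [set w | A (H n w)].
have mF p : measurable (F p) by apply: measurableI => //; exact: pathE_measurable.
have F0 p : p \in walks n x0 -> pr (F p) <= 0.
  move=> pw; rewrite -lee_fin -prE//.
  have mB i : measurable (if i == n then A else setT : set R) by case: ifP.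
  have := pathE_law pw mB; rewrite (_ : _ `&` _ = F p); last first.
    apply/seteqP; split=> w /= [h1 h2]; split=> //; first by have := h2 n (leqnn _); rewrite eqxx.
    by move=> i _; case: eqP => // ->.
  move=> ->; rewrite big_ord_recr/= eqxx hA ?rate_gt0// !mule0.
  by [].
have [m h] := pr_bigU_le mF F0; have [m1 h1] := paths_total n.
apply/le_anti; rewrite pr_ge0 andbT.
have := prC m1; rewrite h1 subrr => hC; rewrite mulr0 in h.
have sub : [set w | A (H n w)] `<=` (\big[setU/set0]_(p <- walks n x0) F p) `|` ~` \big[setU/set0]_(p <- walks n x0) pathE p.
  move=> w Aw; have [hw|hw] := pselect ((\big[setU/set0]_(p <- walks n x0) pathE p) w); [left|by right].
  by move: hw; rewrite -!bigcup_seq => -[p pw pE]; exists p.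
apply: (le_trans (pr_le mHA _ sub)); first by apply: measurableU => //; exact: measurableC.
apply: (le_trans (prU_le m _)); first exact: measurableC.
by rewrite hC addr0.
Qed.

Lemma holding_gt0 : {ae P, forall w i, 0 < H i w}.
Proof.
apply: (negligibleS (A := \bigcup_i ([set w | `]-oo, 0[%classic (H i w)] `|` [set w | [set 0] (H i w)]))).
  move=> w /=; move=> /existsNP[i hi]; exists i => //=; rewrite in_itv/=.
  by move/negP: hi; rewrite -leNgt le_eqVlt => /orP[/eqP|]; [right|left].
apply: negligible_bigcup => i; apply: negligibleU; apply: holding_negligible => //.
- move=> l l0; rewrite /exponential_prob integral0_eq// => y /=; rewrite in_itv/= => y0.
  by rewrite lt0_exponential_pdf.
- by move=> l l0; rewrite /exponential_prob integral_set1.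
Qed.

(** The time spent at x before leaving B, as a function of the holding times along the fixed path
    p. *)
Definition ctime B p x w : R :=
  \sum_(i < (size p).+1) ((i < size (killed B (belast x0 p)))%N && (nth x0 (x0 :: p) i == x))%:R * H i w.

Lemma visits_sum B p x :
  \sum_(i < (size p).+1) ((i < size (killed B (belast x0 p)))%N && (nth x0 (x0 :: p) i == x))%:R =
  ltime x (killed B (belast x0 p)) * rate x.
Proof.
rewrite ltime_count divfK ?gt_eqF ?rate_gt0// -natr_sum; congr (_%:R).
rewrite -(@killed_count _ x0 B x (belast x0 p) (size p).+1) ?size_belast//.
apply: eq_bigr => i _; case: ltnP => //= ik; congr (nat_of_bool (_ == _)).
have ip : (i < size (belast x0 p))%N := leq_trans ik (killed_size _ _).
by rewrite lastI nth_rcons ip.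
Qed.

(** On the event of the path p, the time at x is a sum of independent exponentials with mean [lt].
    The parameter [th] is at most ep / 2 times every rate, so the logarithm of each moment
    generating factor is its linear term up to a relative error ep; Chernoff's bound is applied on
    both sides. The term [M] provides the deviation when [lt] is small. *)
Lemma deviation n B p x (ep M : R) : p \in walks n x0 -> 0 < ep <= 1 / 2 -> 0 <= M ->
  exists2 D, measurable D & pr D <= wt x0 p * (2 * expR (- (gs G * ep / 2 * (ep * M)))) /\
  forall w, pathE p w -> ~ D w ->
   `|ctime B p x w - ltime x (killed B (belast x0 p))| <= ep * (ltime x (killed B (belast x0 p)) + M).
Proof.
move=> pw /andP[ep0 ep1] M0; have [pn _] := mem_walks pw.
set th := gs G * ep / 2; set lt := ltime x _.
have sg := gs_gt0 G; have th0 : 0 < th by rewrite divr_gt0// mulr_gt0.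
pose b i : R := ((i < size (killed B (belast x0 p)))%N && (nth x0 (x0 :: p) i == x))%:R.
have sb : \sum_(i < n.+1) b i = lt * rate x by rewrite -pn; exact: visits_sum.
pose rt i := rate (nth x0 (x0 :: p) i).
have rt0 i : 0 < rt i by exact: rate_gt0.
have rth i : th <= rt i * (ep / 2).
  by rewrite /th -mulrA; apply: ler_wpM2r; [rewrite divr_ge0// ltW|exact: rate_ge].
have b01 i : b i = 0 \/ b i = 1 /\ rt i = rate x.
  rewrite /b /rt; case: andP => [[_ /eqP ->]|_]; [by right|by left].
have tail := @exponential_tail R d Omega P (pathE p) H rt n (wt x0 p) (pathE_measurable p) rt0 (wt_ge0 pw)
  (fun (B0 : nat -> set R) mB => pathE_law pw mB).
have mtail (v s : R) : measurable (pathE p `&` [set w | s <= v * \sum_(i < n.+1) b i * H i w]).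
  apply: measurableI; first exact: pathE_measurable.
  have ms : measurable_fun setT (fun w => v * \sum_(i < n.+1) b i * H i w).
    apply: measurable_funM => //; apply: measurable_sum => i.
    by apply: measurable_funM => //; exact: measurable_funP.
  rewrite -[X in measurable X]setTI.
  rewrite (_ : [set w | _] = (fun w => v * \sum_(i < n.+1) b i * H i w) @^-1` `[s, +oo[%classic); last first.
    by apply/seteqP; split=> w /=; rewrite in_itv/= andbT.
  exact: ms.
have one (v k s : R) : v <= th -> (forall i, rt i / (rt i - v) <= expR (k / rt i)) ->
    - s + k * lt <= - (th * (ep * M)) ->
    pr (pathE p `&` [set w | s <= v * \sum_(i < n.+1) b i * H i w]) <= wt x0 p * expR (- (th * (ep * M))).
  move=> vth hk hs.
  have vr i : v * b i < rt i.
    have h1 := rth i; have h2 := rt0 i; case: (b01 i) => [->|[-> _]]; first by rewrite mulr0.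
    by rewrite mulr1; apply: (le_lt_trans vth); apply: (le_lt_trans h1); nra.
  have E : [set w | s <= \sum_(i < n.+1) v * b i * H i w] = [set w | s <= v * \sum_(i < n.+1) b i * H i w].
    by apply/funext => w /=; rewrite mulr_sumr; congr (is_true (_ <= _)); apply: eq_bigr => i _; rewrite mulrA.
  have := tail (fun i => v * b i) s vr; rewrite E prE ?lee_fin; last exact: mtail.
  move=> h; apply: (le_trans h); apply: ler_wpM2l; first exact: wt_ge0 pw.
  apply: (@le_trans _ _ (expR (- s) * expR (k * lt))); last by rewrite -expRD ler_expR.
  apply: ler_wpM2l; first exact: expR_ge0.
  have -> : k * lt = \sum_(i < n.+1) k / rate x * b i.
    by rewrite -mulr_sumr sb -mulrA [lt * _]mulrC mulKf// gt_eqF// rate_gt0.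
  rewrite expR_sum; apply: ler_prod => i _; apply/andP; split.
    by rewrite divr_ge0 ?subr_ge0 ?(ltW (rt0 i)) ?(ltW (vr i)).
  case: (b01 i) => [->|[-> <-]]; first by rewrite !mulr0 subr0 divff ?gt_eqF// expR0.
  by rewrite !mulr1.
pose s1 := th * ((1 + ep) * lt + ep * M); pose s2 := - (th * ((1 - ep) * lt - ep * M)).
pose D1 := pathE p `&` [set w | s1 <= th * \sum_(i < n.+1) b i * H i w].
pose D2 := pathE p `&` [set w | s2 <= (- th) * \sum_(i < n.+1) b i * H i w].
have lt0 : 0 <= lt by exact: ltime_ge0.
have p1 : pr D1 <= wt x0 p * expR (- (th * (ep * M))).
  apply: (one th (th * (1 + ep))) => [//|i|]; last by rewrite /s1; lra.
  have h1 := rth i; have h2 := rt0 i; have h3 : 0 < rt i - th by rewrite subr_gt0; nra.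
  apply: le_trans (expR_ge1Dx _); rewrite ler_pdivrMr// -(ler_pM2r h2).
  rewrite [leRHS](_ : _ = (rt i + th * (1 + ep)) * (rt i - th)); last by field; rewrite gt_eqF.
  by nra.
have p2 : pr D2 <= wt x0 p * expR (- (th * (ep * M))).
  apply: (one (- th) (- (th * (1 - ep)))) => [|i|]; [by lra| |by rewrite /s2; lra].
  have h1 := rth i; have h2 := rt0 i; rewrite opprK.
  have h3 : 0 < rt i + th by rewrite addr_gt0.
  apply: le_trans (expR_ge1Dx _); rewrite ler_pdivrMr// -(ler_pM2r h2).
  rewrite [leRHS](_ : _ = (rt i - th * (1 - ep)) * (rt i + th)); last by field; rewrite gt_eqF.
  by nra.
exists (D1 `|` D2); first by apply: measurableU; exact: mtail.
split.
  apply: (le_trans (prU_le (mtail _ _) (mtail _ _))); apply: (le_trans (lerD p1 p2)).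
  by rewrite le_eqVlt; apply/orP; left; apply/eqP; ring.
move=> w hw; rewrite /ctime pn => hD.
have -> : \sum_(i < n.+1) ((i < size (killed B (belast x0 p)))%N && (nth x0 (x0 :: p) i == x))%:R * H i w =
   \sum_(i < n.+1) b i * H i w by [].
have h1 : th * \sum_(i < n.+1) b i * H i w < s1.
  by rewrite ltNge; apply/negP => h; apply: hD; left.
have h2 : - th * \sum_(i < n.+1) b i * H i w < s2.
  by rewrite ltNge; apply/negP => h; apply: hD; right.
move: h1 h2; rewrite /s1 /s2 mulNr ltrN2 !ltr_pM2l// => h1 h2.
by rewrite ler_norml -/lt; apply/andP; split; lra.
Qed.

(** From each path event the deviations at all x in B are removed. The loss is at most [size B]
    times [beta] times the weight of the path, and distinct paths are disjoint events of total
    weight at most 1. *)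
Lemma good_event n (Q : pred (seq V)) B (ep M : R) : 0 < ep <= 1 / 2 -> 0 <= M ->
  exists2 Good, measurable Good & EX n x0 (fun p => (Q p)%:R) -
    (size B)%:R * (2 * expR (- (gs G * ep / 2 * (ep * M)))) <= pr Good /\
  forall w, Good w -> exists p, [/\ p \in walks n x0, Q p, pathE p w &
    forall x, x \in B -> `|ctime B p x w - ltime x (killed B (belast x0 p))| <=
      ep * (ltime x (killed B (belast x0 p)) + M)].
Proof.
move=> hep M0; set beta := 2 * expR _.
have beta0 : 0 <= beta by rewrite mulr_ge0 ?expR_ge0.
have hD p x : exists D, measurable D /\ (p \in walks n x0 -> pr D <= wt x0 p * beta /\
  forall w, pathE p w -> ~ D w -> `|ctime B p x w - ltime x (killed B (belast x0 p))| <=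
    ep * (ltime x (killed B (belast x0 p)) + M)).
  have [pw|pw] := boolP (p \in walks n x0); last by exists set0.
  by have [D mD [h1 h2]] := @deviation n B p x ep M pw hep M0; exists D.
pose D p x := projT1 (cid (hD p x)).
have mD p x : measurable (D p x) := (projT2 (cid (hD p x))).1.
have DP p x := (projT2 (cid (hD p x))).2.
pose Ok p := pathE p `\` \big[setU/set0]_(x <- B) D p x.
have mB p : measurable (\big[setU/set0]_(x <- B) D p x) by apply: bigsetU_measurable => x _; exact: mD.
have mOk p : measurable (Ok p) by apply: measurableD => //; exact: pathE_measurable.
have prOk p : p \in walks n x0 -> wt x0 p - (size B)%:R * beta * wt x0 p <= pr (Ok p).
  move=> pw; have [m h] := pr_bigU_le (s := B) (mD p) (fun x _ => (DP p x pw).1).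
  have sub : pathE p `<=` Ok p `|` \big[setU/set0]_(x <- B) D p x.
    by move=> w hw; have [h'|h'] := pselect ((\big[setU/set0]_(x <- B) D p x) w); [right|left].
  have := pr_le (pathE_measurable p) (measurableU _ _ (mOk p) m) sub.
  have := prU_le (mOk p) m; rewrite (pr_pathE pw); move: h; rewrite -mulrA [beta * _]mulrC.
  by move: (_%:R * _) => k h1 h2 h3; lra.
pose W := [seq p <- walks n x0 | Q p].
have WP p : p \in W -> p \in walks n x0 /\ Q p by rewrite mem_filter => /andP[].
have [m E] := @pr_bigU _ W Ok (filter_uniq _ (walks_uniq G n x0)) mOk
  (fun p q w pW qW pO qO => @pathE_inj n p q w (WP p pW).1 (WP q qW).1 pO.1 qO.1).
exists (\big[setU/set0]_(p <- W) Ok p) => //; split.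
  rewrite E; apply: (@le_trans _ _ (\sum_(p <- W) (wt x0 p - (size B)%:R * beta * wt x0 p))); last first.
    by rewrite !big_seq; apply: ler_sum => p /WP[pw _]; exact: prOk.
  rewrite sumrB -mulr_sumr.
  have -> : EX n x0 (fun p => (Q p)%:R) = \sum_(p <- W) wt x0 p.
    rewrite EX_walks big_filter [RHS]big_mkcond; apply: eq_bigr => p _.
    by case: (Q p); rewrite ?mulr1 ?mulr0.
  rewrite lerD2l lerN2; apply: ler_piMr; first by rewrite mulr_ge0.
  have -> : \sum_(p <- W) wt x0 p = EX n x0 (fun p => (Q p)%:R).
    rewrite EX_walks big_filter [LHS]big_mkcond; apply: eq_bigr => p _.
    by case: (Q p); rewrite ?mulr1 ?mulr0.
  rewrite -[leRHS](EX_const G n x0); apply: EX_le => p _; by case: (Q p).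
move=> w; rewrite -bigcup_seq => -[p /= /WP[pw Qp] [hp hD']]; exists p; split=> // x xB.
apply: (DP p x pw).2 => // h; apply: hD'; rewrite -bigcup_seq; by exists x.
Qed.

End Process.

(** * Almost sure limits *)

Lemma ln2_gt0 (R : realType) : 0 < ln 2 :> R.
Proof. by rewrite ln_gt0// ltr1n. Qed.

Lemma one_sub_sq (R : realType) (t : R) : (1 - t) * (1 + t) <= 1.
Proof. by rewrite -subr_ge0 (_ : _ - _ = t ^+ 2) ?sqr_ge0//; ring. Qed.

Lemma one_sub_cube (R : realType) (t : R) : 0 <= t -> t <= 1 / 2 -> (1 - t) * (1 + t / 3) ^+ 2 <= 1.
Proof. by move=> t0 t1; nra. Qed.

Lemma one_add_cube (R : realType) (t : R) : 0 <= t -> t <= 1 / 2 ->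
  (1 + t) * (1 + t / 3) ^+ 2 <= 1 + 4 * t.
Proof. by move=> t0 t1; nra. Qed.

(** * From dyadic scales to all N *)

Section Limits.
Variables (R : realType) (V : choiceType) (B : nat -> seq V) (T : nat -> V -> R).

Definition nested_balls := [/\ forall N, uniq (B N),
  forall N N', (N <= N')%N -> {subset B N <= B N'} &
  forall N N' x, (N <= N')%N -> T N x <= T N' x].

Definition cnt N (lv : R) : nat := size [seq x <- B N | lv <= T N x].

Definition dyadic (k : nat) : R := k%:R * ln 2.

Definition cnt_upper (a e : R) := exists k0, forall k, (k0 <= k)%N ->
  (cnt (2 ^ k) (a / pi * dyadic k ^+ 2))%:R <= expR ((2 - 2 * a + e) * dyadic k).

Definition cnt_lower (a e : R) := exists k0, forall k, (k0 <= k)%N ->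
  expR ((2 - 2 * a - e) * dyadic k) <= (cnt (2 ^ k) (a / pi * dyadic k ^+ 2))%:R.

Lemma cnt_le N N' (lv lv' : R) : nested_balls -> (N <= N')%N -> lv' <= lv -> (cnt N lv <= cnt N' lv')%N.
Proof.
move=> [B_uniq B_sub T_mono] NN hl; apply: uniq_leq_size; first by rewrite filter_uniq.
move=> x; rewrite !mem_filter => /andP[h /(B_sub _ _ NN) ->]; rewrite andbT.
exact: le_trans hl (le_trans h (T_mono _ _ _ NN)).
Qed.

Lemma dyadic_bracket (del : R) (k0 : nat) : 0 < del -> exists N0, forall N, (N0 <= N)%N ->
  exists2 k, (k0 <= k)%N & [/\ (2 ^ k <= N)%N, (N <= 2 ^ k.+1)%N, 0 < dyadic k &
    [/\ dyadic k <= ln N%:R, ln N%:R <= dyadic k.+1 & dyadic k.+1 <= (1 + del) * dyadic k]].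
Proof.
move=> del0; have ln2 := ln2_gt0 R; pose k1 := (maxn k0 (Num.trunc del^-1).+1); exists (2 ^ k1)%N => N hN.
have N0 : (0 < N)%N by apply: leq_trans hN; rewrite expn_gt0.
have /andP[h1 h2] := trunc_log_bounds (isT : (1 < 2)%N) N0.
set k := trunc_log 2 N in h1 h2 *.
have kk1 : (k1 <= k)%N by apply: trunc_log_max.
exists k; first exact: leq_trans (leq_maxl _ _) kk1.
have kpos : (0 < k)%N by apply: leq_trans kk1; rewrite leq_max orbT.
have ln2k j : dyadic j = ln (2 ^ j)%:R.
  by rewrite natrX lnXn// /dyadic mulr_natl.
split=> //; [exact: ltnW|by rewrite mulr_gt0// ltr0n|split].
- by rewrite ln2k ler_ln ?posrE ?ltr0n ?expn_gt0// ler_nat.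
- by rewrite ln2k ler_ln ?posrE ?ltr0n ?expn_gt0// ler_nat ltnW.
- rewrite /dyadic mulrA ler_pM2r// -natr1 mulrDl mul1r lerD2l mulrC -ler_pdivrMr// mul1r.
  have ii : 0 <= del^-1 by rewrite invr_ge0 ltW.
  have /andP[_ h] := truncn_itv ii.
  apply: (le_trans (ltW h)); rewrite ler_nat.
  exact: leq_trans (leq_maxr _ _) kk1.
Qed.

Lemma small_inv (e : R) : 0 < e -> exists m, m.+1%:R^-1 <= e.
Proof.
move=> e0; exists (Num.trunc e^-1).
have ii : 0 <= e^-1 by rewrite invr_ge0 ltW.
have /andP[_ h] := truncn_itv ii.
by rewrite -[leRHS]invrK lef_pV2 ?posrE ?ltr0n ?invr_gt0// ltW.
Qed.

(** Between consecutive powers of 2 the counts are monotone and the logarithms differ by a factor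
    close to 1. Shifting a by [eta] compensates for this factor in the level; the maximum with 0
    keeps the shifted parameter admissible when a is small. *)
Lemma cnt_limit (a : R) : nested_balls -> 0 <= a < 1 ->
  (forall m, cnt_upper (Num.max 0 (a - m.+1%:R^-1)) m.+1%:R^-1) ->
  (forall m, a + m.+1%:R^-1 < 1 -> cnt_lower (a + m.+1%:R^-1) m.+1%:R^-1) ->
  (fun N => ln (cnt N (a / pi * (ln N%:R) ^+ 2))%:R / ln N%:R) @ \oo --> 2 * (1 - a).
Proof.
move=> nB /andP[a0 a1] hU hL; apply/cvgrPdist_le => e e0.
have [m hm] : exists m, m.+1%:R^-1 <= Num.min (e / 5) ((1 - a) / 4).
  by apply: small_inv; rewrite lt_min !divr_gt0// subr_gt0.
have {hU} := hU m; have {hL} := hL m; move: hm; rewrite le_min.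
have : 0 < m.+1%:R^-1 :> R by rewrite invr_gt0.
have : m.+1%:R^-1 <= 1 :> R by rewrite invf_le1// ler1n.
move: (m.+1%:R^-1) => eta eta1 eta0 /andP[etae etaa] hL hU.
have [|k1 {}hL] := hL; first lra.
have [k2 {}hU] := hU.
have d0 : 0 < eta / 3 by rewrite divr_gt0.
have [N0 hN0] := dyadic_bracket (maxn k1 k2) d0.
have pi0 : 0 < pi :> R := pi_gt0 R.
exists N0 => // N /= /hN0[k kk [N1 N2 K0 [K1 K2 K3]]].
have {}hL := hL k (leq_trans (leq_maxl _ _) kk).
have {}hU := hU k.+1 (leqW (leq_trans (leq_maxr _ _) kk)).
move: (dyadic k) (dyadic k.+1) K0 K1 K2 K3 hL hU => K K' K0 K1 K2 K3 hL hU.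
move: (ln N%:R) K1 K2 => x K1 K2.
set c := cnt N _.
have x0 : 0 < x by exact: lt_le_trans K1.
have K'0 : 0 < K' by exact: lt_le_trans K2.
have xK : x <= (1 + eta / 3) * K by exact: le_trans K3.
have sq (u v : R) : 0 <= u -> u <= v -> u ^+ 2 <= v ^+ 2.
  by move=> u0 uv; rewrite lerXn2r ?nnegrE// (le_trans u0).
have cl : expR ((2 - 2 * (a + eta) - eta) * K) <= c%:R.
  apply: (le_trans hL); rewrite ler_nat; apply: (cnt_le nB) => //.
  rewrite mulrAC [leRHS]mulrAC ler_pM2r ?invr_gt0//.
  apply: le_trans (ler_wpM2l a0 (sq _ _ (ltW x0) xK)) _.
  rewrite exprMn mulrA ler_pM2r ?exprn_gt0//.
  move: a0 a1 eta0 eta1; clear; nra.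
have cu : c%:R <= expR ((2 - 2 * Num.max 0 (a - eta) + eta) * K').
  apply: le_trans hU; rewrite ler_nat; apply: (cnt_le nB) => //.
  rewrite mulrAC [leRHS]mulrAC ler_pM2r ?invr_gt0//.
  have [h|h] := leP 0 (a - eta); last by rewrite mul0r mulr_ge0// sqr_ge0.
  apply: le_trans (ler_wpM2l h (sq _ _ (ltW K'0) K3)) _.
  rewrite exprMn mulrA; apply: (@le_trans _ _ (a * K ^+ 2)).
    by rewrite ler_pM2r ?exprn_gt0//; move: h a1 eta0 eta1; clear; nra.
  by apply: ler_wpM2l => //; apply: sq => //; exact: ltW.
have c0 : 0 < c%:R :> R by apply: lt_le_trans cl; exact: expR_gt0.
have lc : (2 - 2 * (a + eta) - eta) * K <= ln c%:R by rewrite -[leLHS]expRK ler_ln ?posrE ?expR_gt0.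
have lu : ln c%:R <= (2 - 2 * a + 3 * eta) * K'.
  apply: (@le_trans _ _ ((2 - 2 * Num.max 0 (a - eta) + eta) * K')).
    by rewrite -[leRHS]expRK ler_ln ?posrE ?expR_gt0.
  rewrite ler_pM2r//; have : a - eta <= Num.max 0 (a - eta) by rewrite le_max lexx orbT.
  lra.
rewrite ler_distlC; apply/andP; split.
  rewrite ler_pdivlMr//; apply: le_trans lc.
  have h : 0 <= 2 - 2 * (a + eta) - eta by lra.
  apply: (@le_trans _ _ ((2 - 2 * (a + eta) - eta) * (1 - eta / 3) * x)).
    by rewrite ler_pM2r//; move: etae etaa a0 a1 eta0 eta1; clear; nra.
  rewrite -mulrA; apply: ler_wpM2l => //.
  apply: le_trans (ler_wpM2l _ xK) _; first lra.
  by rewrite mulrA; apply: ler_piMl; [exact: ltW|exact: one_sub_sq].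
rewrite ler_pdivrMr//; apply: (le_trans lu).
apply: (@le_trans _ _ ((2 - 2 * a + 3 * eta) * ((1 + eta / 3) * x))).
  apply: ler_wpM2l; first lra.
  by apply: (le_trans K3); apply: ler_wpM2l => //; lra.
rewrite mulrA ler_pM2r//; move: etae a0 a1 eta0 eta1; clear; nra.
Qed.

(** Above the level 1 + eta the bound on the count is less than 1, so there is no such point; at the
    level 1 - eta the count is positive. *)
Lemma max_limit (mx : nat -> R) : nested_balls -> (forall N x, x \in B N -> T N x <= mx N) ->
  (forall N, exists2 x, x \in B N & mx N = T N x) ->
  (forall m, cnt_upper (1 + m.+1%:R^-1) m.+1%:R^-1) ->
  (forall m, (0 : R) < 1 - m.+1%:R^-1 -> cnt_lower (1 - m.+1%:R^-1) m.+1%:R^-1) ->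
  (fun N => mx N / (ln N%:R) ^+ 2) @ \oo --> 1 / pi.
Proof.
move=> [B_uniq B_sub T_mono] mx_ge mx_ex hU hL; apply/cvgrPdist_le => e e0.
have [m hm] : exists m, m.+1%:R^-1 <= Num.min (e / 4) (1 / 2).
  by apply: small_inv; rewrite lt_min !divr_gt0.
have {hU} := hU m; have {hL} := hL m; move: hm; rewrite le_min.
have : 0 < m.+1%:R^-1 :> R by rewrite invr_gt0.
move: (m.+1%:R^-1) => eta eta0 /andP[etae etaa] hL hU.
have [|k1 {}hL] := hL; first lra.
have [k2 {}hU] := hU.
have d0 : 0 < eta / 3 by rewrite divr_gt0.
have [N0 hN0] := dyadic_bracket (maxn k1 k2) d0.
have pi0 : 0 < pi :> R := pi_gt0 R.
have pi1 : (pi : R)^-1 <= 1 by rewrite invf_le1// (le_trans _ (pi_ge2 R))// ler1n.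
have pi2 : 0 < (pi : R)^-1 by rewrite invr_gt0.
exists N0 => // N /= /hN0[k kk [N1 N2 K0 [K1 K2 K3]]].
have {}hL := hL k (leq_trans (leq_maxl _ _) kk).
have {}hU := hU k.+1 (leqW (leq_trans (leq_maxr _ _) kk)).
move: (dyadic k) (dyadic k.+1) K0 K1 K2 K3 hL hU => K K' K0 K1 K2 K3 hL hU.
move: (ln N%:R) K1 K2 => x K1 K2.
have x0 : 0 < x by exact: lt_le_trans K1.
have K'0 : 0 < K' by exact: lt_le_trans K2.
have xK : x <= (1 + eta / 3) * K by exact: le_trans K3.
have sq (u v : R) : 0 <= u -> u <= v -> u ^+ 2 <= v ^+ 2.
  by move=> u0 uv; rewrite lerXn2r ?nnegrE// (le_trans u0).
have x2 : 0 < x ^+ 2 by rewrite exprn_gt0.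
have lower : (1 - eta) / pi * K ^+ 2 <= mx N.
  have : (0 < cnt (2 ^ k) ((1 - eta) / pi * K ^+ 2))%N.
    by rewrite -(ltr0n R); apply: lt_le_trans hL; exact: expR_gt0.
  rewrite -has_predT => /hasP[y]; rewrite mem_filter => /andP[h /(B_sub _ _ N1) yB] _.
  by apply: (le_trans h); apply: le_trans (mx_ge N y yB); exact: T_mono.
have upper : mx N <= (1 + eta) / pi * K' ^+ 2.
  have c0 : cnt (2 ^ k.+1) ((1 + eta) / pi * K' ^+ 2) = 0%N.
    apply/eqP; rewrite -leqn0 -ltnS -(ltr_nat R); apply: (le_lt_trans hU).
    rewrite expR_lt1 (_ : 2 - 2 * (1 + eta) + eta = - eta); last by ring.
    by rewrite mulNr oppr_lt0 mulr_gt0.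
  have [y yB ->] := mx_ex N; apply: (le_trans (T_mono _ _ y N2)).
  rewrite leNgt; apply/negP => h; move/size0nil: c0 => /(congr1 (fun s => y \in s)).
  by rewrite mem_filter ltW// (B_sub _ _ N2 _ yB) in_nil.
rewrite ler_distlC; apply/andP; split.
  rewrite ler_pdivlMr//; apply: le_trans lower.
  have h1 := sq _ _ (ltW x0) xK; rewrite exprMn in h1.
  have h2 : (1 - eta) / pi * (1 - eta) * x ^+ 2 <= (1 - eta) / pi * K ^+ 2.
    rewrite -mulrA; apply: ler_wpM2l; first by rewrite divr_ge0 ?(ltW pi0)//; lra.
    have h3 := ler_wpM2l (_ : 0 <= 1 - eta) h1.
    apply: le_trans (h3 _) _; first lra.
    by rewrite mulrA; apply: ler_piMl; [exact: sqr_ge0|apply: one_sub_cube => //; exact: ltW].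
  apply: le_trans h2; rewrite ler_pM2r// mul1r.
  have h4 : eta * pi^-1 <= eta by rewrite ler_piMr// ltW.
  have h5 : 0 <= eta * eta * pi^-1 by rewrite !mulr_ge0 ?ltW.
  move: h4 h5 etae eta0; clear; move: (pi^-1) => p *; nra.
rewrite ler_pdivrMr//; apply: (le_trans upper).
have h1 : K' ^+ 2 <= ((1 + eta / 3) * x) ^+ 2.
  by apply: sq; [exact: ltW|apply: (le_trans K3); apply: ler_wpM2l => //; lra].
apply: (@le_trans _ _ ((1 + eta) / pi * ((1 + eta / 3) * x) ^+ 2)).
  by apply: ler_wpM2l => //; rewrite divr_ge0 ?(ltW pi0)//; lra.
rewrite exprMn mulrA ler_pM2r// mul1r.
have h2 : (1 + eta) * (1 + eta / 3) ^+ 2 <= 1 + 4 * eta by apply: one_add_cube => //; exact: ltW.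
apply: (@le_trans _ _ ((1 + 4 * eta) * pi^-1)); first by rewrite mulrAC ler_pM2r.
have h4 : eta * pi^-1 <= eta by rewrite ler_piMr// ltW.
by move: h4 etae; clear; move: (pi^-1) => p *; nra.
Qed.

End Limits.

Section AlmostSure.
Variables (R : realType) (d : measure_display) (Omega : measurableType d) (P : probability Omega R).

Lemma borel_cantelli_exp (F : nat -> set Omega) (kap : R) (k0 : nat) : 0 < kap -> (forall k, measurable (F k)) ->
  (forall k, (k0 <= k)%N -> pr P (F k) <= expR (- (kap * k%:R))) ->
  {ae P, forall w, exists k1, forall k, (k1 <= k)%N -> ~ F k w}.
Proof.
move=> kap0 mF hF; pose F' k := if (k0 <= k)%N then F k else set0.
have mF' k : measurable (F' k) by rewrite /F'; case: ifP.
pose rho := expR (- kap).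
have rho0 : 0 < rho := expR_gt0 _; have rho1 : rho < 1 by rewrite expR_lt1 oppr_lt0.
have hF' k : (P (F' k) <= (rho ^+ k)%:E)%E.
  rewrite /F'; case: ifP => [k0k|_]; last by rewrite measure0 lee_fin exprn_ge0// ltW.
  by rewrite prE// lee_fin -expRM_natl mulrN [k%:R * _]mulrC; exact: hF.
have part n : (\sum_(0 <= k < n) P (F' k) <= ((1 - rho)^-1)%:E)%E.
  apply: (@le_trans _ _ (\sum_(0 <= k < n) (rho ^+ k)%:E)%E); first exact: lee_sum.
  rewrite sumEFin lee_fin -[leRHS]mul1r ler_pdivlMr ?subr_gt0//.
  have -> : (\sum_(0 <= k < n) rho ^+ k) * (1 - rho) = 1 - rho ^+ n.
    elim: n => [|n IH]; first by rewrite big_geq// mul0r expr0 subrr.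
    by rewrite big_nat_recr//= mulrDl IH exprS; ring.
  by rewrite gerBl exprn_ge0// ltW.
have fin : (\sum_(n <oo) P (F' n) < +oo)%E.
  apply: (@le_lt_trans _ _ ((1 - rho)^-1)%:E); last exact: ltry.
  by apply: lime_le; [exact: is_cvg_nneseries|exact: nearW].
have h0 := lim_sup_set_cvg0 mF' fin.
apply: (negligibleS (A := lim_sup_set F')); last first.
  by apply/negligibleP => //; apply: bigcap_measurable => // k _; apply: bigcup_measurable.
move=> w /= hw k _; apply: contrapT => hn; apply: hw; exists (maxn k0 k) => j.
rewrite geq_max => /andP[j0 jk] Fj; apply: hn; exists j => //.
by rewrite /F' j0.
Qed.

End AlmostSure.

Lemma indicator_bound (R : realType) (a b : bool) : 1 - (a && ~~ b)%:R <= (~~ a)%:R + b%:R :> R.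
Proof. by case: a; case: b => /=; lra. Qed.

Section Scales.
Variables (R : realType) (V : choiceType) (G : rhombic_graph R V) (adj : rel V).
Hypothesis nb_adj : forall x y, (y \in nb G x) = adj x y.
Hypothesis adj_connected : connected_graph adj.
Variables (d : measure_display) (Omega : measurableType d) (P : probability Omega R) (x0 : V).
Variables (X : nat -> Omega -> V) (H : nat -> {RV P >-> R}).
Hypothesis mX : forall n x, measurable [set w | X n w = x].
Hypothesis law : forall (n : nat) (x : nat -> V) (B : nat -> set R), (forall i, measurable (B i)) ->
  P [set w | forall i, (i <= n)%N -> X i w = x i /\ B i (H i w)] =
  (((x 0%N == x0)%:R * \prod_(i < n) jump_prob adj (cond G) (x i) (x i.+1))%:E *
   \prod_(i < n.+1) exponential_prob (jump_rate adj (cond G) (x i)) (B i))%E.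
Variable Y : R -> Omega -> V.
Hypothesis hY : {ae P, forall w, forall (n : nat) (t : R),
        \sum_(i < n) H i w <= t < \sum_(i < n.+1) H i w -> Y t w = X n w}.
Local Notation ball N := (ballseq adj x0 N).
Local Notation lt p B x := (ltime G x (killed B (belast x0 p))).

(** [fine] would hide an infinite local time; [clock_regular] excludes this case. *)
Definition clock w N x : R := fine (local_time (Y ^~ w) x (exit_time adj x0 (Y ^~ w) N)).

Lemma expR_dyadic k : expR (dyadic R k) = (2 ^ k)%:R.
Proof. by rewrite /dyadic expRM_natl lnK ?posrE// natrX. Qed.

Lemma ball_sub_vb N : {subset ball N <= vb G x0 (2 * N%:R)}.
Proof.
move=> x /(mem_ballseq nb_adj adj_connected)/(graph_ball_sub nb_adj adj_connected) h.
by rewrite mem_vb// mulr_ge0.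
Qed.

(* Leaving the ball of radius [2 ^ k] takes about [4 ^ k] steps, so that
   [8 ^ k] steps are enough. *)
Definition good_scale (Q : nat -> pred (seq V)) (ep : R) k w : Prop :=
  exists p, [/\ size p = (8 ^ k)%N, Q k p,
    forall i, (i <= size p)%N -> X i w = nth x0 (x0 :: p) i &
    ~~ all (mem (ball (2 ^ k))) (belast x0 p) /\
    forall x, x \in ball (2 ^ k) -> `|ctime x0 H (ball (2 ^ k)) p x w - lt p (ball (2 ^ k)) x| <=
      ep * (lt p (ball (2 ^ k)) x + dyadic R k ^+ 2)].

(** Three failures are possible at scale k: of [Q], of leaving the ball within 8^k steps, and of the
    concentration of holding times. The last one, of probability exponentially small in the square
    of [dyadic R k], survives the union over all vertices. Borel-Cantelli concludes. *)
Lemma good_scale_ae (Q : nat -> pred (seq V)) (ep kap : R) : 0 < ep <= 1 / 2 -> 0 < kap ->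
  (exists k0, forall k, (k0 <= k)%N ->
    EX G (8 ^ k) x0 (fun p => (~~ Q k p)%:R) <= expR (- (kap * dyadic R k))) ->
  {ae P, forall w, exists k0, forall k, (k0 <= k)%N -> good_scale Q ep k w}.
Proof.
move=> hep kap0 [k0 hQ]; have /andP[ep0 ep1] := hep; have ln2 := ln2_gt0 R.
pose B k := ball (2 ^ k).
pose Q' k p := Q k p && ~~ all (mem (B k)) (belast x0 p).
have hM k : 0 <= dyadic R k ^+ 2 by exact: sqr_ge0.
have hG k := @good_event R V G adj nb_adj d Omega P x0 X H mX law (8 ^ k) (Q' k) (B k) ep (dyadic R k ^+ 2) hep (hM k).
pose F k := ~` projT1 (cid2 (hG k)).
have mF k : measurable (F k) by apply: measurableC; rewrite /F; case: (cid2 _).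
have FP k w : ~ F k w -> good_scale Q ep k w.
  rewrite /F; case: (cid2 _) => Go mGo [_ h] /= /contrapT /h [p [pw /andP[Qp ex] pE dev]].
  by have [ps _] := mem_walks pw; exists p.
have [Cn Cn0 hn] := count_le G; have [Ls Ls1 hs] := discrete_survival G.
pose cc := gs G * ep / 2 * ep.
have cc0 : 0 < cc by rewrite !mulr_gt0// ?gs_gt0// invr_gt0.
(* The three rates are kap, 1 / 2 and 1; half of the smallest leaves room for the factor 3 of the
   union bound. *)
pose kap' := Num.min kap (1 / 2) / 2.
have kap'0 : 0 < kap' by rewrite divr_gt0// lt_min kap0 divr_gt0.
have [k1 hk1] : exists k1, forall k, (k1 <= k)%N -> [/\ (k0 <= k)%N, Ls <= dyadic R k, 4 <= cc * dyadic R k,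
    18 * Cn <= expR (dyadic R k) & 3 <= expR (kap' * dyadic R k)].
  have [L1 L11 hL1] := expR_dominates (18 * Cn) (ltr01 : (0 : R) < 1).
  have [L2 L21 hL2] := expR_dominates (3 : R) kap'0.
  pose W := (Ls + 4 / cc + L1 + L2) / ln 2.
  have c4 : 0 <= 4 / cc by rewrite divr_ge0// ltW.
  exists (maxn k0 (Num.trunc W).+1) => k; rewrite geq_max => /andP[h1 h2].
  have W0 : 0 <= W by rewrite divr_ge0 ?(ltW ln2)//; lra.
  have /andP[_ hW] := truncn_itv W0.
  have : W <= k%:R by apply: (le_trans (ltW hW)); rewrite ler_nat.
  rewrite ler_pdivrMr// -/(dyadic R k) => hk.
  split=> //; first lra.
  - by rewrite mulrC -ler_pdivrMr//; lra.
  - by rewrite -[dyadic R k]mul1r; apply: hL1; lra.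
  - by apply: hL2; lra.
apply: filterS (@borel_cantelli_exp R d Omega P F (kap' * ln 2) k1 _ mF _).
- by move=> w [k2 h]; exists k2 => k /h; exact: FP.
- exact: mulr_gt0.
move=> k /hk1[k0k hLs h4 hC h3].
rewrite -mulrA [ln 2 * _]mulrC -/(dyadic R k).
rewrite /F; case: (cid2 _) => Go mGo [hGo _] /=; rewrite prC//.
have BV : {subset B k <= vb G x0 (2 * expR (dyadic R k))} by rewrite expR_dyadic; exact: ball_sub_vb.
have h8 : expR (3 * dyadic R k) <= (8 ^ k)%:R.
  by rewrite expRM_natl expR_dyadic -natrX -expnM mulnC expnM.
have surv := hs (dyadic R k) x0 (B k) (8 ^ k)%N hLs BV h8.
have L1 : 1 <= dyadic R k by lra.
have eQ : 1 - EX G (8 ^ k) x0 (fun p => (Q' k p)%:R) <= expR (- (kap * dyadic R k)) + expR (- (dyadic R k / 2)).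
  have := hQ k k0k; have -> : 1 - EX G (8 ^ k) x0 (fun p => (Q' k p)%:R) =
     EX G (8 ^ k) x0 (fun p => 1 * 1 + (- 1) * (Q' k p)%:R).
    by rewrite (EX_lin G _ x0 (fun=> 1)) EX_const !mul1r mulN1r.
  move=> h; apply: (le_trans _ (lerD h surv)).
  rewrite -[X in X + _]mul1r -[X in _ + X]mul1r -EX_lin; apply: EX_le => p _.
  by rewrite /Q' !mul1r mulN1r; exact: indicator_bound.
have sB : (size (B k))%:R * (2 * expR (- (gs G * ep / 2 * (ep * dyadic R k ^+ 2)))) <= expR (- dyadic R k).
  have s1 : (size (B k))%:R <= 9 * Cn * expR (dyadic R k) ^+ 2.
    apply: le_trans (hn x0 (2 * expR (dyadic R k)) (B k) _ _ _) _.
    - by rewrite mulr_ge0 ?expR_ge0.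
    - exact: ballseq_uniq.
    - by move=> y /BV; rewrite mem_vb// mulr_ge0 ?expR_ge0.
    rewrite (_ : 9 * Cn * _ = Cn * (3 * expR (dyadic R k)) ^+ 2); last by ring.
    rewrite ler_pM2l// lerXn2r ?nnegrE ?addr_ge0 ?mulr_ge0 ?expR_ge0//.
    have : 1 <= expR (dyadic R k) by rewrite -expR0 ler_expR; lra.
    by lra.
  have s2 : expR (- (gs G * ep / 2 * (ep * dyadic R k ^+ 2))) <= expR (- (4 * dyadic R k)).
    rewrite ler_expR lerN2 mulrA -/cc expr2 mulrA; apply: ler_wpM2r => //; lra.
  apply: (@le_trans _ _ (9 * Cn * expR (dyadic R k) ^+ 2 * (2 * expR (- (4 * dyadic R k))))).
    by apply: ler_pM => //; rewrite ?ler_pM2l ?mulr_ge0 ?expR_ge0.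
  rewrite [leLHS](_ : _ = 18 * Cn * (expR (dyadic R k) ^+ 2 * expR (- (4 * dyadic R k)))); last by ring.
  apply: le_trans (ler_wpM2r _ hC) _; first by apply: mulr_ge0; [exact: sqr_ge0|exact: expR_ge0].
  by rewrite -expRM_natl -!expRD ler_expR; lra.
have tri (c : R) : 2 * kap' <= c -> expR (- (c * dyadic R k)) <= expR (- (kap' * dyadic R k)) / 3.
  move=> hc; apply: (@le_trans _ _ (expR (- (kap' * dyadic R k)) * expR (- (kap' * dyadic R k)))).
    by rewrite -expRD ler_expR -opprD lerN2 -mulrDl; apply: ler_wpM2r; lra.
  apply: ler_wpM2l; first exact: expR_ge0.
  by rewrite expRN lef_pV2 ?posrE ?expR_gt0.
have m1 : 2 * kap' <= kap by rewrite /kap' mulrC divfK// ge_min lexx.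
have m2 : 2 * kap' <= 1 / 2 by rewrite /kap' mulrC divfK// ge_min lexx orbT.
have t1 := tri _ m1; have t2 := tri _ m2; have t3 := tri 1 (_ : 2 * kap' <= 1).
have {}t3 := t3 ltac:(lra).
rewrite mul1r in t3; rewrite (_ : 1 / 2 * dyadic R k = dyadic R k / 2) in t2; last by ring.
by move: hGo eQ sB t1 t2 t3; clear; move: (EX _ _ _ _) (_%:R * (2 * _)) => *; lra.
Qed.

Lemma dyadic_large (L0 : R) : exists k0, forall k, (k0 <= k)%N -> L0 <= dyadic R k.
Proof.
have ln2 := ln2_gt0 R; pose W := `|L0| / ln 2; have W0 : 0 <= W by rewrite divr_ge0// ltW.
have /andP[_ hW] := truncn_itv W0; exists (Num.trunc W).+1 => k hk.
apply: (le_trans (ler_norm L0)); rewrite /dyadic -ler_pdivrMr//.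
by apply: (le_trans (ltW hW)); rewrite ler_nat.
Qed.

Definition regular w := (forall i, 0 < H i w) /\
  forall (n : nat) (t : R), \sum_(i < n) H i w <= t < \sum_(i < n.+1) H i w -> Y t w = X n w.

Definition first_exit w N j := (forall i, (i < j)%N -> graph_ball adj x0 N (X i w)) /\
  ~ graph_ball adj x0 N (X j w).

Lemma first_exit_clock w N j x : regular w -> first_exit w N j ->
  local_time (Y ^~ w) x (exit_time adj x0 (Y ^~ w) N) = (\sum_(i < j) (X i w == x)%:R * H i w)%:E.
Proof.
move=> [Hw Yw] [h1 h2].
rewrite (@exit_time_trajectory R V adj x0 (Y ^~ w) (X ^~ w) (fun i => H i w) Hw Yw N j h1 h2).
exact: (@local_time_trajectory R V (Y ^~ w) (X ^~ w) (fun i => H i w) Hw Yw x j).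
Qed.

Lemma good_scale_exit Q ep k w : good_scale Q ep k w -> exists p, [/\ Q k p,
  first_exit w (2 ^ k) (size (killed (ball (2 ^ k)) (belast x0 p))) &
  forall x, x \in ball (2 ^ k) ->
    `|\sum_(i < size (killed (ball (2 ^ k)) (belast x0 p))) (X i w == x)%:R * H i w -
      lt p (ball (2 ^ k)) x| <= ep * (lt p (ball (2 ^ k)) x + dyadic R k ^+ 2)].
Proof.
move=> [p [ps Qp pE [ex dev]]]; exists p; set B := ball _ in ex dev *.
have mB x : x \in B <-> graph_ball adj x0 (2 ^ k) x by exact: (mem_ballseq nb_adj adj_connected).
have [js jout] := @killed_out _ x0 B _ ex; rewrite size_belast in js.
set j := size (killed B (belast x0 p)) in js jout *.
have Xn i : (i < size p)%N -> X i w = nth x0 (belast x0 p) i.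
  by move=> ip; rewrite pE ?(ltnW ip)// lastI nth_rcons size_belast ip.
split=> //.
  split=> [i ij|]; first by apply/mB; rewrite Xn ?(ltn_trans ij)//; exact: killed_in.
  by move/mB; rewrite Xn//; exact/negP.
move=> x xB; suff -> : \sum_(i < j) (X i w == x)%:R * H i w = ctime x0 H B p x w by exact: dev.
rewrite /ctime -/j (big_ord_widen _ (fun i => (X i w == x)%:R * H i w) (leqW (ltnW js))).
rewrite [LHS]big_mkcond; apply: eq_bigr => i _; case: ifP => [ij|_]; last by rewrite mul0r.
by rewrite pE// (leq_trans (ltnW ij))// ltnW.
Qed.

(** Every N is below some good scale 2^k, whose ball is left after finitely many jumps. All exit
    times are therefore finite and the local times are finite sums of holding times. *)
Lemma clock_regular Q ep w : regular w -> (exists k0, forall k, (k0 <= k)%N -> good_scale Q ep k w) ->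
  nested_balls (fun N => ball N) (clock w) /\
  forall N x, local_time (Y ^~ w) x (exit_time adj x0 (Y ^~ w) N) = (clock w N x)%:E.
Proof.
move=> rw [k0 hk0].
have idx N : exists j, first_exit w N j.
  have [p [_ [_ h] _]] := good_scale_exit (hk0 (maxn k0 N) (leq_maxl _ _)).
  have exj : exists j, `[< ~ graph_ball adj x0 N (X j w) >].
    exists (size (killed (ball (2 ^ maxn k0 N)) (belast x0 p))); apply/asboolP => h'; apply: h.
    apply: (leq_trans h'); apply: (leq_trans (ltnW (ltn_expl N (isT : (1 < 2)%N)))).
    by rewrite leq_exp2l// leq_maxr.
  case: (ex_minnP exj) => j /asboolP jout jmin; exists j; split=> // i ij.
  by apply: contrapT => hi; have := jmin i (introT (asboolP _) hi); rewrite leqNgt ij.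
have loc N x : local_time (Y ^~ w) x (exit_time adj x0 (Y ^~ w) N) = (clock w N x)%:E.
  by have [j hj] := idx N; rewrite /clock (first_exit_clock x rw hj).
split=> //; split=> [N|N N' NN x|N N' x NN]; first exact: ballseq_uniq.
  move=> /(mem_ballseq nb_adj adj_connected) h; apply/(mem_ballseq nb_adj adj_connected).
  exact: leq_trans h NN.
have [j hj] := idx N; have [j' hj'] := idx N'.
rewrite /clock (first_exit_clock x rw hj) (first_exit_clock x rw hj')/=.
have jj : (j <= j')%N.
  by rewrite leqNgt; apply/negP => h; apply: hj'.2; exact: leq_trans (hj.1 _ h) NN.
rewrite -(big_mkord xpredT (fun i => (X i w == x)%:R * H i w)) -(big_mkord xpredT (fun i => (X i w == x)%:R * H i w)).
rewrite (big_cat_nat (n := j) (p := j'))//= lerDl sumr_ge0// => i _.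
by rewrite mulr_ge0// ltW//; exact: rw.1.
Qed.

Lemma good_scale_dev Q ep k w : regular w -> good_scale Q ep k w -> exists2 p, Q k p &
  forall x, x \in ball (2 ^ k) ->
    `|clock w (2 ^ k) x - lt p (ball (2 ^ k)) x| <= ep * (lt p (ball (2 ^ k)) x + dyadic R k ^+ 2).
Proof.
move=> rw /good_scale_exit[p [Qp hj dev]]; exists p => // x xB.
by rewrite /clock (first_exit_clock x rw hj)/=; exact: dev.
Qed.

Lemma level_dyadic (a L : R) : level a L = a / pi * L ^+ 2.
Proof.
rewrite /level /scale (_ : _ * _ = (2 / 2) * (a / pi * L ^+ 2)).
  by rewrite divff ?mul1r// pnatr_eq0.
by rewrite invfM; ring.
Qed.

Lemma regular_ae : {ae P, forall w, regular w}.
Proof.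
have h := holding_gt0 nb_adj mX law.
by apply: filterS2 h hY => w h1 h2; split.
Qed.

(** Since [ep * (pi + a) <= e / 4], a vertex that is a-thick for the process is thick for the
    embedded walk with parameter a - e / 4, or with parameter 0 if this is negative. *)
Lemma upper_ae (a e : R) : 0 <= a -> 0 < e ->
  {ae P, forall w, regular w -> cnt_upper (fun N => ball N) (clock w) a e}.
Proof.
move=> a0 e0; have pi0 := pi_gt0 R; have pa : 0 < pi + a by rewrite ltr_pwDl.
pose a1 := Num.max 0 (a - e / 4).
have a10 : 0 <= a1 by rewrite le_max lexx.
have a1a : a1 <= a by rewrite ge_max a0; lra.
have aa1 : a - e / 4 <= a1 by rewrite le_max lexx orbT.
pose ep := Num.min (1 / 2) (e / 4 / (pi + a)).
have ep0 : 0 < ep by rewrite lt_min !divr_gt0.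
have ep1 : ep <= 1 / 2 by rewrite ge_min lexx.
have ep2 : ep * (pi + a) <= e / 4 by rewrite -ler_pdivlMr// ge_min lexx orbT.
have e2 : 0 < e / 2 by rewrite divr_gt0.
have [kap kap0 [L0 L01 hU]] := discrete_upper G a10 e2.
have [k0 hk0] := dyadic_large L0.
pose Q k (p : seq V) : bool := (size (thick G (ball (2 ^ k)) (level a1 (dyadic R k))
   (killed (ball (2 ^ k)) (belast x0 p))))%:R < expR ((2 - 2 * a1 + e / 2) * dyadic R k).
have hQ : exists k1, forall k, (k1 <= k)%N ->
    EX G (8 ^ k) x0 (fun p => (~~ Q k p)%:R) <= expR (- (kap * dyadic R k)).
  exists k0 => k kk; apply: le_trans (hU (dyadic R k) x0 (ball (2 ^ k)) (8 ^ k)%N (hk0 k kk) _ _).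
  - by apply: EX_le => p _; rewrite /Q -leNgt.
  - exact: ballseq_uniq.
  - by rewrite expR_dyadic; exact: ball_sub_vb.
have ep01 : 0 < ep <= 1 / 2 by rewrite ep0.
apply: filterS (good_scale_ae ep01 kap0 hQ) => w [k1 hk1] rw.
exists k1 => k /hk1 /(good_scale_dev rw)[p Qp dev].
have d0 : 0 <= dyadic R k by rewrite mulr_ge0// ltW// ln2_gt0.
apply: (@le_trans _ _ (expR ((2 - 2 * a1 + e / 2) * dyadic R k))); last first.
  by rewrite ler_expR; apply: ler_wpM2r => //; lra.
apply/ltW; apply: le_lt_trans Qp; rewrite ler_nat.
apply: uniq_leq_size; first by rewrite filter_uniq// ballseq_uniq.
move=> x; rewrite !mem_filter => /andP[hx xB]; rewrite xB andbT.
have := dev x xB; have := ltime_ge0 G x (killed (ball (2 ^ k)) (belast x0 p)).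
move: (lt p _ x) hx => l hx l0; rewrite ler_distl => /andP[_ h].
have D0 : 0 <= dyadic R k ^+ 2 by exact: sqr_ge0.
move: hx h; rewrite level_dyadic; move: (dyadic R k ^+ 2) D0 => D D0 hx h.
have [h0|h0] := leP (a - e / 4) 0.
  by rewrite /a1 (max_l h0) !mul0r.
have a1E : a1 = a - e / 4 by rewrite /a1 max_r// ltW.
have h1 : a / pi * D <= (1 + ep) * l + ep * D by apply: (le_trans hx); apply: (le_trans h); lra.
rewrite -(ler_pM2l (_ : 0 < 1 + ep)); last lra.
apply: (@le_trans _ _ (a / pi * D - ep * D)); last lra.
rewrite -mulrBl mulrA; apply: ler_wpM2r => //.
rewrite -(ler_pM2r pi0) mulrBl !mulrA !divfK ?gt_eqF//.
have := ler_wpM2l (ltW ep0) a1a; move: ep2; rewrite mulrDr a1E; lra.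
Qed.

(** Conversely, thickness of the embedded walk with the larger parameter a + del survives the
    deviation of the holding times, as [ep * (pi + 1) <= del]. *)
Lemma lower_ae (a e : R) : inhabited V -> 0 < a < 1 -> 0 < e ->
  {ae P, forall w, regular w -> cnt_lower (fun N => ball N) (clock w) a e}.
Proof.
move=> iV /andP[a0 a1'] e0; have pi0 := pi_gt0 R; have pa : 0 < (pi : R) + 1 by exact: addr_gt0 pi0 ltr01.
pose del := Num.min (e / 4) ((1 - a) / 2).
have del0 : 0 < del by rewrite lt_min !divr_gt0// subr_gt0.
have [del1 del2] : del <= e / 4 /\ del <= (1 - a) / 2 by rewrite !ge_min !lexx orbT.
pose a1 := a + del; have a101 : 0 < a1 < 1 by rewrite /a1; lra.
pose ep := Num.min (1 / 2) (del / (pi + 1)).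
have ep0 : 0 < ep by rewrite lt_min; apply/andP; split; exact: divr_gt0.
have ep1 : ep <= 1 / 2 by rewrite ge_min lexx.
have ep2 : ep * ((pi : R) + 1) <= del by rewrite -ler_pdivlMr// ge_min lexx orbT.
have e2 : 0 < e / 2 by rewrite divr_gt0.
pose c := gs G ^+ 2 / 4.
have c0 : 0 < c by rewrite divr_gt0// exprn_gt0// gs_gt0.
have [kap kap0 [L0 L01 hL]] := discrete_lower G iV a101 e2 c0.
have [k0 hk0] := dyadic_large L0.
have [N0 N00 hN0] := graph_ball_sup nb_adj adj_connected x0.
pose Q k (p : seq V) : bool := expR ((2 - 2 * a1 - e / 2) * dyadic R k) <=
  (size (thick G (ball (2 ^ k)) (level a1 (dyadic R k)) (killed (ball (2 ^ k)) (belast x0 p))))%:R.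
have hQ : exists k1, forall k, (k1 <= k)%N ->
    EX G (8 ^ k) x0 (fun p => (~~ Q k p)%:R) <= expR (- (kap * dyadic R k)).
  exists (maxn k0 N0) => k; rewrite geq_max => /andP[kk kN]; apply: hL; first exact: hk0.
    rewrite expR_dyadic => x; rewrite mem_vb => [hx|]; last first.
      by apply: mulr_ge0; [exact: ltW|exact: ler0n].
    apply/(mem_ballseq nb_adj adj_connected); apply: hN0 => //.
    exact: leq_trans kN (ltnW (ltn_expl k (isT : (1 < 2)%N))).
  by rewrite expRM_natl expR_dyadic -natrX -expnM mulnC expnM.
have ep01 : 0 < ep <= 1 / 2 by rewrite ep0.
apply: filterS (good_scale_ae ep01 kap0 hQ) => w [k1 hk1] rw.
exists k1 => k /hk1 /(good_scale_dev rw)[p Qp dev].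
have d0 : 0 <= dyadic R k by rewrite mulr_ge0// ltW// ln2_gt0.
apply: (@le_trans _ _ (expR ((2 - 2 * a1 - e / 2) * dyadic R k))).
  by rewrite ler_expR; apply: ler_wpM2r => //; rewrite /a1; lra.
apply: (le_trans Qp); rewrite ler_nat.
apply: uniq_leq_size; first by rewrite filter_uniq// ballseq_uniq.
move=> x; rewrite !mem_filter => /andP[hx xB]; rewrite xB andbT.
have := dev x xB; move: (lt p _ x) hx => l hx; rewrite ler_distl => /andP[h _].
have D0 : 0 <= dyadic R k ^+ 2 by exact: sqr_ge0.
move: hx h; rewrite level_dyadic; move: (dyadic R k ^+ 2) D0 => D D0 hx h.
apply: le_trans h; apply: (@le_trans _ _ ((1 - ep) * (a1 / pi * D) - ep * D)); last first.
  have ep1' : 0 <= 1 - ep by lra.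
  apply: (@le_trans _ _ ((1 - ep) * l - ep * D)); last lra.
  by rewrite lerD2r; exact: ler_wpM2l.
rewrite mulrA -mulrBl; apply: ler_wpM2r => //.
rewrite -(ler_pM2r pi0) mulrBl !mulrA !divfK ?gt_eqF//.
have : ep * a1 <= ep by rewrite ler_piMr ?(ltW ep0)// ltW//; case/andP: a101.
by move: ep2; rewrite /a1 mulrDr mulr1 mulrDr; lra.
Qed.

End Scales.

Lemma bigmaxe_ex (R : realType) (I : eqType) (s : seq I) (f : I -> R) x : x \in s ->
  exists y, [/\ y \in s, (\big[maxe/-oo]_(i <- s) (f i)%:E)%E = (f y)%:E & forall z, z \in s -> f z <= f y].
Proof.
elim: s x => // a s IH x _; rewrite big_cons.
case: s IH => [_|b s IH].
  rewrite big_nil; exists a; split; [exact: mem_head|by rewrite maxeNy|].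
  by move=> z; rewrite inE => /eqP ->.
have [y [ys -> ymax]] := IH b (mem_head _ _).
rewrite -EFin_max; have [h|h] := leP (f a) (f y).
  exists y; split=> [|//|z]; first by rewrite inE ys orbT.
  rewrite inE => /orP[/eqP -> //|]; exact: ymax.
exists a; split=> [|//|z]; first exact: mem_head.
rewrite inE => /orP[/eqP -> //|/ymax h'].
exact: le_trans h' (ltW h).
Qed.

Section Conclusion.
Variables (R : realType) (V : choiceType) (adj : rel V) (x0 : V) (y : R -> V) (T : nat -> V -> R).
Variable (B : nat -> seq V).
Hypothesis memB : forall N x, x \in B N <-> graph_ball adj x0 N x.
Hypothesis BE : forall N, enum_fset (fset_set (graph_ball adj x0 N)) = B N.
Hypothesis B0 : forall N, x0 \in B N.
Hypothesis nB : nested_balls B T.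
Hypothesis loc : forall N x, local_time y x (exit_time adj x0 y N) = (T N x)%:E.

Lemma thick_points_card a N :
  #|` fset_set (thick_points adj x0 y a N)| = cnt B T N (a / pi * (ln N%:R) ^+ 2).
Proof.
have [B_uniq _ _] := nB.
have E x : thick_points adj x0 y a N x <-> x \in [seq x <- B N | a / pi * (ln N%:R) ^+ 2 <= T N x].
  rewrite mem_filter /thick_points /= loc lee_fin; split=> [[/memB -> ->]//|/andP[-> /memB]//].
have fin : finite_set (thick_points adj x0 y a N).
  apply: (@sub_finite_set _ _ [set` [seq x <- B N | a / pi * (ln N%:R) ^+ 2 <= T N x]]); last exact: finite_seq.
  by move=> x /E.
apply: perm_size; apply: uniq_perm; [exact: fset_uniq|by rewrite filter_uniq|] => x.
rewrite -[LHS]/(x \in fset_set _) in_fset_set//.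
by apply/idP/idP; rewrite inE => /E.
Qed.

Lemma max_local_time_limit :
  (forall m, cnt_upper B T (1 + m.+1%:R^-1) m.+1%:R^-1) ->
  (forall m, (0 : R) < 1 - m.+1%:R^-1 -> cnt_lower B T (1 - m.+1%:R^-1) m.+1%:R^-1) ->
  (fun N : nat => (max_local_time adj x0 y N / ((ln N%:R) ^+ 2)%:E)%E) @ \oo --> (1 / pi)%:E.
Proof.
move=> hU hL; pose mx N := fine (max_local_time adj x0 y N).
have mxP N : exists z, [/\ z \in B N, max_local_time adj x0 y N = (T N z)%:E & forall x, x \in B N -> T N x <= T N z].
  rewrite /max_local_time BE; have [z [zB E zmax]] := bigmaxe_ex (T N) (B0 N).
  by exists z; split=> //; rewrite -E; apply: eq_bigr => x _; rewrite loc.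
have mxE N : max_local_time adj x0 y N = (mx N)%:E by have [z [_ E _]] := mxP N; rewrite /mx E.
have lim : (fun N => mx N / (ln N%:R) ^+ 2) @ \oo --> 1 / pi.
  apply: (max_limit nB) hU hL => [N x xB|N].
    by have [z [_ E zmax]] := mxP N; rewrite /mx E; exact: zmax.
  by have [z [zB E _]] := mxP N; exists z => //; rewrite /mx E.
(* From N = 2 on the logarithm is positive, and the quotient of extended reals is the real one. *)
have E : \forall N \near \oo, (mx N / (ln N%:R) ^+ 2)%:E = (max_local_time adj x0 y N / ((ln N%:R) ^+ 2)%:E)%E.
  exists 2%N => // N /= N2; rewrite mxE inver gt_eqF ?EFinM//.
  by rewrite exprn_gt0// ln_gt0// ltr1n.
apply: cvg_trans (near_eq_cvg E) _.
by apply/fine_cvgP; split; [exact: nearW|exact: lim].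
Qed.

End Conclusion.

Theorem theorem1p1p2 (R : realType)
    (V : choiceType) (adj : rel V) (pos : V -> R[i])
    (Vinfinite : infinite_set [set: V])
    (adj_connected : connected_graph adj)
    (adj_isoradial : isoradial adj pos)
    (theta : V -> V -> R)
    (thetaP : forall x y, adj x y ->
      is_rhombus_half_angle adj pos x y (theta x y))
    (eta : R) (eta_itv : 0 < eta < pi / 4)
    (theta_itv : forall x y, adj x y -> eta < theta x y < pi / 2 - eta)
    (d : measure_display) (Omega : measurableType d) (P : probability Omega R)
    (x0 : V) (Y : R -> Omega -> V)
    (Y_jump : jump_process_from adj (fun x y => tan (theta x y)) P x0 Y) :
  {ae P, forall w,
     (fun N : nat => (max_local_time adj x0 (Y ^~ w) N
                        / ((ln N%:R) ^+ 2)%:E)%E) @ \oo --> (1 / pi)%:E} /\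
  (forall a : R, 0 <= a < 1 ->
     {ae P, forall w,
        (fun N : nat =>
           ln (#|` fset_set (thick_points adj x0 (Y ^~ w) a N)|%:R : R)
             / ln N%:R) @ \oo --> 2 * (1 - a)}).
Proof.
have [G [nb_adj thE]] := isoradial_rhombic_graph Vinfinite adj_connected adj_isoradial thetaP eta_itv theta_itv.
have cE : (fun x y => tan (theta x y)) = cond G.
  by apply/funext => x; apply/funext => y; rewrite /cond thE.
rewrite cE in Y_jump; have [X [H [mX law hY]]] := Y_jump.
have iV : inhabited V by constructor.
have reg := regular_ae nb_adj mX law hY.
have up a e := @upper_ae R V G adj nb_adj adj_connected d Omega P x0 X H mX law Y a e.
have low a e := @lower_ae R V G adj nb_adj adj_connected d Omega P x0 X H mX law Y a e iV.
(* The trivial [Q] extracts only that all large dyadic balls are left, as [clock_regular]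
   requires. *)
have gs_ae : {ae P, forall w, exists k0, forall k, (k0 <= k)%N -> good_scale G adj x0 X H (fun _ _ => true) (1 / 2) k w}.
  apply: (good_scale_ae nb_adj adj_connected mX law (kap := 1)) => //; first lra.
  by exists 0%N => k _; rewrite /= EX_const expR_ge0.
have memB := mem_ballseq nb_adj adj_connected.
have inv0 m : 0 < m.+1%:R^-1 :> R by rewrite invr_gt0.
split=> [|a /andP[a0 a1]].
  (* Parameters of the form 1 / (m + 1) are countably many, so one null set serves for all of
     them. *)
  have h1 : {ae P, forall w m, regular X H Y w -> cnt_upper (fun N => ballseq adj x0 N) (clock adj x0 Y w) (1 + m.+1%:R^-1) m.+1%:R^-1}.
    by apply: ae_foralln => m; apply: up => //; exact: addr_ge0.
  have h2 : {ae P, forall w m, regular X H Y w -> (0 : R) < 1 - m.+1%:R^-1 ->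
      cnt_lower (fun N => ballseq adj x0 N) (clock adj x0 Y w) (1 - m.+1%:R^-1) m.+1%:R^-1}.
    apply: ae_foralln => m; have [h|h] := ltP (0 : R) (1 - m.+1%:R^-1); last by apply: aeW => w _.
    have := low (1 - m.+1%:R^-1) m.+1%:R^-1 _ (inv0 m); rewrite h gtrBl inv0 => /(_ isT).
    by apply: filterS => w hw rw _; exact: hw.
  apply: filterS2 (filterI reg gs_ae) (filterI h1 h2) => w [rw gw] [u l].
  have [nB loc] := clock_regular nb_adj adj_connected rw gw.
  apply: (max_local_time_limit (B := fun N => ballseq adj x0 N) (T := clock adj x0 Y w)) => //.
  - by move=> N; exact: (ballseq0 nb_adj adj_connected).
  - by move=> m; exact: u.
  - by move=> m; exact: l.
have h1 : {ae P, forall w m, regular X H Y w -> cnt_upper (fun N => ballseq adj x0 N) (clock adj x0 Y w) (Num.max 0 (a - m.+1%:R^-1)) m.+1%:R^-1}.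
  by apply: ae_foralln => m; apply: up => //; rewrite le_max lexx.
have h2 : {ae P, forall w m, regular X H Y w -> a + m.+1%:R^-1 < 1 ->
    cnt_lower (fun N => ballseq adj x0 N) (clock adj x0 Y w) (a + m.+1%:R^-1) m.+1%:R^-1}.
  apply: ae_foralln => m; have [h|h] := ltP (a + m.+1%:R^-1) 1; last by apply: aeW => w _.
  have := low (a + m.+1%:R^-1) m.+1%:R^-1 _ (inv0 m); rewrite h ltr_wpDl// => /(_ isT).
  by apply: filterS => w hw rw _; exact: hw.
apply: filterS2 (filterI reg gs_ae) (filterI h1 h2) => w [rw gw] [u l].
have [nB loc] := clock_regular nb_adj adj_connected rw gw.
have E N : #|` fset_set (thick_points adj x0 (Y ^~ w) a N)| =
    cnt (fun N => ballseq adj x0 N) (clock adj x0 Y w) N (a / pi * (ln N%:R) ^+ 2).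
  by apply: thick_points_card => // M x; exact: memB.
under eq_fun do rewrite E.
by apply: cnt_limit => // [|m|m]; [rewrite a0|exact: u|exact: l].
Qed.
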